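(* Let $k$ be a commutative Noetherian ring (with 1), let $A$ be a $k$-algebra which is finitely generated and projective as a $k$-module, and let $J$ be an idempotent two-sided ideal of $A$ (i.e. $J^2=J$). (a) For any given $\mathfrak p\in\operatorname{Spec} k$, if $\overline{J(\mathfrak p)}$ is a heredity ideal in the $k(\mathfrak p)$-algebra $A(\mathfrak p)$, then the natural map $J(\mathfrak p)\to\overline{J(\mathfrak p)}$ is an isomorphism, so that $J(\mathfrak p)$ identifies with an ideal in $A(\mathfrak p)$. Moreover, $J$ is a heredity ideal in $A$ if and only if for each $\mathfrak p\in\operatorname{Spec} k$, $\overline{J(\mathfrak p)}$ is a heredity ideal in $A(\mathfrak p)$. (b) $J$ is a heredity ideal of separable type if and only if, for every maximal ideal $\mathfrak m$ of $k$, $\overline{J(\mathfrak m)}$ is a heredity ideal in $A(\mathfrak m)$ of separable type. (c) Assume in addition that $k$ is an integrally closed domain and that $A/J$ is projective over $k$. Then $J$ is a heredity ideal of semisplit type if and only if $\overline{J(\mathfrak p)}$ is a heredity ideal of semisplit type in $A(\mathfrak p)$ for every prime ideal $\mathfrak p$ of $k$ of height $\leq 1$. (d) Assume in addition that $k$ is a regular domain of dimension at most 2 and that $A/J$ is projective over $k$. Then $J$ is a heredity ideal of split type if and only if $\overline{J(\mathfrak p)}$ is a heredity ideal of split type in $A(\mathfrak p)$ for every prime ideal $\mathfrak p$ of $k$ of height $\leq 1$.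
   Context: For $\mathfrak p\in\operatorname{Spec}k$ and a $k$-module $X$, $k(\mathfrak p)$ denotes the residue field $k_{\mathfrak p}/\mathfrak p k_{\mathfrak p}$ and $X(\mathfrak p):=X_{\mathfrak p}/\mathfrak pX_{\mathfrak p}=X\otimes_kk(\mathfrak p)$. If $X$ is a $k$-submodule of a $k$-algebra $A$, $\overline{X(\mathfrak p)}$ is the image of the natural map $X(\mathfrak p)\to A(\mathfrak p)$. All $k$-algebras are finitely generated as $k$-modules. Heredity ideal: let $A$ be a $k$-algebra projective over $k$. A two-sided ideal $J$ of $A$ is a heredity ideal if (0) $A/J$ is projective over $k$; (1) $J$ is projective as a left $A$-module; (2) $J^2=J$; (3) the $k$-algebra $E:=\operatorname{End}_A({}_AJ)$ is $k$-semisimple. A finite $k$-algebra $E$ is $k$-semisimple if and only if $E(\mathfrak p)$ is a semisimple $k(\mathfrak p)$-algebra for all $\mathfrak p\in\operatorname{Spec}k$ (this may be taken as the definition). The heredity ideal $J$ is of separable (resp. semisplit, split) type if $E=\operatorname{End}_A({}_AJ)$ is separable (resp. semisplit, split) over $k$. Here $E$ is separable over $k$ if the $(E,E)$-bimodule multiplication map $E\otimes_kE\to E$ is split; $E$ is semisplit if it is a finite direct product of algebras each of which is separable over $k$ with center $k$ (i.e. Azumaya over $k$); $E$ is split if it is a finite direct product of algebras each of which is the endomorphism algebra $\operatorname{End}_k(Q)$ of a finitely generated projective $k$-module $Q$. The same definitions are used with $k$ replaced by the field $k(\mathfrak p)$ and $A$ by $A(\mathfrak p)$. *)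

(* Defs.v *)
From HB Require Import structures.
From mathcomp Require Import all_boot all_algebra ring boolp.

Set Implicit Arguments.
Unset Strict Implicit.
Unset Printing Implicit Defensive.

Import GRing.Theory.
Local Open Scope ring_scope.
Local Open Scope quotient_scope.

(* An associative unital algebra over a commutative ring, on top of its module
   structure. [algType] is unsuitable since it excludes the zero algebra, which
   occurs as [End_A(0)] and as the fibre of an algebra away from its support. *)
HB.mixin Record Lmodule_isPzAlgebra (k : comPzRingType) A
    of GRing.Lmodule k A := {
  alg_one : A;
  alg_mul : A -> A -> A;
  alg_mulA : associative alg_mul;
  alg_mul1 : left_id alg_one alg_mul;
  alg_mulr1 : right_id alg_one alg_mul;
  alg_mulDl : left_distributive alg_mul +%R;
  alg_mulDr : right_distributive alg_mul +%R;
  alg_scaleAl : forall (a : k) (x y : A),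
    a *: alg_mul x y = alg_mul (a *: x) y;
  alg_scaleAr : forall (a : k) (x y : A),
    a *: alg_mul x y = alg_mul x (a *: y)
}.

#[short(type="pzAlgType")]
HB.structure Definition PzAlgebra (k : comPzRingType) :=
  {A of GRing.Lmodule k A & Lmodule_isPzAlgebra k A}.

HB.instance Definition _ (k : comPzRingType) (A : pzAlgType k) :=
  GRing.Zmodule_isPzRing.Build (PzAlgebra.sort A)
    alg_mulA alg_mul1 alg_mulr1 alg_mulDl alg_mulDr.

Definition alg_hom (k : comPzRingType) (A B : pzAlgType k) (f : A -> B) :=
  linear f /\ GRing.monoid_morphism f.

Section SubmoduleType.
Variables (R : pzRingType) (M : lmodType R) (S : submodClosed M).

Inductive submod : predArgType := Submod u & u \in S.

Definition submod_val (w : submod) : M := let: Submod u _ := w in u.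
HB.instance Definition _ := [isSub of submod for submod_val].
HB.instance Definition _ := [Choice of submod by <:].
Fact submod_closed_mem : GRing.subsemimod_closed (mem S).
Proof. exact: GRing.subsemimodClosedP. Qed.
HB.instance Definition _ :=
  GRing.SubChoice_isSubLmodule.Build R M _ submod submod_closed_mem.

Fact submod_val_linear : linear submod_val.
Proof. by move=> a x y; rewrite -[submod_val]/val linearP. Qed.
HB.instance Definition _ :=
  GRing.isLinear.Build R submod M _ submod_val submod_val_linear.
End SubmoduleType.

Section QuotientModule.
Variables (R : pzRingType) (M : lmodType R) (S : submodClosed M).

Fact submodClosed_zmod : zmod_closed (GRing.SubmodClosed.sort S).
Proof. exact/GRing.subsemimod_closedB/GRing.subsemimodClosedP. Qed.
Definition submod_pred : {pred M} := S.
HB.instance Definition _ :=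
  GRing.isZmodClosed.Build M submod_pred submodClosed_zmod.

Definition quomod := Quotient.quot submod_pred.
HB.instance Definition _ := GRing.Zmodule.on quomod.

Definition quopi (x : M) : quomod := \pi_(Quotient.quot submod_pred) x.

Lemma quopiE (x y : M) : (quopi x == quopi y) = (x - y \in S).
Proof. exact: (@eqmodE M (Quotient.equiv_equiv submod_pred)). Qed.

Lemma quopiP (x y : M) : x - y \in S -> quopi x = quopi y.
Proof. by rewrite -quopiE => /eqP. Qed.

Lemma quo_ind (P : quomod -> Prop) : (forall x, P (quopi x)) -> forall c, P c.
Proof. by move=> Px c; rewrite -[c]reprK; apply: Px. Qed.

Lemma quo_repr (x : M) : repr (quopi x) - x \in S.
Proof. by rewrite -quopiE /quopi reprK. Qed.

Lemma quopiD (x y : M) : quopi (x + y) = quopi x + quopi y.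
Proof. by rewrite /quopi !piE. Qed.

Definition quo_scale (a : R) (c : quomod) : quomod := quopi (a *: repr c).

Lemma quo_scaleE a x : quo_scale a (quopi x) = quopi (a *: x).
Proof. by apply: quopiP; rewrite -scalerBr rpredZ ?quo_repr. Qed.

Fact quo_scaleA a b c : quo_scale a (quo_scale b c) = quo_scale (a * b) c.
Proof. by elim/quo_ind: c => x; rewrite !quo_scaleE scalerA. Qed.
Fact quo_scale1 : left_id 1 quo_scale.
Proof. by elim/quo_ind => x; rewrite quo_scaleE scale1r. Qed.
Fact quo_scaleDr : right_distributive quo_scale +%R.
Proof.
move=> a c d; elim/quo_ind: c => x; elim/quo_ind: d => y.
by rewrite -quopiD !quo_scaleE scalerDr quopiD.
Qed.
Fact quo_scaleDl c : {morph quo_scale^~ c : a b / a + b}.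
Proof. by elim/quo_ind: c => x a b; rewrite !quo_scaleE scalerDl quopiD. Qed.

HB.instance Definition _ := GRing.Zmodule_isLmodule.Build R quomod
  quo_scaleA quo_scale1 quo_scaleDr quo_scaleDl.
End QuotientModule.


Notation ideal k := (submodClosed k^o).

Definition prime_ideal (k : comPzRingType) (I : ideal k) :=
  1 \notin I /\ forall a b : k, a * b \in I -> a \in I \/ b \in I.

Definition maximal_ideal (k : comPzRingType) (I : ideal k) :=
  1 \notin I /\
  forall I' : ideal k, 1 \notin I' -> {subset I <= I'} -> {subset I' <= I}.

Record spec (k : comPzRingType) := Spec {
  spec_ideal :> ideal k;
  spec_prime : prime_ideal spec_ideal
}.

Section Localization.
Variables (k : comPzRingType) (p : spec k).

Definition denom := {s : k | s \notin spec_ideal p}.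

Definition dval (s : denom) : k := sval s.

Fact denom1_subproof : (1 : k) \notin spec_ideal p.
Proof. by case: (spec_prime p). Qed.
Definition denom1 : denom := exist _ 1 denom1_subproof.

Fact denomM_subproof (s t : denom) : dval s * dval t \notin spec_ideal p.
Proof.
apply/negP => /(spec_prime p).2.
by case; apply/negP; [apply: (valP s)|apply: (valP t)].
Qed.
Definition denomM (s t : denom) : denom :=
  exist _ (dval s * dval t) (denomM_subproof s t).

Lemma denomMA : associative denomM.
Proof. by move=> s t u; apply: val_inj; apply: mulrA. Qed.
Lemma denomMC : commutative denomM.
Proof. by move=> s t; apply: val_inj; apply: mulrC. Qed.
Lemma denom1M : left_id denom1 denomM.
Proof. by move=> s; apply: val_inj; apply: mul1r. Qed.
Lemma denomM1 : right_id denom1 denomM.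
Proof. by move=> s; apply: val_inj; apply: mulr1. Qed.

Lemma dvalM s t : dval (denomM s t) = dval s * dval t.
Proof. by []. Qed.
Lemma dval1 : dval denom1 = 1.
Proof. by []. Qed.

Section LocModule.
Variable M : lmodType k.

Definition loc_equiv (u v : M * denom) : bool :=
  `[< exists w : denom,
        dval w *: (dval v.2 *: u.1) = dval w *: (dval u.2 *: v.1) >].

Fact loc_equiv_refl : reflexive loc_equiv.
Proof. by move=> u; apply/asboolP; exists denom1. Qed.
Fact loc_equiv_sym : symmetric loc_equiv.
Proof. by move=> u v; apply/asboolP/asboolP => -[w E]; exists w. Qed.
Fact loc_equiv_trans : transitive loc_equiv.
Proof.
move=> [y t] [x s] [z r] /asboolP[w1 /= E1] /asboolP[w2 /= E2].
apply/asboolP; exists (denomM (denomM w1 w2) t) => /=.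
have -> : dval w1 * dval w2 * dval t *: (dval r *: x) =
          (dval w2 * dval r) *: (dval w1 *: (dval t *: x)).
  by rewrite !scalerA ?dvalM; congr (_ *: _); ring.
rewrite E1; have -> : (dval w2 * dval r) *: (dval w1 *: (dval s *: y)) =
          (dval w1 * dval s) *: (dval w2 *: (dval r *: y)).
  by rewrite !scalerA ?dvalM; congr (_ *: _); ring.
by rewrite E2 !scalerA ?dvalM; congr (_ *: _); ring.
Qed.

Canonical loc_equiv_equiv :=
  EquivRel loc_equiv loc_equiv_refl loc_equiv_sym loc_equiv_trans.

Definition loc := {eq_quot loc_equiv}.
HB.instance Definition _ := Choice.on loc.

Definition locfrac (x : M) (s : denom) : loc :=
  \pi_({eq_quot loc_equiv}) (x, s).

Lemma locfracP x s y t :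
  locfrac x s = locfrac y t <->
  exists w : denom, dval w *: (dval t *: x) = dval w *: (dval s *: y).
Proof.
split=> [/eqmodP/asboolP//|E].
by apply/eqmodP/asboolP.
Qed.

Lemma locfrac_eq x s y t :
  dval t *: x = dval s *: y -> locfrac x s = locfrac y t.
Proof. by move=> E; apply/locfracP; exists denom1; rewrite E. Qed.

Lemma loc_ind (P : loc -> Prop) :
  (forall x s, P (locfrac x s)) -> forall c, P c.
Proof. by move=> Pf c; rewrite -[c]reprK; case: (repr c) => x s; apply: Pf. Qed.

Lemma loc_reprP x s : exists w : denom,
  dval w *: (dval s *: (repr (locfrac x s)).1) =
  dval w *: (dval (repr (locfrac x s)).2 *: x).
Proof.
by apply/locfracP; rewrite -[RHS]reprK /locfrac -surjective_pairing.
Qed.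

Definition loc0 : loc := locfrac 0 denom1.
Definition loc_opp (c : loc) : loc := locfrac (- (repr c).1) (repr c).2.
Definition loc_add (c d : loc) : loc :=
  locfrac (dval (repr d).2 *: (repr c).1 + dval (repr c).2 *: (repr d).1)
       (denomM (repr c).2 (repr d).2).

Lemma loc_oppE x s : loc_opp (locfrac x s) = locfrac (- x) s.
Proof.
have [w E] := loc_reprP x s; apply/locfracP; exists w.
by rewrite !scalerN E.
Qed.

Lemma loc_addE x s y t :
  loc_add (locfrac x s) (locfrac y t) =
  locfrac (dval t *: x + dval s *: y) (denomM s t).
Proof.
have [w E] := loc_reprP x s; have [v F] := loc_reprP y t.
rewrite /loc_add; move: (repr (locfrac x s)) (repr (locfrac y t)) E F.
move=> [x' s'] [y' t'] /= E F.
apply/locfracP; exists (denomM w v) => /=.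
rewrite !scalerDr; congr (_ + _).
  transitivity ((dval v * dval t * dval t') *: (dval w *: (dval s *: x'))).
    by rewrite !scalerA ?dvalM; congr (_ *: _); ring.
  by rewrite E !scalerA ?dvalM; congr (_ *: _); ring.
transitivity ((dval w * dval s * dval s') *: (dval v *: (dval t *: y'))).
  by rewrite !scalerA ?dvalM; congr (_ *: _); ring.
by rewrite F !scalerA ?dvalM; congr (_ *: _); ring.
Qed.

Fact loc_addA : associative loc_add.
Proof.
elim/loc_ind=> x s; elim/loc_ind=> y t; elim/loc_ind=> z r.
rewrite !loc_addE denomMA; congr locfrac.
rewrite !scalerDr !scalerA addrA.
by congr (_ + _ + _); congr (_ *: _); rewrite ?dvalM; ring.
Qed.
Fact loc_addC : commutative loc_add.
Proof.
elim/loc_ind=> x s; elim/loc_ind=> y t.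
by rewrite !loc_addE denomMC addrC.
Qed.
Fact loc_add0 : left_id loc0 loc_add.
Proof.
by elim/loc_ind=> x s; rewrite loc_addE denom1M scaler0 add0r scale1r.
Qed.
Fact loc_addN : left_inverse loc0 loc_opp loc_add.
Proof.
elim/loc_ind=> x s; rewrite loc_oppE loc_addE scalerN addNr.
by apply: locfrac_eq; rewrite !scaler0.
Qed.

HB.instance Definition _ :=
  GRing.isZmodule.Build loc loc_addA loc_addC loc_add0 loc_addN.

Lemma locfracD x s y t :
  locfrac x s + locfrac y t = locfrac (dval t *: x + dval s *: y) (denomM s t).
Proof. exact: loc_addE. Qed.
End LocModule.

Section LocBilinear.
Variables (M N P : lmodType k) (b : M -> N -> P).

Definition loc_bil (c : loc M) (d : loc N) : loc P :=
  locfrac (b (repr c).1 (repr d).1) (denomM (repr c).2 (repr d).2).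

Hypothesis bZl : forall a x y, b (a *: x) y = a *: b x y.
Hypothesis bZr : forall a x y, b x (a *: y) = a *: b x y.

Lemma loc_bilE x s y t :
  loc_bil (locfrac x s) (locfrac y t) = locfrac (b x y) (denomM s t).
Proof.
have [w E] := loc_reprP x s; have [v F] := loc_reprP y t.
rewrite /loc_bil; move: (repr (locfrac x s)) (repr (locfrac y t)) E F.
move=> [x' s'] [y' t'] /= E F.
apply/locfracP; exists (denomM w v) => /=.
transitivity (b (dval w *: (dval s *: x')) (dval v *: (dval t *: y'))).
  by rewrite !(bZl, bZr) !scalerA ?dvalM; congr (_ *: _); ring.
by rewrite E F !(bZl, bZr) !scalerA ?dvalM; congr (_ *: _); ring.
Qed.
End LocBilinear.

Definition locring := loc k^o.
HB.instance Definition _ := GRing.Zmodule.on locring.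

Definition locring_mul : locring -> locring -> locring :=
  @loc_bil k^o k^o k^o *%R.

Lemma locring_mulE (a b : k) s t :
  locring_mul (locfrac (a : k^o) s) (locfrac (b : k^o) t) =
  locfrac (a * b : k^o) (denomM s t).
Proof.
rewrite /locring_mul loc_bilE // => {a s b t} a x y.
  by rewrite -[a *: x]/(a * x) -[RHS]/(a * _) mulrA.
by rewrite -[a *: y]/(a * y) -[RHS]/(a * _) mulrCA.
Qed.

Fact locring_mulA : associative locring_mul.
Proof.
elim/loc_ind=> x s; elim/loc_ind=> y t; elim/loc_ind=> z r.
rewrite (locring_mulE y z) (locring_mulE x y) !locring_mulE denomMA.
by congr locfrac; apply: mulrA.
Qed.
Fact locring_mulC : commutative locring_mul.
Proof.
elim/loc_ind=> x s; elim/loc_ind=> y t.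
by rewrite !locring_mulE denomMC; congr locfrac; apply: mulrC.
Qed.
Fact locring_mul1 : left_id (locfrac (1 : k^o) denom1) locring_mul.
Proof.
elim/loc_ind=> x s; rewrite locring_mulE denom1M.
by congr locfrac; apply: mul1r.
Qed.
Fact locring_mulD : left_distributive locring_mul +%R.
Proof.
elim/loc_ind=> x s; elim/loc_ind=> y t; elim/loc_ind=> z r.
rewrite locfracD !locring_mulE locfracD; apply: locfrac_eq => /=.
rewrite -![_ *: _]/(_ * _) ?dvalM; ring.
Qed.

HB.instance Definition _ := GRing.Zmodule_isComPzRing.Build locring
  locring_mulA locring_mulC locring_mul1 locring_mulD.

Section LocScale.
Variable M : lmodType k.

Definition loc_scale : locring -> loc M -> loc M := @loc_bil k^o M M *:%R.

Lemma loc_scaleE (a : k) s (x : M) t :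
  loc_scale (locfrac (a : k^o) s) (locfrac x t) = locfrac (a *: x) (denomM s t).
Proof.
rewrite /loc_scale loc_bilE // => {a s x t} a x y.
  by rewrite scalerA.
by rewrite !scalerA mulrC.
Qed.

Fact loc_scaleA a b c : loc_scale a (loc_scale b c) = loc_scale (a * b) c.
Proof.
elim/loc_ind: a => x s; elim/loc_ind: b => y t; elim/loc_ind: c => z r.
rewrite (loc_scaleE y) [_ * _](locring_mulE x y) !loc_scaleE denomMA.
by rewrite scalerA.
Qed.
Fact loc_scale1 : left_id 1 loc_scale.
Proof. by elim/loc_ind=> x s; rewrite loc_scaleE denom1M scale1r. Qed.
Fact loc_scaleDr : right_distributive loc_scale +%R.
Proof.
elim/loc_ind=> x s; elim/loc_ind=> y t; elim/loc_ind=> z r.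
rewrite locfracD !loc_scaleE locfracD; apply: locfrac_eq => /=.
rewrite !scalerDr !scalerA ?dvalM; congr (_ *: _ + _ *: _); ring.
Qed.
Fact loc_scaleDl c : {morph loc_scale^~ c : a b / a + b}.
Proof.
elim/loc_ind: c => z r; elim/loc_ind=> x s; elim/loc_ind=> y t.
rewrite [_ + _]locfracD !loc_scaleE locfracD; apply: locfrac_eq => /=.
rewrite -![_ *: (_ : k^o)]/(_ * _) !scalerDl !scalerDr !scalerA ?dvalM.
congr (_ *: _ + _ *: _); ring.
Qed.

HB.instance Definition _ := GRing.Zmodule_isLmodule.Build locring (loc M)
  loc_scaleA loc_scale1 loc_scaleDr loc_scaleDl.

Lemma locfracZ (a : k) s (x : M) t :
  (locfrac (a : k^o) s : locring) *: locfrac x t =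
  locfrac (a *: x) (denomM s t).
Proof. exact: loc_scaleE. Qed.
End LocScale.

Section LocAlgebra.
Variable A : pzAlgType k.

Definition loc_mul : loc A -> loc A -> loc A := @loc_bil A A A *%R.

Lemma loc_mulE (x : A) s (y : A) t :
  loc_mul (locfrac x s) (locfrac y t) = locfrac (x * y) (denomM s t).
Proof.
rewrite /loc_mul loc_bilE // => a u v.
  by rewrite -[u * v]/(alg_mul u v) alg_scaleAl.
by rewrite -[u * v]/(alg_mul u v) alg_scaleAr.
Qed.

Fact loc_mulA : associative loc_mul.
Proof.
elim/loc_ind=> x s; elim/loc_ind=> y t; elim/loc_ind=> z r.
by rewrite (loc_mulE y) (loc_mulE x) !loc_mulE denomMA mulrA.
Qed.
Fact loc_mul1 : left_id (locfrac (1 : A) denom1) loc_mul.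
Proof. by elim/loc_ind=> x s; rewrite loc_mulE denom1M mul1r. Qed.
Fact loc_mulr1 : right_id (locfrac (1 : A) denom1) loc_mul.
Proof. by elim/loc_ind=> x s; rewrite loc_mulE denomM1 mulr1. Qed.
Fact loc_scaleAl (a : locring) c d :
  a *: loc_mul c d = loc_mul (a *: c) d.
Proof.
elim/loc_ind: a => a s; elim/loc_ind: c => x t; elim/loc_ind: d => y r.
rewrite (loc_mulE x _ y) (locfracZ a s x) locfracZ loc_mulE denomMA.
rewrite -[x * y]/(alg_mul x y).
by rewrite alg_scaleAl.
Qed.
Fact loc_scaleAr (a : locring) c d :
  a *: loc_mul c d = loc_mul c (a *: d).
Proof.
elim/loc_ind: a => a s; elim/loc_ind: c => x t; elim/loc_ind: d => y r.
rewrite (loc_mulE x _ y) (locfracZ a s y) locfracZ loc_mulE !denomMA.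
rewrite [denomM t s]denomMC.
by rewrite -[x * y]/(alg_mul x y) alg_scaleAr.
Qed.
Fact loc_mulDl : left_distributive loc_mul +%R.
Proof.
elim/loc_ind=> x s; elim/loc_ind=> y t; elim/loc_ind=> z r.
rewrite locfracD !loc_mulE locfracD; apply: locfrac_eq => /=.
rewrite mulrDl -![_ * z]/(alg_mul _ z) -!alg_scaleAl.
rewrite !scalerDr !scalerA ?dvalM; congr (_ *: _ + _ *: _); ring.
Qed.
Fact loc_mulDr : right_distributive loc_mul +%R.
Proof.
elim/loc_ind=> z r; elim/loc_ind=> x s; elim/loc_ind=> y t.
rewrite locfracD !loc_mulE locfracD; apply: locfrac_eq => /=.
rewrite mulrDr -![z * _]/(alg_mul z _) -!alg_scaleAr.
rewrite !scalerDr !scalerA ?dvalM; congr (_ *: _ + _ *: _); ring.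
Qed.

HB.instance Definition _ := Lmodule_isPzAlgebra.Build locring (loc A)
  loc_mulA loc_mul1 loc_mulr1 loc_mulDl loc_mulDr loc_scaleAl loc_scaleAr.
End LocAlgebra.

Section LocMap.
Variables (M N : lmodType k) (f : {linear M -> N}).

Definition loc_map (c : loc M) : loc N := locfrac (f (repr c).1) (repr c).2.

Lemma loc_mapE x s : loc_map (locfrac x s) = locfrac (f x) s.
Proof.
have [w E] := loc_reprP x s; apply/locfracP; exists w.
by rewrite -!(linearZ_LR f) E.
Qed.

Fact loc_map_linear : linear loc_map.
Proof.
move=> a c d.
elim/loc_ind: a => a s; elim/loc_ind: c => x t; elim/loc_ind: d => y r.
rewrite locfracZ locfracD (loc_mapE x) (loc_mapE y).
rewrite (locfracZ a s (f x)) locfracD.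
by rewrite loc_mapE linearD !(linearZ_LR f).
Qed.
HB.instance Definition _ :=
  GRing.isLinear.Build locring (loc M) (loc N) _ loc_map loc_map_linear.
End LocMap.
End Localization.

(* M / IM as a module over R / IR, where I is any set of elements of R and IM
   is the submodule generated by the products a x with a in I and x in M *)
Section Reduction.
Variables (R : comPzRingType) (I : {pred R}).

Section ReductionModule.
Variable M : lmodType R.

Definition mulspan : {pred M} := fun x =>
  `[< exists s : seq (R * M),
        all (fun u => u.1 \in I) s /\ x = \sum_(u <- s) u.1 *: u.2 >].

Fact mulspan_closed : GRing.subsemimod_closed mulspan.
Proof.
split.
  split; first by apply/asboolP; exists [::]; rewrite big_nil.
  move=> _ _ /asboolP[s [sI ->]] /asboolP[t [tI ->]].
  by apply/asboolP; exists (s ++ t); rewrite all_cat sI tI big_cat.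
move=> a _ /asboolP[s [sI ->]]; apply/asboolP.
exists [seq (u.1, a *: u.2) | u <- s]; split.
  by rewrite all_map; apply: sub_all sI.
rewrite big_map scaler_sumr; apply: eq_bigr => u _ /=.
by rewrite !scalerA mulrC.
Qed.
HB.instance Definition _ :=
  GRing.isSubmodClosed.Build R M mulspan mulspan_closed.

Lemma mulspan_mem a x : a \in I -> a *: x \in mulspan.
Proof.
move=> aI; apply/asboolP; exists [:: (a, x)].
by rewrite /= aI big_seq1.
Qed.

Definition redmod := quomod mulspan.
HB.instance Definition _ := GRing.Zmodule.on redmod.

Definition redpi (x : M) : redmod := quopi mulspan x.

Lemma red_ind (P : redmod -> Prop) : (forall x, P (redpi x)) -> forall c, P c.
Proof. exact: quo_ind. Qed.
Lemma redpiP (x y : M) : x - y \in mulspan -> redpi x = redpi y.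
Proof. exact: quopiP. Qed.
Lemma redpiD (x y : M) : redpi (x + y) = redpi x + redpi y.
Proof. exact: quopiD. Qed.
Lemma red_repr (x : M) : repr (redpi x) - x \in mulspan.
Proof. exact: quo_repr. Qed.
End ReductionModule.

Lemma mulspan_morph (M N : lmodType R) (g : M -> N) x :
    {morph g : y z / y + z} -> (forall a y, g (a *: y) = a *: g y) ->
  x \in @mulspan M -> g x \in @mulspan N.
Proof.
move=> gD gZ /asboolP[s [sI ->]]; apply/asboolP.
exists [seq (u.1, g u.2) | u <- s]; split.
  by rewrite all_map; apply: sub_all sI.
have g0 : g 0 = 0 by rewrite -(scale0r 0) gZ scale0r.
by rewrite big_map (big_morph g gD g0); apply: eq_bigr => u _; rewrite gZ.
Qed.

Section ReductionBilinear.
Variables (M N P : lmodType R) (b : M -> N -> P).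

Definition red_bil (c : redmod M) (d : redmod N) : redmod P :=
  redpi (b (repr c) (repr d)).

Hypothesis bDl : forall y, {morph b^~ y : x x' / x + x'}.
Hypothesis bDr : forall x, {morph b x : y y' / y + y'}.
Hypothesis bZl : forall a x y, b (a *: x) y = a *: b x y.
Hypothesis bZr : forall a x y, b x (a *: y) = a *: b x y.

Lemma red_bilE x y : red_bil (redpi x) (redpi y) = redpi (b x y).
Proof.
have Ex := red_repr x; have Ey := red_repr y.
rewrite /red_bil; move: (repr (redpi x)) (repr (redpi y)) Ex Ey => x' y' Ex Ey.
transitivity (redpi (b x y')); apply: redpiP.
  have -> : b x' y' - b x y' = b (x' - x) y'.
    by rewrite bDl -[- x]scaleN1r bZl scaleN1r.
  by apply: (mulspan_morph (g := b^~ y')) => // a z; apply: bZl.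
have -> : b x y' - b x y = b x (y' - y).
  by rewrite bDr -[- y]scaleN1r bZr scaleN1r.
by apply: (mulspan_morph (g := b x)) => // a z; apply: bZr.
Qed.
End ReductionBilinear.

Definition redring := redmod R^o.
HB.instance Definition _ := GRing.Zmodule.on redring.

Definition redring_mul : redring -> redring -> redring :=
  @red_bil R^o R^o R^o *%R.

Lemma redring_mulE (a b : R^o) :
  redring_mul (redpi a) (redpi b) = redpi (a * b).
Proof.
apply: red_bilE => [x y z|x y z|a' x y|a' x y].
- exact: mulrDl.
- exact: mulrDr.
- exact/esym/mulrA.
- exact: mulrCA.
Qed.

Fact redring_mulA : associative redring_mul.
Proof.
elim/red_ind=> x; elim/red_ind=> y; elim/red_ind=> z.
rewrite (redring_mulE y z) (redring_mulE x y) !redring_mulE.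
by congr redpi; apply: mulrA.
Qed.
Fact redring_mulC : commutative redring_mul.
Proof.
elim/red_ind=> x; elim/red_ind=> y.
by rewrite !redring_mulE; congr redpi; apply: mulrC.
Qed.
Fact redring_mul1 : left_id (redpi (1 : R^o)) redring_mul.
Proof.
elim/red_ind=> x; rewrite redring_mulE.
by congr redpi; apply: mul1r.
Qed.
Fact redring_mulD : left_distributive redring_mul +%R.
Proof.
elim/red_ind=> x; elim/red_ind=> y; elim/red_ind=> z.
rewrite -redpiD !redring_mulE -redpiD.
by congr redpi; apply: mulrDl.
Qed.

HB.instance Definition _ := GRing.Zmodule_isComPzRing.Build redring
  redring_mulA redring_mulC redring_mul1 redring_mulD.

Section ReductionScale.
Variable M : lmodType R.

Definition red_scale : redring -> redmod M -> redmod M := @red_bil R^o M M *:%R.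

Lemma red_scaleE (a : R^o) (x : M) :
  red_scale (redpi a) (redpi x) = redpi (a *: x).
Proof.
apply: red_bilE => [y b c|b y z|b c y|b c y].
- exact: scalerDl.
- exact: scalerDr.
- exact/esym/scalerA.
- by rewrite !scalerA mulrC.
Qed.

Fact red_scaleA a b c : red_scale a (red_scale b c) = red_scale (a * b) c.
Proof.
elim/red_ind: a => a; elim/red_ind: b => b; elim/red_ind: c => x.
by rewrite (red_scaleE b) [_ * _](redring_mulE a b) !red_scaleE scalerA.
Qed.
Fact red_scale1 : left_id 1 red_scale.
Proof. by elim/red_ind=> x; rewrite red_scaleE scale1r. Qed.
Fact red_scaleDr : right_distributive red_scale +%R.
Proof.
elim/red_ind=> a; elim/red_ind=> x; elim/red_ind=> y.
by rewrite -redpiD !red_scaleE -redpiD scalerDr.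
Qed.
Fact red_scaleDl c : {morph red_scale^~ c : a b / a + b}.
Proof.
elim/red_ind: c => x; elim/red_ind=> a; elim/red_ind=> b.
by rewrite -[_ + _]redpiD !red_scaleE -redpiD scalerDl.
Qed.

HB.instance Definition _ := GRing.Zmodule_isLmodule.Build redring (redmod M)
  red_scaleA red_scale1 red_scaleDr red_scaleDl.

Lemma redpiZ (a : R^o) (x : M) :
  (redpi a : redring) *: redpi x = redpi (a *: x).
Proof. exact: red_scaleE. Qed.
End ReductionScale.

Section ReductionAlgebra.
Variable A : pzAlgType R.

Definition red_mul : redmod A -> redmod A -> redmod A := @red_bil A A A *%R.

Lemma red_mulE (x y : A) : red_mul (redpi x) (redpi y) = redpi (x * y).
Proof.
apply: red_bilE => [z u v|z u v|a u v|a u v].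
- exact: mulrDl.
- exact: mulrDr.
- exact/esym/alg_scaleAl.
- exact/esym/alg_scaleAr.
Qed.

Fact red_mulA : associative red_mul.
Proof.
elim/red_ind=> x; elim/red_ind=> y; elim/red_ind=> z.
by rewrite (red_mulE y) (red_mulE x) !red_mulE mulrA.
Qed.
Fact red_mul1 : left_id (redpi (1 : A)) red_mul.
Proof. by elim/red_ind=> x; rewrite red_mulE mul1r. Qed.
Fact red_mulr1 : right_id (redpi (1 : A)) red_mul.
Proof. by elim/red_ind=> x; rewrite red_mulE mulr1. Qed.
Fact red_mulDl : left_distributive red_mul +%R.
Proof.
elim/red_ind=> x; elim/red_ind=> y; elim/red_ind=> z.
by rewrite -redpiD !red_mulE -redpiD mulrDl.
Qed.
Fact red_mulDr : right_distributive red_mul +%R.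
Proof.
elim/red_ind=> x; elim/red_ind=> y; elim/red_ind=> z.
by rewrite -redpiD !red_mulE -redpiD mulrDr.
Qed.
Fact red_scaleAl (a : redring) c d : a *: red_mul c d = red_mul (a *: c) d.
Proof.
elim/red_ind: a => a; elim/red_ind: c => x; elim/red_ind: d => y.
rewrite (red_mulE x y) (redpiZ a x) redpiZ red_mulE.
by congr redpi; apply: alg_scaleAl.
Qed.
Fact red_scaleAr (a : redring) c d : a *: red_mul c d = red_mul c (a *: d).
Proof.
elim/red_ind: a => a; elim/red_ind: c => x; elim/red_ind: d => y.
rewrite (red_mulE x y) (redpiZ a y) redpiZ red_mulE.
by congr redpi; apply: alg_scaleAr.
Qed.

HB.instance Definition _ := Lmodule_isPzAlgebra.Build redring (redmod A)
  red_mulA red_mul1 red_mulr1 red_mulDl red_mulDr red_scaleAl red_scaleAr.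
End ReductionAlgebra.

Section ReductionMap.
Variables (M N : lmodType R) (f : {linear M -> N}).

Definition red_map (c : redmod M) : redmod N := redpi (f (repr c)).

Lemma red_mapE x : red_map (redpi x) = redpi (f x).
Proof.
apply: redpiP; rewrite -linearB; apply: mulspan_morph (red_repr x).
  exact: linearD.
exact: linearZ_LR.
Qed.

Fact red_map_linear : linear red_map.
Proof.
move=> a c d; elim/red_ind: a => a; elim/red_ind: c => x; elim/red_ind: d => y.
rewrite redpiZ -redpiD (red_mapE x) (red_mapE y) redpiZ -redpiD.
by rewrite red_mapE linearD (linearZ_LR f).
Qed.
HB.instance Definition _ :=
  GRing.isLinear.Build redring (redmod M) (redmod N) _ red_map red_map_linear.
End ReductionMap.
End Reduction.

(* The image of p in k_p generates p k_p, so that reducing by it gives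
   k(p) = k_p / p k_p and M(p) = M_p / p M_p. *)
Section Fibre.
Variables (k : comPzRingType) (p : spec k).

Definition locprime : {pred locring p} := fun c =>
  `[< exists a : k, a \in spec_ideal p /\ c = locfrac (a : k^o) (denom1 p) >].

Definition resfield : comPzRingType := redring locprime.

Definition fibre (M : lmodType k) : lmodType resfield :=
  redmod locprime (loc p M).

Definition fibre_alg (A : pzAlgType k) : pzAlgType resfield :=
  redmod locprime (loc p A).

Definition fibre_map (M N : lmodType k) (f : {linear M -> N}) :
    {linear fibre M -> fibre N} :=
  red_map (loc_map f).
End Fibre.

Record ideal2 (k : comPzRingType) (A : pzAlgType k) := Ideal2 {
  ideal2_sub :> GRing.SubmodClosed.type A;
  ideal2Ml : forall a x : A, x \in ideal2_sub -> a * x \in ideal2_sub;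
  ideal2Mr : forall x a : A, x \in ideal2_sub -> x * a \in ideal2_sub
}.

Section TwoSidedIdeal.
Variables (k : comPzRingType) (A : pzAlgType k) (J : ideal2 A).

Definition ideal_mod : lmodType k := submod (ideal2_sub J).

Definition lideal_pred : {pred A^o} := ideal2_sub J.
Fact lideal_pred_closed : GRing.subsemimod_closed lideal_pred.
Proof.
split; last by move=> a x; apply: ideal2Ml.
by split=> [|x y]; [apply: (rpred0 J) | apply: (rpredD (S := J))].
Qed.
HB.instance Definition _ :=
  GRing.isSubmodClosed.Build A A^o lideal_pred lideal_pred_closed.

Definition ideal_lmod : lmodType A := submod lideal_pred.

Definition ideal_square : {pred A} := fun x =>
  `[< exists s : seq (A * A),
        all (fun u => (u.1 \in ideal2_sub J) && (u.2 \in ideal2_sub J)) s /\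
        x = \sum_(u <- s) u.1 * u.2 >].

Definition idempotent_ideal := ideal_square =i ideal2_sub J.

Variable p : spec k.

Definition fibre_incl : {linear fibre p ideal_mod -> fibre_alg p A} :=
  @fibre_map k p ideal_mod A (@submod_val k A (ideal2_sub J)).

Definition fibre_ideal_pred : {pred fibre_alg p A} := fun c =>
  `[< exists z, c = fibre_incl z >].

Fact fibre_ideal_closed : GRing.subsemimod_closed fibre_ideal_pred.
Proof.
split; first split.
- by apply/asboolP; exists 0; rewrite linear0.
- move=> _ _ /asboolP[z ->] /asboolP[w ->].
  by apply/asboolP; exists (z + w); rewrite linearD.
move=> a _ /asboolP[z ->].
by apply/asboolP; exists (a *: z); rewrite (linearZ_LR fibre_incl).
Qed.
HB.instance Definition _ := GRing.isSubmodClosed.Build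
  (resfield p) (fibre_alg p A) fibre_ideal_pred fibre_ideal_closed.

Fact fibre_ideal_l (a c : fibre_alg p A) :
  c \in fibre_ideal_pred -> a * c \in fibre_ideal_pred.
Proof.
elim/red_ind: a; elim/loc_ind=> a t /asboolP[z ->].
elim/red_ind: z; elim/loc_ind=> -[x xJ] s.
apply/asboolP.
exists (redpi _ (locfrac (Submod (ideal2Ml a xJ)) (denomM t s))).
rewrite /fibre_incl /= red_mapE [RHS]red_mapE /= !loc_mapE.
by rewrite [LHS]red_mulE [_ * _]loc_mulE.
Qed.

Fact fibre_ideal_r (c a : fibre_alg p A) :
  c \in fibre_ideal_pred -> c * a \in fibre_ideal_pred.
Proof.
elim/red_ind: a; elim/loc_ind=> a t /asboolP[z ->].
elim/red_ind: z; elim/loc_ind=> -[x xJ] s.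
apply/asboolP.
exists (redpi _ (locfrac (Submod (ideal2Mr a xJ)) (denomM s t))).
rewrite /fibre_incl /= red_mapE [RHS]red_mapE /= !loc_mapE.
by rewrite [LHS]red_mulE [_ * _]loc_mulE.
Qed.

Definition fibre_ideal : ideal2 (fibre_alg p A) :=
  @Ideal2 _ (fibre_alg p A) fibre_ideal_pred fibre_ideal_l fibre_ideal_r.
End TwoSidedIdeal.

Section FibreIdealMap.
Variables (k : comPzRingType) (A : pzAlgType k) (J : ideal2 A) (p : spec k).

Fact fibre_incl_mem (z : fibre p (ideal_mod J)) :
  fibre_incl J p z \in fibre_ideal J p.
Proof. by apply/asboolP; exists z. Qed.

Definition fibre_ideal_map (z : fibre p (ideal_mod J)) :
    ideal_mod (fibre_ideal J p) :=
  Submod (fibre_incl_mem z).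

Fact fibre_ideal_map_linear : linear fibre_ideal_map.
Proof. by move=> a x y; apply: val_inj; apply: (linearP (fibre_incl J p)). Qed.
HB.instance Definition _ := GRing.isLinear.Build (resfield p)
  (fibre p (ideal_mod J)) (ideal_mod (fibre_ideal J p)) _
  fibre_ideal_map fibre_ideal_map_linear.
End FibreIdealMap.

Record central_morph (k : comPzRingType) (R : pzRingType) := CentralMorph {
  central_fun :> {rmorphism k -> R};
  central_funC : forall (a : k) (x : R), central_fun a * x = x * central_fun a
}.

Definition central_id (k : comPzRingType) : central_morph k k :=
  @CentralMorph k k idfun (@mulrC k).

Section AlgebraScalars.
Variables (k : comPzRingType) (A : pzAlgType k).

Definition alg_scalar (a : k) : A := a *: (1 : A).

Fact alg_scalar_zmod : zmod_morphism alg_scalar.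
Proof. by move=> a b; apply: scalerBl. Qed.
Fact alg_scalar_monoid : GRing.monoid_morphism alg_scalar.
Proof.
split=> [|a b]; first exact: scale1r.
by rewrite /alg_scalar -[RHS]alg_scaleAl -[alg_mul _ _]/(1 * _) mul1r scalerA.
Qed.
HB.instance Definition _ :=
  GRing.isZmodMorphism.Build k A alg_scalar alg_scalar_zmod.
HB.instance Definition _ :=
  GRing.isMonoidMorphism.Build k A alg_scalar alg_scalar_monoid.

Fact alg_scalarC a x : alg_scalar a * x = x * alg_scalar a.
Proof.
rewrite -[LHS]alg_scaleAl -[RHS]alg_scaleAr.
by rewrite -[alg_mul 1 x]/(1 * x) -[alg_mul x 1]/(x * 1) mul1r mulr1.
Qed.

Definition alg_central : central_morph k A :=
  @CentralMorph k A alg_scalar alg_scalarC.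
End AlgebraScalars.

(* The k-algebra End_R(M), where k acts on M through a central morphism to R.
   The product is composition; the opposite convention would give the opposite
   algebra, for which all the properties used below are equivalent. *)
Definition endo (k : comPzRingType) (R : pzRingType) of central_morph k R :=
  fun M : lmodType R => {linear M -> M} : Type.

Section Endomorphisms.
Variables (k : comPzRingType) (R : pzRingType) (eta : central_morph k R).
Variable M : lmodType R.

Local Notation E := (endo eta M).
HB.instance Definition _ := gen_eqMixin E.
HB.instance Definition _ := gen_choiceMixin E.
Definition endo_fun (f : E) : {linear M -> M} := f.

Lemma endoP (f g : E) : endo_fun f =1 endo_fun g -> f = g.
Proof.
case: f => f [[F1] [F2]]; case: g => g [[G1] [G2]] /= /funext fg.
subst g; congr (GRing.Linear.Pack (GRing.Linear.Class _ _)).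
  by congr (Algebra.isNmodMorphism.Axioms_ _); apply: Prop_irrelevance.
by congr (GRing.isScalable.Axioms_ _); apply: Prop_irrelevance.
Qed.

Definition endo_add (f g : E) : E := endo_fun f \+ endo_fun g.
Definition endo_opp (f : E) : E := \- endo_fun f.
Definition endo_zero : E := \0 : M -> M.
Definition endo_one : E := idfun : M -> M.
Definition endo_mul (f g : E) : E := endo_fun f \o endo_fun g.

Definition endo_scale_fun (a : k) (f : E) : M -> M :=
  fun x => eta a *: endo_fun f x.
Fact endo_scale_linear a f : linear (endo_scale_fun a f).
Proof.
move=> b x y.
by rewrite /endo_scale_fun linearP scalerDr !scalerA central_funC.
Qed.
HB.instance Definition _ a f :=
  GRing.isLinear.Build R M M _ (endo_scale_fun a f) (endo_scale_linear a f).
Definition endo_scale (a : k) (f : E) : E := endo_scale_fun a f.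

Fact endo_addA : associative endo_add.
Proof. by move=> f g h; apply: endoP => x; apply: addrA. Qed.
Fact endo_addC : commutative endo_add.
Proof. by move=> f g; apply: endoP => x; apply: addrC. Qed.
Fact endo_add0 : left_id endo_zero endo_add.
Proof. by move=> f; apply: endoP => x; apply: add0r. Qed.
Fact endo_addN : left_inverse endo_zero endo_opp endo_add.
Proof. by move=> f; apply: endoP => x; apply: addNr. Qed.
HB.instance Definition _ :=
  GRing.isZmodule.Build E endo_addA endo_addC endo_add0 endo_addN.

Fact endo_scaleA a b f : endo_scale a (endo_scale b f) = endo_scale (a * b) f.
Proof.
by apply: endoP => x; rewrite /= /endo_scale_fun /= scalerA -rmorphM.
Qed.
Fact endo_scale1 : left_id 1 endo_scale.
Proof.
by move=> f; apply: endoP => x; rewrite /= /endo_scale_fun rmorph1 scale1r.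
Qed.
Fact endo_scaleDr : right_distributive endo_scale +%R.
Proof. by move=> a f g; apply: endoP => x; apply: scalerDr. Qed.
Fact endo_scaleDl f : {morph endo_scale^~ f : a b / a + b}.
Proof.
by move=> a b; apply: endoP => x; rewrite /= /endo_scale_fun rmorphD scalerDl.
Qed.
HB.instance Definition _ := GRing.Zmodule_isLmodule.Build k E
  endo_scaleA endo_scale1 endo_scaleDr endo_scaleDl.

Fact endo_mulA : associative endo_mul.
Proof. by move=> f g h; apply: endoP. Qed.
Fact endo_mul1 : left_id endo_one endo_mul.
Proof. by move=> f; apply: endoP. Qed.
Fact endo_mulr1 : right_id endo_one endo_mul.
Proof. by move=> f; apply: endoP. Qed.
Fact endo_mulDl : left_distributive endo_mul +%R.
Proof. by move=> f g h; apply: endoP. Qed.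
Fact endo_mulDr : right_distributive endo_mul +%R.
Proof. by move=> f g h; apply: endoP => x; apply: (linearD (endo_fun f)). Qed.
Fact endo_scaleAl (a : k) f g : a *: endo_mul f g = endo_mul (a *: f) g.
Proof. by apply: endoP. Qed.
Fact endo_scaleAr (a : k) f g : a *: endo_mul f g = endo_mul f (a *: g).
Proof.
by apply: endoP => x; apply/esym; apply: (linearZ_LR (endo_fun f)).
Qed.
HB.instance Definition _ := Lmodule_isPzAlgebra.Build k E
  endo_mulA endo_mul1 endo_mulr1 endo_mulDl endo_mulDr
  endo_scaleAl endo_scaleAr.
End Endomorphisms.

(* M (x)_k N as formal sums of pairs modulo the bilinearity relations; maps out
   of it are given on representatives *)
Section TensorProduct.
Variables (k : comPzRingType) (M N : lmodType k).

Inductive tensor_rel : seq (M * N) -> seq (M * N) -> Prop :=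
| TensorRefl s : tensor_rel s s
| TensorSym s t : tensor_rel s t -> tensor_rel t s
| TensorTrans s t u : tensor_rel s t -> tensor_rel t u -> tensor_rel s u
| TensorCat s s' t t' :
    tensor_rel s s' -> tensor_rel t t' -> tensor_rel (s ++ t) (s' ++ t')
| TensorCatC s t : tensor_rel (s ++ t) (t ++ s)
| Tensor0l y : tensor_rel [:: (0, y)] [::]
| TensorDl x x' y : tensor_rel [:: (x + x', y)] [:: (x, y); (x', y)]
| TensorDr x y y' : tensor_rel [:: (x, y + y')] [:: (x, y); (x, y')]
| TensorZ a x y : tensor_rel [:: (a *: x, y)] [:: (x, a *: y)].

Definition tensor_eqv (s t : seq (M * N)) : bool := `[< tensor_rel s t >].
Fact tensor_eqv_refl : reflexive tensor_eqv.
Proof. by move=> s; apply/asboolP/TensorRefl. Qed.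
Fact tensor_eqv_sym : symmetric tensor_eqv.
Proof. by move=> s t; apply/asboolP/asboolP => /TensorSym. Qed.
Fact tensor_eqv_trans : transitive tensor_eqv.
Proof.
by move=> t s u /asboolP st /asboolP tu; apply/asboolP/(TensorTrans st tu).
Qed.
Canonical tensor_eqv_equiv :=
  EquivRel tensor_eqv tensor_eqv_refl tensor_eqv_sym tensor_eqv_trans.

Definition tensor := {eq_quot tensor_eqv}.
HB.instance Definition _ := Choice.on tensor.

Definition tclass (s : seq (M * N)) : tensor := \pi_({eq_quot tensor_eqv}) s.

Lemma tclassP s t : tclass s = tclass t <-> tensor_rel s t.
Proof.
split=> [/eqmodP/asboolP//|E].
by apply/eqmodP/asboolP.
Qed.

Lemma tclass_ind (P : tensor -> Prop) :
  (forall s, P (tclass s)) -> forall c, P c.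
Proof. by move=> Ps c; rewrite -[c]reprK; apply: Ps. Qed.

Lemma tclass_repr s : tensor_rel (repr (tclass s)) s.
Proof. by apply/tclassP; rewrite [LHS]reprK. Qed.

Definition tensor_add (c d : tensor) : tensor := tclass (repr c ++ repr d).
Definition tensor_zero : tensor := tclass [::].
Definition tensor_scale (a : k) (c : tensor) : tensor :=
  tclass [seq (a *: u.1, u.2) | u <- repr c].
Definition tensor_opp (c : tensor) : tensor := tensor_scale (- 1) c.

Lemma tensor_addE s t : tensor_add (tclass s) (tclass t) = tclass (s ++ t).
Proof. by apply/tclassP/TensorCat; apply: tclass_repr. Qed.

Lemma tensor_rel_map1 (f : M -> M) s t :
    (forall x x', f (x + x') = f x + f x') ->
    (forall a x, f (a *: x) = a *: f x) ->
  tensor_rel s t ->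
  tensor_rel [seq (f u.1, u.2) | u <- s] [seq (f u.1, u.2) | u <- t].
Proof.
move=> fD fZ; elim=> /=.
- by move=> *; apply: TensorRefl.
- by move=> *; apply: TensorSym.
- by move=> ? ? ? _ E _ F; apply: TensorTrans E F.
- by move=> ? ? ? ? _ E _ F; rewrite !map_cat; apply: TensorCat.
- by move=> *; rewrite !map_cat; apply: TensorCatC.
- by move=> y; rewrite -(scale0r 0) fZ scale0r; apply: Tensor0l.
- by move=> x x' y; rewrite fD; apply: TensorDl.
- by move=> *; apply: TensorDr.
- by move=> *; rewrite fZ; apply: TensorZ.
Qed.

Lemma tensor_rel_map2 (f : N -> N) s t :
    (forall y y', f (y + y') = f y + f y') ->
    (forall a y, f (a *: y) = a *: f y) ->
  tensor_rel s t ->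
  tensor_rel [seq (u.1, f u.2) | u <- s] [seq (u.1, f u.2) | u <- t].
Proof.
move=> fD fZ; elim=> /=.
- by move=> *; apply: TensorRefl.
- by move=> *; apply: TensorSym.
- by move=> ? ? ? _ E _ F; apply: TensorTrans E F.
- by move=> ? ? ? ? _ E _ F; rewrite !map_cat; apply: TensorCat.
- by move=> *; rewrite !map_cat; apply: TensorCatC.
- by move=> *; apply: Tensor0l.
- by move=> *; apply: TensorDl.
- by move=> x y y'; rewrite fD; apply: TensorDr.
- by move=> *; rewrite fZ; apply: TensorZ.
Qed.

Lemma tensor_scaleE a s :
  tensor_scale a (tclass s) = tclass [seq (a *: u.1, u.2) | u <- s].
Proof.
apply/tclassP; apply: tensor_rel_map1 (tclass_repr s) => [x x'|b x].
  exact: scalerDr.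
by rewrite !scalerA mulrC.
Qed.

Fact tensor_addA : associative tensor_add.
Proof.
elim/tclass_ind=> s; elim/tclass_ind=> t; elim/tclass_ind=> u.
by rewrite (tensor_addE t) (tensor_addE s) !tensor_addE catA.
Qed.
Fact tensor_addC : commutative tensor_add.
Proof.
elim/tclass_ind=> s; elim/tclass_ind=> t.
by rewrite !tensor_addE; apply/tclassP/TensorCatC.
Qed.
Fact tensor_add0 : left_id tensor_zero tensor_add.
Proof. by elim/tclass_ind=> s; rewrite /tensor_zero tensor_addE. Qed.

Lemma tensor_scaleDl_rel a b s :
  tensor_rel [seq ((a + b) *: u.1, u.2) | u <- s]
    ([seq (a *: u.1, u.2) | u <- s] ++ [seq (b *: u.1, u.2) | u <- s]).
Proof.
elim: s => [|[x y] s IHs] /=; first exact: TensorRefl.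
rewrite -cat1s scalerDl.
apply: (TensorTrans (TensorCat (TensorDl (a *: x) (b *: x) y) IHs)) => /=.
rewrite -[X in tensor_rel X]cat1s -[X in tensor_rel _ X]cat1s.
apply: TensorCat; first exact: TensorRefl.
set S := map _ s; set T := map _ s.
rewrite -[X in tensor_rel _ (_ ++ X)]cat1s -cat1s !catA.
by apply: TensorCat; [apply: (TensorCatC [:: _] S)|apply: TensorRefl].
Qed.

Fact tensor_scaleDl c :
  {morph tensor_scale^~ c : a b / a + b >-> tensor_add a b}.
Proof.
elim/tclass_ind: c => s a b; rewrite !tensor_scaleE tensor_addE.
exact/tclassP/tensor_scaleDl_rel.
Qed.
Fact tensor_scale0 c : tensor_scale 0 c = tensor_zero.
Proof.
elim/tclass_ind: c => s; rewrite tensor_scaleE; apply/tclassP.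
elim: s => [|[x y] s IHs] /=; first exact: TensorRefl.
by rewrite scale0r -cat1s; apply: (TensorCat (Tensor0l y) IHs).
Qed.
Fact tensor_scale1 : left_id 1 tensor_scale.
Proof.
elim/tclass_ind=> s; rewrite tensor_scaleE; congr tclass.
by rewrite -[RHS]map_id; apply: eq_map => -[x y]; rewrite scale1r.
Qed.
Fact tensor_addN : left_inverse tensor_zero tensor_opp tensor_add.
Proof.
move=> c; rewrite -[X in tensor_add _ X]tensor_scale1.
by rewrite -tensor_scaleDl addNr tensor_scale0.
Qed.
HB.instance Definition _ := GRing.isZmodule.Build tensor
  tensor_addA tensor_addC tensor_add0 tensor_addN.

Fact tensor_scaleA a b c :
  tensor_scale a (tensor_scale b c) = tensor_scale (a * b) c.
Proof.
elim/tclass_ind: c => s; rewrite !tensor_scaleE -map_comp; congr tclass.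
by apply: eq_map => -[x y] /=; rewrite scalerA.
Qed.
Fact tensor_scaleDr : right_distributive tensor_scale +%R.
Proof.
move=> a; elim/tclass_ind=> s; elim/tclass_ind=> t.
by rewrite [_ + _]tensor_addE !tensor_scaleE [RHS]tensor_addE map_cat.
Qed.
HB.instance Definition _ := GRing.Zmodule_isLmodule.Build k tensor
  tensor_scaleA tensor_scale1 tensor_scaleDr tensor_scaleDl.
End TensorProduct.

Section TensorBimodule.
Variables (k : comPzRingType) (E : pzAlgType k).

Definition tensor_lact (e : E) (c : tensor E E) : tensor E E :=
  tclass [seq (e * u.1, u.2) | u <- repr c].
Definition tensor_ract (c : tensor E E) (e : E) : tensor E E :=
  tclass [seq (u.1, u.2 * e) | u <- repr c].
Definition tensor_mult (c : tensor E E) : E := \sum_(u <- repr c) u.1 * u.2.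

Lemma tensor_lactE e (s : seq (E * E)) :
  tensor_lact e (tclass s) = tclass [seq (e * u.1, u.2) | u <- s].
Proof.
apply/tclassP; apply: tensor_rel_map1 (tclass_repr s) => [x x'|a x].
  exact: mulrDr.
exact/esym/alg_scaleAr.
Qed.

Lemma tensor_ractE (s : seq (E * E)) e :
  tensor_ract (tclass s) e = tclass [seq (u.1, u.2 * e) | u <- s].
Proof.
apply/tclassP.
apply: (@tensor_rel_map2 k E E (fun x => x * e)) (tclass_repr s) => [x x'|a x].
  exact: mulrDl.
exact/esym/alg_scaleAl.
Qed.

Lemma tensor_multE (s : seq (E * E)) :
  tensor_mult (tclass s) = \sum_(u <- s) u.1 * u.2.
Proof.
rewrite /tensor_mult; move: (repr _) (tclass_repr s) => t; elim=> {s t} /=.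
- by [].
- by move=> s t _ ->.
- by move=> s t u _ -> _ ->.
- by move=> s s' t t' _ E1 _ E2; rewrite !big_cat E1 E2.
- by move=> s t; rewrite !big_cat /= addrC.
- by move=> y; rewrite big_seq1 big_nil mul0r.
- by move=> x x' y; rewrite !big_cons !big_nil !addr0 mulrDl.
- by move=> x y y'; rewrite !big_cons !big_nil !addr0 mulrDr.
- move=> a x y; rewrite !big_seq1 /= -[LHS]alg_scaleAl.
  exact: alg_scaleAr.
Qed.

Definition separable_alg :=
  exists s : E -> tensor E E,
    [/\ {morph s : x y / x + y},
        forall e x, s (e * x) = tensor_lact e (s x),
        forall x e, s (x * e) = tensor_ract (s x) e &
        forall x, tensor_mult (s x) = x].
End TensorBimodule.

Definition fin_gen (R : pzRingType) (M : lmodType R) :=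
  exists (n : nat) (v : 'I_n -> M),
    forall x, exists c : 'I_n -> R, x = \sum_i c i *: v i.

Definition projective (R : pzRingType) (P : lmodType R) :=
  forall (U V : lmodType R) (g : {linear U -> V}) (f : {linear P -> V}),
    (forall v, exists u, g u = v) ->
    exists h : {linear P -> U}, forall x, g (h x) = f x.

Definition noetherian (k : comPzRingType) :=
  forall I : ideal k, fin_gen (submod I).

Definition semisimple_ring (E : pzRingType) :=
  forall L : submodClosed E^o, exists L' : submodClosed E^o,
    (forall x, x \in L -> x \in L' -> x = 0) /\
    (forall x, exists y z, [/\ y \in L, z \in L' & x = y + z]).

Definition k_semisimple (k : comPzRingType) (E : pzAlgType k) :=
  forall p : spec k, semisimple_ring (fibre_alg p E).

Definition alg_product (k : comPzRingType) (E : pzAlgType k) (n : nat)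
    (F : 'I_n -> pzAlgType k) :=
  exists phi : forall i, E -> F i,
    (forall i, alg_hom (phi i)) /\
    (forall y : (forall i, F i), exists! x, forall i, phi i x = y i).

Definition azumaya (k : comPzRingType) (E : pzAlgType k) :=
  [/\ separable_alg E,
      forall a : k, a *: (1 : E) = 0 -> a = 0 &
      forall z : E, (forall x, z * x = x * z) ->
        exists a : k, z = a *: (1 : E)].

Definition semisplit_alg (k : comPzRingType) (E : pzAlgType k) :=
  exists (n : nat) (F : 'I_n -> pzAlgType k),
    (forall i, azumaya (F i)) /\ alg_product E F.

Definition endk (k : comPzRingType) (Q : lmodType k) : pzAlgType k :=
  endo (central_id k) Q.

Definition split_alg (k : comPzRingType) (E : pzAlgType k) :=
  exists (n : nat) (Q : 'I_n -> lmodType k),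
    (forall i, fin_gen (Q i) /\ projective (Q i)) /\
    alg_product E (fun i => endk (Q i)).

Section HeredityIdeals.
Variables (k : comPzRingType) (A : pzAlgType k) (J : ideal2 A).

Definition end_ideal : pzAlgType k := endo (alg_central A) (ideal_lmod J).

Definition heredity :=
  [/\ projective (quomod J : lmodType k),
      projective (ideal_lmod J),
      idempotent_ideal J &
      k_semisimple end_ideal].

Definition heredity_separable := heredity /\ separable_alg end_ideal.
Definition heredity_semisplit := heredity /\ semisplit_alg end_ideal.
Definition heredity_split := heredity /\ split_alg end_ideal.
End HeredityIdeals.

Section RingConditions.
Variable k : comPzRingType.

Definition is_domain :=
  (1 : k) <> 0 /\ forall a b : k, a * b = 0 -> a = 0 \/ b = 0.

Definition zero_pred : {pred k^o} := pred1 0.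
Fact zero_pred_closed : GRing.subsemimod_closed zero_pred.
Proof.
split; first split.
- by rewrite inE.
- by move=> x y; rewrite !inE => /eqP-> /eqP->; rewrite addr0.
by move=> a x; rewrite !inE => /eqP->; rewrite scaler0.
Qed.
HB.instance Definition _ :=
  GRing.isSubmodClosed.Build k k^o zero_pred zero_pred_closed.

Fact zero_pred_prime : is_domain -> prime_ideal (zero_pred : ideal k).
Proof.
move=> [/eqP k1 kM]; split=> [|a b]; first by rewrite inE.
by rewrite !inE => /eqP/kM[]->; rewrite eqxx; [left|right].
Qed.

(* k_(0) is the field of fractions of the domain k. *)
Definition fracfield (dom : is_domain) : comPzRingType :=
  locring (Spec (zero_pred_prime dom)).
Definition to_fracfield (dom : is_domain) (a : k) : fracfield dom :=
  locfrac (a : k^o) (denom1 _).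

Definition integrally_closed_domain :=
  exists dom : is_domain, forall x : fracfield dom,
    (exists (n : nat) (c : 'I_n -> k),
       x ^+ n + \sum_(i < n) to_fracfield dom (c i) * x ^+ i = 0) ->
    exists a : k, x = to_fracfield dom a.

Definition prime_chain (n : nat) (c : 'I_n.+1 -> spec k) :=
  forall i j : 'I_n.+1, (i < j)%N ->
    {subset c i <= c j} /\ ~ {subset c j <= c i}.

Definition height_le (p : spec k) (d : nat) :=
  forall n (c : 'I_n.+1 -> spec k),
    prime_chain c -> c ord_max =i p -> (n <= d)%N.

Definition krull_dim_le (d : nat) :=
  forall n (c : 'I_n.+1 -> spec k), prime_chain c -> (n <= d)%N.

Definition krull_dim (d : nat) :=
  krull_dim_le d /\ exists c : 'I_d.+1 -> spec k, prime_chain c.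

Definition regular_local :=
  noetherian k /\
  exists m : ideal k,
    [/\ maximal_ideal m,
        forall m' : ideal k, maximal_ideal m' -> m' =i m &
        exists d, krull_dim d /\
          exists v : 'I_d -> k, forall x,
            x \in m <-> exists c : 'I_d -> k, x = \sum_i c i * v i].
End RingConditions.

Definition regular_domain (k : comPzRingType) :=
  [/\ is_domain k, noetherian k &
      forall p : spec k, regular_local (locring p)].

(* Main.v *)
(* Properties are localised by denominators: for each property the s in k for which
   it holds up to the factor s form an ideal, and an ideal contained in no maximal
   ideal is k.

   If the image of J(p) in A(p) is a heredity ideal, then J = J^2 forces J(p) -> A(p)
   to be injective, so J is a direct summand of A near p. The obstructions to J being
   projective over A, and to E = End_A(J) being separable, are classes of cocycles
   that become coboundaries in the fibre, hence near p by Nakayama. Moreover E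
   commutes with base change, which gives (a) and (b).

   For (c), the central idempotents of E at the generic point lie in E, since their
   denominators form an ideal contained in no prime of height one; this reduces to E
   with centre k. If J is heredity with E separable at all primes of height <= 1 but
   not at P, take P minimal over the ideal I of denominators, so that P^T <= I at P.
   In k_P / P^N Fitting's lemma gives J = BeB with e idempotent, and the determinant
   d of C (x) C -> End(C), C = eBe, divides all long products of elements of I. Were d not
   a unit, some P^M would lie in (d) + P^N, hence in (d), making P principal of
   height <= 1. So d is a unit, C is Azumaya, and J is heredity at P after all.

   For (d), let F be an Azumaya factor of E and g in F an element that spans a rank
   one corner generically. Then Q = F g Frac(k) /\ F satisfies F = End(Q), by
   comparing at primes of height one. As Q is saturated in F, a minimal presentation
   of Q at P = (a, b) has a relation module R with R = PR, so Q is projective. *)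

Require Import Defs.
From HB Require Import structures.
From mathcomp Require Import all_boot all_algebra ring boolp.

Set Implicit Arguments.
Unset Strict Implicit.
Unset Printing Implicit Defensive.

Import GRing.Theory.
Local Open Scope ring_scope.

(** * Linear maps and submodules given by predicates *)

(** The familiar purity argument for Azumaya algebras looks at the determinant of E (x) E^op ->
    End(E), a unit as soon as it is one in height one. It needs E projective over [k], and E =
    End_A(J) is known to be so only once J is projective over A, which has itself to be proved; in
    dimension three or more reflexivity of E does not suffice. What survives is J = J^2: it provides
    idempotents, but only where idempotents lift, hence over the quotient of k_p by a power of p.
    There C = eBe is free and a determinant exists, but the ring has zero divisors and the
    determinant can no longer be compared at primes of height one. Divisibility of long products
    replaces that comparison, and the power of p is fixed large enough beforehand. No localised
    algebras are glued: each property has a form with a denominator ([sdual], [sretract], [adual],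
    [csep], [sandwich]). Semisimplicity over [k] alone is not lifted, being fibrewise by
    definition. *)

Section Packing.
Variables (R : pzRingType) (M N : lmodType R).

Definition mklin (f : M -> N) (f_lin : linear f) : {linear M -> N} :=
  HB.pack f (GRing.isLinear.Build R M N *:%R f f_lin).

Lemma linearP2 (f : {linear M -> N}) :
  (forall x y, f (x + y) = f x + f y) * (forall a x, f (a *: x) = a *: f x).
Proof. by split=> *; [exact: linearD | exact: linearZ_LR]. Qed.

Section Raw.
Variables (f : M -> N) (fl : linear f).
Lemma linD x y : f (x + y) = f x + f y. Proof. exact: (linearD (mklin fl)). Qed.
Lemma linZ a x : f (a *: x) = a *: f x. Proof. exact: (linearZ_LR (mklin fl)). Qed.
Lemma lin0 : f 0 = 0. Proof. exact: (linear0 (mklin fl)). Qed.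
Lemma linN x : f (- x) = - f x. Proof. exact: (linearN (mklin fl)). Qed.
Lemma linB x y : f (x - y) = f x - f y. Proof. exact: (linearB (mklin fl)). Qed.
Lemma linsum (I : Type) (r : seq I) (P : pred I) (F : I -> M) :
  f (\sum_(i <- r | P i) F i) = \sum_(i <- r | P i) f (F i).
Proof. exact: (linear_sum (mklin fl)). Qed.
End Raw.
End Packing.

(** * Deciding identities in abelian groups by reflection *)

Section AbelianGroupEquations.
Inductive zexp := ZVar of nat | ZAdd of zexp & zexp | ZOpp of zexp | ZZero.

Fixpoint zeval (V : zmodType) (env : seq V) (e : zexp) : V :=
  match e with
  | ZVar n => nth 0 env n
  | ZAdd a b => zeval env a + zeval env b
  | ZOpp a => - zeval env a
  | ZZero => 0
  end.

Fixpoint zcoef (e : zexp) (n : nat) : int :=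
  match e with
  | ZVar m => (m == n)%:Z
  | ZAdd a b => zcoef a n + zcoef b n
  | ZOpp a => - zcoef a n
  | ZZero => 0
  end.

Lemma zeval_coef (V : zmodType) (env : seq V) e :
  zeval env e = \sum_(i < size env) env`_i *~ zcoef e i.
Proof.
elim: e => [n|a IHa b IHb|a IHa|] /=.
- have [lt|ge] := ltnP n (size env); last first.
    rewrite nth_default // big1 // => i _.
    by rewrite gtn_eqF ?mulr0z // (leq_trans (ltn_ord i)).
  rewrite (bigD1 (Ordinal lt)) //= eqxx mulr1z big1 ?addr0 // => i ni.
  by rewrite [n == i]eq_sym (negPf (ni : (i != n :> nat))) mulr0z.
- by rewrite IHa IHb -big_split; apply: eq_bigr => i _; rewrite mulrzDr.
- by rewrite IHa -sumrN; apply: eq_bigr => i _; rewrite mulrNz.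
by rewrite big1 // => i _; rewrite mulr0z.
Qed.

Definition zcheck e1 e2 n := all (fun m => zcoef e1 m == zcoef e2 m) (iota 0 n).

(** Over any abelian group an expression is determined by its integer coefficients. Only positions
    below [n] are compared, since an index beyond [env] evaluates to 0. This lets [abel] act in
    modules and in non-commutative algebras. *)
Lemma zexp_eq (V : zmodType) (env : seq V) e1 e2 n :
  zcheck e1 e2 n -> size env = n ->
  zeval env e1 = zeval env e2.
Proof.
move=> + En; rewrite -{}En => /allP H; rewrite !zeval_coef; apply: eq_bigr => i _.
by have /eqP-> : zcoef e1 i == zcoef e2 i by apply: H; rewrite mem_iota ltn_ord.
Qed.
End AbelianGroupEquations.

Ltac zatom x l :=
  lazymatch l with
  | context [cons x _] => l
  | _ => constr:(cons x l)
  end.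
Ltac zatoms e l :=
  lazymatch e with
  | ?x + ?y => let l := zatoms x l in zatoms y l
  | - ?x => zatoms x l
  | 0 => l
  | _ => zatom e l
  end.
Ltac zindex x l :=
  lazymatch l with
  | cons x _ => constr:(0%N)
  | cons _ ?l' => let n := zindex x l' in constr:(S n)
  end.
Ltac zquote e l :=
  lazymatch e with
  | ?x + ?y => let a := zquote x l in let b := zquote y l in constr:(ZAdd a b)
  | - ?x => let a := zquote x l in constr:(ZOpp a)
  | 0 => constr:(ZZero)
  | _ => let n := zindex e l in constr:(ZVar n)
  end.
Ltac zfirst e :=
  lazymatch e with
  | ?x + ?y => let r := zfirst x in lazymatch r with tt => zfirst y | _ => r end
  | - ?x => zfirst x
  | 0 => constr:(tt)
  | _ => match goal with
         | _ => let _ := match goal with _ => is_var e end in constr:(tt)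
         | _ => e
         end
  end.
(* Atoms are named by [set], which identifies them up to conversion. *)
Ltac zgen :=
  repeat lazymatch goal with
  | |- @eq ?T ?x ?y =>
    let r := zfirst x in
    let r := lazymatch r with tt => zfirst y | _ => r end in
    lazymatch r with
    | tt => fail
    | _ => let v := fresh "v" in set v := r; clearbody v
    end
  end.
Ltac abel :=
  zgen;
  lazymatch goal with
  | |- @eq ?T ?x ?y =>
    let l := zatoms x (@nil T) in let l := zatoms y l in
    let a := zquote x l in let b := zquote y l in
    let n := eval lazy in (size l) in
    exact (@zexp_eq _ l a b n (erefl true <: zcheck a b n) (erefl n))
  end.

Lemma comp_linear (R : pzRingType) (M N P : lmodType R)
  (f : {linear N -> P}) (g : {linear M -> N}) : linear (f \o g).
Proof. by move=> a x y; rewrite /= !linearP. Qed.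

Lemma sum_linear (R : pzRingType) (M N : lmodType R) (I : Type) (r : seq I)
  (P : pred I) (F : I -> M -> N) : (forall i, linear (F i)) ->
  linear (fun x => \sum_(i <- r | P i) F i x).
Proof.
move=> Fl a x y; rewrite scaler_sumr -big_split; apply: eq_bigr => i _.
exact: Fl.
Qed.

Lemma scalel_linear (k : comPzRingType) (M N : lmodType k)
  (f : {linear M -> k^o}) (y : N) : linear (fun x => (f x : k) *: y).
Proof.
move=> a u v; rewrite linearP scalerDl; congr (_ + _).
by rewrite -[a *: f u]/(a * f u : k) -scalerA.
Qed.

Lemma scale_linear (k : comPzRingType) (M N : lmodType k) (a : k)
  (f : {linear M -> N}) : linear (fun x => a *: f x).
Proof.
by move=> b u v; rewrite linearP scalerDr !scalerA mulrC.
Qed.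

Lemma mulr_linear (k : comPzRingType) (M : lmodType k) (a : k)
  (f : {linear M -> k^o}) : linear (fun x => a * (f x : k) : k^o).
Proof. exact: (@scale_linear k M k^o a f). Qed.

Section Submodules.
Variables (R : pzRingType) (M : lmodType R).
Implicit Types D : M -> Prop.

(** Submodules as predicates in [Prop]: most of those below are given by existential conditions.
    [mksub] bundles them when a module structure is wanted. *)
Definition smod D :=
  [/\ D 0, forall x y, D x -> D y -> D (x + y) & forall a x, D x -> D (a *: x)].

Section Theory.
Variables (D : M -> Prop) (DP : smod D).
Lemma smod0 : D 0. Proof. by case: DP. Qed.
Lemma smodD x y : D x -> D y -> D (x + y). Proof. by case: DP => _ + _; apply. Qed.
Lemma smodZ a x : D x -> D (a *: x). Proof. by case: DP => _ _; apply. Qed.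
Lemma smodN x : D x -> D (- x). Proof. by rewrite -scaleN1r; apply: smodZ. Qed.
Lemma smodB x y : D x -> D y -> D (x - y).
Proof. by move=> Dx /smodN; apply: smodD. Qed.
Lemma smod_sum (I : Type) (r : seq I) (P : pred I) (F : I -> M) :
  (forall i, P i -> D (F i)) -> D (\sum_(i <- r | P i) F i).
Proof. by move=> DF; apply: (big_ind D) => //; [exact: smod0 | exact: smodD]. Qed.

Definition sub_pred : {pred M} := fun x => `[< D x >].
Fact sub_pred_closed : GRing.subsemimod_closed sub_pred.
Proof.
split; first split.
- exact/asboolP/smod0.
- by move=> x y /asboolP Dx /asboolP Dy; apply/asboolP/smodD.
by move=> a x /asboolP Dx; apply/asboolP/smodZ.
Qed.
Definition mksub : submodClosed M :=
  HB.pack sub_pred (GRing.isSubmodClosed.Build R M sub_pred sub_pred_closed).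
Lemma mksubE x : (x \in mksub) <-> D x.
Proof. by split=> [/asboolP|Dx]//; apply/asboolP. Qed.
End Theory.

Lemma smod_mem (S : submodClosed M) : smod (fun x => x \in S).
Proof. by split=> [|x y|a x]; [apply: rpred0|apply: rpredD|apply: rpredZ]. Qed.

Lemma smod_zero : smod (fun x => x = 0).
Proof. by split=> // [x y -> ->|a x ->]; rewrite ?addr0 ?scaler0. Qed.

Lemma smod_add D E : smod D -> smod E ->
  smod (fun z => exists2 w, E w & D (z - w)).
Proof.
move=> DP EP; split.
- by exists 0; rewrite ?subr0; apply: smod0.
- move=> x y [w Ew Dw] [v Ev Dv]; exists (w + v); first exact: smodD.
  by rewrite opprD addrACA; apply: smodD.
move=> a x [w Ew Dw]; exists (a *: w); first exact: smodZ.
by rewrite -scalerBr; apply: smodZ.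
Qed.
End Submodules.

Lemma smod_preim (R : pzRingType) (M N : lmodType R) (f : {linear M -> N})
  (D : N -> Prop) : smod D -> smod (fun x => D (f x)).
Proof.
move=> DP; split=> [|x y Dx Dy|a x Dx].
- by rewrite linear0; apply: smod0.
- by rewrite linearD; apply: smodD.
by rewrite (linearP2 f); apply: smodZ.
Qed.

Lemma smod_ker (R : pzRingType) (M N : lmodType R) (f : {linear M -> N}) :
  smod (fun x => f x = 0).
Proof. exact: (smod_preim f (smod_zero N)). Qed.

Lemma big_optionD (V : nmodType) (I : finType) (F : option I -> V) :
  \sum_o F o = F None + \sum_i F (Some i).
Proof.
rewrite (bigD1 None) //=; congr (_ + _).
rewrite (reindex_omap Some id) /=; last by case.
by apply: eq_bigl => i; rewrite eqxx.
Qed.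

Section Spans.
Variables (k : comPzRingType).
Definition ideal_like (C : k -> Prop) := @smod k k^o C.

Lemma ideal_like_mem (I : ideal k) : ideal_like (fun a => a \in I).
Proof. exact: smod_mem. Qed.

Definition allk (a : k) := True.
Lemma ideal_like_all : ideal_like allk. Proof. by []. Qed.

Section Module.
Variable M : lmodType k.
Implicit Types (D : M -> Prop) (l : seq M).

(** The submodule D + C x_1 + ... + C x_n. With [C] a prime it expresses the hypothesis of
    Nakayama's lemma, with [allk] ordinary generation modulo [D]. *)
Fixpoint addspan (C : k -> Prop) D l : M -> Prop :=
  if l is x :: l' then fun y => exists2 a, C a & addspan C D l' (y - a *: x)
  else D.

Lemma smod_addspan C D l : ideal_like C -> smod D -> smod (addspan C D l).
Proof.
move=> CP DP; elim: l => //= x l IHl; split.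
- by exists 0; [exact: (smod0 CP) | rewrite scale0r subr0; apply: smod0].
- move=> y z [a Ca Ha] [b Cb Hb]; exists (a + b); first exact: (smodD CP).
  by rewrite scalerDl opprD addrACA; apply: smodD.
move=> a y [b Cb Hb]; exists (a * b); first exact: (smodZ CP a Cb).
by rewrite -scalerA -scalerBr; apply: smodZ.
Qed.

Lemma addspan_sub C D l y : ideal_like C -> D y -> addspan C D l y.
Proof.
move=> CP Dy; elim: l => //= x l IHl.
by exists 0; [exact: (smod0 CP) | rewrite scale0r subr0].
Qed.

Lemma addspan_ind C D l (E : M -> Prop) : smod E ->
  (forall y, D y -> E y) -> (forall a x, C a -> x \in l -> E (a *: x)) ->
  forall y, addspan C D l y -> E y.
Proof.
move=> EP DE; elim: l => //= x l IHl lE y [a Ca Hy].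
rewrite -[y](subrK (a *: x)); apply: smodD => //.
  by apply: IHl Hy => b z Cb zl; apply: lE; rewrite // inE zl orbT.
by apply: lE; rewrite ?mem_head.
Qed.

Lemma addspan_mem C D l a x : ideal_like C -> smod D -> C a ->
  x \in l -> addspan C D l (a *: x).
Proof.
move=> CP DP Ca; elim: l => //= z l IHl; rewrite inE => /predU1P[->|xl].
  by exists a => //; rewrite subrr; apply: (smod0 (smod_addspan _ CP DP)).
by exists 0; [exact: (smod0 CP) | rewrite scale0r subr0; apply: IHl].
Qed.

Definition spn l := addspan allk (fun y => y = 0) l.

Lemma smod_spn l : smod (spn l).
Proof. by apply: smod_addspan => //; apply: smod_zero. Qed.
Lemma spn_mem l x : x \in l -> spn l x.
Proof.
move=> xl; rewrite -[x]scale1r; apply: addspan_mem => //; exact: smod_zero.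
Qed.
Lemma spn_ind l (E : M -> Prop) : smod E -> (forall x, x \in l -> E x) ->
  forall y, spn l y -> E y.
Proof.
move=> EP lE; apply: addspan_ind => // [y ->|a x _ /lE]; first exact: smod0.
exact: smodZ.
Qed.

Lemma spn_sum (I : Type) (r : seq I) (c : I -> k) (x : I -> M) :
  spn [seq x i | i <- r] (\sum_(i <- r) c i *: x i).
Proof.
elim: r => [|i r IHr]; first by rewrite big_nil.
by rewrite big_cons; exists (c i) => //; rewrite addrC addKr.
Qed.

Lemma spn_cat l1 l2 y : spn (l1 ++ l2) y <->
  exists2 w, spn l1 w & spn l2 (y - w).
Proof.
split.
  move: y; apply: spn_ind => [|x].
    by apply: smod_add; apply: smod_spn.
  rewrite mem_cat => /orP[xl|xl].
    exists x; first exact: spn_mem.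
    by rewrite subrr; apply: (smod0 (smod_spn _)).
  exists 0; first exact: (smod0 (smod_spn _)).
  by rewrite subr0; apply: spn_mem.
move=> [w l1w l2w]; rewrite -[y](subrK w); apply: (smodD (smod_spn _)).
  move: (y - w) l2w; apply: spn_ind => [|x xl]; first exact: smod_spn.
  by apply: spn_mem; rewrite mem_cat xl orbT.
move: w l1w {l2w}; apply: spn_ind => [|x xl]; first exact: smod_spn.
by apply: spn_mem; rewrite mem_cat xl.
Qed.

Lemma mulspan_ind (I : {pred k}) (E : M -> Prop) : smod E ->
  (forall a x, a \in I -> E (a *: x)) -> forall y, y \in @mulspan k I M -> E y.
Proof.
move=> EP IE y /asboolP[s [/allP sI ->]]; rewrite big_seq.
by apply: (smod_sum EP) => u us; apply/IE/sI.
Qed.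

Lemma smod_mulspan (I : {pred k}) : smod (fun y => y \in @mulspan k I M).
Proof. exact: smod_mem. Qed.
End Module.

Lemma mulspan_lin (M N : lmodType k) (I : {pred k}) (f : {linear M -> N}) y :
  y \in @mulspan k I M -> f y \in @mulspan k I N.
Proof. by apply: mulspan_morph; [exact: linearD | exact: linearZ_LR]. Qed.

End Spans.
Arguments allk {k}.

(** * Nakayama's lemma and local splitting *)

Section Nakayama.
Variables (k : comPzRingType) (p : spec k).
Local Notation P := (spec_ideal p).
Implicit Types M : lmodType k.

Lemma spec1 : 1 \notin P. Proof. by case: (spec_prime p). Qed.
Lemma specM a b : a \notin P -> b \notin P -> a * b \notin P.
Proof.
by move=> aP bP; apply/negP => /(spec_prime p).2[]; apply/negP.
Qed.
Lemma specMr a b : a \in P -> a * b \in P.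
Proof. by move=> aP; rewrite mulrC; apply: (@rpredZ k k^o P). Qed.
Lemma specMl a b : b \in P -> a * b \in P.
Proof. by move=> aP; apply: (@rpredZ k k^o P). Qed.
Lemma specB a b : a \notin P -> b \in P -> a - b \notin P.
Proof.
move=> aP bP; apply: contra aP => abP.
by rewrite -[a](subrK b); apply: (@rpredD k^o P).
Qed.
Lemma specX a n : a \notin P -> a ^+ n \notin P.
Proof.
by move=> aP; elim: n => [|n IHn]; rewrite ?expr0 ?spec1 // exprS specM.
Qed.

(** Membership of y/1 in the localised submodule D_p, without forming M_p. *)
Definition loc_in M (D : M -> Prop) (y : M) := exists2 s : k, s \notin P & D (s *: y).

Lemma loc_in_sub M (D : M -> Prop) y : D y -> loc_in D y.
Proof. by exists 1; rewrite ?spec1 ?scale1r. Qed.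

Lemma loc_in_imp M (D E : M -> Prop) y :
  (forall z, D z -> E z) -> loc_in D y -> loc_in E y.
Proof. by move=> DE [s sP /DE]; exists s. Qed.

Lemma smod_loc_in M (D : M -> Prop) : smod D -> smod (loc_in D).
Proof.
move=> DP; split.
- by exists 1; rewrite ?spec1 ?scaler0 //; apply: smod0.
- move=> x y [s sP Dx] [t tP Dy]; exists (s * t); first exact: specM.
  rewrite scalerDr; apply: smodD => //; last by rewrite -scalerA; apply: smodZ.
  by rewrite mulrC -scalerA; apply: smodZ.
move=> a x [s sP Dx]; exists s => //.
by rewrite scalerA mulrC -scalerA; apply: smodZ.
Qed.

Lemma loc_in_idem M (D : M -> Prop) y :
  loc_in (loc_in D) y -> loc_in D y.
Proof.
by move=> [s sP [t tP Dy]]; exists (t * s); rewrite ?specM // -scalerA.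
Qed.

Lemma loc_inZ M (D : M -> Prop) s y : s \notin P ->
  loc_in D (s *: y) -> loc_in D y.
Proof. by move=> sP Hy; apply: loc_in_idem; exists s. Qed.

Lemma loc_in_all M (D : M -> Prop) (l : seq M) : smod D ->
  (forall x, x \in l -> loc_in D x) ->
  exists2 s : k, s \notin P & forall x, x \in l -> D (s *: x).
Proof.
move=> DP; elim: l => [|x l IHl] lD; first by exists 1; rewrite ?spec1.
have [|s sP Hs] := IHl; first by move=> y yl; apply: lD; rewrite inE yl orbT.
have [t tP Dx] := lD x (mem_head _ _); exists (s * t); first exact: specM.
move=> y; rewrite inE => /predU1P[->|yl]; first by rewrite -scalerA; apply: smodZ.
by rewrite mulrC -scalerA; apply: (smodZ DP); apply: Hs.
Qed.

Lemma loc_in_span M (D : M -> Prop) (l : seq M) : smod D ->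
  (forall x, x \in l -> loc_in D x) ->
  exists2 s : k, s \notin P & forall x, spn l x -> D (s *: x).
Proof.
move=> DP /(loc_in_all DP)[s sP Hs]; exists s => //.
apply: spn_ind => //; split=> [|x y|a x].
- by rewrite scaler0; apply: smod0.
- by rewrite scalerDr; apply: smodD.
by rewrite scalerA mulrC -scalerA; apply: smodZ.
Qed.

(** The relation for the head x reads (s - a) x in D + p l with s - a outside p, so x can be
    eliminated from the other relations, without determinants. *)
Lemma nakayama_seq M (D : M -> Prop) (l : seq M) : smod D ->
  (forall x, x \in l -> loc_in (addspan (fun a => a \in P) D l) x) ->
  exists2 s : k, s \notin P & forall x, x \in l -> D (s *: x).
Proof.
have PP := ideal_like_mem P.
move=> DP; elim: l => [|x l IHl] lH; first by exists 1; rewrite ?spec1.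
have [s sP /= [a aP Ha]] := lH x (mem_head _ _).
have EP := smod_addspan l PP DP.
rewrite -scalerBl in Ha; have uP := specB sP aP.
have [|t tP Ht] := IHl.
  move=> y yl; have [|v vP /= [b bP Hb]] := lH y; first by rewrite inE yl orbT.
  exists ((s - a) * v); first exact: specM.
  have -> : ((s - a) * v) *: y = (s - a) *: (v *: y - b *: x) + b *: ((s - a) *: x).
    by rewrite scalerBr !scalerA [b * _]mulrC subrK.
  by apply: (smodD EP); apply: (smodZ EP).
exists (t * (s - a)); first exact: specM.
have tE z : addspan (fun a => a \in P) D l z -> D (t *: z).
  move: z; apply: addspan_ind => [|z Dz|b z _ zl]; last 2 first.
  - exact: smodZ.
  - by rewrite scalerA mulrC -scalerA; apply: (smodZ DP); apply: Ht.
  split=> [|z w|b z]; first by rewrite scaler0; apply: smod0.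
    by rewrite scalerDr; apply: smodD.
  by rewrite scalerA mulrC -scalerA; apply: smodZ.
move=> y; rewrite inE => /predU1P[->|yl]; first by rewrite -scalerA; apply: tE.
by rewrite mulrC -scalerA; apply: (smodZ DP); apply: Ht.
Qed.

Lemma nakayama M (D : M -> Prop) (l : seq M) (s0 : k) : smod D -> s0 \notin P ->
  (forall y, addspan allk D l (s0 *: y)) ->
  (forall y, loc_in (fun z => exists2 w, w \in @mulspan k P M & D (z - w)) y) ->
  exists2 s : k, s \notin P & forall y, D (s *: y).
Proof.
have PP := ideal_like_mem P.
move=> DP s0P gen H.
have EP := smod_addspan l PP DP.
have [|s sP Hs] := @nakayama_seq M D l DP.
  move=> x xl; have [t tP [w wP Dw]] := H x.
  exists (s0 * t); first exact: specM.
  rewrite -scalerA -[t *: x](subrK w) scalerDr; apply: (smodD EP).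
    by apply/addspan_sub => //; apply: smodZ.
  move: w wP {Dw}; apply: mulspan_ind => [|a z aP].
    split=> [|z v|b z]; first by rewrite scaler0; apply: (smod0 EP).
      by rewrite scalerDr; apply: (smodD EP).
    by rewrite scalerA mulrC -scalerA; apply: (smodZ EP).
  rewrite scalerA mulrC -scalerA; move: (s0 *: z) (gen z).
  apply: addspan_ind => [|v Dv|b v _ vl].
  - split=> [|z' v|b z']; first by rewrite scaler0; apply: (smod0 EP).
      by rewrite scalerDr; apply: (smodD EP).
    by rewrite scalerA mulrC -scalerA; apply: (smodZ EP).
  - by apply: addspan_sub => //; apply: smodZ.
  by rewrite scalerA; apply: addspan_mem => //; apply: specMr.
exists (s * s0); first exact: specM.
move=> y; rewrite -scalerA; move: (s0 *: y) (gen y).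
apply: addspan_ind => [|v Dv|b v _ vl]; last 2 first.
- exact: smodZ.
- by rewrite scalerA mulrC -scalerA; apply: (smodZ DP); apply: Hs.
split=> [|z v|b z]; first by rewrite scaler0; apply: smod0.
  by rewrite scalerDr; apply: smodD.
by rewrite scalerA mulrC -scalerA; apply: smodZ.
Qed.

(** Functionals defined over [k] separate the points of the fibre M(p). This holds when M has a dual
    basis at p ([sdual_detects]). *)
Definition detects M :=
  forall z : M, (forall f : {linear M -> k^o}, (f z : k) \in P) ->
  loc_in (fun y => y \in @mulspan k P M) z.

(* If Y / D -> Z is injective modulo p then it is locally split; the induction
   splits off one generator at a time. *)
Lemma local_split (Y Z : lmodType k) (D : Y -> Prop) (d : {linear Y -> Z})
    (l : seq Y) (s0 : k) : smod D -> (forall y, D y -> d y = 0) -> s0 \notin P ->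
  (forall y, addspan allk D l (s0 *: y)) -> detects Z ->
  (forall y, loc_in (fun z => z \in @mulspan k P Z) (d y) ->
     loc_in (fun z => exists2 w, w \in @mulspan k P Y & D (z - w)) y) ->
  exists2 s : k, s \notin P & exists (I : finType) (w : I -> Y)
    (f : I -> {linear Z -> k^o}),
    forall y, D (s *: y - \sum_i (f i (d y) : k) *: w i).
Proof.
move=> DP D0 s0P gen Zd; move: {2}(size l) (leqnn (size l)) => n.
elim: n l D d DP D0 gen => [|n IHn] l D d DP D0 gen ln inj.
  move: ln gen; rewrite leqn0 size_eq0 => /eqP-> /= gen.
  exists s0 => //; exists void, (fun _ => 0), (fun _ => \0) => y.
  by rewrite big1 ?subr0 // => -[].
pose E z := exists2 w, w \in @mulspan k P Y & D (z - w).
have EP : smod E by apply: smod_add (smod_mulspan _ _).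
have [all_l|] := pselect (forall x, x \in l -> loc_in E x).
  have [s sP Hs] : exists2 s : k, s \notin P & forall y, D (s *: y).
    apply: (nakayama DP s0P gen) => y; apply: (@loc_inZ _ _ s0) => //.
    move: (s0 *: y) (gen y); apply: addspan_ind => [|v Dv|b v _ vl].
    - exact: smod_loc_in.
    - by apply: loc_in_sub; exists 0; rewrite ?subr0 ?rpred0.
    by apply: (smodZ (smod_loc_in EP)); apply: all_l.
  exists s => //; exists void, (fun _ => 0), (fun _ => \0) => y.
  by rewrite big1 ?subr0 // => -[].
move=> /existsNP[x /not_implyP[xl nEx]].
have [f ufP] : exists f : {linear Z -> k^o}, (f (d x) : k) \notin P.
  apply: contrapT => /forallNP nf; apply/nEx/inj/Zd => f.
  by apply: contrapT => /negP; apply: nf.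
pose u : k := f (d x).
(* [d'] is [u] times the projection of [d] along [d x]. It kills [x], so [x] may be added to [D] and
   removed from the generators. *)
have d'_lin : linear (fun y => u *: d y - (f (d y) : k) *: d x).
  move=> a y z; rewrite (linearP d) (linearP f) scalerDr scalerBr !scalerA [u * a]mulrC.
  by rewrite addrACA -opprD -[in RHS]scalerDl.
pose d' := mklin d'_lin.
have D'P : smod (addspan allk D [:: x]) by apply: smod_addspan.
have [||||s sP [I [w [g Hg]]]] :=
  IHn (rem x l) (addspan allk D [:: x]) d' D'P.
- move=> y [a _] /= /D0; rewrite linearB (linearP2 d) => /eqP.
  rewrite subr_eq0 => /eqP->; rewrite (linearP2 f) scalerA.
  by rewrite -[a *: _]/(a * _ : k) mulrC subrr.
- move=> y; move: (s0 *: y) (gen y); have D2P := smod_addspan (rem x l) (ideal_like_all k) D'P.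
  apply: addspan_ind => [//|v Dv|b v _ vl].
    by do 2!apply: addspan_sub => //.
  have [->|nvx] := eqVneq v x.
    by apply: addspan_sub => //; exists b => //=; rewrite subrr; apply: smod0.
  by apply: addspan_mem => //; move: vl; rewrite (perm_mem (perm_to_rem xl)) inE (negPf nvx).
- by rewrite size_rem // -ltnS prednK // lt0n size_eq0; apply: contraTN xl => /eqP->.
- move=> y Hy; have [|t tP [v vP Dv]] := inj (u *: y - (f (d y) : k) *: x).
    by move: Hy; rewrite linearB !(linearP2 d).
  exists (t * u); first exact: specM.
  exists v => //; exists (t * f (d y)) => //=.
  by move: Dv; rewrite scalerBr !scalerA addrAC.
have g_lin i : linear (fun z => u * (u * g i z - f z * g i (d x)) : k^o).
  move=> a z z'; rewrite (linearP (g i)) (linearP f) -![a *: _]/(a * _ : k).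
  move: (g i z) (g i z') (g i (d x)) (f z) (f z') => /= g1 g2 g3 f1 f2.
  rewrite -![(_ : k^o) + _]/(_ + _ : k).
  ring.
pose c i y : k := u * g i (d y) - f (d y) * g i (d x).
have h_lin :
    linear (fun z => s * f z - \sum_i (u * g i z - f z * g i (d x)) * f (d (w i)) : k^o).
  move=> a z z'; rewrite -[RHS]/(a * (_ - _) + (_ - _) : k) mulrBr mulr_sumr.
  rewrite addrACA -opprD -big_split; congr (_ - _ : k).
    by rewrite (linearP f) -[a *: _]/(a * _ : k) mulrDr mulrCA.
  apply: eq_bigr => i _; rewrite (linearP (g i)) (linearP f) -![a *: _]/(a * _ : k).
  move: (g i z) (g i z') (g i (d x)) (f z) (f z') (f (d (w i))) => /= g1 g2 g3 f1 f2 f3.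
  ring.
exists (u * s); first exact: specM.
exists (option I), (fun o => if o is Some i then w i else x),
  (fun o => if o is Some i then mklin (g_lin i) else mklin h_lin) => y.
have [a _ /= Da] := Hg y; set ys := (_ - \sum_i _) in Da.
have ysE : ys = s *: y - \sum_i c i y *: w i.
  by congr (_ - _); apply: eq_bigr => i _; rewrite linearB !(linearP2 (g i)).
clearbody ys.
(* The induction hypothesis determines the coefficient [a] of [x] only through a u, hence the
   further factor [u] in the final denominator u s. *)
have fys : f (d ys) = a * u :> k.
  have /D0/(congr1 f) := Da; rewrite (linearB d) (linearZ_LR d) (linearB f) linear0.
  by rewrite (linearZ_LR f) => h; apply: (subr0_eq h).
have -> : \sum_i (((if i is Some j then mklin (g_lin j) else mklin h_lin) (d y) : k)
     *: (if i is Some j then w j else x)) =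
   \sum_i (u * c i y) *: w i + (f (d ys) : k) *: x.
  rewrite big_optionD addrC; congr (_ + _).
  congr (_ *: _); rewrite ysE !linearB !(linearP2 d) (linearP2 f); congr (_ - _ : k).
  rewrite !linear_sum; apply: eq_bigr => i _.
  by rewrite (linearZ_LR d) (linearZ_LR f).
rewrite fys; have := smodZ DP u Da; rewrite ysE !scalerBr !scalerA [u * a]mulrC.
rewrite scaler_sumr opprD addrA.
by under eq_bigr => i _ do rewrite scalerA.
Qed.
End Nakayama.

(** * Noetherian rings and primes *)

Section Noetherian.
Variables (k : comPzRingType) (k_noeth : noetherian k).

Lemma ideal_gens (C : k -> Prop) : ideal_like C ->
  exists2 l : seq k, (forall a, a \in l -> C a) &
    forall a, C a -> @spn k k^o l a.
Proof.
move=> CP; have [n [v Hv]] := k_noeth (mksub CP).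
exists [seq submod_val (v i) | i <- enum 'I_n].
  by move=> a /mapP[i _ ->]; case: (v i) => u uC; apply/(mksubE CP).
move=> a Ca; have aC : (a : k^o) \in mksub CP by apply/mksubE.
have [c /(congr1 (@submod_val _ _ _)) /= ->] := Hv (Submod aC).
rewrite linear_sum -big_enum /=.
exact: spn_sum.
Qed.

(** The coefficients of the head generator in elements of D form a finitely generated ideal; lifts
    of its generators, with generators of the part of D spanned by the tail, generate D. *)
Lemma submodule_gens (M : lmodType k) (l : seq M) (D : M -> Prop) : smod D ->
  (forall y, D y -> spn l y) ->
  exists2 l' : seq M, (forall x, x \in l' -> D x) &
    forall y, D y -> spn l' y.
Proof.
elim: l D => [|x l IHl] D DP Dl.
  by exists [::] => // y /Dl.
have [|y [] //|l1 l1D l1P] := IHl (fun y => D y /\ spn l y).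
  have SP := smod_spn l; split=> [|y z [? ?] [? ?]|a y [? ?]].
  - by split; [exact: (smod0 DP) | exact: (smod0 SP)].
  - by split; [exact: (smodD DP) | exact: (smodD SP)].
  by split; [exact: (smodZ DP) | exact: (smodZ SP)].
pose C (a : k) := exists2 y, D y & spn l (y - a *: x).
have CP : ideal_like C.
  have SP := smod_spn l; split=> [|a b [y Dy Hy] [z Dz Hz]|a b [y Dy Hy]].
  - exists 0; first exact: (smod0 DP).
    by rewrite scale0r subr0; apply: (smod0 SP).
  - exists (y + z); first exact: (smodD DP).
    by rewrite scalerDl opprD addrACA; apply: (smodD SP).
  exists (a *: y); first exact: (smodZ DP).
  by rewrite -[a *: b]/(a * b) -scalerA -scalerBr; apply: (smodZ SP).
have [lC CC Cgen] := ideal_gens CP.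
have [l2 l2D l2P] : exists2 l2 : seq M, (forall x, x \in l2 -> D x) &
    forall a, a \in lC -> exists2 y, y \in l2 & spn l (y - a *: x).
  elim: lC CC {Cgen} => [|a lC IH] CC; first by exists [::].
  have [|l2 l2D l2P] := IH; first by move=> b bl; apply: CC; rewrite inE bl orbT.
  have [y Dy Hy] := CC a (mem_head _ _).
  exists (y :: l2) => [z|b]; rewrite inE => /predU1P[->//|]; first exact: l2D.
    by exists y; rewrite ?mem_head.
  by move=> /l2P[z zl Hz]; exists z; rewrite // inE zl orbT.
exists (l2 ++ l1) => [y|y Dy].
  by rewrite mem_cat => /orP[/l2D|/l1D[]].
have [a _ ya] := Dl y Dy.
have [w Hw Hwa] : exists2 w, spn l2 w & spn l (w - a *: x).
  have := Cgen a (ex_intro2 _ _ y Dy ya); move: (a).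
  apply: (@spn_ind k k^o) => [|b bl].
    split=> [|b c [w Hw Hwb] [v Hv Hvc]|b c [w Hw Hwc]].
    - by exists 0; rewrite ?scale0r ?subr0; apply: (smod0 (smod_spn _)).
    - exists (w + v); first exact: (smodD (smod_spn _)).
      by rewrite scalerDl opprD addrACA; apply: (smodD (smod_spn _)).
    exists (b *: w); first exact: (smodZ (smod_spn _)).
    by rewrite -[b *: c]/(b * c) -scalerA -scalerBr; apply: (smodZ (smod_spn _)).
  by have [w wl Hw] := l2P b bl; exists w => //; apply: spn_mem.
have Dw : D w by move: w Hw {Hwa}; apply: spn_ind.
apply/spn_cat; exists w => //; apply: l1P; split; first exact: (smodB DP).
rewrite -[y](subrK (a *: x)) -addrA; apply: (smodD (smod_spn _)) => //.
by rewrite -[_ - w]opprB; apply: (smodN (smod_spn _)).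
Qed.

(** Otherwise choice builds a strictly ascending chain; its union is finitely generated, hence
    reached at a finite stage. *)
Lemma submodule_max (M : lmodType k) (l : seq M) (F : (M -> Prop) -> Prop) :
  (forall y, spn l y) -> (forall D, F D -> smod D) -> (exists D, F D) ->
  exists2 D, F D & forall E, F E -> (forall x, D x -> E x) ->
    forall x, E x -> D x.
Proof.
move=> lM FS [D0 FD0]; apply: contrapT => nmax.
have next (D : {D | F D}) : exists E : {D | F D},
    (forall x, sval D x -> sval E x) /\ exists x, sval E x /\ ~ sval D x.
  case: D => D FD; apply: contrapT => nE; apply: nmax; exists D => // E FE DE x Ex.
  apply: contrapT => nDx; apply: nE; exists (exist _ E FE); split=> //=.
  by exists x.
have [f Hf] := choice next.
pose D n := sval (iter n f (exist _ D0 FD0)).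
have DS n : smod (D n) by apply/FS/(svalP (iter n f _)).
have Dmono n m : (n <= m)%N -> forall x, D n x -> D m x.
  elim: m => [|m IHm]; first by rewrite leqn0 => /eqP->.
  rewrite leq_eqVlt => /predU1P[-> //|/IHm DD x /DD Dx].
  by apply: (Hf _).1.
pose U x := exists n, D n x.
have US : smod U.
  split=> [|x y [n Dx] [m Dy]|a x [n Dx]]; first by exists 0%N; apply: (smod0 (DS _)).
    exists (maxn n m); apply: (smodD (DS _)).
      exact: Dmono (leq_maxl _ _) _ Dx.
    exact: Dmono (leq_maxr _ _) _ Dy.
  by exists n; apply: (smodZ (DS _)).
have [l' l'U Ul'] := submodule_gens US (fun y _ => lM y).
have [n Hn] : exists n, forall x, x \in l' -> D n x.
  elim: l' l'U {Ul'} => [|x l' IH] lU; first by exists 0%N.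
  have [|n Hn] := IH; first by move=> y yl; apply: lU; rewrite inE yl orbT.
  have [m Dx] := lU x (mem_head _ _); exists (maxn n m) => y.
  rewrite inE => /predU1P[->|/Hn Dy]; first exact: Dmono (leq_maxr _ _) _ Dx.
  exact: Dmono (leq_maxl _ _) _ Dy.
have [x [Ex nEx]] := (Hf (iter n f (exist _ D0 FD0))).2; apply: nEx.
by apply: (spn_ind (DS n) Hn); apply: Ul'; exists n.+1.
Qed.

Lemma fin_gen_seq (M : lmodType k) :
  fin_gen M -> exists l : seq M, forall y, spn l y.
Proof.
move=> [n [v Hv]]; exists [seq v i | i <- enum 'I_n] => y.
by have [c ->] := Hv y; rewrite -big_enum; apply: spn_sum.
Qed.

Lemma ideal_max (F : (k -> Prop) -> Prop) :
  (forall C, F C -> ideal_like C) -> (exists C, F C) ->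
  exists2 C, F C & forall C', F C' -> (forall x, C x -> C' x) ->
    forall x, C' x -> C x.
Proof.
apply: (@submodule_max k^o [:: 1]) => y.
exists y => //=; have -> : y *: (1 : k^o) = y by exact: mulr1.
by rewrite subrr.
Qed.

Definition ideal_of (C : k -> Prop) (CP : ideal_like C) : ideal k :=
  @mksub k k^o C CP.
Lemma ideal_ofE C CP (a : k) : (a \in @ideal_of C CP) <-> C a.
Proof. exact: (@mksubE k k^o C CP a). Qed.

Definition mkspec (C : k -> Prop) (CP : ideal_like C) (n1 : ~ C 1)
    (prC : forall a b, C (a * b) -> C a \/ C b) : spec k.
Proof.
apply: (@Spec k (ideal_of CP)); split; first by apply/negP => /ideal_ofE.
by move=> a b /ideal_ofE/prC[] ?; [left|right]; apply/ideal_ofE.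
Defined.

Lemma mkspecE C CP n1 prC a :
  (a \in spec_ideal (@mkspec C CP n1 prC)) <-> C a.
Proof. exact: ideal_ofE. Qed.

Lemma ideal_in_maximal (C : k -> Prop) : ideal_like C -> ~ C 1 ->
  exists2 p : spec k, maximal_ideal p & forall a, C a -> a \in spec_ideal p.
Proof.
move=> CP n1.
have [|| E [[EP nE1] CE] Emax] := @ideal_max
  (fun E => (ideal_like E /\ ~ E 1) /\ forall a, C a -> E a).
- by move=> E [[]].
- by exists C.
have Emax2 (I : ideal k) : 1 \notin I -> (forall a, E a -> a \in I) ->
    forall a, a \in I -> E a.
  move=> I1 EI; apply: (Emax (fun a => a \in I)) => //; split=> [|a /CE/EI//].
  by split; [exact: ideal_like_mem | exact/negP].
have prE a b : E (a * b) -> E a \/ E b.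
  move=> Eab; apply: contrapT => /not_orP[nEa nEb].
  have extend c : ~ E c -> exists2 r, E (1 - r * c) & True.
    move=> nEc; apply: contrapT => nr; apply: nEc.
    have cP : ideal_like (addspan allk (E : k^o -> Prop) [:: c : k^o]).
      exact: smod_addspan.
    apply: (Emax (addspan allk (E : k^o -> Prop) [:: c : k^o])); last 2 first.
    - by move=> x Ex; apply: addspan_sub.
    - by exists 1 => //=; rewrite -[1 *: _]/(1 * c) mul1r subrr; apply: (smod0 EP).
    split; last by move=> x /CE Ex; apply: addspan_sub.
    by split=> // -[r _ Er]; apply: nr; exists r.
  have [r Er _] := extend a nEa; apply: nEb.
  have -> : b = b * (1 - r * a) + r * (a * b) by ring.
  by apply: (smodD EP); apply: (smodZ EP).
exists (mkspec EP nE1 prE); last by move=> a /CE Ea; apply/mkspecE.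
split=> [|I' I'1 sI a aI]; first by apply/negP => /mkspecE.
by apply/mkspecE; apply: Emax2 I'1 _ _ aI => b Eb; apply/sI/mkspecE.
Qed.

Lemma ideal_local (C : k -> Prop) : ideal_like C ->
  (forall p : spec k, maximal_ideal p -> exists2 s, s \notin spec_ideal p & C s) ->
  C 1.
Proof.
move=> CP Cp; apply: contrapT => nC1.
have [p pmax pC] := ideal_in_maximal CP nC1.
by have [s /negP sp /pC] := Cp p pmax.
Qed.

(** Says that a product of prime ideals lies in [C], tested on products with one factor from each
    prime, so that no product ideal is formed. [powsub] does the same for powers. *)
Fixpoint prod_sub (ps : seq (spec k)) (C : k -> Prop) : Prop :=
  if ps is p :: ps' then
    forall x, x \in spec_ideal p -> prod_sub ps' (fun a => C (x * a))
  else C 1.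

Fixpoint all_above (C : k -> Prop) (ps : seq (spec k)) : Prop :=
  if ps is p :: ps' then
    (forall a, C a -> a \in spec_ideal p) /\ all_above C ps'
  else True.

Lemma prod_sub_cat ps qs (C1 C2 C : k -> Prop) : prod_sub ps C1 ->
  prod_sub qs C2 -> (forall x y, C1 x -> C2 y -> C (x * y)) ->
  prod_sub (ps ++ qs) C.
Proof.
elim: ps C1 C => [|p ps IHps] C1 C /=.
  move=> C11 + /(_ 1) H; elim: qs C2 C H => [|q qs IHqs] C2 C H /=.
    by move=> /(H _ C11); rewrite mulr1.
  by move=> Hq x xq; apply: IHqs (Hq x xq) => y _ /(H _ C11); rewrite !mul1r.
move=> H Hq CC x xp; apply: IHps (H x xp) Hq _ => a b /CC + /[dup] Cb => /(_ _ Cb).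
by rewrite mulrA.
Qed.

Lemma all_above_cat ps qs C : all_above C ps -> all_above C qs ->
  all_above C (ps ++ qs).
Proof. by elim: ps => //= p ps IHps [Cp /IHps H] /H. Qed.

Lemma all_above_sub ps (C C' : k -> Prop) : (forall a, C a -> C' a) ->
  all_above C' ps -> all_above C ps.
Proof.
by move=> CC'; elim: ps => //= p ps IHps [Cp /IHps H]; split=> // a /CC'/Cp.
Qed.

(** Noetherian induction: a maximal counterexample E is prime, since for ab in E the products found
    for E + (a) and E + (b) concatenate to one inside E; but a prime contains itself. *)
Lemma prime_product (C : k -> Prop) : ideal_like C ->
  exists2 ps, all_above C ps & prod_sub ps C.
Proof.
move=> CP; apply: contrapT => nC.
have [||E [EP nE] Emax] := @ideal_max (fun E => ideal_like E /\
  ~ exists2 ps, all_above E ps & prod_sub ps E).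
- by move=> E [].
- by exists C.
have E1 : ~ E 1 by move=> E1; apply: nE; exists [::].
have prE a b : E (a * b) -> E a \/ E b.
  move=> Eab; apply: contrapT => /not_orP[nEa nEb].
  pose X c := addspan allk (E : k^o -> Prop) [:: c : k^o].
  have XP c : ideal_like (X c) by apply: smod_addspan.
  have EX c x : E x -> X c x by move=> Ex; apply: addspan_sub.
  have extend c : ~ E c -> exists2 ps, all_above (X c) ps & prod_sub ps (X c).
    move=> nEc; apply: contrapT => nX; apply: nEc.
    apply: (Emax (X c)); [exact: (conj (XP c) nX) | | ]; last first.
      by exists 1 => //=; rewrite -[1 *: _]/(1 * c) mul1r subrr; apply: (smod0 EP).
    by move=> x Ex; apply: addspan_sub.
  have [ps psa psE] := extend a nEa; have [qs qsa qsE] := extend b nEb.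
  apply: nE; exists (ps ++ qs).
    by apply: all_above_cat; [apply: all_above_sub psa | apply: all_above_sub qsa] => x /EX.
  apply: prod_sub_cat psE qsE _ => x y [r _ /= Ex] [s _ /= Ey].
  have -> : x * y = y * (x - r * a) + (r * a) * (y - s * b) + (r * s) * (a * b) by ring.
  by apply: (smodD EP); first apply: (smodD EP); apply: (smodZ EP).
apply: nE; exists [:: mkspec EP E1 prE].
  by split=> // a Ea; apply/mkspecE.
by move=> x /mkspecE Ex; rewrite /= mulr1.
Qed.

Definition powsub (p : spec k) (T : nat) (C : k -> Prop) :=
  forall l : seq k, size l = T -> (forall x, x \in l -> x \in spec_ideal p) ->
  C (\prod_(x <- l) x).

Lemma prod_sub_imp ps (C C' : k -> Prop) : (forall a, C a -> C' a) ->
  prod_sub ps C -> prod_sub ps C'.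
Proof.
elim: ps C C' => [|p ps IHps] C C' CC' /=; first exact: CC'.
by move=> H x xp; apply: IHps (H x xp) => a; apply: CC'.
Qed.

(** If no factor lay inside q, elements outside q taken from all of them would have their product in
    q; [c] accumulates that product. *)
Lemma prod_sub_some ps (q : spec k) (c : k) : c \notin spec_ideal q ->
  prod_sub ps (fun a => c * a \in spec_ideal q) ->
  exists2 p : spec k, List.In p ps & {subset spec_ideal p <= spec_ideal q}.
Proof.
elim: ps c => [|p ps IHps] c cq /=; first by rewrite mulr1 (negPf cq).
move=> H; have [pq|npq] := pselect {subset spec_ideal p <= spec_ideal q}.
  by exists p => //; left.
have [x xp xq] : exists2 x, x \in spec_ideal p & x \notin spec_ideal q.
  apply: contrapT => nx; apply: npq => x xp; apply: contrapT => /negP xq.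
  by apply: nx; exists x.
have [|r rps rq] := IHps (c * x) (specM cq xq); last by exists r => //; right.
by apply: prod_sub_imp (H x xp) => a; rewrite mulrA.
Qed.

Lemma minimal_in_seq (ps : seq (spec k)) (Q : spec k -> Prop) :
  (exists2 p, List.In p ps & Q p) ->
  exists2 p, List.In p ps /\ Q p & forall p', List.In p' ps -> Q p' ->
    {subset spec_ideal p' <= spec_ideal p} ->
    {subset spec_ideal p <= spec_ideal p'}.
Proof.
elim: ps => [|r ps IHps] [p //= pps Qp].
have [/IHps[m [mps Qm] mmin]|nps] := pselect (exists2 p, List.In p ps & Q p).
  have [[Qr rm]|nr] := pselect (Q r /\ {subset spec_ideal r <= spec_ideal m}).
    exists r; first by split=> //; left.
    move=> p' [<-//|p'ps] Qp' p'r x /rm; apply: mmin => // y /p'r; exact: rm.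
  exists m; first by split=> //; right.
  by move=> p' [<- Qr rm|]; [case: nr | apply: mmin].
have rp : r = p by case: pps => // ?; case: nps; exists p.
exists r; first by split; [left | rewrite rp].
by move=> p' [<-//|p'ps] Qp'; case: nps; exists p'.
Qed.

(** In a product of primes over C that lies in C, choose a factor p minimal among those inside q.
    Factors not contained in p have an element that is inverted at p, the others equal p, and T
    counts these. *)
Lemma minimal_prime (C : k -> Prop) (q : spec k) : ideal_like C ->
  (forall a, C a -> a \in spec_ideal q) ->
  exists p : spec k, [/\ forall a, C a -> a \in spec_ideal p,
    {subset spec_ideal p <= spec_ideal q} &
    exists T, powsub p T (@loc_in k p k^o C)].
Proof.
move=> CP Cq; have [ps psa psC] := prime_product CP.
have [|p [pps pq] pmin] := @minimal_in_seq ps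
    (fun p => {subset spec_ideal p <= spec_ideal q}).
  apply: (@prod_sub_some ps q 1 (spec1 q)).
  by apply: prod_sub_imp psC => a Ca; rewrite mul1r; apply: Cq.
exists p; split=> //.
  elim: ps psa pps {psC pmin} => //= r ps IH [Cr psa] [<-//|]; exact: IH.
suff [T HT] : exists T, forall C', prod_sub ps C' -> powsub p T (@loc_in k p k^o C').
  by exists T; apply: HT.
have: forall p', List.In p' ps -> {subset spec_ideal p' <= spec_ideal p} ->
    {subset spec_ideal p <= spec_ideal p'}.
  by move=> p' p'ps p'p; apply: pmin => // x /p'p/pq.
elim: (ps) => [|r rs IHrs] rmin /=.
  exists 0%N => C' C'1 l /size0nil-> _; rewrite big_nil.
  exact: (@loc_in_sub k p k^o).
have [|T HT] := IHrs; first by move=> p' ?; apply: rmin; right.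
have [rp|nrp] := pselect {subset spec_ideal r <= spec_ideal p}.
  exists T.+1 => C' HC' [|x l] // [lT] lp.
  have xr : x \in spec_ideal r by apply: (rmin r _ rp); [left|apply/lp/mem_head].
  have [|s sp Cs] := HT _ (HC' x xr) l lT.
    by move=> y yl; apply: lp; rewrite inE yl orbT.
  exists s => //; rewrite big_cons; move: Cs.
  by rewrite -![s *: _]/((s : k) * _) mulrCA.
have [x xr xp] : exists2 x, x \in spec_ideal r & x \notin spec_ideal p.
  apply: contrapT => nx; apply: nrp => x xp; apply: contrapT => /negP xq.
  by apply: nx; exists x.
exists T => C' HC' l lT lp; have [s sp Cs] := HT _ (HC' x xr) l lT lp.
exists (x * s); first exact: specM.
by rewrite -[_ *: _]/((x * s : k) * _) -mulrA.
Qed.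
End Noetherian.

(** * Base change *)

Section PzAlgebraTheory.
Variables (k : comPzRingType) (A : pzAlgType k).
Lemma pzscaleAl (a : k) (x y : A) : a *: (x * y) = (a *: x) * y.
Proof. exact: alg_scaleAl. Qed.
Lemma pzscaleAr (a : k) (x y : A) : a *: (x * y) = x * (a *: y).
Proof. exact: alg_scaleAr. Qed.
Lemma mull_linear (x : A) : linear (fun y : A => x * y).
Proof. by move=> a y z; rewrite mulrDr pzscaleAr. Qed.
Lemma mulr_linear_alg (x : A) : linear (fun y : A => y * x).
Proof. by move=> a y z; rewrite mulrDl pzscaleAl. Qed.
End PzAlgebraTheory.

Section BaseChange.
Variables (k k' : comPzRingType) (phi : {rmorphism k -> k'}).

Definition semilin (M : lmodType k) (M' : lmodType k') (g : M -> M') :=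
  (forall x y, g (x + y) = g x + g y) /\ (forall a x, g (a *: x) = phi a *: g x).

(* M' is k' (x)_k M, described by its universal property: this treats localisations,
   residue fields and the truncations k_p / p^n k_p uniformly. *)
Definition is_bc (M : lmodType k) (M' : lmodType k') (i : M -> M') :=
  [/\ semilin i,
      forall y, exists s : seq (k' * M), y = \sum_(u <- s) u.1 *: i u.2 &
      forall (N : lmodType k') (g : M -> N), semilin g ->
        exists h : {linear M' -> N}, forall x, h (i x) = g x].

Section Semilinear.
Variables (M : lmodType k) (M' : lmodType k') (g : M -> M') (gP : semilin g).
Lemma semilinD x y : g (x + y) = g x + g y. Proof. exact: gP.1. Qed.
Lemma semilinZ a x : g (a *: x) = phi a *: g x. Proof. exact: gP.2. Qed.
Lemma semilin0 : g 0 = 0. Proof. by rewrite -(scale0r 0) semilinZ rmorph0 scale0r. Qed.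
Lemma semilinN x : g (- x) = - g x.
Proof. by rewrite -scaleN1r semilinZ rmorphN1 scaleN1r. Qed.
Lemma semilinB x y : g (x - y) = g x - g y. Proof. by rewrite semilinD semilinN. Qed.
Lemma semilin_sum (I : Type) (r : seq I) (P : pred I) (F : I -> M) :
  g (\sum_(i <- r | P i) F i) = \sum_(i <- r | P i) g (F i).
Proof. exact: (big_morph g semilinD semilin0). Qed.
End Semilinear.

Lemma semilin_comp_lin (L M : lmodType k) (M' : lmodType k')
  (g : M -> M') (f : {linear L -> M}) : semilin g -> semilin (g \o f).
Proof.
by move=> gP; split=> [x y|a x] /=; rewrite ?linearD ?(linearZ_LR f) ?gP.1 ?gP.2.
Qed.


Section Theory.
Variables (M : lmodType k) (M' : lmodType k') (i : M -> M') (iP : is_bc i).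

Lemma bc_semilin : semilin i. Proof. by case: iP. Qed.

Lemma bc_ind (E : M' -> Prop) : smod E -> (forall x, E (i x)) -> forall y, E y.
Proof.
move=> EP Ei y; case: iP => _ /(_ y)[s ->] _.
by apply: (smod_sum EP) => u _; apply: (smodZ EP).
Qed.

Lemma bc_ext (N : lmodType k') (f g : {linear M' -> N}) :
  (forall x, f (i x) = g (i x)) -> forall y, f y = g y.
Proof.
move=> fg; apply: bc_ind => //; split=> [|x y fgx fgy|a x fgx].
- by rewrite !linear0.
- by rewrite !linearD fgx fgy.
by rewrite (linearZ_LR f) (linearZ_LR g) fgx.
Qed.

Definition bc_lift (N : lmodType k') (g : M -> N) (gP : semilin g) :
    {linear M' -> N} :=
  sval (cid (let: And3 _ _ H := iP in H N g gP)).

Lemma bc_liftE (N : lmodType k') (g : M -> N) (gP : semilin g) x :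
  bc_lift gP (i x) = g x.
Proof. by rewrite /bc_lift; case: cid => h /= ->. Qed.

End Theory.

Section Maps.
Variables (M N : lmodType k) (M' N' : lmodType k').
Variables (i : M -> M') (j : N -> N') (iP : is_bc i) (jP : semilin j).
Definition bc_map (f : {linear M -> N}) : {linear M' -> N'} :=
  bc_lift iP (semilin_comp_lin f jP).
Lemma bc_mapE f x : bc_map f (i x) = j (f x).
Proof. exact: bc_liftE. Qed.
End Maps.
End BaseChange.

Lemma bc_regular (k k' : comPzRingType) (phi : {rmorphism k -> k'}) :
  @is_bc k k' phi k^o k'^o phi.
Proof.
split; first by split=> [x y|a x]; [exact: rmorphD | exact: rmorphM].
  move=> y; exists [:: (y : k', 1 : k^o)].
  by rewrite big_seq1 /= rmorph1 -[_ *: _]/(_ * _ : k') mulr1.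
move=> N g gP.
have hl : linear (fun c : k'^o => (c : k') *: g 1).
  by move=> a x y; rewrite scalerDl -[a *: x]/(a * x : k') scalerA.
exists (mklin hl) => x /=.
by rewrite -(semilinZ gP); congr g; apply: mulr1.
Qed.

Section BaseChangeFunctionals.
Variables (k k' : comPzRingType) (phi : {rmorphism k -> k'}).
Variables (M : lmodType k) (M' : lmodType k') (i : M -> M') (iP : is_bc phi i).

Definition bc_fun (f : {linear M -> k^o}) : {linear M' -> k'^o} :=
  bc_map iP (bc_semilin (bc_regular phi)) f.
Lemma bc_funE f x : bc_fun f (i x) = phi (f x). Proof. exact: bc_mapE. Qed.
End BaseChangeFunctionals.

(** Restriction of scalars, on a copy of M that carries the second action. It lets a universal
    property over [k] be applied to modules over [k']. *)
Definition restr (k k' : comPzRingType) (psi : {rmorphism k -> k'})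
  (M : lmodType k') : Type := M.

Section Restriction.
Variables (k k' : comPzRingType) (psi : {rmorphism k -> k'}) (M : lmodType k').
Local Notation X := (restr psi M).
HB.instance Definition _ := GRing.Zmodule.on X.
Definition restr_scale (a : k) (x : X) : X := psi a *: (x : M).
Fact restr_scaleA a b x : restr_scale a (restr_scale b x) = restr_scale (a * b) x.
Proof. by rewrite /restr_scale scalerA rmorphM. Qed.
Fact restr_scale1 : left_id 1 restr_scale.
Proof. by move=> x; rewrite /restr_scale rmorph1 scale1r. Qed.
Fact restr_scaleDr : right_distributive restr_scale +%R.
Proof. by move=> a x y; apply: scalerDr. Qed.
Fact restr_scaleDl x : {morph restr_scale^~ x : a b / a + b}.
Proof. by move=> a b; rewrite /restr_scale rmorphD scalerDl. Qed.
HB.instance Definition _ := GRing.Zmodule_isLmodule.Build k X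
  restr_scaleA restr_scale1 restr_scaleDr restr_scaleDl.
End Restriction.

Section Composition.
Variables (k k1 k2 : comPzRingType).
Variables (phi : {rmorphism k -> k1}) (psi : {rmorphism k1 -> k2}).

Lemma bc_comp (M : lmodType k) (M1 : lmodType k1) (M2 : lmodType k2)
    (i : M -> M1) (j : M1 -> M2) :
  is_bc phi i -> is_bc psi j -> is_bc (psi \o phi) (j \o i).
Proof.
move=> iP jP; have jS := bc_semilin jP; have iS := bc_semilin iP; split.
- by split=> [x y|a x] /=; rewrite ?iS.1 ?iS.2 ?jS.1 ?jS.2.
- move=> y; have : smod (fun y => exists s : seq (k2 * M),
    y = \sum_(u <- s) u.1 *: (j \o i) u.2).
    split=> [|_ _ [s ->] [t ->]|a _ [s ->]].
    + by exists [::]; rewrite big_nil.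
    + by exists (s ++ t); rewrite big_cat.
    exists [seq (a * u.1, u.2) | u <- s]; rewrite big_map scaler_sumr.
    by apply: eq_bigr => u _; rewrite scalerA.
  move/(bc_ind jP); apply=> {}y.
  case: iP => _ /(_ y)[s ->] _; exists [seq (psi u.1, u.2) | u <- s].
  rewrite big_map (semilin_sum jS); apply: eq_bigr => u _.
  by rewrite (semilinZ jS).
move=> N g [gD gZ].
have gS : semilin phi (g : M -> restr psi N) by [].
pose g1 := bc_lift iP gS.
have g1S : semilin psi (g1 : M1 -> N).
  by split=> [x y|a x]; [exact: (linearD g1) | exact: (linearZ_LR g1)].
by exists (bc_lift jP g1S) => x /=; rewrite bc_liftE [LHS](bc_liftE iP gS).
Qed.

(** Transitivity read backwards; it presents a residue field fibre as a base change of an algebra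
    already truncated at a power of p. *)
Lemma bc_cancel (M : lmodType k) (M1 : lmodType k1) (M2 : lmodType k2)
    (i : M -> M1) (h : M -> M2) (chi : {rmorphism k -> k2}) :
  (forall a, chi a = psi (phi a)) ->
  is_bc phi i -> is_bc chi h ->
  exists2 j : M1 -> M2, (forall x, j (i x) = h x) & is_bc psi j.
Proof.
move=> chiE iP hP; have hS := bc_semilin hP; have iS := bc_semilin iP.
have hS1 : semilin phi (h : M -> restr psi M2).
  by split=> [x y|a x]; [exact: hS.1 | rewrite hS.2 chiE].
pose j := bc_lift iP hS1; have jE x : j (i x) = h x by apply: bc_liftE.
exists j => //; split.
- by split=> [x y|a x]; [exact: (linearD j) | exact: (linearZ_LR j)].
- move=> y; case: hP => _ /(_ y)[s ->] _; exists [seq (u.1, i u.2) | u <- s].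
  by rewrite big_map; apply: eq_bigr => u _; rewrite /= jE.
move=> N g gP; have gS : semilin chi (g \o i).
  by split=> [x y|a x] /=; rewrite ?iS.1 ?iS.2 ?gP.1 ?gP.2 ?chiE.
exists (bc_lift hP gS) => x.
pose f1 : M1 -> restr psi N := bc_lift hP gS \o j.
have f1l : linear f1.
  by move=> a u v; rewrite /f1 /= linearP [LHS]linearP.
have g1l : linear (g : M1 -> restr psi N).
  by move=> a u v; rewrite [LHS]gP.1 gP.2.
apply: (bc_ext iP (f := mklin f1l) (g := mklin g1l)) => u.
by rewrite /= /f1 /= jE bc_liftE.
Qed.
End Composition.

(** * Localisation and reduction as base changes *)

Section LocRedHom.
Variables (k : comPzRingType) (p : spec k).
Local Notation inj := (fun x => locfrac x (denom1 p)).

Definition loc_hom (a : k) : locring p := locfrac (a : k^o) (denom1 p).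
Fact loc_hom_zmod : zmod_morphism loc_hom.
Proof.
move=> a b; rewrite /loc_hom; apply/esym; rewrite -[LHS]/(loc_add _ (loc_opp _)).
by rewrite loc_oppE loc_addE denom1M !scale1r.
Qed.
Fact loc_hom_monoid : GRing.monoid_morphism loc_hom.
Proof. by split=> // a b; rewrite /loc_hom [RHS]locring_mulE denom1M. Qed.
HB.instance Definition _ := GRing.isZmodMorphism.Build k (locring p) loc_hom loc_hom_zmod.
HB.instance Definition _ := GRing.isMonoidMorphism.Build k (locring p) loc_hom loc_hom_monoid.

Definition locinv (s : denom p) : locring p := locfrac (1 : k^o) s.
Lemma locinvP s : locinv s * loc_hom (dval s) = 1.
Proof.
rewrite [LHS]locring_mulE denomM1 mul1r; apply: locfrac_eq.
by rewrite dval1 scale1r -[RHS]/(dval s * 1) mulr1.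
Qed.

Lemma loc_unit (s : k) : s \notin spec_ideal p -> exists c, c * loc_hom s = 1.
Proof. by move=> sp; exists (locinv (exist _ s sp)); apply: locinvP. Qed.

Lemma locfrac_scale (M : lmodType k) (x : M) s :
  locfrac x s = locinv s *: (inj x).
Proof. by rewrite locfracZ scale1r denomM1. Qed.

Lemma bc_loc (M : lmodType k) : is_bc loc_hom (inj : M -> loc p M).
Proof.
split; first split=> [x y|a x].
- by rewrite [RHS]locfracD !scale1r denom1M.
- by rewrite [RHS]locfracZ denom1M.
- elim/loc_ind => x s; exists [:: (locinv s, x)].
  by rewrite big_seq1 locfrac_scale.
move=> N g gP.
pose h (c : loc p M) := locinv (repr c).2 *: g (repr c).1.
have hE x s : h (locfrac x s) = locinv s *: g x.
  rewrite /h; have [w E] := loc_reprP x s.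
  move: (repr _) E => [x' s'] /= /(congr1 g); rewrite !gP.2 => E.
  have {}E : loc_hom (dval s) *: g x' = loc_hom (dval s') *: g x.
    have := congr1 ( *:%R (locinv w)) E.
    by rewrite !(scalerA (locinv w)) !locinvP !scale1r.
  rewrite -[g x']scale1r -(locinvP s) -scalerA E !scalerA; congr (_ *: _).
  by rewrite -mulrA mulrCA locinvP mulr1.
have hl : linear h.
  elim/loc_ind=> a r; elim/loc_ind=> x s; elim/loc_ind=> y t.
  rewrite locfracZ locfracD !hE !gP.1 !gP.2 !scalerDr !scalerA.
  have lM u v : locinv (denomM u v) = locinv u * locinv v.
    by rewrite [RHS]locring_mulE mul1r.
  rewrite !lM (locfrac_scale (a : k^o)); congr (_ *: _ + _ *: _).
    rewrite -[_ *: _]/(locinv r * loc_hom a).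
    transitivity (locinv r * locinv s * loc_hom a * (locinv t * loc_hom (dval t))); first by ring.
    by rewrite locinvP; ring.
  rewrite dvalM rmorphM.
  transitivity (locinv t * (locinv r * loc_hom (dval r)) * (locinv s * loc_hom (dval s))); first by ring.
  by rewrite !locinvP !mulr1.
exists (mklin hl) => x /=; rewrite hE.
by have -> : locinv (denom1 p) = 1 by []; rewrite scale1r.
Qed.
End LocRedHom.

Section RedHom.
Variables (R : comPzRingType) (I : {pred R}).
Definition red_hom (a : R) : redring I := redpi I (a : R^o).
Lemma redpi_eq0 (M : lmodType R) (x : M) : redpi I x = 0 <-> x \in @mulspan R I M.
Proof.
have <- : redpi I (0 : M) = 0.
  have /esym/eqP := redpiD I (0 : M) 0.
  by rewrite addr0 -subr_eq0 addrK => /eqP.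
rewrite /redpi; split=> [/eqP|Ix]; first by rewrite quopiE subr0.
by apply: quopiP; rewrite subr0.
Qed.
Fact red_hom_zmod : zmod_morphism red_hom.
Proof.
move=> a b; rewrite /red_hom; have := redpiD I (a - b : R^o) b.
by rewrite -[_ + b]/(a - b + b : R) subrK => ->; rewrite addrK.
Qed.
Fact red_hom_monoid : GRing.monoid_morphism red_hom.
Proof. by split=> // a b; rewrite /red_hom [RHS]redring_mulE. Qed.
HB.instance Definition _ := GRing.isZmodMorphism.Build R (redring I) red_hom red_hom_zmod.
HB.instance Definition _ := GRing.isMonoidMorphism.Build R (redring I) red_hom red_hom_monoid.

Lemma red_hom0 (a : R) : a \in I -> red_hom a = 0.
Proof.
move=> aI; apply/redpi_eq0; have -> : a = a *: (1 : R^o) by exact/esym/mulr1.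
exact: mulspan_mem.
Qed.

Lemma bc_red (M : lmodType R) : is_bc red_hom (@redpi R I M).
Proof.
split; first split=> [x y|a x].
- exact: redpiD.
- by rewrite [RHS]redpiZ.
- by elim/red_ind => x; exists [:: (1, x)]; rewrite big_seq1 scale1r.
move=> N g gP.
have gI x : x \in @mulspan R I M -> g x = 0.
  move: x; apply: mulspan_ind => [|a x aI].
    split=> [|x y gx gy|a x gx]; first exact: (semilin0 gP).
      by rewrite gP.1 gx gy addr0.
    by rewrite gP.2 gx scaler0.
  by rewrite gP.2 -[X in X *: _]/(red_hom a) red_hom0 ?scale0r.
pose h (c : redmod I M) := g (repr c).
have hE x : h (redpi I x) = g x.
  rewrite /h; have := gI _ (red_repr I x); rewrite (semilinB gP) => /eqP.
  by rewrite subr_eq0 => /eqP.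
have hl : linear h.
  elim/red_ind=> a; elim/red_ind=> x; elim/red_ind=> y.
  by rewrite redpiZ -redpiD !hE gP.1 gP.2.
by exists (mklin hl) => x /=; rewrite hE.
Qed.
End RedHom.

Section Fibres.
Variables (k : comPzRingType) (p : spec k) (I : {pred locring p}).

Definition lr_hom : {rmorphism k -> redring I} := red_hom I \o @loc_hom k p.
Definition lrpi (M : lmodType k) (x : M) : redmod I (loc p M) :=
  redpi I (locfrac x (denom1 p)).

Lemma bc_lr (M : lmodType k) : is_bc lr_hom (@lrpi M).
Proof. exact: (bc_comp (@bc_loc k p M) (@bc_red _ I (loc p M))). Qed.

Lemma lr_unit (s : k) : s \notin spec_ideal p -> exists c, c * lr_hom s = 1.
Proof.
move=> /loc_unit[c Hc]; exists (red_hom I c).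
by rewrite /lr_hom /= -rmorphM Hc rmorph1.
Qed.

Lemma lr_frac (M : lmodType k) (y : redmod I (loc p M)) :
  exists2 s : k, s \notin spec_ideal p & exists x, lr_hom s *: y = lrpi x.
Proof.
elim/red_ind: y; elim/loc_ind=> x s; exists (dval s); first exact: (valP s).
exists x; rewrite /lrpi /lr_hom /= [LHS]redpiZ locfracZ denom1M; congr redpi.
by apply: locfrac_eq; rewrite dval1 scale1r.
Qed.

Lemma lrpi_eq0 (Q : k -> Prop) (M : lmodType k) (x : M) :
  (forall c, c \in I <-> exists2 a, Q a & c = loc_hom p a) ->
  lrpi x = 0 <-> @loc_in k p M (fun y => y \in @mulspan k (fun a => `[< Q a >]) M) x.
Proof.
move=> IQ; split.
  move/redpi_eq0 => xI; pose E := @loc_in k p M (fun y => y \in @mulspan k (fun a => `[< Q a >]) M).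
  rewrite -[loc_in _ _ _]/(E x).
  have EP : smod E by apply/smod_loc_in/smod_mem.
  have EZ s y : s \notin spec_ideal p -> E (s *: y) -> E y by apply: loc_inZ.
  (* [F] looks at the numerator of a representative; this is well defined because elements outside p
     can be cancelled in [E]. *)
  pose F (c : loc p M) := E (repr c).1.
  have FE y s : F (locfrac y s) <-> E y.
    have [w Ew] := loc_reprP y s; rewrite /F; move: (repr _).1 (repr _).2 Ew => z t Ew.
    split=> [/(smodZ EP (dval s))/(smodZ EP (dval w))|/(smodZ EP (dval t))/(smodZ EP (dval w))].
      by rewrite Ew => /(EZ _ _ (valP w))/(EZ _ _ (valP t)).
    by rewrite -Ew => /(EZ _ _ (valP w))/(EZ _ _ (valP s)).
  suff /FE : F (locfrac x (denom1 p)) by [].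
  move: xI; apply: mulspan_ind => [|c y /IQ[a Qa ->]].
    split; first by apply/FE/(smod0 EP).
      elim/loc_ind=> y s; elim/loc_ind=> z t /FE Ey /FE Ez.
      by rewrite locfracD; apply/FE; apply: (smodD EP); apply: (smodZ EP).
    elim/loc_ind=> a s; elim/loc_ind=> y t /FE Ey.
    by rewrite locfracZ; apply/FE; apply: (smodZ EP).
  elim/loc_ind: y => y s; rewrite locfracZ; apply/FE/loc_in_sub.
  by apply: mulspan_mem; apply/asboolP.
move=> [s sp xQ]; have [c Hc] := lr_unit sp; have lS := bc_semilin (bc_lr M).
rewrite -[lrpi x]scale1r -Hc -scalerA -(semilinZ lS).
suff -> : lrpi (s *: x) = 0 by rewrite scaler0.
move: (s *: x) xQ; apply: mulspan_ind => [|a y /asboolP Qa].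
  split=> [|y z Hy Hz|a y Hy]; first exact: (semilin0 lS).
    by rewrite (semilinD lS) Hy Hz addr0.
  by rewrite (semilinZ lS) Hy scaler0.
suff r0 : lr_hom a = 0 by rewrite (semilinZ lS) -[X in X *: _]/(lr_hom a) r0 scale0r.
by apply: red_hom0; apply/IQ; exists a.
Qed.

Lemma lr_fracs (M : lmodType k) (T : finType) (y : T -> redmod I (loc p M)) :
  exists2 s : k, s \notin spec_ideal p &
    exists x : T -> M, forall t, lr_hom s *: y t = lrpi (x t).
Proof.
have /choice[s Hs] : forall t, exists s, s \notin spec_ideal p /\
    exists x, lr_hom s *: y t = lrpi x.
  by move=> t; have [s sp H] := lr_frac (y t); exists s.
have /choice[x Hx] : forall t, exists x, lr_hom (s t) *: y t = lrpi x.
  by move=> t; exact: (Hs t).2.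
exists (\prod_t s t).
  by elim/big_ind: _ => [|a b|t _]; [exact: spec1|exact: specM|exact: (Hs t).1].
exists (fun t => (\prod_(u | u != t) s u) *: x t) => t.
rewrite (semilinZ (bc_semilin (bc_lr M))) -Hx scalerA -rmorphM.
by rewrite [in LHS](bigD1 t) //= mulrC.
Qed.

Section Algebra.
Variable A : pzAlgType k.
Definition lr_alg : pzAlgType (redring I) := redmod I (loc p A).
Lemma lrpiM (x y : A) : lrpi (x * y) = (lrpi x : lr_alg) * (lrpi y : lr_alg).
Proof.
rewrite /lrpi [RHS]red_mulE; congr (redpi _ _).
by rewrite [RHS]loc_mulE denom1M.
Qed.
Lemma lrpi1 : lrpi (1 : A) = (1 : lr_alg). Proof. by []. Qed.
End Algebra.
End Fibres.

(** * Dual bases with denominators *)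

Section DualBasis.
Variables (R : pzRingType) (P : lmodType R).

Definition dual_basis := exists (I : finType) (x : I -> P)
  (f : I -> {linear P -> R^o}), forall y, y = \sum_i (f i y : R) *: x i.

Lemma dual_basis_projective : dual_basis -> projective P.
Proof.
move=> [I [x [f Hf]]] U V g h gS.
have /choice[u Hu] : forall i, exists u, g u = h (x i) by move=> i; apply: gS.
have hl : linear (fun y => \sum_i (f i y : R) *: u i).
  apply: sum_linear => i a y z.
  by rewrite linearP scalerDl -[a *: f i y]/(a * f i y : R) scalerA.
exists (mklin hl) => y /=; rewrite [y in RHS]Hf !linear_sum.
by apply: eq_bigr => i _; rewrite !linearZ_LR Hu.
Qed.

Lemma projective_dual_basis (I : finType) (x : I -> P) :
  (forall y, exists c : I -> R, y = \sum_i c i *: x i) -> projective P ->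
  exists f : I -> {linear P -> R^o}, forall y, y = \sum_i (f i y : R) *: x i.
Proof.
move=> gen PP.
have gl : linear (fun c : {ffun I -> R^o} => \sum_i (c i : R) *: x i).
  apply: sum_linear => i a c d.
  by rewrite !ffunE scalerDl -[a *: c i]/(a * c i : R) scalerA.
have idl : linear (fun y : P => y) by [].
have [|h Hh] := PP _ _ (mklin gl) (mklin idl).
  move=> y; have [c Hc] := gen y; exists [ffun i => c i : R^o] => /=.
  by rewrite [RHS]Hc; apply: eq_bigr => i _; rewrite ffunE.
have fl i : linear (fun y => h y i) by move=> a y z; rewrite linearP !ffunE.
by exists (fun i => mklin (fl i)) => y; rewrite -[LHS]Hh.
Qed.
End DualBasis.

Section ScaledDual.
Variables (k : comPzRingType).
Implicit Types M : lmodType k.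

(* M becomes finitely generated projective after inverting s. *)
Definition sdual M (s : k) := exists (I : finType) (x : I -> M)
  (f : I -> {linear M -> k^o}), forall y, s *: y = \sum_i (f i y : k) *: x i.

Lemma sdual_ideal M : ideal_like (@sdual M).
Proof.
split.
- exists void, (fun _ => 0), (fun _ => \0) => y.
  by rewrite scale0r big1 // => -[].
- move=> s t [I [x [f Hf]]] [J [z [g Hg]]].
  exists (I + J)%type, (fun o => match o with inl i => x i | inr j => z j end),
    (fun o => match o with inl i => f i | inr j => g j end) => y.
  by rewrite big_sumType /= -Hf -Hg scalerDl.
move=> a s [I [x [f Hf]]]; exists I, x, (fun i => mklin (mulr_linear a (f i))) => y.
rewrite -[a *: s]/(a * s) -scalerA Hf scaler_sumr.
by apply: eq_bigr => i _; rewrite scalerA.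
Qed.

Lemma sdual1_projective M : sdual M 1 -> projective M.
Proof.
move=> [I [x [f Hf]]]; apply: dual_basis_projective.
by exists I, x, f => y; rewrite -Hf scale1r.
Qed.

Lemma spn_fin M (l : seq M) y : spn l y ->
  exists c : 'I_(size l) -> k, y = \sum_i c i *: tnth (in_tuple l) i.
Proof.
move: y; apply: spn_ind => [|x xl].
  split; first by exists (fun _ => 0); rewrite big1 // => i _; rewrite scale0r.
    move=> _ _ [c ->] [d ->]; exists (fun i => c i + d i).
    by rewrite -big_split; apply: eq_bigr => i _; rewrite scalerDl.
  move=> a _ [c ->]; exists (fun i => a * c i).
  by rewrite scaler_sumr; apply: eq_bigr => i _; rewrite scalerA.
have /tnthP[i ->] : x \in in_tuple l by [].
exists (fun j => (i == j)%:R); rewrite (bigD1 i) //= eqxx scale1r big1 ?addr0 //.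
by move=> j /negPf ij; rewrite eq_sym ij scale0r.
Qed.

Lemma projective_sdual M (l : seq M) : (forall y, spn l y) -> projective M ->
  sdual M 1.
Proof.
move=> lM /projective_dual_basis-/(_ _ _ (fun y => spn_fin (lM y)))[f Hf].
by exists 'I_(size l), (tnth (in_tuple l)), f => y; rewrite scale1r.
Qed.

Lemma addspan_spn M (D : M -> Prop) l y : smod D -> spn l y -> addspan allk D l y.
Proof.
move=> DP; have EP := smod_addspan l (ideal_like_all k) DP.
by apply: spn_ind => // x xl; rewrite -[x]scale1r; apply: addspan_mem.
Qed.

Lemma sdual_span M (s : k) : sdual M s -> exists l : seq M, forall y, spn l (s *: y).
Proof.
move=> [I [x [f Hf]]]; exists [seq x i | i <- enum I] => y.
by rewrite Hf -big_enum; apply: spn_sum.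
Qed.

Lemma sdual_detects (p : spec k) M (s : k) : s \notin spec_ideal p ->
  sdual M s -> detects p M.
Proof.
move=> sp [I [x [f Hf]]] z fz; exists s => //; rewrite Hf.
by apply: (smod_sum (smod_mem _)) => i _; apply/mulspan_mem/fz.
Qed.

Lemma submod_gens (M : lmodType k) (l : seq M) (S : submodClosed M) :
  noetherian k -> (forall y, spn l y) ->
  exists l' : seq (submod S), forall y, spn l' y.
Proof.
move=> kN lM; have [l1 l1S gen] := submodule_gens kN (smod_mem S) (fun y _ => lM y).
exists (pmap insub l1) => y.
have : spn l1 (submod_val y) by apply: gen; case: y.
suff H : forall v, spn l1 v -> exists2 z : submod S, submod_val z = v & spn (pmap insub l1) z.
  by move/H => [z /val_inj <-].
apply: spn_ind => [|x xl].
  have SP := smod_spn (pmap insub l1 : seq (submod S)).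
  split; first by exists 0; [exact: linear0 | exact: (smod0 SP)].
    move=> _ _ [z <- Hz] [w <- Hw]; exists (z + w); first exact: linearD.
    exact: (smodD SP).
  move=> a _ [z <- Hz]; exists (a *: z); first exact: linearZ_LR.
  exact: (smodZ SP).
exists (Submod (l1S x xl)) => //; apply: spn_mem.
by rewrite mem_pmap_sub.
Qed.
End ScaledDual.

(** * Fibres over residue fields *)

Section ResidueFields.
Variables (k : comPzRingType) (p : spec k).

Definition fhom : {rmorphism k -> resfield p} := lr_hom (@locprime k p).
Definition fib (M : lmodType k) (x : M) : fibre p M := @lrpi k p (@locprime k p) M x.

Lemma bc_fib (M : lmodType k) : is_bc fhom (@fib M).
Proof. exact: bc_lr. Qed.

Lemma locprimeE c : (c \in @locprime k p) <->
  exists2 a : k, a \in spec_ideal p & c = loc_hom p a.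
Proof.
by split=> [/asboolP[a []]|[a ap ->]]; [exists a | apply/asboolP; exists a].
Qed.

Lemma mulspan_eq (M : lmodType k) (I1 I2 : {pred k}) y :
  I1 =i I2 -> y \in @mulspan k I1 M -> y \in @mulspan k I2 M.
Proof.
move=> E; move: y; apply: mulspan_ind; first exact: smod_mem.
by move=> a x; rewrite E; apply: mulspan_mem.
Qed.

Lemma fib_eq0 (M : lmodType k) (x : M) :
  fib x = 0 <-> loc_in p (fun y => y \in @mulspan k (spec_ideal p) M) x.
Proof.
rewrite /fib (lrpi_eq0 _ locprimeE); split; apply: loc_in_imp => y;
  apply: mulspan_eq => a.
  by apply/asboolP/idP.
by apply/idP/asboolP.
Qed.

Lemma fhom_unit (s : k) : s \notin spec_ideal p -> exists c, c * fhom s = 1.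
Proof. exact: lr_unit. Qed.

Lemma fhom0 (a : k) : a \in spec_ideal p -> fhom a = 0.
Proof. by move=> ap; apply/red_hom0/locprimeE; exists a. Qed.

Section BaseChanged.
Variables (M : lmodType k) (M' : lmodType (resfield p)) (i : M -> M').
Hypothesis iP : is_bc fhom i.

Let to : {linear M' -> fibre p M} := bc_lift iP (bc_semilin (bc_fib M)).
Let from : {linear fibre p M -> M'} := bc_lift (bc_fib M) (bc_semilin iP).
Let fromK : cancel to from.
Proof.
apply: (bc_ext iP (f := mklin (comp_linear from to)) (g := mklin (fun a x y => erefl))).
by move=> x; rewrite /= /to bc_liftE /from bc_liftE.
Qed.

Lemma bc_fib_eq0 (x : M) :
  i x = 0 <-> loc_in p (fun y => y \in @mulspan k (spec_ideal p) M) x.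
Proof.
rewrite -fib_eq0; split=> [ix|fx].
  by rewrite -(bc_liftE iP (bc_semilin (bc_fib M))) ix linear0.
by rewrite -(bc_liftE (bc_fib M) (bc_semilin iP)) fx linear0.
Qed.

Lemma bc_fib_fracs (T : finType) (y : T -> M') :
  exists2 s : k, s \notin spec_ideal p &
    exists x : T -> M, forall t, fhom s *: y t = i (x t).
Proof.
have [s sp [x Hx]] := lr_fracs (fun t => to (y t)).
exists s => //; exists x => t; rewrite -[y t]fromK -(linearZ_LR from) [X in from X]Hx.
exact: bc_liftE.
Qed.

Lemma bc_fib_frac (y : M') :
  exists2 s : k, s \notin spec_ideal p & exists x : M, fhom s *: y = i x.
Proof.
have [s sp [x Hx]] := bc_fib_fracs (fun _ : unit => y).
by exists s => //; exists (x tt); apply: Hx.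
Qed.
End BaseChanged.

Definition field_like (K : comPzRingType) :=
  (1 : K) <> 0 /\ forall c : K, c <> 0 -> exists d, d * c = 1.

Lemma fhom_frac (c : resfield p) :
  exists2 s : k, s \notin spec_ideal p & exists a : k, fhom s * c = fhom a.
Proof.
have [s sp [a Ha]] := bc_fib_frac (bc_regular fhom) (c : (resfield p)^o).
by exists s => //; exists a.
Qed.

Lemma fhom_eq0 (a : k) : fhom a = 0 -> a \in spec_ideal p.
Proof.
move=> fa; have /(bc_fib_eq0 (bc_regular fhom))[s sp] : fhom a = 0 :> (resfield p)^o by [].
move=> H; have {}H : s * a \in spec_ideal p.
  have Hp : forall b : k^o, b \in @mulspan k (spec_ideal p) k^o -> b \in spec_ideal p.
    apply: mulspan_ind; first exact: ideal_like_mem.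
    by move=> b x bp; apply: specMr.
  exact: Hp.
by case: ((spec_prime p).2 _ _ H) => //; rewrite (negPf sp).
Qed.

Lemma resfield_field : field_like (resfield p).
Proof.
split=> [|c c0].
  by rewrite -(rmorph1 fhom) => /fhom_eq0; apply/negP/spec1.
have [s sp [a Ha]] := fhom_frac c.
have [ap|ap] := boolP (a \in spec_ideal p).
  case: c0; have [d Hd] := fhom_unit sp.
  by rewrite -[c]mul1r -Hd -mulrA Ha (fhom0 ap) mulr0.
have [d Hd] := fhom_unit ap; exists (d * fhom s).
by rewrite -mulrA Ha.
Qed.

Variable A : pzAlgType k.
Lemma fibM (x y : A) : fib (x * y) = (fib x : fibre_alg p A) * (fib y : fibre_alg p A).
Proof. exact: lrpiM. Qed.
Lemma fib1 : fib (1 : A) = (1 : fibre_alg p A).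
Proof. exact: lrpi1. Qed.
End ResidueFields.

(** * Ideals as modules and their endomorphisms *)

Section IdealModule.
Variables (k : comPzRingType) (A : pzAlgType k) (J : ideal2 A).
Local Notation X := (ideal_mod J).

Definition jval : {linear X -> A} := @submod_val k A (ideal2_sub J).
Lemma jval_in (x : X) : jval x \in ideal2_sub J. Proof. by case: x. Qed.
Lemma jval_inj : injective jval. Proof. exact: val_inj. Qed.

Definition jact (a : A) (x : X) : X := Submod (ideal2Ml a (jval_in x)).
Definition jract (x : X) (a : A) : X := Submod (ideal2Mr a (jval_in x)).
Lemma jactE a x : jval (jact a x) = a * jval x. Proof. by []. Qed.
Lemma jractE x a : jval (jract x a) = jval x * a. Proof. by []. Qed.

Lemma jact_linl x : linear (jact^~ x).
Proof.
move=> c a b; apply: jval_inj; rewrite linearP !jactE.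
by rewrite mulrDl pzscaleAl.
Qed.
Lemma jact_linr a : linear (jact a).
Proof.
move=> c x y; apply: jval_inj; rewrite linearP !jactE.
by rewrite linearP mulrDr pzscaleAr.
Qed.
Lemma jract_linl a : linear (jract^~ a).
Proof.
move=> c x y; apply: jval_inj; rewrite linearP !jractE.
by rewrite linearP mulrDl pzscaleAl.
Qed.
Lemma jract_linr x : linear (jract x).
Proof.
move=> c a b; apply: jval_inj; rewrite linearP !jractE.
by rewrite mulrDr pzscaleAr.
Qed.
Lemma jactA a b x : jact a (jact b x) = jact (a * b) x.
Proof. by apply: jval_inj; rewrite !jactE mulrA. Qed.
Lemma jact1 x : jact 1 x = x. Proof. by apply: jval_inj; rewrite jactE mul1r. Qed.
Lemma jact_jract a x b : jact a (jract x b) = jract (jact a x) b.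
Proof. by apply: jval_inj; rewrite jactE !jractE mulrA. Qed.

Fact jX_in (x : ideal_lmod J) : (submod_val x : A) \in ideal2_sub J.
Proof. by case: x. Qed.
Fact jL_in (x : X) : (jval x : A^o) \in lideal_pred J.
Proof. by case: x. Qed.
(** J occurs both as a [k]-module ([ideal_mod]) and as a left A-module ([ideal_lmod]). Calculations
    take place in the first, with A acting through [jact]; [jX] and [jL] translate. *)
Definition jX (x : ideal_lmod J) : X := Submod (jX_in x).
Definition jL (x : X) : ideal_lmod J := Submod (jL_in x).
Lemma jLK : cancel jL jX. Proof. by move=> x; apply: val_inj. Qed.
Lemma jXK : cancel jX jL. Proof. by move=> x; apply: val_inj. Qed.
Lemma jX_add x y : jX (x + y) = jX x + jX y.
Proof. exact: val_inj. Qed.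
Lemma jX_act (a : A) x : jX (a *: x) = jact a (jX x).
Proof. exact: val_inj. Qed.
Lemma jL_add x y : jL (x + y) = jL x + jL y.
Proof. by apply: (can_inj jXK); rewrite jX_add !jLK. Qed.
Lemma jL_act (a : A) x : jL (jact a x) = a *: jL x.
Proof. by apply: (can_inj jXK); rewrite jX_act !jLK. Qed.
Lemma jactZ (c : k) (x : X) : c *: x = jact (alg_scalar A c) x.
Proof.
by apply: jval_inj; rewrite (linearZ_LR jval) jactE -pzscaleAl mul1r.
Qed.

Local Notation E := (end_ideal J).
Definition emap_fun (f : E) (x : X) : X := jX (endo_fun f (jL x)).
Lemma emap_act f a x : emap_fun f (jact a x) = jact a (emap_fun f x).
Proof. by rewrite /emap_fun jL_act linearZ_LR jX_act. Qed.
Lemma emap_linear f : linear (emap_fun f).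
Proof.
move=> c x y; rewrite [in LHS]jactZ [RHS]addrC [in RHS]jactZ -emap_act addrC.
by rewrite /emap_fun jL_add linearD jX_add.
Qed.
Definition emap (f : E) : {linear X -> X} := mklin (emap_linear f).
Lemma emapA f a x : emap f (jact a x) = jact a (emap f x).
Proof. exact: emap_act. Qed.

Section Make.
Variables (g : X -> X) (gl : linear g) (gA : forall a x, g (jact a x) = jact a (g x)).
Fact emk_linear : linear (fun x : ideal_lmod J => jL (g (jX x))).
Proof.
move=> a x y; rewrite jX_add jX_act -jL_act -jL_add -gA; congr jL.
by have := gl 1 (jact a (jX x)) (jX y); rewrite !scale1r.
Qed.
Definition emk : E := (mklin emk_linear : {linear ideal_lmod J -> ideal_lmod J}).
Lemma emkE x : emap emk x = g x.
Proof. by rewrite /emap /= /emap_fun /= !jLK. Qed.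
End Make.

Lemma emap_inj (f g : E) : (forall x, emap f x = emap g x) -> f = g.
Proof.
move=> fg; apply: endoP => x; have := fg (jX x).
by rewrite /= /emap_fun !jXK => /(can_inj jXK).
Qed.
Lemma emapD (f g : E) x : emap (f + g) x = emap f x + emap g x.
Proof. by rewrite /= /emap_fun -jX_add. Qed.
Lemma emapM (f g : E) x : emap (f * g) x = emap f (emap g x).
Proof. by rewrite /= /emap_fun jXK. Qed.
Lemma emap1 x : emap 1 x = x.
Proof. by rewrite /= /emap_fun -[RHS]jLK. Qed.
Lemma emapZ (c : k) (f : E) x : emap (c *: f) x = c *: emap f x.
Proof. by rewrite [RHS]jactZ /= /emap_fun -jX_act. Qed.
Lemma emap0 x : emap 0 x = 0.
Proof. by rewrite -(scale0r 0) emapZ scale0r. Qed.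
Lemma emap_sum (I : Type) (r : seq I) (P : pred I) (F : I -> E) x :
  emap (\sum_(i <- r | P i) F i) x = \sum_(i <- r | P i) emap (F i) x.
Proof.
by elim/big_rec2: _ => [|i y f _ <-]; rewrite ?emap0 ?emapD.
Qed.
Lemma emap_lin_l x : linear (fun f : E => emap f x).
Proof. by move=> c f g; rewrite emapD emapZ. Qed.

Definition rho (a : A) : E :=
  emk (jract_linl a) (fun b x => esym (jact_jract b x a)).
Lemma rhoE a x : emap (rho a) x = jract x a. Proof. exact: emkE. Qed.
Lemma rho_linear : linear rho.
Proof.
move=> c a b; apply: emap_inj => x.
by rewrite emapD emapZ !rhoE jract_linr.
Qed.
Lemma rhoM a b : rho (a * b) = rho b * rho a.
Proof.
by apply: emap_inj => x; rewrite emapM !rhoE; apply: jval_inj; rewrite !jractE mulrA.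
Qed.
(** For y and x in J the product y x is also y acting from the left on x, which commutes with f. So
    [rho] maps J onto a left ideal of E, through which E is accessible from J. *)
Lemma rho_left (f : E) (x : X) : f * rho (jval x) = rho (jval (emap f x)).
Proof.
apply: emap_inj => y; rewrite emapM !rhoE.
have H z w : jract z (jval w) = jact (jval z) w by apply: jval_inj.
by rewrite !H emapA.
Qed.

(* As J = J^2, functionals J -> A with values in J suffice to express that J is
   projective over A, here after inverting s. *)
Definition adual (s : k) := exists (I : finType) (x : I -> X) (f : I -> E),
  forall y, s *: y = \sum_i jact (jval (emap (f i) y)) (x i).

Lemma adual_ideal : ideal_like adual.
Proof.
split.
- exists void, (fun _ => 0), (fun _ => 0) => y.
  by rewrite scale0r big1 // => -[].
- move=> s t [I [x [f Hf]]] [I' [z [g Hg]]].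
  exists (I + I')%type, (fun o => match o with inl i => x i | inr j => z j end),
    (fun o => match o with inl i => f i | inr j => g j end) => y.
  by rewrite big_sumType /= -Hf -Hg scalerDl.
move=> a s [I [x [f Hf]]]; exists I, x, (fun i => a *: f i) => y.
rewrite -[a *: s]/(a * s) -scalerA Hf scaler_sumr.
apply: eq_bigr => i _; rewrite emapZ (linearZ_LR jval).
by apply: jval_inj; rewrite linearZ_LR !jactE pzscaleAl.
Qed.

Lemma idempotent_seq : idempotent_ideal J ->
  forall x : X, exists s : seq (X * X), x = \sum_(u <- s) jact (jval u.1) u.2.
Proof.
move=> JJ x; have /asboolP[s [/allP sJ xE]] : jval x \in ideal_square J.
  by rewrite JJ jval_in.
have : exists t : seq (X * X), \sum_(u <- s) u.1 * u.2 =
    jval (\sum_(u <- t) jact (jval u.1) u.2).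
  elim: s sJ {xE} => [|[a b] s IHs] sJ.
    by exists [::]; rewrite !big_nil linear0.
  have [|t Ht] := IHs; first by move=> u us; apply: sJ; rewrite inE us orbT.
  have /andP[aJ bJ] := sJ _ (mem_head _ _).
  exists ((Submod aJ, Submod bJ) :: t).
  by rewrite !big_cons Ht linearD.
by move=> [t Ht]; exists t; apply: jval_inj; rewrite -Ht -xE.
Qed.

Lemma adual_projective : adual 1 -> projective (ideal_lmod J).
Proof.
move=> [I [x [f Hf]]]; apply: dual_basis_projective.
have gl i : linear (fun y : ideal_lmod J => jval (emap (f i) (jX y)) : A^o).
  move=> a y z; rewrite jX_add jX_act linearD emapA linearD jactE.
  by [].
exists I, (fun i => jL (x i)), (fun i => mklin (gl i)) => y.
rewrite -[LHS]jXK -[jX y in LHS]scale1r Hf.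
rewrite (big_morph jL jL_add (id1 := 0)); last by apply: (can_inj jXK); apply: val_inj.
by apply: eq_bigr => i _; rewrite jL_act.
Qed.

Lemma projective_adual (l : seq X) : idempotent_ideal J ->
  (forall y, spn l y) -> projective (ideal_lmod J) -> adual 1.
Proof.
move=> JJ lJ /projective_dual_basis-/(_ _ (fun i => jL (tnth (in_tuple l) i))).
case=> [y|f Hf].
  have [c Hc] := spn_fin (lJ (jX y)); exists (fun i => alg_scalar A (c i)).
  rewrite -[LHS]jXK Hc (big_morph jL jL_add (id1 := 0)).
    by apply: eq_bigr => i _; rewrite jactZ jL_act.
  by apply: (can_inj jXK); apply: val_inj.
(* By A-linearity a functional maps J = JJ into J A, hence into J. *)
have fJ i x : (f i (jL x) : A) \in ideal2_sub J.
  have [s ->] := idempotent_seq JJ x.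
  rewrite (big_morph jL jL_add (id1 := 0)); last by apply: (can_inj jXK); apply: val_inj.
  rewrite linear_sum; apply: (@rpred_sum A) => u _.
  by rewrite jL_act linearZ_LR; apply/ideal2Mr/jval_in.
pose g i (x : X) : X := Submod (fJ i x).
have gA i a x : g i (jact a x) = jact a (g i x).
  by apply: jval_inj; rewrite jactE /= jL_act linearZ_LR.
have gl i : linear (g i).
  move=> c x y; apply: jval_inj; rewrite linearP /= jactZ jL_add jL_act linearD linearZ_LR.
  by congr (_ + _); rewrite -[LHS]pzscaleAl mul1r.
exists 'I_(size l), (tnth (in_tuple l)), (fun i => emk (gl i) (gA i)) => y.
rewrite scale1r -[LHS]jLK (Hf (jL y)).
rewrite (big_morph jX jX_add (id1 := 0)); last exact: val_inj.
by apply: eq_bigr => i _; rewrite jX_act jLK emkE.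
Qed.
End IdealModule.
Arguments jval {k A J}.

Section IdealBaseChange.
Variables (k k' : comPzRingType) (phi : {rmorphism k -> k'}).
Variables (A : pzAlgType k) (A' : pzAlgType k') (i : A -> A').
Hypotheses (iP : is_bc phi i) (iM : forall x y, i (x * y) = i x * i y) (i1 : i 1 = 1).
Variables (J : ideal2 A) (J' : ideal2 A').
Local Notation X := (ideal_mod J).
Local Notation X' := (ideal_mod J').

(** J' is the k'-span of the image of J in A'. This alone does not make J' a base change of J: the
    kernel of k' (x) J -> A' is what [bc_jbc] has to exclude. *)
Definition ideal_bc :=
  (forall x : X, i (jval x) \in ideal2_sub J') /\
  (forall y : X', exists s : seq (k' * X), jval y = \sum_(u <- s) u.1 *: i (jval u.2)).

Hypothesis JP : ideal_bc.
Definition jbc (x : X) : X' := Submod (JP.1 x).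
Lemma jbcE x : jval (jbc x) = i (jval x). Proof. by []. Qed.

Lemma jbc_semilin : semilin phi jbc.
Proof.
have iS := bc_semilin iP.
by split=> [x y|a x]; apply: jval_inj; rewrite ?linearD ?linearZ_LR jbcE
  ?linearD ?(linearZ_LR jval) ?iS.1 ?iS.2.
Qed.

Lemma jbc_spans (y : X') : exists s : seq (k' * X), y = \sum_(u <- s) u.1 *: jbc u.2.
Proof.
have [s Hs] := JP.2 y; exists s; apply: jval_inj; rewrite Hs linear_sum.
by apply: eq_bigr => u _; rewrite linearZ_LR.
Qed.

Lemma jbc_ind (E : X' -> Prop) : smod E -> (forall x, E (jbc x)) -> forall y, E y.
Proof.
move=> EP Ei y; have [s ->] := jbc_spans y.
by apply: (smod_sum EP) => u _; apply: (smodZ EP).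
Qed.

Lemma jbc_act a x : jbc (jact a x) = jact (i a) (jbc x).
Proof. by apply: jval_inj; rewrite /= iM. Qed.
Lemma jbc_ract x a : jbc (jract x a) = jract (jbc x) (i a).
Proof. by apply: jval_inj; rewrite /= iM. Qed.

Definition sretract (s : k) := exists r : {linear A -> X}, forall x, r (jval x) = s *: x.

(** A retraction of A onto J up to s, with s invertible in k', extends every semilinear map on J to
    A and hence to A'. *)
Lemma bc_jbc (s : k) (c : k') : c * phi s = 1 -> sretract s -> is_bc phi jbc.
Proof.
move=> cs [r Hr]; split; [exact: jbc_semilin | exact: jbc_spans |].
move=> N g gP.
pose h := bc_lift iP (semilin_comp_lin r gP).
exists (mklin (scale_linear c (mklin (comp_linear h (@jval _ _ J'))))) => x.
transitivity (c *: h (i (jval x))); first by [].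
by rewrite /h bc_liftE /= Hr (semilinZ gP) scalerA cs scale1r.
Qed.
End IdealBaseChange.

(** * Ideals that are direct summands up to a denominator *)

Section Retracts.
Variables (k : comPzRingType) (A : pzAlgType k) (J : ideal2 A).

Lemma sretract_ideal : ideal_like (sretract J).
Proof.
split.
- have zl : linear (fun _ : A => 0 : ideal_mod J).
    by move=> a x y; rewrite scaler0 addr0.
  by exists (mklin zl) => x; rewrite scale0r.
- move=> s t [r Hr] [q Hq].
  have zl : linear (fun x : A => r x + q x).
    by move=> a x y; rewrite !linearP scalerDr addrACA.
  by exists (mklin zl) => x /=; rewrite Hr Hq scalerDl.
move=> a s [r Hr]; exists (mklin (scale_linear a r)) => x /=.
by rewrite Hr scalerA.
Qed.

Lemma sdual_retract (M M' : lmodType k) (i : {linear M' -> M}) (r : {linear M -> M'})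
  (s t : k) : (forall x, r (i x) = s *: x) -> sdual M t -> sdual M' (t * s).
Proof.
move=> ri [I [x [f Hf]]]; exists I, (fun i => r (x i)),
  (fun j => mklin (comp_linear (f j) i)) => y.
by rewrite -scalerA -ri -(linearZ_LR r) Hf linear_sum; apply: eq_bigr => j _; rewrite linearZ_LR.
Qed.

Lemma sretract_quo_projective : sdual A 1 -> sretract J 1 ->
  projective (quomod J : lmodType k).
Proof.
move=> A1 [r Hr].
have pil : linear (@quopi k A J).
  by move=> a x y; rewrite quopiD; congr (_ + _); apply/esym/quo_scaleE.
have sl : linear (fun x : A => x - jval (r x)).
  by move=> a x y; rewrite (linearP r) (linearP (@jval _ _ J)) scalerBr opprD addrACA.
pose sec (c : quomod J) : A := repr c - jval (r (repr c)).
have secE x : sec (quopi J x) = x - jval (r x).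
  rewrite /sec; set z := repr _.
  have zx : z - x \in ideal2_sub J := quo_repr J x.
  have /eqP := Hr (Submod zx).
  rewrite scale1r -[jval _]/(z - x) linearB => /eqP/(congr1 (@jval _ _ J)).
  rewrite linearB /= => E.
  move: (submod_val (r z)) (submod_val (r x)) E => a b E.
  have -> : z = a - b + x by rewrite E subrK.
  by rewrite addrC !addrA addNr add0r addrC.
have secl : linear sec.
  move=> a c d; elim/quo_ind: c => x; elim/quo_ind: d => y.
  have -> : a *: quopi J x + quopi J y = quopi J (a *: x + y) by rewrite pil.
  by rewrite !secE sl.
apply: sdual1_projective; rewrite -[1]mulr1.
apply: (@sdual_retract A _ (mklin secl) (mklin pil)) A1 => c /=.
elim/quo_ind: c => x; rewrite secE scale1r; apply: quopiP.
have -> : x - jval (r x) - x = jval (- r x) by rewrite linearN addrAC subrr add0r.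
exact: jval_in.
Qed.

Lemma quo_projective_sretract (l : seq A) : (forall y, spn l y) ->
  projective (quomod J : lmodType k) -> sretract J 1.
Proof.
move=> lA QP.
have pil : linear (@quopi k A J).
  by move=> a x y; rewrite quopiD; congr (_ + _); apply/esym/quo_scaleE.
have idl : linear (fun c : quomod J => c) by [].
have [|h Hh] := QP _ _ (mklin pil) (mklin idl).
  by elim/quo_ind => x; exists x.
have inJ x : x - h (quopi J x) \in ideal2_sub J.
  by have /eqP := esym (Hh (quopi J x)); rewrite /= quopiE.
pose r (x : A) : ideal_mod J := Submod (inJ x).
have rl : linear r.
  move=> a x y; apply: jval_inj; rewrite linearP /= pil linearP scalerBr.
  by rewrite opprD addrACA.
exists (mklin rl) => x; rewrite scale1r; apply: jval_inj => /=.
have -> : quopi J (jval x) = 0; last by rewrite linear0 subr0.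
have <- : quopi J 0 = 0.
  have /esym/eqP := quopiD J (0 : A) 0.
  by rewrite addr0 -subr_eq0 addrK => /eqP.
by apply: quopiP; rewrite subr0 jval_in.
Qed.
End Retracts.

Section FibreIdeals.
Variables (k : comPzRingType) (A : pzAlgType k) (J : ideal2 A) (p : spec k).
Local Notation X := (ideal_mod J).
Local Notation Jp := (fibre_ideal J p).

Lemma fibre_mapE (M N : lmodType k) (f : {linear M -> N}) x :
  fibre_map p f (fib p x) = fib p (f x).
Proof. by apply: (eq_trans (red_mapE _ _ _)); congr (redpi _ _); apply: loc_mapE. Qed.

Lemma fibre_ideal_inE (x : X) : fib p (jval x) \in ideal2_sub Jp.
Proof.
apply/asboolP; exists (fib p x); exact/esym/fibre_mapE.
Qed.

Lemma fibre_ideal_bc : ideal_bc (@fib k p A) J Jp.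
Proof.
split=> [x|y]; first exact: fibre_ideal_inE.
have /asboolP[z ->] := jval_in y.
case: (bc_fib p X) => _ /(_ z)[s ->] _; exists s.
rewrite linear_sum; apply: eq_bigr => u _.
by rewrite (linearZ_LR (fibre_incl J p)) fibre_mapE.
Qed.
Definition jfib : X -> ideal_mod Jp := jbc fibre_ideal_bc.

Lemma jfib_act a x : jfib (jact a x) = jact (fib p a : fibre_alg p A) (jfib x).
Proof. by apply: jbc_act; exact: fibM. Qed.
Lemma jfib_semilin : semilin (fhom p) jfib.
Proof. exact/jbc_semilin/bc_fib. Qed.
Lemma jfibE x : jval (jfib x) = fib p (jval x). Proof. by []. Qed.

Lemma jfib_fracs (T : finType) (y : T -> ideal_mod Jp) :
  exists2 s : k, s \notin spec_ideal p &
    exists x : T -> X, forall t, fhom p s *: y t = jfib (x t).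
Proof.
have /choice[z Hz] : forall t, exists z, jval (y t) = fibre_incl J p z.
  by move=> t; apply/asboolP/(jval_in (y t)).
have [s sp [x Hx]] := bc_fib_fracs (bc_fib p X) z.
exists s => //; exists x => t; apply: jval_inj.
by rewrite linearZ_LR Hz -linearZ_LR Hx jfibE /= fibre_mapE.
Qed.

(* Writing y in J as sum a_l b_l and b_l through a dual basis of the fibre,
   the coefficients reduce to f_i(y) = 0. *)
Lemma fibre_heredity_inj (y : X) :
  idempotent_ideal J -> adual Jp 1 -> jfib y = 0 ->
  loc_in p (fun z => z \in @mulspan k (spec_ideal p) X) y.
Proof.
move=> JJ [I [x [f Hf]]] y0.
have LP : smod (loc_in p (fun z => z \in @mulspan k (spec_ideal p) X)).
  exact/smod_loc_in/smod_mem.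
(* A linear map A -> J carries pA into pJ; in this way vanishing in A(p) turns into vanishing in
   J(p). *)
have lin_L (g : {linear A -> X}) a : fib p a = 0 ->
    loc_in p (fun z => z \in @mulspan k (spec_ideal p) X) (g a).
  move/fib_eq0 => [s sp Hs]; exists s => //.
  by rewrite -(linearZ_LR g); apply: mulspan_lin.
have [u yE] := idempotent_seq JJ y; rewrite big_tnth in yE.
set a := fun l => (tnth (in_tuple u) l).1 in yE; set b := fun l => (tnth (in_tuple u) l).2.
have {}yE : y = \sum_l jact (jval (a l)) (b l) by [].
have [s sp [c Hc]] := jfib_fracs (fun li : 'I_(size u) * I => emap (f li.2) (jfib (b li.1))).
have [t tp [z Hz]] := jfib_fracs x.
apply: (@loc_inZ _ _ _ _ (s * t)); first exact: specM.
have jS := jfib_semilin.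
pose r l := (s * t) *: b l - \sum_i jact (jval (c (l, i))) (z i).
have r0 l : fib p (jval (r l)) = 0.
  rewrite -jfibE -[RHS](linear0 (@jval _ _ Jp)); apply: (congr1 (@jval _ _ Jp)).
  rewrite (semilinB jS) (semilinZ jS) (semilin_sum jS) -[jfib (b l)]scale1r Hf.
  rewrite scaler_sumr -sumrB big1 // => i _; rewrite jfib_act -jfibE -Hc -Hz.
  apply: jval_inj; rewrite linear0 linearB linearZ_LR !jactE !linearZ_LR.
  rewrite -pzscaleAl -pzscaleAr scalerA -rmorphM; exact: subrr.
pose v i := \sum_l jval (a l) * jval (c (l, i)).
have v0 i : fib p (v i) = 0.
  rewrite /v (semilin_sum (bc_semilin (bc_fib p A))).
  transitivity (fhom p s *: jval (emap (f i) (jfib y))); last first.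
    by rewrite y0 !linear0.
  rewrite yE (semilin_sum jS) !linear_sum; apply: eq_bigr => l _.
  rewrite fibM -[fib p (jval (c _))]jfibE -Hc linearZ_LR jfib_act emapA jactE.
  exact/esym/pzscaleAr.
have -> : (s * t) *: y = \sum_l jact (jval (a l)) (r l) + \sum_i jact (v i) (z i).
  rewrite yE scaler_sumr; apply: jval_inj; rewrite linearD !linear_sum.
  under [X in _ = _ + X]eq_bigr => i _ do rewrite jactE /v mulr_suml.
  rewrite exchange_big -big_split; apply: eq_bigr => l _ /=.
  rewrite -[submod_val (\sum_i _)]/(jval _) linear_sum mulrBr -pzscaleAr mulr_sumr.
  rewrite -addrA addrC -sumrN -big_split big1 ?add0r // => i _ /=.
  by rewrite mulrA addNr.
apply: (smodD LP); apply: (smod_sum LP) => j _.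
  have -> : jact (jval (a j)) (r j) = mklin (jract_linr (a j)) (jval (r j)).
    by apply: jval_inj.
  exact: lin_L.
exact: (lin_L (mklin (jact_linl (z j)))).
Qed.
End FibreIdeals.

(** * Lifting projectivity from a fibre *)

Section FiniteFamilies.
Variables (k : comPzRingType) (T : finType).
Local Notation F M := {ffun T -> M}.

Definition ffsingle (M : lmodType k) (t : T) (x : M) : F M :=
  [ffun u => if u == t then x else 0].
Lemma ffsingle_linear (M : lmodType k) t : linear (@ffsingle M t).
Proof.
move=> a x y; apply/ffunP => u; rewrite !ffunE.
by case: eqP => // _; rewrite scaler0 addr0.
Qed.
Lemma ffun_single (M : lmodType k) (c : F M) : c = \sum_t ffsingle t (c t).
Proof.
apply/ffunP => u; rewrite sum_ffunE (bigD1 u) //= ffunE eqxx big1 ?addr0 //.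
by move=> t /negPf ut; rewrite ffunE eq_sym ut.
Qed.

Lemma sdual_ffun (M : lmodType k) s : sdual M s -> sdual (F M) s.
Proof.
move=> [I [x [f Hf]]].
have fl t i : linear (fun c : F M => f i (c t)) by move=> a c d; rewrite !ffunE linearP.
exists (T * I)%type, (fun u => ffsingle u.1 (x u.2)), (fun u => mklin (fl u.1 u.2)) => c.
rewrite -(pair_bigA _ (fun t i => (f i (c t) : k) *: ffsingle t (x i))) /=.
rewrite [c in LHS]ffun_single scaler_sumr; apply: eq_bigr => t _.
pose g := mklin (@ffsingle_linear M t); rewrite -[ffsingle t (c t)]/(g (c t)).
rewrite -(linearZ_LR g) Hf linear_sum; apply: eq_bigr => i _.
exact: linearZ_LR.
Qed.

Lemma loc_in_ffun (p : spec k) (M : lmodType k) (c : F M) :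
  (forall t, loc_in p (fun z => z \in @mulspan k (spec_ideal p) M) (c t)) ->
  loc_in p (fun z => z \in @mulspan k (spec_ideal p) (F M)) c.
Proof.
move=> H; rewrite [c]ffun_single.
apply: smod_sum => [|t _]; first exact/smod_loc_in/smod_mem.
have [s sp Hs] := H t; exists s => //.
rewrite -(linearZ_LR (mklin (@ffsingle_linear M t))).
exact: (mulspan_lin (mklin (@ffsingle_linear M t))).
Qed.

Lemma loc_in_ffun_coord (p : spec k) (M : lmodType k) (c : F M) t :
  loc_in p (fun z => z \in @mulspan k (spec_ideal p) (F M)) c ->
  loc_in p (fun z => z \in @mulspan k (spec_ideal p) M) (c t).
Proof.
have fl : linear (fun c : F M => c t) by move=> a x y; rewrite !ffunE.
move=> [s sp Hs]; exists s => //.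
have := mulspan_lin (mklin fl) Hs; by rewrite /= ffunE.
Qed.
End FiniteFamilies.

Lemma linear_expand (k : comPzRingType) (M N : lmodType k) (I : finType) (x : I -> M)
  (f : I -> {linear M -> k^o}) (g : {linear M -> N}) s :
  (forall y, s *: y = \sum_i (f i y : k) *: x i) ->
  forall y, s *: g y = \sum_i (f i y : k) *: g (x i).
Proof.
move=> Hf y; rewrite -(linearZ_LR g) Hf linear_sum.
by apply: eq_bigr => i _; rewrite linearZ_LR.
Qed.

Lemma adual_functionals (k : comPzRingType) (A : pzAlgType k) (J : ideal2 A) (s : k)
    (I : finType) (x : I -> ideal_mod J) (f : I -> {linear ideal_mod J -> A}) :
  idempotent_ideal J -> (forall i a y, f i (jact a y) = a * f i y) ->
  (forall y, s *: y = \sum_i jact (f i y) (x i)) -> adual J s.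
Proof.
move=> JJ fA Hf.
have fJ i y : f i y \in ideal2_sub J.
  have [u ->] := idempotent_seq JJ y; rewrite linear_sum.
  by apply: (@rpred_sum A) => v _; rewrite fA; apply/ideal2Mr/jval_in.
pose g i y : ideal_mod J := Submod (fJ i y).
have gl i : linear (g i) by move=> a y z; apply: jval_inj; rewrite linearP /= linearP.
have gA i a y : g i (jact a y) = jact a (g i y) by apply: jval_inj; rewrite jactE /= fA.
exists I, x, (fun i => emk (gl i) (gA i)) => y; rewrite Hf.
by apply: eq_bigr => i _; rewrite emkE.
Qed.

Section LocalLifting.
Variables (k : comPzRingType) (A : pzAlgType k) (J : ideal2 A) (p : spec k).
Local Notation X := (ideal_mod J).
Local Notation Jp := (fibre_ideal J p).

(** [local_split] for the inclusion of J into A, with D = 0. *)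
Lemma local_retract (l : seq X) : (forall y, spn l y) -> sdual A 1 ->
  (forall y : X, jfib p y = 0 ->
    loc_in p (fun z => z \in @mulspan k (spec_ideal p) X) y) ->
  exists2 s : k, s \notin spec_ideal p & sretract J s.
Proof.
move=> lJ A1 inj.
have [|||y||y|s sp [I [w [f Hf]]]] := @local_split k p X A (fun y => y = 0) (@jval k A J) l 1.
- exact: smod_zero.
- by move=> y ->; rewrite linear0.
- exact: spec1.
- by rewrite scale1r; apply: lJ.
- exact: sdual_detects (spec1 p) A1.
- move/fib_eq0 => y0; have /inj[s sp Hs] : jfib p y = 0.
    by apply: jval_inj; rewrite jfibE y0 linear0.
  by exists s => //; exists (s *: y) => //; rewrite subrr.
exists s => //.
have rl : linear (fun a : A => \sum_i (f i a : k) *: w i).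
  by apply: sum_linear => i; apply: scalel_linear.
by exists (mklin rl) => y; have /eqP := Hf y; rewrite subr_eq0 => /eqP.
Qed.

Section Projectivity.
Variables (l : seq X) (lJ : forall y, spn l y).
Hypotheses (JJ : idempotent_ideal J) (A1 : sdual A 1) (X1 : sdual X 1).
Hypothesis jfib0 : forall y : X, jfib p y = 0 <->
    loc_in p (fun z => z \in @mulspan k (spec_ideal p) X) y.
Hypothesis Jp1 : adual Jp 1.
Local Notation n := (size l).
Local Notation V := {ffun 'I_n -> A}.
Local Notation x i := (tnth (in_tuple l) i).

Let mu (v : V) : X := \sum_i jact (v i) (x i).
Let mu_linear : linear mu.
Proof.
by apply: sum_linear => i a v w; rewrite !ffunE jact_linl.
Qed.
Let aact (a : A) (v : V) : V := [ffun i => a * v i].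
Let aact_linl v : linear (aact^~ v).
Proof. by move=> c a b; apply/ffunP => i; rewrite !ffunE mulrDl -pzscaleAl. Qed.
Let aact_linr a : linear (aact a).
Proof. by move=> c u v; apply/ffunP => i; rewrite !ffunE mulrDr -pzscaleAr. Qed.
Let aactA a b v : aact a (aact b v) = aact (a * b) v.
Proof. by apply/ffunP => i; rewrite !ffunE mulrA. Qed.
Let mu_act a v : mu (aact a v) = jact a (mu v).
Proof.
rewrite /mu -[RHS]/(mklin (jact_linr a) _) linear_sum; apply: eq_bigr => i _.
by rewrite ffunE /= jactA.
Qed.

Local Notation muL := (mklin mu_linear).
Local Notation K := (submod (mksub (smod_ker muL))).
Let kval : {linear K -> V} := @submod_val k V (mksub (smod_ker muL)).
Let kval_inj : injective kval. Proof. exact: val_inj. Qed.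
Let kvalP w : mu (kval w) = 0.
Proof. by case: w => v vK; apply/(mksubE (smod_ker muL)). Qed.
Let kmk v (Hv : mu v = 0) : K := Submod (let: conj _ h := mksubE (smod_ker muL) v in h Hv).
Let kact_in a w : mu (aact a (kval w)) = 0.
Proof. by rewrite mu_act kvalP; apply: (lin0 (jact_linr a)). Qed.
Let kact a w : K := kmk (kact_in a w).
Let kact_linr a : linear (kact a).
Proof.
move=> c u v; apply: kval_inj; rewrite (linearP kval).
transitivity (aact a (kval (c *: u + v))); first by [].
by rewrite (linearP kval) aact_linr.
Qed.
Let kact_linl w : linear (kact^~ w).
Proof. by move=> c a b; apply: kval_inj; rewrite linearP /= aact_linl. Qed.
Let kactA a b w : kact a (kact b w) = kact (a * b) w.
Proof. by apply: kval_inj; rewrite /= aactA. Qed.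

(* The obstruction to an A-linear section of A^n -> J is the class of a cocycle
   A x J -> K; modulo p a cocycle c bounds h(x) = - sum c(g_e x, y_e), where
   (y_e, g_e) is a dual basis of the fibre. *)
Lemma local_adual : exists2 s : k, s \notin spec_ideal p & adual J s.
Proof.
have [f Hf] := projective_dual_basis (fun y => spn_fin (lJ y)) (sdual1_projective X1).
have [T [a [al Hal]]] := A1.
have Hf1 y : 1 *: y = \sum_i (f i y : k) *: x i by rewrite scale1r.
pose sg (y : X) : V := [ffun i => (f i y : k) *: (1 : A)].
have sg_lin : linear sg.
  move=> c y z; apply/ffunP => i; rewrite !ffunE linearP scalerDl.
  by rewrite -[c *: f i y]/(c * f i y : k) scalerA.
have mu_sg y : mu (sg y) = y.
  rewrite [RHS]Hf; apply: eq_bigr => i _; rewrite ffunE.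
  by rewrite (linZ (jact_linl (x i))) jact1.
have K1 : sdual K 1.
  have rl_in v : mu (v - sg (mu v)) = 0.
    by rewrite (linB mu_linear) /= mu_sg subrr.
  have rl : linear (fun v => kmk (rl_in v)).
    move=> c u v; apply: kval_inj; rewrite linearP /= mu_linear sg_lin.
    by rewrite scalerBr opprD addrACA.
  rewrite -[1]mulr1; apply: (@sdual_retract k _ _ kval (mklin rl)); last exact: sdual_ffun.
  move=> w; rewrite scale1r; apply: kval_inj => /=.
  by rewrite kvalP (lin0 sg_lin) subr0.
pose Y := {ffun T * 'I_n -> K}; pose Z := {ffun T * T * 'I_n -> K}.
(* A bilinear map A x J -> K is encoded by a table [c] of values at pairs of generators, so that the
   space [Y] of tables is finitely generated over [k] and Nakayama's lemma applies. A table is not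
   determined by its map [ct c]. *)
pose ct (c : Y) (b : A) (y : X) : K := \sum_t \sum_i ((al t b : k) * f i y) *: c (t, i).
have ct_linc b y : linear (fun c => ct c b y).
  apply: sum_linear => t; apply: sum_linear => i d u v.
  by rewrite !ffunE scalerDr !scalerA mulrC.
have ct_linb c y : linear (fun b => ct c b y).
  apply: sum_linear => t; apply: sum_linear => i d u v.
  by rewrite linearP mulrDl scalerDl scalerA -[d *: _]/(d * _ : k) mulrA.
have ct_liny c b : linear (ct c b).
  apply: sum_linear => t; apply: sum_linear => i d u v.
  by rewrite linearP mulrDr scalerDl scalerA -[d *: _]/(d * _ : k) mulrCA.
have bil (be : A -> X -> K) : (forall y, linear (be^~ y)) -> (forall b, linear (be b)) ->
    forall b y, ct [ffun u => be (a u.1) (x u.2)] b y = be b y.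
  move=> lb ly b y; rewrite /ct.
  have := linear_expand (mklin (lb y)) Hal b; rewrite scale1r /= => ->.
  apply: eq_bigr => t _; have := linear_expand (mklin (ly (a t))) Hf1 y.
  rewrite scale1r /= => ->; rewrite scaler_sumr; apply: eq_bigr => i _.
  by rewrite scalerA ffunE.
pose coc c b b' y := kact b (ct c b' y) - ct c (b * b') y + ct c b (jact b' y).
pose d (c : Y) : Z := [ffun u => coc c (a u.1.1) (a u.1.2) (x u.2)].
have coc_lin b b' y : linear (fun c => coc c b b' y).
  move=> e u v; rewrite /coc !ct_linc kact_linr.
  by rewrite !scalerDr scalerN; abel.
have d_lin : linear d.
  by move=> e u v; apply/ffunP => z; rewrite !ffunE; apply: coc_lin.
pose D (c : Y) := exists2 h : {linear X -> K}, True &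
  forall b y, ct c b y = kact b (h y) - h (jact b y).
have DP : smod D.
  have zl : linear (fun _ : X => 0 : K) by move=> e u v; rewrite scaler0 addr0.
  split.
  - exists (mklin zl) => // b y /=.
    by rewrite (lin0 (ct_linc b y)) (lin0 (kact_linr b)) subr0.
  - move=> c c' [h _ Hh] [h' _ Hh'].
    have hl : linear (fun y => h y + h' y).
      by move=> e u v; rewrite !linearP scalerDr addrACA.
    exists (mklin hl) => // b y /=; rewrite (linD (ct_linc b y)) /= Hh Hh'.
    by rewrite (linD (kact_linr b)) /= opprD addrACA.
  move=> e c [h _ Hh]; exists (mklin (scale_linear e h)) => // b y /=.
  rewrite (linZ (ct_linc b y)) Hh.
  by rewrite (linZ (kact_linr b)) scalerBr.
have dD c : D c -> d c = 0.
  move=> [h _ Hh]; apply/ffunP => u; rewrite !ffunE /coc !Hh.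
  rewrite (linB (kact_linr _)) /= kactA jactA.
  abel.
have Z1 : sdual Z 1 by apply: sdual_ffun.
have [ly Hly] : exists ly : seq Y, forall y, spn ly (1 *: y) by apply/sdual_span/sdual_ffun.
have [|s sp [I [w [g Hg]]]] := @local_split k p Y Z D (mklin d_lin) ly 1 DP dD (spec1 p)
  (fun y => addspan_spn DP (Hly y)) (sdual_detects (spec1 p) Z1).
  move=> c Hc.
  pose L (w : K) := loc_in p (fun w => w \in @mulspan k (spec_ideal p) K) w.
  have LP : smod L by apply/smod_loc_in/smod_mem.
  have coc_lin1 b' y : linear (fun b => coc c b b' y).
    move=> e u v; rewrite /coc kact_linl mulrDl -pzscaleAl !ct_linb.
    by rewrite !scalerDr scalerN; abel.
  have coc_lin2 b y : linear (fun b' => coc c b b' y).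
    move=> e u v; rewrite /coc ct_linb kact_linr mulrDr -pzscaleAr ct_linb jact_linl ct_liny.
    by rewrite !scalerDr scalerN; abel.
  have coc_lin3 b b' : linear (coc c b b').
    move=> e u v; rewrite /coc ct_liny kact_linr ct_liny jact_linr ct_liny.
    by rewrite !scalerDr scalerN; abel.
  have cocL b b' y : L (coc c b b' y).
    have := linear_expand (mklin (coc_lin1 b' y)) Hal b; rewrite scale1r /= => ->.
    apply: (smod_sum LP) => t _; apply: (smodZ LP).
    have := linear_expand (mklin (coc_lin2 (a t) y)) Hal b'; rewrite scale1r /= => ->.
    apply: (smod_sum LP) => t' _; apply: (smodZ LP).
    have := linear_expand (mklin (coc_lin3 (a t) (a t'))) Hf1 y; rewrite scale1r /= => ->.
    apply: (smod_sum LP) => i _; apply: (smodZ LP).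
    by have := loc_in_ffun_coord (t, t', i) Hc; rewrite /= ffunE.
  have lin_L (g : {linear X -> K}) w : jfib p w = 0 -> L (g w).
    move/jfib0 => [s sp Hs]; exists s => //.
    by rewrite -(linearZ_LR g); apply: mulspan_lin.
  have [I [ye [ge Hge]]] := Jp1.
  have [s1 s1p [ga Hga]] := jfib_fracs (fun ei : I * 'I_n => emap (ge ei.1) (jfib p (x ei.2))).
  have [s2 s2p [z Hz]] := jfib_fracs ye.
  have jS := @jfib_semilin _ _ J p.
  have G_lin e : linear (fun y => \sum_i (f i y : k) *: ga (e, i)).
    by apply: sum_linear => i; apply: scalel_linear.
  pose G e := mklin (G_lin e).
  have GE e y : jfib p (G e y) = fhom p s1 *: emap (ge e) (jfib p y).
    rewrite [y in RHS]Hf [LHS](semilin_sum jS) (semilin_sum jS) !linear_sum; apply: eq_bigr => i _.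
    rewrite !(semilinZ jS) linearZ_LR -Hga /=.
    by rewrite !scalerA mulrC.
  pose W (e : I) (y : X) := ct c (jval (G e y)) (z e).
  have W_lin e : linear (W e).
    by move=> r u v; rewrite /W linearP linearP ct_linb.
  have h_lin : linear (fun y => - \sum_e W e y).
    move=> r u v; rewrite (sum_linear (index_enum I) xpredT W_lin) opprD scalerN.
    by [].
  pose h := mklin h_lin.
  have key b y : L ((s1 * s2) *: ct c b y - (kact b (h y) - h (jact b y))).
    pose Q e := kact b (W e y); pose Pe e := ct c b (jact (jval (G e y)) (z e)).
    have -> : (s1 * s2) *: ct c b y - (kact b (h y) - h (jact b y)) =
       ct c b ((s1 * s2) *: y - \sum_e jact (jval (G e y)) (z e)) +
       \sum_e (coc c b (jval (G e y)) (z e) -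
         ct c (jval (G e (jact b y) - jact b (G e y))) (z e)).
      have -> : kact b (h y) = - \sum_e Q e.
        rewrite /= [LHS](linN (kact_linr b)) /=; congr (- _).
        by rewrite [LHS](linsum (kact_linr b)).
      have -> : h (jact b y) = - \sum_e W e (jact b y) by [].
      have -> : ct c b ((s1 * s2) *: y - \sum_e jact (jval (G e y)) (z e)) =
          (s1 * s2) *: ct c b y - \sum_e Pe e.
        rewrite [LHS](linB (ct_liny c b)) /= (linZ (ct_liny c b)).
        by congr (_ - _); rewrite [LHS](linsum (ct_liny c b)).
      have -> : \sum_e (coc c b (jval (G e y)) (z e) -
         ct c (jval (G e (jact b y) - jact b (G e y))) (z e)) =
         \sum_e Q e + \sum_e Pe e - \sum_e W e (jact b y).
        transitivity (\sum_e (Q e + Pe e - W e (jact b y))); last by rewrite sumrB big_split.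
        apply: eq_bigr => e _; rewrite /coc linearB.
        rewrite [X in _ - X](linB (ct_linb c (z e))) /Q /Pe /W.
        have -> : jval (jact b (G e y)) = b * jval (G e y) by [].
        abel.
      rewrite opprB opprK [\sum_e Q e + _]addrC -!addrA; congr (_ + _).
      by rewrite addrA addNr add0r addrC.
    apply: (smodD LP).
      apply: (lin_L (mklin (ct_liny c b))).
      rewrite (semilinB jS) (semilinZ jS) (semilin_sum jS) -[jfib p y]scale1r Hge.
      rewrite scaler_sumr -sumrB big1 // => e _; rewrite jfib_act -jfibE GE -Hz.
      apply: jval_inj; rewrite linear0 linearB linearZ_LR !jactE !linearZ_LR.
      rewrite -pzscaleAl -pzscaleAr scalerA -rmorphM; exact: subrr.
    apply: (smod_sum LP) => e _; apply: (smodB LP); first exact: cocL.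
    have Lg : linear (fun w : X => ct c (jval w) (z e)).
      by move=> r u v; rewrite linearP ct_linb.
    apply: (lin_L (mklin Lg)); rewrite (semilinB jS) jfib_act !GE jfib_act emapA.
    by rewrite (linZ (jact_linr _)) subrr.
  pose be b y := kact b (h y) - h (jact b y).
  pose c1 : Y := [ffun u => be (a u.1) (x u.2)].
  pose c2 : Y := [ffun u => ct c (a u.1) (x u.2)].
  have c1E b y : ct c1 b y = be b y.
    apply: bil => {b}{}y e u v; rewrite /be.
      by rewrite kact_linl jact_linl linearP scalerBr opprD addrACA.
    by rewrite linearP kact_linr jact_linr linearP scalerBr opprD addrACA.
  have c2E b y : ct c2 b y = ct c b y by apply: bil.
  apply: (@loc_inZ _ _ _ _ (s1 * s2)); first exact: specM.
  set E := (fun z => exists2 w, _ & _).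
  have EP : smod (loc_in p E) by apply/smod_loc_in/smod_add => //; exact: smod_mem.
  have DE v : D v -> loc_in p E v.
    by move=> Dv; apply: loc_in_sub; exists 0; rewrite ?subr0 // rpred0.
  (* Three summands: [c] and [c2] are tables of one map, so their difference is the coboundary of 0;
     s1 s2 [c2] - [c1] vanishes modulo p by [key]; [c1] is the coboundary of [h]. *)
  rewrite -[_ *: c](subrK ((s1 * s2) *: c2)) -[X in _ + X](subrK c1) addrA.
  apply: (smodD EP); first apply: (smodD EP).
  - rewrite -scalerBr; apply: (smodZ EP); apply: DE.
    have zl : linear (fun _ : X => 0 : K) by move=> e u v; rewrite scaler0 addr0.
    exists (mklin zl) => // b y /=.
    rewrite (linB (ct_linc b y)) /= c2E.
    by rewrite (lin0 (kact_linr b)) !subrr.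
  - have [t|s sp Hs] := @loc_in_ffun k _ p K ((s1 * s2) *: c2 - c1).
      by rewrite !ffunE; apply: key.
    by exists s => //; exists (s *: ((s1 * s2) *: c2 - c1)); rewrite ?subrr //; apply: (smod0 DP).
  by apply: DE; exists h.
(* The failure of the [k]-linear section [sg] to be A-linear: a cocycle, hence a coboundary after
   multiplication by [s]. Correcting s [sg] accordingly yields the A-linear map [S]. *)
pose be b y := sg (jact b y) - aact b (sg y).
have be_in b y : mu (be b y) = 0.
  by rewrite (linB mu_linear) /= mu_act !mu_sg subrr.
pose bk b y := kmk (be_in b y).
have bk_linb y : linear (bk^~ y).
  move=> e u v; apply: kval_inj; rewrite linearP /= /be jact_linl sg_lin aact_linl.
  by rewrite scalerBr opprD addrACA.
have bk_liny b : linear (bk b).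
  move=> e u v; apply: kval_inj; rewrite linearP /= /be jact_linr !sg_lin aact_linr.
  by rewrite scalerBr opprD addrACA.
pose c0 : Y := [ffun u => bk (a u.1) (x u.2)].
have c0E b y : ct c0 b y = bk b y by apply: bil.
have dc0 : d c0 = 0.
  apply/ffunP => u; rewrite !ffunE /coc !c0E; apply: kval_inj => /=.
  rewrite /be (linB (aact_linr _)) aactA jactA.
  abel.
have [h _ Hh] : D (s *: c0).
  have := Hg c0; rewrite /= dc0 big1 ?subr0 // => i _.
  by rewrite linear0 scale0r.
pose S y := s *: sg y + kval (h y).
have SL : linear S.
  move=> e u v; rewrite /S sg_lin (linearP h) (linearP kval) !scalerDr !scalerA.
  by rewrite [s * e]mulrC; abel.
have S_lin i : linear (fun y => S y i) by move=> e u v; rewrite SL !ffunE.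
exists s => //; apply: (@adual_functionals _ _ _ _ _ (fun i => x i) (fun i => mklin (S_lin i)) JJ).
  move=> i b y /=; have := Hh b y.
  rewrite (linZ (ct_linc b y)) c0E => /(congr1 kval).
  rewrite (linearZ_LR kval) (linearB kval) -[kval (bk b y)]/(be b y).
  rewrite -[kval (kact _ _)]/(aact b (kval (h y))) /be scalerBr => E.
  suff -> : S (jact b y) = aact b (S y) by rewrite ffunE.
  rewrite /S (linD (aact_linr b)) (linZ (aact_linr b)); apply/eqP; rewrite -subr_eq0.
  move/eqP: E; rewrite -subr_eq0 => /eqP E; apply/eqP; rewrite -[RHS]E; abel.
move=> y; rewrite -[y in LHS]mu_sg -(linZ mu_linear) /=.
transitivity (mu (S y)); last by [].
by rewrite /S (linD mu_linear) /= kvalP addr0.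
Qed.
End Projectivity.
End LocalLifting.

(** * Separability and its lifting from a fibre *)

Section TensorTheory.
Variables (k : comPzRingType) (M N : lmodType k).
Local Notation T := (tensor M N).

Definition tens (x : M) (y : N) : T := tclass [:: (x, y)].

Lemma tclass_cat s t : tclass (s ++ t) = tclass s + tclass t :> T.
Proof. exact/esym/tensor_addE. Qed.
Lemma tclassE (s : seq (M * N)) : tclass s = \sum_(u <- s) tens u.1 u.2.
Proof.
elim: s => [|[x y] s IHs]; first by rewrite big_nil.
by rewrite big_cons -IHs -cat1s tclass_cat.
Qed.
Lemma tens_sum (t : T) : exists s : seq (M * N), t = \sum_(u <- s) tens u.1 u.2.
Proof. by elim/tclass_ind: t => s; exists s; rewrite tclassE. Qed.
Lemma tens_linl y : linear (tens^~ y).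
Proof.
move=> a x z; transitivity (tens (a *: x) y + tens z y).
  by rewrite -tclass_cat; apply/tclassP/TensorDl.
by congr (_ + _); rewrite [RHS]tensor_scaleE.
Qed.
Lemma tens_linr x : linear (tens x).
Proof.
move=> a y z; transitivity (tens x (a *: y) + tens x z).
  by rewrite -tclass_cat; apply/tclassP/TensorDr.
by congr (_ + _); rewrite [RHS]tensor_scaleE; apply/tclassP/TensorSym/TensorZ.
Qed.

Lemma tens_ind (E : T -> Prop) : smod E -> (forall x y, E (tens x y)) -> forall t, E t.
Proof.
by move=> EP Et t; have [s ->] := tens_sum t; apply: (smod_sum EP).
Qed.

Section Lift.
Variables (P : lmodType k) (b : M -> N -> P).
Hypotheses (bl : forall y, linear (b^~ y)) (br : forall x, linear (b x)).

Definition tlift_fun (t : T) : P := \sum_(u <- repr t) b u.1 u.2.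
Lemma tlift_class s : tlift_fun (tclass s) = \sum_(u <- s) b u.1 u.2.
Proof.
rewrite /tlift_fun; move: (repr _) (tclass_repr s) => t; elim=> {s t} //=.
- by move=> s t u _ -> _ ->.
- by move=> s s' t t' _ E1 _ E2; rewrite !big_cat E1 E2.
- by move=> s t; rewrite !big_cat /= addrC.
- by move=> y; rewrite big_seq1 big_nil (lin0 (bl y)).
- by move=> x x' y; rewrite !big_cons !big_nil !addr0 (linD (bl y)).
- by move=> x y y'; rewrite !big_cons !big_nil !addr0 (linD (br x)).
by move=> a x y; rewrite !big_seq1 /= (linZ (bl y)) (linZ (br x)).
Qed.
Lemma tlift_linear : linear tlift_fun.
Proof.
move=> a s t; elim/tclass_ind: s => s; elim/tclass_ind: t => t.
have -> : a *: tclass s + tclass t = tclass ([seq (a *: u.1, u.2) | u <- s] ++ t) :> T.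
  by rewrite tclass_cat; congr (_ + _); apply: tensor_scaleE.
rewrite !tlift_class big_cat big_map /= scaler_sumr; congr (_ + _).
by apply: eq_bigr => u _; rewrite (linZ (bl _)).
Qed.
Definition tlift : {linear T -> P} := mklin tlift_linear.
Lemma tliftE x y : tlift (tens x y) = b x y.
Proof. by rewrite /= tlift_class big_seq1. Qed.
End Lift.
End TensorTheory.

(** Extend in the first variable for each fixed y; uniqueness makes the extension semilinear in y,
    so that it extends once more. *)
Lemma bc_bilin (k k' : comPzRingType) (phi : {rmorphism k -> k'})
  (M N : lmodType k) (M' N' P' : lmodType k') (i : M -> M') (j : N -> N')
  (g : M -> N -> P') : is_bc phi i -> is_bc phi j ->
  (forall y, semilin phi (g^~ y)) -> (forall x, semilin phi (g x)) ->
  exists b : M' -> N' -> P', [/\ forall y, linear (b^~ y), forall x, linear (b x) &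
    forall x y, b (i x) (j y) = g x y].
Proof.
move=> iP jP gl gr.
pose h y : {linear M' -> P'} := bc_lift iP (gl y).
have hE x y : h y (i x) = g x y by apply: bc_liftE.
have hS x : semilin phi (fun y => h y x).
  split=> [y z|a y].
    apply: (bc_ext iP (f := h (y + z)) (g := mklin (_ : linear (fun x => h y x + h z x)))).
      by move=> c u v; rewrite !linearP scalerDr; abel.
    by move=> v u; rewrite /= !hE (gr u).1.
  apply: (bc_ext iP (f := h (a *: y)) (g := mklin (scale_linear (phi a) (h y)))) => u.
  by rewrite /= !hE (gr u).2.
exists (fun x y => bc_lift jP (hS x) y); split=> [y|x|x y].
- move=> a x z; apply: (bc_ext jP (f := bc_lift jP (hS (a *: x + z)))
    (g := mklin (_ : linear (fun y => a *: bc_lift jP (hS x) y + bc_lift jP (hS z) y)))).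
    move=> c u v; rewrite (linearP (bc_lift jP (hS x))) (linearP (bc_lift jP (hS z))).
    by rewrite !scalerDr !scalerA [a * c]mulrC; abel.
  by move=> v u; rewrite /= !bc_liftE linearP.
- by move=> a y z; rewrite linearP.
by rewrite bc_liftE hE.
Qed.

Section Separability.
Variables (k : comPzRingType) (E : pzAlgType k).
Local Notation T := (tensor E E).
Local Notation lact := (@tensor_lact k E).
Local Notation ract := (@tensor_ract k E).
Local Notation mult := (@tensor_mult k E).

Lemma lact_tens e x y : lact e (tens x y) = tens (e * x) y.
Proof. exact: tensor_lactE. Qed.
Lemma ract_tens e x y : ract (tens x y) e = tens x (y * e).
Proof. exact: tensor_ractE. Qed.
Lemma mult_tens x y : mult (tens x y) = x * y.
Proof. by rewrite /tens tensor_multE big_seq1. Qed.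

Lemma tclass_scale a (s : seq (E * E)) :
  a *: tclass s = tclass [seq (a *: u.1, u.2) | u <- s] :> T.
Proof. exact: tensor_scaleE. Qed.
Lemma lact_linr e : linear (lact e).
Proof.
move=> a s t; elim/tclass_ind: s => s; elim/tclass_ind: t => t.
rewrite tclass_scale -tclass_cat !tensor_lactE tclass_scale -tclass_cat map_cat -!map_comp.
by congr (tclass (_ ++ _)); apply: eq_map => u /=; rewrite pzscaleAr.
Qed.
Lemma ract_linl e : linear (ract^~ e).
Proof.
move=> a s t; elim/tclass_ind: s => s; elim/tclass_ind: t => t.
by rewrite tclass_scale -tclass_cat !tensor_ractE tclass_scale -tclass_cat map_cat -!map_comp.
Qed.
Lemma mult_linear : linear mult.
Proof.
move=> a s t; elim/tclass_ind: s => s; elim/tclass_ind: t => t.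
rewrite tclass_scale -tclass_cat !tensor_multE big_cat big_map scaler_sumr /=.
by congr (_ + _); apply: eq_bigr => u _; rewrite pzscaleAl.
Qed.
Lemma lact_linl t : linear (lact^~ t).
Proof.
move=> a x y; move: t; apply: tens_ind => [|u v].
  split=> [|s t Hs Ht|c s Hs].
  - by rewrite !(lin0 (lact_linr _)) scaler0 addr0.
  - by rewrite !(linD (lact_linr _)) Hs Ht scalerDr; abel.
  by rewrite !(linZ (lact_linr _)) Hs scalerDr !scalerA mulrC.
by rewrite !lact_tens mulrDl -pzscaleAl tens_linl.
Qed.
Lemma ract_linr t : linear (ract t).
Proof.
move=> a x y; move: t; apply: tens_ind => [|u v].
  split=> [|s t Hs Ht|c s Hs].
  - by rewrite !(lin0 (ract_linl _)) scaler0 addr0.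
  - by rewrite !(linD (ract_linl _)) Hs Ht scalerDr; abel.
  by rewrite !(linZ (ract_linl _)) Hs scalerDr !scalerA mulrC.
by rewrite !ract_tens mulrDr -pzscaleAr tens_linr.
Qed.

Lemma tensor_eq (N : lmodType k) (f g : T -> N) : linear f -> linear g ->
  (forall x y, f (tens x y) = g (tens x y)) -> forall t, f t = g t.
Proof.
move=> fl gl fg; apply: tens_ind => //; split=> [|s t Hs Ht|c s Hs].
- by rewrite (lin0 fl) (lin0 gl).
- by rewrite (linD fl) (linD gl) Hs Ht.
by rewrite (linZ fl) (linZ gl) Hs.
Qed.

Lemma lactM a b t : lact a (lact b t) = lact (a * b) t.
Proof.
apply: (@tensor_eq _ (fun t => lact a (lact b t)) (lact (a * b))); last by move=> x y; rewrite !lact_tens mulrA.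
  by move=> c u v; rewrite !lact_linr.
exact: lact_linr.
Qed.
Lemma ractM a b t : ract (ract t a) b = ract t (a * b).
Proof.
apply: (@tensor_eq _ (fun t => ract (ract t a) b) (ract^~ (a * b))); last by move=> x y; rewrite !ract_tens mulrA.
  by move=> c u v; rewrite !ract_linl.
exact: ract_linl.
Qed.
Lemma lact_ract a b t : lact a (ract t b) = ract (lact a t) b.
Proof.
apply: (@tensor_eq _ (fun t => lact a (ract t b)) (fun t => ract (lact a t) b)); last by move=> x y; rewrite lact_tens !ract_tens lact_tens.
  by move=> c u v; rewrite ract_linl lact_linr.
by move=> c u v; rewrite lact_linr ract_linl.
Qed.
Lemma mult_lact a t : mult (lact a t) = a * mult t.
Proof.
apply: (@tensor_eq _ (fun t => mult (lact a t)) (fun t => a * mult t)); last by move=> x y; rewrite lact_tens !mult_tens mulrA.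
  by move=> c u v; rewrite lact_linr mult_linear.
by move=> c u v; rewrite mult_linear mull_linear.
Qed.
Lemma mult_ract a t : mult (ract t a) = mult t * a.
Proof.
apply: (@tensor_eq _ (fun t => mult (ract t a)) (fun t => mult t * a)); last by move=> x y; rewrite ract_tens !mult_tens mulrA.
  by move=> c u v; rewrite ract_linl mult_linear.
by move=> c u v; rewrite mult_linear mulr_linear_alg.
Qed.
Lemma lact1 t : lact 1 t = t.
Proof.
apply: (@tensor_eq _ (lact 1) (fun t => t)) => //; first exact: lact_linr.
by move=> x y; rewrite lact_tens mul1r.
Qed.

(* Casimir element with multiplication s; s = 1 is separability. *)
Definition csep (s : k) :=
  exists t : T, mult t = s *: (1 : E) /\ forall e, lact e t = ract t e.

Lemma csep_ideal : ideal_like csep.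
Proof.
split.
- exists 0; rewrite (lin0 mult_linear) scale0r; split=> // e.
  by rewrite (lin0 (lact_linr e)) (lin0 (ract_linl e)).
- move=> s s' [t [tm tc]] [t' [t'm t'c]]; exists (t + t').
  rewrite (linD mult_linear) tm t'm scalerDl; split=> // e.
  by rewrite (linD (lact_linr e)) (linD (ract_linl e)) tc t'c.
move=> a s [t [tm tc]]; exists (a *: t).
rewrite (linZ mult_linear) tm scalerA; split=> // e.
by rewrite (linZ (lact_linr e)) (linZ (ract_linl e)) tc.
Qed.

Lemma csep1P : separable_alg E <-> csep 1.
Proof.
split=> [[s [sD sl sr sm]]|[t [tm tc]]].
  exists (s 1); rewrite sm scale1r; split=> // e.
  by rewrite -sl -sr mul1r mulr1.
exists (fun x => lact x t); split=> [x y|e x|x e|x].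
- exact: (linD (lact_linl t)).
- by rewrite lactM.
- by rewrite -lactM tc lact_ract.
by rewrite mult_lact tm scale1r mulr1.
Qed.

(** By the universal property of E (x) E the Casimir identity holds under every bilinear map, which
    allows averaging arguments outside the tensor product. *)
Lemma csep_bilin (s : k) : csep s -> exists u : seq (E * E),
  \sum_(v <- u) v.1 * v.2 = s *: (1 : E) /\
  forall (P : lmodType k) (b : E -> E -> P), (forall y, linear (b^~ y)) ->
    (forall x, linear (b x)) -> forall e,
    \sum_(v <- u) b (e * v.1) v.2 = \sum_(v <- u) b v.1 (v.2 * e).
Proof.
move=> [t [tm tc]]; have [u Hu] := tens_sum t; exists u; split.
  by rewrite -tm Hu (linsum mult_linear); apply: eq_bigr => v _; rewrite mult_tens.
move=> P b bl br e; have := congr1 (tlift bl br) (tc e).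
rewrite Hu (linsum (lact_linr e)) (linsum (ract_linl e)) !linear_sum.
under eq_bigr => v _ do rewrite lact_tens tliftE.
by under [RHS]eq_bigr => v _ do rewrite ract_tens tliftE.
Qed.

Lemma csep_intro (s : k) (u : seq (E * E)) :
  \sum_(v <- u) v.1 * v.2 = s *: (1 : E) ->
  (forall e, \sum_(v <- u) tens (e * v.1) v.2 = \sum_(v <- u) tens v.1 (v.2 * e)) ->
  csep s.
Proof.
move=> um uc; exists (\sum_(v <- u) tens v.1 v.2); split.
  by rewrite (linsum mult_linear) -um; apply: eq_bigr => v _; rewrite mult_tens.
move=> e; rewrite (linsum (lact_linr e)) (linsum (ract_linl e)).
under eq_bigr => v _ do rewrite lact_tens.
by under [RHS]eq_bigr => v _ do rewrite ract_tens.
Qed.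
End Separability.

Lemma bc_csep (k k' : comPzRingType) (phi : {rmorphism k -> k'})
  (E : pzAlgType k) (E' : pzAlgType k') (i : E -> E') (s : k) (c : k') :
  is_bc phi i -> (forall x y, i (x * y) = i x * i y) -> i 1 = 1 ->
  c * phi s = 1 -> csep E s -> csep E' 1.
Proof.
move=> iP iM i1 cs /csep_bilin[u [um uc]]; have iS := bc_semilin iP.
pose u' := [seq (c *: i v.1, i v.2) | v <- u].
apply: (@csep_intro _ _ _ u').
  rewrite big_map /=; under eq_bigr => v _ do rewrite -pzscaleAl -iM.
  by rewrite -scaler_sumr -(semilin_sum iS) um (semilinZ iS) i1 scalerA cs.
(* The tensor product over k' is regarded as a [k]-module, where the Casimir identity over [k] may
   be applied. *)
pose P := restr phi (tensor E' E').
have H e : \sum_(v <- u) tens (i (e * v.1)) (i v.2) = \sum_(v <- u) tens (i v.1) (i (v.2 * e)).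
  apply: (uc P (fun x y => tens (i x) (i y))) => [y|x] a z w.
    by rewrite iS.1 iS.2 tens_linl.
  by rewrite iS.1 iS.2 tens_linr.
rewrite /u'; apply: (bc_ind iP) => [|e]; last first.
  rewrite !big_map /=; under eq_bigr => v _ do rewrite -pzscaleAr -iM (linZ (tens_linl _)).
  under [RHS]eq_bigr => v _ do rewrite -iM (linZ (tens_linl _)).
  by rewrite -!scaler_sumr H.
split=> [|x y Hx Hy|a x Hx].
- rewrite !big1 // => v _; first by rewrite mulr0 (lin0 (tens_linr _)).
  by rewrite mul0r (lin0 (tens_linl _)).
- under eq_bigr => v _ do rewrite mulrDl (linD (tens_linl _)).
  under [RHS]eq_bigr => v _ do rewrite mulrDr (linD (tens_linr _)).
  by rewrite !big_split Hx Hy.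
under eq_bigr => v _ do rewrite -pzscaleAl (linZ (tens_linl _)).
under [RHS]eq_bigr => v _ do rewrite -pzscaleAr (linZ (tens_linr _)).
by rewrite -!scaler_sumr Hx.
Qed.

Section LocalSeparability.
Variables (k : comPzRingType) (E : pzAlgType k) (p : spec k) (s0 : k).
Hypotheses (s0p : s0 \notin spec_ideal p) (E0 : sdual E s0).
Variables (E' : pzAlgType (resfield p)) (i : E -> E').
Hypotheses (iP : is_bc (fhom p) i) (iM : forall x y, i (x * y) = i x * i y) (i1 : i 1 = 1).
Hypothesis E'sep : csep E' 1.
Local Notation T := (tensor E E).
Local Notation lact := (@tensor_lact k E).
Local Notation ract := (@tensor_ract k E).
Local Notation multL := (mklin (@mult_linear k E)).
Local Notation K := (submod (mksub (smod_ker multL))).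
Let kval : {linear K -> T} := @submod_val k T (mksub (smod_ker multL)).
Let kval_inj : injective kval. Proof. exact: val_inj. Qed.
Let kvalP w : tensor_mult (kval w) = 0.
Proof. by case: w => v vK; apply/(mksubE (smod_ker multL)). Qed.
Let kmk v (Hv : tensor_mult v = 0) : K :=
  Submod (let: conj _ h := mksubE (smod_ker multL) v in h Hv).
Let kl_in a w : tensor_mult (lact a (kval w)) = 0.
Proof. by rewrite mult_lact kvalP mulr0. Qed.
Let kr_in w a : tensor_mult (ract (kval w) a) = 0.
Proof. by rewrite mult_ract kvalP mul0r. Qed.
Let kl a w : K := kmk (kl_in a w).
Let kr w a : K := kmk (kr_in w a).
Let kl_linr a : linear (kl a).
Proof.
move=> c u v; apply: kval_inj; rewrite (linearP kval).
transitivity (lact a (kval (c *: u + v))); first by [].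
by rewrite (linearP kval) lact_linr.
Qed.
Let kl_linl w : linear (kl^~ w).
Proof. by move=> c a b; apply: kval_inj; rewrite (linearP kval); apply: lact_linl. Qed.
Let kr_linl a : linear (kr^~ a).
Proof.
move=> c u v; apply: kval_inj; rewrite (linearP kval).
transitivity (ract (kval (c *: u + v)) a); first by [].
by rewrite (linearP kval) ract_linl.
Qed.
Let kr_linr w : linear (kr w).
Proof. by move=> c a b; apply: kval_inj; rewrite (linearP kval); apply: ract_linr. Qed.
Let klM a b w : kl a (kl b w) = kl (a * b) w.
Proof. by apply: kval_inj; apply: lactM. Qed.
Let krM a b w : kr (kr w a) b = kr w (a * b).
Proof. by apply: kval_inj; apply: ractM. Qed.
Let kl_kr a b w : kl a (kr w b) = kr (kl a w) b.
Proof. by apply: kval_inj; apply: lact_ract. Qed.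

Let K0 : sdual K (s0 * s0).
Proof.
have r_in (v : T) : tensor_mult (v - tens (tensor_mult v) (1 : E)) = 0.
  by rewrite (linB (@mult_linear k E)) mult_tens mulr1 subrr.
have rl : linear (fun v => kmk (r_in v)).
  move=> c u v; apply: kval_inj; rewrite (linearP kval).
  transitivity (c *: u + v - tens (tensor_mult (c *: u + v)) (1 : E)); first by [].
  rewrite mult_linear tens_linl -[kval (kmk _)]/(u - _) -[kval (kmk _)]/(v - _).
  by rewrite scalerBr; abel.
rewrite -[s0 * s0]mulr1; apply: (@sdual_retract k _ _ kval (mklin rl)).
  move=> w; rewrite scale1r; apply: kval_inj.
  transitivity (kval w - tens (tensor_mult (kval w)) (1 : E)); first by [].
  by rewrite kvalP (lin0 (tens_linl (1 : E))) subr0.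
have [I [x [f Hf]]] := E0.
have ffl (j : I * I) b : linear (fun a => (f j.1 a : k) * f j.2 b : k^o).
  by move=> c u v; rewrite linearP mulrDl -[c *: f _ u]/(c * f _ u : k) -mulrA.
have ffr (j : I * I) a : linear (fun b => (f j.1 a : k) * f j.2 b : k^o).
  by move=> c u v; rewrite linearP mulrDr -[c *: f _ u]/(c * f _ u : k) mulrCA.
exists (I * I)%type, (fun j => tens (x j.1) (x j.2)), (fun j => tlift (ffl j) (ffr j)).
apply: (@tensor_eq _ _ _ (fun y => (s0 * s0) *: y)
  (fun y => \sum_j (tlift (ffl j) (ffr j) y : k) *: tens (x j.1) (x j.2))).
- by move=> c u v; rewrite scalerDr !scalerA mulrC.
- by apply: sum_linear => j; apply: scalel_linear.
move=> a b; rewrite -scalerA -(linZ (tens_linl b)) -(linZ (tens_linr _)) !Hf.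
rewrite (linsum (tens_linl _)) -(pair_bigA _ (fun j1 j2 => (tlift (ffl (j1, j2)) (ffr (j1, j2))
   (tens a b) : k) *: tens (x j1) (x j2))) /=.
apply: eq_bigr => j _; rewrite (linZ (tens_linl _)) (linsum (tens_linr _)) scaler_sumr.
apply: eq_bigr => j' _; rewrite (linZ (tens_linr _)) scalerA.
by rewrite -[tlift_fun _ _]/(tlift (ffl (j, j')) (ffr (j, j')) (tens a b)) tliftE.
Qed.

(* A derivation c into K = ker(E (x) E -> E) becomes inner modulo p:
   if sum u (x) v is a separability idempotent then w = sum u c(v) satisfies
   e w - w e = c(e). *)
Lemma local_csep : exists2 s : k, s \notin spec_ideal p & csep E s.
Proof.
have [I [x [f Hf]]] := E0.
pose Y := {ffun I -> K}; pose Z := {ffun I * I -> K}.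
pose ct (c : Y) (e : E) : K := \sum_j (f j e : k) *: c j.
have ct_linc e : linear (ct^~ e).
  apply: sum_linear => j d u v.
  by rewrite !ffunE scalerDr !scalerA mulrC.
have ct_line c : linear (ct c) by apply: sum_linear => j; apply: scalel_linear.
have expand (be : E -> K) : linear be -> forall e, ct [ffun j => be (x j)] e = s0 *: be e.
  move=> bl e; rewrite -[s0 *: _]/(s0 *: mklin bl e) (linear_expand (mklin bl) Hf).
  by apply: eq_bigr => j _; rewrite ffunE.
pose coc c a b := kl a (ct c b) - ct c (a * b) + kr (ct c a) b.
pose d (c : Y) : Z := [ffun u => coc c (x u.1) (x u.2)].
have coc_lin a b : linear (fun c => coc c a b).
  by move=> e u v; rewrite /coc !ct_linc kl_linr kr_linl !scalerDr scalerN; abel.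
have d_lin : linear d.
  by move=> e u v; apply/ffunP => z; rewrite !ffunE; apply: coc_lin.
pose D (c : Y) := exists w : K, forall e, ct c e = kl e w - kr w e.
have DP : smod D.
  split.
  - exists 0 => e; rewrite (lin0 (ct_linc e)) (lin0 (kl_linr e)) (lin0 (kr_linl e)); abel.
  - move=> c c' [w Hw] [w' Hw']; exists (w + w') => e.
    by rewrite (linD (ct_linc e)) Hw Hw' (linD (kl_linr e)) (linD (kr_linl e)); abel.
  move=> a c [w Hw]; exists (a *: w) => e.
  by rewrite (linZ (ct_linc e)) Hw (linZ (kl_linr e)) (linZ (kr_linl e)) scalerBr.
have dD c : D c -> d c = 0.
  move=> [w Hw]; apply/ffunP => u; rewrite !ffunE /coc !Hw.
  rewrite (linB (kl_linr _)) (linB (kr_linl _)) klM krM kl_kr; abel.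
have s00p : s0 * s0 \notin spec_ideal p by apply: specM.
have Z1 : sdual Z (s0 * s0) by exact: (sdual_ffun _ K0).
have [ly Hly] : exists ly : seq Y, forall y, spn ly ((s0 * s0) *: y) by exact: (sdual_span (sdual_ffun _ K0)).
have [|s sp [I' [w [g Hg]]]] := @local_split k p Y Z D (mklin d_lin) ly (s0 * s0) DP dD s00p
  (fun y => addspan_spn DP (Hly y)) (sdual_detects s00p Z1).
  move=> c Hc.
  pose L (w : K) := loc_in p (fun w => w \in @mulspan k (spec_ideal p) K) w.
  have LP : smod L by apply/smod_loc_in/smod_mem.
  have coc_lin1 b : linear (fun a => coc c a b).
    move=> e u v; rewrite /coc kl_linl mulrDl -pzscaleAl !ct_line kr_linl.
    by rewrite !scalerDr scalerN; abel.
  have coc_lin2 a : linear (coc c a).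
    move=> e u v; rewrite /coc ct_line kl_linr mulrDr -pzscaleAr ct_line kr_linr.
    by rewrite !scalerDr scalerN; abel.
  have cocL a b : L (coc c a b).
    apply: (@loc_inZ _ _ _ _ s0) => //.
    rewrite [X in loc_in p _ X](linear_expand (mklin (coc_lin1 b)) Hf).
    apply: (smod_sum LP) => t _; apply: (smodZ LP).
    apply: (@loc_inZ _ _ _ _ s0) => //.
    rewrite [X in loc_in p _ X](linear_expand (mklin (coc_lin2 (x t))) Hf).
    apply: (smod_sum LP) => t' _; apply: (smodZ LP).
    by have := loc_in_ffun_coord (t, t') Hc; rewrite /= ffunE.
  have [u [um uc]] := csep_bilin E'sep.
  have [s1 s1p [U HU]] := bc_fib_fracs iP (fun l : 'I_(size u) => (tnth (in_tuple u) l).1).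
  have [s2 s2p [V HV]] := bc_fib_fracs iP (fun l : 'I_(size u) => (tnth (in_tuple u) l).2).
  have iS := bc_semilin iP; have fS := bc_semilin (bc_fib p K).
  rewrite big_tnth in um.
  pose om := \sum_l kl (U l) (ct c (V l)).
  have key e : L ((s1 * s2) *: ct c e - (kl e om - kr om e)).
    have [||be [bel ber beE]] := bc_bilin (g := fun a b => fib p (kl a (ct c b))) iP iP.
    - by move=> b; apply: (semilin_comp_lin (mklin (kl_linl (ct c b))) fS).
    - have gl a : linear (fun b => kl a (ct c b)) by move=> r u' v; rewrite ct_line kl_linr.
      by move=> a; apply: (semilin_comp_lin (mklin (gl a)) fS).
    have fibL w : fib p w = 0 -> L w by move/fib_eq0.
    have HLR : L (\sum_l kl (e * U l) (ct c (V l)) - \sum_l kl (U l) (ct c (V l * e))).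
      apply: fibL; rewrite (semilinB fS) !(semilin_sum fS).
      under eq_bigr => l _ do rewrite -beE iM -HU -HV -pzscaleAr (linZ (bel _)) (linZ (ber _)).
      under [X in _ - X]eq_bigr => l _ do rewrite -beE iM -HU -HV -pzscaleAl (linZ (bel _)) (linZ (ber _)).
      rewrite -!scaler_sumr -scalerBr -scalerBr.
      have HH := uc _ be bel ber (i e); rewrite !(big_tnth _ _ u) in HH.
      set S1 := \sum_l _; set S2 := \sum_l _.
      have -> : S1 = S2 by exact: HH.
      by rewrite subrr !scaler0.
    have omE : kl e om = \sum_l kl (e * U l) (ct c (V l)).
      by rewrite /om (linsum (kl_linr e)); apply: eq_bigr => l _; rewrite klM.
    have omE2 : kr om e = \sum_l kl (U l) (kr (ct c (V l)) e).
      by rewrite /om (linsum (kr_linl e)); apply: eq_bigr => l _; rewrite kl_kr.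
    have cV : \sum_l kl (U l) (coc c (V l) e) = \sum_l kl (U l * V l) (ct c e) -
        \sum_l kl (U l) (ct c (V l * e)) + kr om e.
      rewrite omE2 -sumrB -big_split; apply: eq_bigr => l _.
      by rewrite /coc (linD (kl_linr _)) (linB (kl_linr _)) klM.
    have UVct : L ((s1 * s2) *: ct c e - \sum_l kl (U l * V l) (ct c e)).
      have Lw : linear (fun a => kl a (ct c e)) by exact: kl_linl.
      have /(bc_fib_eq0 iP)[r rp Hr] : i ((s1 * s2) *: (1 : E) - \sum_l U l * V l) = 0.
        rewrite (semilinB iS) (semilinZ iS) (semilin_sum iS) i1.
        under eq_bigr => l _ do rewrite iM -HU -HV -pzscaleAl -pzscaleAr scalerA -rmorphM.
        by rewrite -scaler_sumr um scale1r subrr.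
      have := mulspan_lin (mklin Lw) Hr; rewrite (linearZ_LR (mklin Lw)) linearB linearZ_LR linear_sum => Hw.
      have k1 : mklin Lw 1 = ct c e by apply: kval_inj; apply: lact1.
      by rewrite k1 in Hw; exists r.
    (* Three terms that vanish modulo p, by the relation sum u v = 1 up to denominators, by the
       cocycle condition for [c], and by the Casimir identity moving [e] from [u] to [v]. *)
    have -> : (s1 * s2) *: ct c e - (kl e om - kr om e) =
      ((s1 * s2) *: ct c e - \sum_l kl (U l * V l) (ct c e)) +
      \sum_l kl (U l) (coc c (V l) e) -
      (\sum_l kl (e * U l) (ct c (V l)) - \sum_l kl (U l) (ct c (V l * e))).
      by rewrite cV omE; abel.
    apply: (smodB LP) => //; apply: (smodD LP) => //; apply: (smod_sum LP) => l _.
    have [r rp Hr] := cocL (V l) e; exists r => //.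
    by rewrite -(linZ (kl_linr (U l))); apply: (mulspan_lin (mklin (kl_linr (U l)))).
  pose c1 : Y := [ffun j => kl (x j) om - kr om (x j)].
  pose c2 : Y := [ffun j => ct c (x j)].
  have c1E e : ct c1 e = s0 *: (kl e om - kr om e).
    apply: (expand (fun e => kl e om - kr om e)) => a u' v.
    by rewrite kl_linl kr_linr scalerBr; abel.
  have c2E e : ct c2 e = s0 *: ct c e by apply: expand.
  apply: (@loc_inZ _ _ _ _ (s1 * s2 * s0)); first by apply: specM => //; apply: specM.
  set F := (fun z => exists2 w, _ & _).
  have FP : smod (loc_in p F) by apply/smod_loc_in/smod_add => //; exact: smod_mem.
  have DF v : D v -> loc_in p F v.
    by move=> Dv; apply: loc_in_sub; exists 0; rewrite ?subr0 // rpred0.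
  rewrite -[_ *: c](subrK ((s1 * s2) *: c2)) -[X in _ + X](subrK c1) addrA.
  apply: (smodD FP); first apply: (smodD FP).
  - have -> : (s1 * s2 * s0) *: c - (s1 * s2) *: c2 = (s1 * s2) *: (s0 *: c - c2).
      by rewrite scalerBr scalerA.
    apply: (smodZ FP); apply: DF.
    exists 0 => e; rewrite (linB (ct_linc e)) (linZ (ct_linc e)) c2E.
    by rewrite (lin0 (kl_linr e)) (lin0 (kr_linl e)) !subrr.
  - have [t|s sp Hs] := @loc_in_ffun k _ p K ((s1 * s2) *: c2 - c1).
      by rewrite !ffunE; apply: key.
    by exists s => //; exists (s *: ((s1 * s2) *: c2 - c1)); rewrite ?subrr //; apply: (smod0 DP).
  by apply: DF; exists (s0 *: om) => e; rewrite c1E (linZ (kl_linr e)) (linZ (kr_linl e)) scalerBr.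
have be_in e : tensor_mult (tens e (1 : E) - tens (1 : E) e : T) = 0.
  by rewrite (linB (@mult_linear k E)) !mult_tens mulr1 mul1r subrr.
(* The universal derivation e (x) 1 - 1 (x) e. If a multiple of it is inner, given by [om], then the
   same multiple of 1 (x) 1 minus [om] is a Casimir element. *)
pose bk e := kmk (be_in e).
have bk_lin : linear bk.
  move=> a u v; apply: kval_inj; rewrite (linearP kval).
  transitivity (tens (a *: u + v) (1 : E) - tens (1 : E) (a *: u + v) : T); first by [].
  rewrite tens_linl tens_linr -[kval (bk u)]/(tens u (1 : E) - tens (1 : E) u) -[kval (bk v)]/(tens v (1 : E) - tens (1 : E) v).
  by rewrite scalerBr; abel.
pose c0 : Y := [ffun j => bk (x j)].
have c0E e : ct c0 e = s0 *: bk e by apply: expand.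
have dc0 : d c0 = 0.
  apply/ffunP => u; rewrite !ffunE /coc !c0E (linZ (kl_linr _)) (linZ (kr_linl _)).
  rewrite -scalerBr -scalerDr; apply: kval_inj; rewrite (linearZ_LR kval) (linear0 kval).
  transitivity (s0 *: (lact (x u.1) (tens (x u.2) (1 : E) - tens (1 : E) (x u.2)) -
     (tens (x u.1 * x u.2) (1 : E) - tens (1 : E) (x u.1 * x u.2)) +
     ract (tens (x u.1) (1 : E) - tens (1 : E) (x u.1)) (x u.2))); first by [].
  rewrite (linB (lact_linr _)) (linB (ract_linl _)) !lact_tens !ract_tens !mul1r !mulr1.
  by rewrite -[RHS](scaler0 _ s0); congr (_ *: _); abel.
have [om Hom] : D (s *: c0).
  have := Hg c0; rewrite /= dc0 big1 ?subr0 // => j _.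
  by rewrite linear0 scale0r.
exists (s * s0); first exact: specM.
exists ((s * s0) *: tens (1 : E) (1 : E) - kval om); split.
  by rewrite (linB (@mult_linear k E)) (linZ (@mult_linear k E)) mult_tens kvalP subr0 mulr1.
move=> e; have /(congr1 kval) := Hom e.
rewrite (linZ (ct_linc e)) c0E scalerA (linearZ_LR kval) (linearB kval).
rewrite -[kval (bk e)]/(tens e (1 : E) - tens (1 : E) e) -[kval (kl _ _)]/(lact e (kval om)).
rewrite -[kval (kr _ _)]/(ract (kval om) e) scalerBr => /eqP; rewrite -subr_eq0 => /eqP H.
rewrite (linB (lact_linr _)) (linB (ract_linl _)) (linZ (lact_linr _)) (linZ (ract_linl _)).
rewrite lact_tens ract_tens mulr1 mul1r; apply/eqP; rewrite -subr_eq0; apply/eqP.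
by rewrite -[RHS]H; abel.
Qed.
End LocalSeparability.

Lemma bc_sdual (k k' : comPzRingType) (phi : {rmorphism k -> k'})
  (M : lmodType k) (M' : lmodType k') (i : M -> M') (s : k) (c : k') :
  is_bc phi i -> c * phi s = 1 -> sdual M s -> sdual M' 1.
Proof.
move=> iP cs [I [x [f Hf]]]; have iS := bc_semilin iP.
exists I, (fun j => i (x j)), (fun j => mklin (mulr_linear c (bc_fun iP (f j)))).
apply: (bc_ind iP) => [|y].
  have L1 : linear (fun y : M' => \sum_j (mklin (mulr_linear c (bc_fun iP (f j))) y : k') *: i (x j)).
    by apply: sum_linear => j; apply: scalel_linear.
  split=> [|y z Hy Hz|a y Hy].
  - by rewrite scaler0 (lin0 L1).
  - by rewrite scalerDr (linD L1) Hy Hz.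
  by rewrite (linZ L1) -Hy !scale1r.
rewrite scale1r; transitivity (c *: i (s *: y)).
  by rewrite (semilinZ iS) scalerA cs scale1r.
rewrite Hf (semilin_sum iS) scaler_sumr; apply: eq_bigr => j _.
by rewrite (semilinZ iS) scalerA /= bc_funE.
Qed.

Lemma sum_smod (k k' : comPzRingType) (M : lmodType k) (M' : lmodType k') (i : M -> M') :
  smod (fun y => exists s : seq (k' * M), y = \sum_(u <- s) u.1 *: i u.2).
Proof.
split=> [|_ _ [s ->] [t ->]|a _ [s ->]].
- by exists [::]; rewrite big_nil.
- by exists (s ++ t); rewrite big_cat.
exists [seq (a * u.1, u.2) | u <- s]; rewrite big_map scaler_sumr.
by apply: eq_bigr => u _; rewrite scalerA.
Qed.

(** * Endomorphism algebras and base change *)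

Section AdualTheory.
Variables (k : comPzRingType) (A : pzAlgType k) (J : ideal2 A).
Local Notation X := (ideal_mod J).
Local Notation E := (end_ideal J).

Lemma jact_val (x y : X) : jact (jval x) y = jract x (jval y).
Proof. exact: jval_inj. Qed.

(** The dual basis relation read inside E: s lies in rho(J) E. With the converse [adual_intro] this
    is a criterion for projectivity. *)
Lemma adual_sum (s : k) (I : finType) (x : I -> X) (f : I -> E) :
  (forall y, s *: y = \sum_i jact (jval (emap (f i) y)) (x i)) ->
  \sum_i rho J (jval (x i)) * f i = s *: (1 : E).
Proof.
move=> Hf; apply: emap_inj => y; rewrite emap_sum emapZ emap1 Hf.
by apply: eq_bigr => i _; rewrite emapM rhoE jact_val.
Qed.

(** By [adual_sum] and [rho_left], s h = sum rho(h x_l) f_l: an endomorphism is governed by the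
    elements h x_l of J, and J has a dual basis over [k]. *)
Lemma sdual_end (s t : k) : adual J s -> sdual X t -> sdual E (t * s).
Proof.
move=> [I [x [f Hf]]] [I' [y [g Hg]]].
have Ll j : linear (fun h : E => g j.2 (emap h (x j.1)) : k^o).
  by move=> a h h'; rewrite emap_lin_l linearP.
exists (I * I')%type, (fun j => rho J (jval (y j.2)) * f j.1), (fun j => mklin (Ll j)) => h.
rewrite -scalerA -[h in LHS]mulr1 pzscaleAr -(adual_sum Hf) mulr_sumr scaler_sumr.
rewrite -(pair_bigA _ (fun j1 j2 => (mklin (Ll (j1, j2)) h : k) *: (rho J (jval (y j2)) * f j1))) /=.
apply: eq_bigr => j _; rewrite mulrA rho_left pzscaleAl -(linZ (@rho_linear _ _ J)).
rewrite -linearZ_LR Hg linear_sum (linsum (@rho_linear _ _ J)) mulr_suml.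
by apply: eq_bigr => j' _; rewrite linearZ_LR (linZ (@rho_linear _ _ J)) pzscaleAl.
Qed.

Lemma emap_ract (f : E) x y : emap f (jract x (jval y)) = jract x (jval (emap f y)).
Proof. by rewrite -!jact_val emapA. Qed.
End AdualTheory.

Section EndBaseChange.
Variables (k k' : comPzRingType) (phi : {rmorphism k -> k'}).
Variables (A : pzAlgType k) (A' : pzAlgType k') (i : A -> A').
Hypotheses (iP : is_bc phi i) (iM : forall x y, i (x * y) = i x * i y).
Variables (J : ideal2 A) (J' : ideal2 A') (JP : ideal_bc i J J').
Local Notation X := (ideal_mod J).
Local Notation X' := (ideal_mod J').
Local Notation E := (end_ideal J).
Local Notation E' := (end_ideal J').
Local Notation j := (jbc JP).
Hypothesis jP : is_bc phi j.
Let jS := bc_semilin jP.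

Section Make.
Variable f : E.
Let g : {linear X' -> X'} := bc_lift jP (semilin_comp_lin (emap f) jS).
Let gE x : g (j x) = j (emap f x). Proof. exact: bc_liftE. Qed.
Let gA a x : g (jact a x) = jact a (g x).
Proof.
move: a; apply: (bc_ind iP) => [|a].
  split=> [|a b Ha Hb|c a Ha].
  - by rewrite !(lin0 (jact_linl _)) linear0.
  - by rewrite !(linD (jact_linl _)) linearD Ha Hb.
  by rewrite !(linZ (jact_linl _)) linearZ_LR Ha.
move: x; apply: (bc_ind jP) => [|x].
  split=> [|y z Hy Hz|c y Hy].
  - by rewrite (linear0 g) !(lin0 (jact_linr _)) (linear0 g).
  - by rewrite (linearD g) !(linD (jact_linr _)) (linearD g) Hy Hz.
  by rewrite (linearZ_LR g) !(linZ (jact_linr _)) (linearZ_LR g) Hy.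
by rewrite -(jbc_act iM) !gE emapA (jbc_act iM).
Qed.
Definition ebc : E' := emk (linearP g) gA.
Lemma ebcE x : emap ebc (j x) = j (emap f x).
Proof. by rewrite /ebc emkE. Qed.
End Make.

Lemma end_bc_eq (f g : E') : (forall x, emap f (j x) = emap g (j x)) -> f = g.
Proof.
by move=> fg; apply: emap_inj; apply: (bc_ext jP).
Qed.

Lemma ebc_semilin : semilin phi ebc.
Proof.
split=> [f g|a f]; apply: end_bc_eq => x.
  by rewrite emapD !ebcE emapD jS.1.
by rewrite emapZ !ebcE emapZ jS.2.
Qed.
Lemma ebcM f g : ebc (f * g) = ebc f * ebc g.
Proof. by apply: end_bc_eq => x; rewrite emapM !ebcE emapM. Qed.
Lemma ebc1 : ebc 1 = 1.
Proof. by apply: end_bc_eq => x; rewrite ebcE !emap1. Qed.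
Lemma ebc_rho x : ebc (rho J (jval x)) = rho J' (jval (j x)).
Proof. by apply: end_bc_eq => y; rewrite ebcE !rhoE -!jact_val (jbc_act iM). Qed.

Lemma bc_adual (s : k) : adual J s -> adual J' (phi s).
Proof.
move=> [I [x [f Hf]]]; exists I, (fun l => j (x l)), (fun l => ebc (f l)).
pose F y := \sum_l jact (jval (emap (ebc (f l)) y)) (j (x l)).
have FL : linear F.
  by apply: sum_linear => l a y z; rewrite !linearP jact_linl.
have idl : linear (fun y : X' => y) by [].
apply: (bc_ext jP (f := mklin (scale_linear (phi s) (mklin idl))) (g := mklin FL)) => y /=.
rewrite -(semilinZ jS) Hf (semilin_sum jS); apply: eq_bigr => l _.
by rewrite ebcE (jbc_act iM).
Qed.

Variables (s : k) (c : k').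
Hypotheses (cs : c * phi s = 1) (Js : adual J s).

(* g = c sum_l rho(g(x_l)) f_l expresses every endomorphism of J' through those of J. *)
Lemma bc_ebc : is_bc phi ebc.
Proof.
have [I [x [f Hf]]] := Js; have fs := adual_sum Hf.
have fs' (g : E') : g = c *: \sum_l rho J' (jval (emap g (j (x l)))) * ebc (f l).
  transitivity (c *: (g * ebc (s *: (1 : E)))).
    by rewrite (semilinZ ebc_semilin) ebc1 -pzscaleAr mulr1 scalerA cs scale1r.
  rewrite -fs (semilin_sum ebc_semilin) mulr_sumr; congr (_ *: _).
  by apply: eq_bigr => l _; rewrite ebcM ebc_rho mulrA rho_left.
split; first exact: ebc_semilin.
  move=> g; have SP := @sum_smod k k' E E' ebc; rewrite (fs' g).
  apply: (smodZ SP); apply: (smod_sum SP) => l _.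
  move: (emap g _); apply: (bc_ind jP) => [|y].
    split=> [|y z Hy Hz|a y Hy].
    - by rewrite linear0 (lin0 (@rho_linear _ _ J')) mul0r; apply: (smod0 SP).
    - by rewrite linearD (linD (@rho_linear _ _ J')) mulrDl; apply: (smodD SP).
    by rewrite linearZ_LR (linZ (@rho_linear _ _ J')) -pzscaleAl; apply: (smodZ SP).
  rewrite -ebc_rho -ebcM; exists [:: (1, rho J (jval y) * f l)].
  by rewrite big_seq1 scale1r.
move=> N g gP.
have HS l : semilin phi (fun y : X => g (rho J (jval y) * f l)).
  split=> [y z|a y].
    by rewrite linearD (linD (@rho_linear _ _ J)) mulrDl gP.1.
  by rewrite linearZ_LR (linZ (@rho_linear _ _ J)) -pzscaleAl gP.2.
pose h (g' : E') := c *: \sum_l bc_lift jP (HS l) (emap g' (j (x l))).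
have hl : linear h.
  move=> a u v; rewrite /h.
  have -> : \sum_l bc_lift jP (HS l) (emap (a *: u + v) (j (x l))) =
     a *: \sum_l bc_lift jP (HS l) (emap u (j (x l))) + \sum_l bc_lift jP (HS l) (emap v (j (x l))).
    rewrite scaler_sumr -big_split; apply: eq_bigr => l _.
    by rewrite emap_lin_l linearP.
  by rewrite scalerDr !scalerA mulrC.
exists (mklin hl) => u /=; rewrite /h.
transitivity (c *: g (u * (s *: (1 : E)))); last first.
  by rewrite -pzscaleAr mulr1 gP.2 scalerA cs scale1r.
rewrite -fs mulr_sumr (semilin_sum gP); congr (_ *: _); apply: eq_bigr => l _.
by rewrite ebcE bc_liftE mulrA rho_left.
Qed.
End EndBaseChange.

Section RingIso.
Lemma semisimple_iso (R S : pzRingType) (f : R -> S) (f' : S -> R) :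
  (forall x y, f (x + y) = f x + f y) -> (forall x y, f (x * y) = f x * f y) ->
  cancel f f' -> cancel f' f -> semisimple_ring R -> semisimple_ring S.
Proof.
move=> fD fM fK f'K Rss L.
have f0 : f 0 = 0 by have /eqP := fD 0 0; rewrite addr0 -subr_eq0 opprD addrA subrr add0r oppr_eq0 => /eqP.
have f'D x y : f' (x + y) = f' x + f' y by apply: (can_inj fK); rewrite fD !f'K.
have f'M x y : f' (x * y) = f' x * f' y by apply: (can_inj fK); rewrite fM !f'K.
have f'0 : f' 0 = 0 by apply: (can_inj fK); rewrite f'K f0.
have LP := smod_mem L.
have L0P : @smod R R^o (fun x => f x \in L).
  split=> [|x y Lx Ly|a x Lx]; first by rewrite f0; apply: (smod0 LP).
    by rewrite fD; apply: (smodD LP).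
  by rewrite [f _]fM; apply: (smodZ LP).
have [M [M1 M2]] := Rss (mksub L0P).
have MP := smod_mem M.
have L'P : @smod S S^o (fun x => f' x \in M).
  split=> [|x y Lx Ly|a x Lx]; first by rewrite f'0; apply: (smod0 MP).
    by rewrite f'D; apply: (smodD MP).
  by rewrite [f' _]f'M; apply: (smodZ MP).
exists (mksub L'P); split=> [x Lx /(mksubE L'P) Mx|x].
  rewrite -[x]f'K; rewrite (M1 (f' x)) //; apply/(mksubE L0P).
  by rewrite f'K.
have [y [z [/(mksubE L0P) Ly Mz xE]]] := M2 (f' x).
exists (f y), (f z); split=> //; first by apply/(mksubE L'P); rewrite fK.
by rewrite -fD -xE f'K.
Qed.

Section BC.
Variables (k k' : comPzRingType) (phi : {rmorphism k -> k'}).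
Variables (E : pzAlgType k) (E1 E2 : pzAlgType k') (i : E -> E1) (j : E -> E2).
Hypotheses (iP : is_bc phi i) (jP : is_bc phi j).
Hypotheses (iM : forall x y, i (x * y) = i x * i y) (jM : forall x y, j (x * y) = j x * j y).
Let f : {linear E1 -> E2} := bc_lift iP (bc_semilin jP).
Let g : {linear E2 -> E1} := bc_lift jP (bc_semilin iP).

Lemma bc_lift_cancel : cancel f g.
Proof.
apply: (bc_ext iP (f := mklin (comp_linear g f)) (g := mklin (fun a x y => erefl))) => x.
by rewrite /= /f /g !bc_liftE.
Qed.

Lemma bc_lift_mul x y : f (x * y) = f x * f y.
Proof.
move: y; apply: (bc_ext iP (f := mklin (comp_linear f (mklin (mull_linear x))))
  (g := mklin (comp_linear (mklin (mull_linear (f x))) f))) => y /=.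
move: x; apply: (bc_ext iP (f := mklin (comp_linear f (mklin (mulr_linear_alg (i y)))))
  (g := mklin (comp_linear (mklin (mulr_linear_alg (f (i y)))) f))) => x /=.
by rewrite -iM /f !bc_liftE jM.
Qed.
End BC.

Lemma bc_semisimple (k k' : comPzRingType) (phi : {rmorphism k -> k'})
  (E : pzAlgType k) (E1 E2 : pzAlgType k') (i : E -> E1) (j : E -> E2) :
  is_bc phi i -> is_bc phi j -> (forall x y, i (x * y) = i x * i y) ->
  (forall x y, j (x * y) = j x * j y) -> semisimple_ring E1 -> semisimple_ring E2.
Proof.
move=> iP jP iM jM; apply: semisimple_iso (bc_lift_cancel iP jP) (bc_lift_cancel jP iP).
  exact: linearD.
exact: bc_lift_mul.
Qed.
End RingIso.

Lemma spec_neq0 (k : comPzRingType) (q : spec k) s : s \notin spec_ideal q -> s <> 0.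
Proof.
move=> /negP sq s0; apply: sq; rewrite s0; exact: (smod0 (ideal_like_mem (spec_ideal q))).
Qed.

(** * Fibres of algebras over a field *)

Section OverFields.
Variables (K : comPzRingType) (Kf : field_like K).

Lemma field_mem (q : spec K) a : a \in spec_ideal q -> a = 0.
Proof.
move=> aq; apply: contrapT => /Kf.2[d da].
by have := spec1 q; rewrite -da (specMl _ aq).
Qed.

Lemma field_inv (c : K) : c <> 0 -> exists d : K, d * c = 1.
Proof. exact: Kf.2. Qed.

Lemma field_spec : exists q : spec K, True.
Proof.
have zP : ideal_like (fun a : K => a = 0) := smod_zero K^o.
have z1 : ~ (1 : K) = 0 := Kf.1.
have zpr (a b : K) : a * b = 0 -> a = 0 \/ b = 0.
  move=> ab; have [->|a0] := pselect (a = 0); first by left.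
  right; have [d da] := field_inv a0.
  by rewrite -[b]mul1r -da -mulrA ab mulr0.
by exists (mkspec zP z1 zpr).
Qed.

Lemma field_fib_bij (E : pzAlgType K) (q : spec K) :
  exists g : fibre_alg q E -> E, cancel (@fib K q E) g /\ cancel g (@fib K q E).
Proof.
have bcq := bc_fib q E; have fS := bc_semilin bcq.
have surj (y : fibre q E) : exists x : E, fib q x = y.
  have [s sq [x Hx]] := bc_fib_frac bcq y.
  have [|d ds] := field_inv (c := s).
    exact: spec_neq0 sq.
  exists (d *: x); rewrite (semilinZ fS) -Hx scalerA.
  by rewrite -rmorphM ds rmorph1 scale1r.
have inj (x y : E) : fib q x = fib q y -> x = y.
  move=> xy; have /fib_eq0[s sq] : fib q (x - y) = 0 by rewrite (semilinB fS) xy subrr.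
  have [|d ds] := field_inv (c := s).
    exact: spec_neq0 sq.
  have mz v : v \in @mulspan K (spec_ideal q) E -> v = 0.
    move: v; apply: mulspan_ind; first exact: smod_zero.
    by move=> a v /field_mem->; rewrite scale0r.
  move/mz/(congr1 ( *:%R d)); rewrite scalerA ds scale1r scaler0 => /eqP.
  by rewrite subr_eq0 => /eqP.
have [g Hg] := choice surj; exists g; split=> // x.
by apply: inj; rewrite Hg.
Qed.

(** The only prime of a field is 0, and the fibre there is the algebra itself. *)
Lemma field_k_semisimple (E : pzAlgType K) : k_semisimple E <-> semisimple_ring E.
Proof.
split=> [Es|Es q].
  have [q _] := field_spec; have [g [fK gK]] := field_fib_bij E q.
  apply: (semisimple_iso (f := g) (f' := @fib K q E) _ _ gK fK (Es q)) => x y; apply: (can_inj fK).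
    by rewrite gK (semilinD (bc_semilin (bc_fib q E))) !gK.
  by rewrite gK fibM !gK.
have [g [fK gK]] := field_fib_bij E q.
apply: (@semisimple_iso E (fibre_alg q E) (@fib K q E) g _ _ fK gK Es) => x y; last exact: fibM.
exact: (semilinD (bc_semilin (bc_fib q E))).
Qed.
End OverFields.

(** * Algebras over fields, products and endomorphism algebras *)

Section FieldModules.
Variables (K : comPzRingType) (Kf : field_like K).

(** A generating family of least size is a basis. *)
Lemma field_basis (M : lmodType K) (l : seq M) : (forall y, spn l y) ->
  exists (n : nat) (x : 'I_n -> M) (f : 'I_n -> {linear M -> K^o}),
    (forall y, y = \sum_i (f i y : K) *: x i) /\
    forall i j, (f i (x j) : K) = (i == j)%:R.
Proof.
move=> lM.
pose Q n := exists x : 'I_n -> M, forall y, exists c : 'I_n -> K, y = \sum_i c i *: x i.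
have exQ : exists n, `[< Q n >].
  exists (size l); apply/asboolP; exists (tnth (in_tuple l)) => y; exact/spn_fin/lM.
case: (ex_minnP exQ) => n /asboolP[x xM] nmin.
have indep (c : 'I_n -> K) : \sum_i c i *: x i = 0 -> forall i, c i = 0.
  move=> c0 i; apply: contrapT => /(field_inv Kf)[e ec].
  case: n x xM nmin c c0 i ec {exQ} => [|n] x xM nmin c c0 i ec; first by case: i ec.
  suff : Q n by move/asboolP/nmin; rewrite ltnn.
  exists (fun j => x (lift i j)) => y; have [d Hd] := xM y.
  exists (fun j => d (lift i j) - d i * e * c (lift i j)).
  have xi : x i = - (e *: \sum_j c (lift i j) *: x (lift i j)).
    move: c0; rewrite (bigD1_ord i) //= => /(congr1 ( *:%R e)).
    rewrite scalerDr scalerA ec scale1r scaler0 => /eqP.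
    by rewrite addr_eq0 => /eqP.
  rewrite Hd (bigD1_ord i) //= xi scalerN scalerA scaler_sumr addrC -sumrB.
  by apply: eq_bigr => j _; rewrite scalerBl scalerA.
have [c Hc] := choice xM.
have cu y (d : 'I_n -> K) : y = \sum_i d i *: x i -> forall i, c y i = d i.
  move=> yd i; apply/eqP; rewrite -subr_eq0; apply/eqP.
  apply: (indep (fun i => c y i - d i)).
  by under eq_bigr => j _ do rewrite scalerBl; rewrite sumrB -yd -Hc subrr.
have cl i : linear (fun y => c y i : K^o).
  move=> a y z; apply: (cu _ (fun i => a * c y i + c z i)).
  under eq_bigr => j _ do rewrite scalerDl -scalerA.
  by rewrite big_split -scaler_sumr -!Hc.
exists n, x, (fun i => mklin (cl i)); split=> // i j.
apply: (cu _ (fun i => (i == j)%:R)); rewrite (bigD1 j) //= eqxx scale1r big1 ?addr0 //.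
by move=> m /negPf ->; rewrite scale0r.
Qed.

Lemma field_sdual (M : lmodType K) (l : seq M) : (forall y, spn l y) -> sdual M 1.
Proof.
by move=> /field_basis[n [x [f [Hf _]]]]; exists 'I_n, x, f => y; rewrite scale1r.
Qed.

Lemma quopi_linear (M : lmodType K) (S : submodClosed M) : linear (quopi S).
Proof. by move=> a x y; rewrite quopiD; congr (_ + _); apply/esym/quo_scaleE. Qed.

Lemma field_retract (M : lmodType K) (l : seq M) (S : submodClosed M) :
  (forall y, spn l y) -> exists r : {linear M -> M},
    (forall x, r x \in S) /\ (forall x, x \in S -> r x = x).
Proof.
move=> lM; pose q := mklin (quopi_linear S).
have qM : forall c : quomod S, spn [seq q x | x <- l] c.
  elim/quo_ind => x; rewrite -[quopi S x]/(q x); move: x (lM x).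
  apply: spn_ind => [|x xl]; first exact/smod_preim/smod_spn.
  by apply: spn_mem; apply: map_f.
have idl : linear (fun c : quomod S => c) by [].
have [|h Hh] := sdual1_projective (field_sdual qM) (g:=q) (mklin idl).
  by elim/quo_ind => x; exists x.
have q0 x : q x = 0 <-> x \in S.
  rewrite -(linear0 q) /=; split=> [/eqP|xS]; first by rewrite quopiE subr0.
  by apply: quopiP; rewrite subr0.
have rl : linear (fun x => x - h (q x)).
  by move=> a x y; rewrite (linearP q) (linearP h) scalerBr; abel.
exists (mklin rl); split=> x /=.
  by apply/q0; rewrite linearB; have := Hh (q x) => /= ->; rewrite subrr.
by move/q0; rewrite -[quopi S x]/(q x) => ->; rewrite linear0 subr0.
Qed.

Lemma smod_scalars (E : pzAlgType K) (L : submodClosed E^o) : @smod K E (fun x => x \in L).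
Proof.
have LP := smod_mem L; split=> [|x y|a x Lx]; [exact: (smod0 LP)|exact: (smodD LP)|].
have -> : a *: x = (a *: (1 : E)) *: (x : E^o) by rewrite -[RHS]pzscaleAl mul1r.
exact: (smodZ LP).
Qed.

(* Maschke's argument: average a linear projection over the separability idempotent. *)
Lemma csep_semisimple (E : pzAlgType K) (l : seq E) : (forall y, spn l y) ->
  csep E 1 -> semisimple_ring E.
Proof.
move=> lE /csep_bilin[u [um uc]] L; have LP := smod_mem L.
have LK := smod_scalars L.
have [r [rS rid]] := field_retract (mksub LK) lE.
pose r' x := \sum_(v <- u) v.1 * r (v.2 * x).
have r'l e x : r' (e * x) = e * r' x.
  have bl (y : E) : linear (fun a : E => a * r (y * x)) by move=> a b c; rewrite mulrDl -pzscaleAl.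
  have br (a : E) : linear (fun y : E => a * r (y * x)).
    by move=> c y z; rewrite mulrDl -pzscaleAl linearP mulrDr -pzscaleAr.
  have := uc _ (fun a y => a * r (y * x)) bl br e; rewrite /r' mulr_sumr => H.
  under eq_bigr => v _ do rewrite mulrA.
  by rewrite -H; apply: eq_bigr => v _; rewrite mulrA.
have r'D x y : r' (x + y) = r' x + r' y.
  by rewrite -big_split; apply: eq_bigr => v _; rewrite mulrDr linearD mulrDr.
have r'L x : r' x \in L.
  apply: (smod_sum LP) => v _; apply: (smodZ LP v.1 (x := r (v.2 * x) : E^o)).
  by apply/(mksubE LK)/rS.
have r'id x : x \in L -> r' x = x.
  move=> Lx; rewrite -[RHS]mul1r -[1](scale1r (1 : E)) -um mulr_suml.
  apply: eq_bigr => v _; rewrite rid ?mulrA //; apply/(mksubE LK).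
  exact: (smodZ LP v.2 (x := x : E^o)).
have MP : @smod E E^o (fun x => r' x = 0).
  split=> [|x y Hx Hy|a x Hx].
  - by rewrite -[0 in LHS](mul0r 0) r'l mul0r.
  - by rewrite r'D Hx Hy addr0.
  by rewrite [r' _]r'l Hx mulr0.
exists (mksub MP); split=> [x Lx /(mksubE MP)|x].
  by rewrite r'id.
exists (r' x), (x - r' x); split=> //; last by rewrite addrC subrK.
apply/(mksubE MP).
have r'N y : r' (- y) = - r' y by rewrite -mulN1r r'l mulN1r.
by rewrite r'D r'N [r' (r' x)]r'id // subrr.
Qed.
End FieldModules.

Section Products.
Variables (k : comPzRingType) (E : pzAlgType k) (n : nat) (F : 'I_n -> pzAlgType k).
Variable phi : forall i, E -> F i.
Hypotheses (phiP : forall i, alg_hom (phi i))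
  (phiU : forall y : (forall i, F i), exists! x, forall i, phi i x = y i).

Lemma prod_homL i : linear (phi i). Proof. exact: (phiP i).1. Qed.
Lemma prod_homM i x y : phi i (x * y) = phi i x * phi i y. Proof. exact: (phiP i).2.2. Qed.
Lemma prod_hom1 i : phi i 1 = 1. Proof. exact: (phiP i).2.1. Qed.

Lemma prod_inj x y : (forall i, phi i x = phi i y) -> x = y.
Proof. by move=> xy; have [z [_ zU]] := phiU (fun i => phi i y); rewrite -(zU x) // -(zU y). Qed.

Lemma prod_section : exists s : forall i, {linear F i -> E},
  [/\ forall i y, phi i (s i y) = y, forall i j y, j != i -> phi j (s i y) = 0 &
      forall x, x = \sum_i s i (phi i x)].
Proof.
have ex i (y : F i) : exists x, phi i x = y /\ forall j, j != i -> phi j x = 0.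
  have [x [Hx _]] := phiU (dfwith (fun j => 0 : F j) y).
  by exists x; split=> [|j ji]; rewrite Hx ?dfwith_in // dfwith_out // eq_sym.
pose s i y := sval (cid (ex i y)).
have s1 i y : phi i (s i y) = y by rewrite /s; case: cid => x [].
have s2 i j y : j != i -> phi j (s i y) = 0 by move=> ji; rewrite /s; case: cid => x [_ H] /=; exact: H.
have sl i : linear (s i).
  move=> a x y; apply: prod_inj => j; rewrite prod_homL.
  have [->|ji] := eqVneq j i; first by rewrite !s1.
  by rewrite !s2 // scaler0 addr0.
exists (fun i => mklin (sl i)); split=> // x; apply: prod_inj => j /=.
rewrite (linsum (@prod_homL j)) (bigD1 j) //= s1 big1 ?addr0 // => i ij.
by rewrite s2 // eq_sym.
Qed.
End Products.

(** Projections and sections are extended separately; the identities that make E a product are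
    identities of linear maps and persist. *)
Lemma alg_product_bc (k k' : comPzRingType) (h : {rmorphism k -> k'})
  (E : pzAlgType k) (E' : pzAlgType k') (i : E -> E') (n : nat)
  (F : 'I_n -> pzAlgType k) (F' : 'I_n -> pzAlgType k') (j : forall m, F m -> F' m) :
  is_bc h i -> (forall x y, i (x * y) = i x * i y) -> i 1 = 1 ->
  (forall m, is_bc h (j m)) -> (forall m x y, j m (x * y) = j m x * j m y) ->
  (forall m, j m 1 = 1) -> alg_product E F -> alg_product E' F'.
Proof.
move=> iP iM i1 jP jM j1 [phi [phiP phiU]].
have [s [s1 s2 s3]] := prod_section phiP phiU.
have phiL m : linear (phi m) := prod_homL phiP m.
have jS m := bc_semilin (jP m); have iS := bc_semilin iP.
pose phi' m : {linear E' -> F' m} :=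
  bc_lift iP (semilin_comp_lin (mklin (phiL m)) (jS m)).
have phi'E m x : phi' m (i x) = j m (phi m x) by apply: bc_liftE.
pose s' m : {linear F' m -> E'} := bc_lift (jP m) (semilin_comp_lin (s m) iS).
have s'E m y : s' m (j m y) = i (s m y) by apply: bc_liftE.
have s1' m : forall y, phi' m (s' m y) = y.
  apply: (bc_ext (jP m) (f := mklin (comp_linear (phi' m) (s' m))) (g := mklin (fun a x y => erefl))).
  by move=> y; rewrite /= s'E phi'E s1.
have s2' m m' : m' != m -> forall y, phi' m' (s' m y) = 0.
  move=> mm; have zl : linear (fun _ : F' m => 0 : F' m') by move=> a x y; rewrite scaler0 addr0.
  apply: (bc_ext (jP m) (f := mklin (comp_linear (phi' m') (s' m))) (g := mklin zl)).
  by move=> y; rewrite /= s'E phi'E s2 // (semilin0 (jS _)).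
have s3' : forall x, x = \sum_m s' m (phi' m x).
  have Sl : linear (fun x => \sum_m s' m (phi' m x)) by apply: sum_linear => m a x y; rewrite !linearP.
  apply: (bc_ext iP (f := mklin (fun a x y => erefl)) (g := mklin Sl)) => x /=.
  rewrite [in LHS](s3 x) (semilin_sum iS); apply: eq_bigr => m _.
  by rewrite phi'E s'E.
exists (fun m => phi' m); split=> [m|y].
  split; first exact: linearP.
  split; first by rewrite -i1 phi'E (prod_hom1 phiP) j1.
  move=> x y; move: y.
  apply: (bc_ext iP (f := mklin (comp_linear (phi' m) (mklin (mull_linear x))))
    (g := mklin (comp_linear (mklin (mull_linear (phi' m x))) (phi' m)))) => y /=.
  move: x.
  apply: (bc_ext iP (f := mklin (comp_linear (phi' m) (mklin (mulr_linear_alg (i y)))))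
    (g := mklin (comp_linear (mklin (mulr_linear_alg (phi' m (i y)))) (phi' m)))) => x /=.
  by rewrite -iM !phi'E (prod_homM phiP) jM.
exists (\sum_m s' m (y m)); split=> [m|x Hx].
  rewrite linear_sum (bigD1 m) //= s1' big1 ?addr0 // => m' mm'.
  by rewrite s2' // eq_sym.
by rewrite [RHS]s3'; apply: eq_bigr => m _; rewrite Hx.
Qed.

(** Averaging z over a Casimir element lands in the centre: the identity is applied to the bilinear
    map (a, y) -> a z y. *)
Lemma csep_central (k : comPzRingType) (E : pzAlgType k) (u : seq (E * E)) :
  (forall (P : lmodType k) (b : E -> E -> P), (forall y, linear (b^~ y)) ->
    (forall x, linear (b x)) -> forall e,
    \sum_(v <- u) b (e * v.1) v.2 = \sum_(v <- u) b v.1 (v.2 * e)) ->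
  forall z e, e * \sum_(v <- u) v.1 * z * v.2 = (\sum_(v <- u) v.1 * z * v.2) * e.
Proof.
move=> uc z e.
have bl (y : E) : linear (fun a : E => a * z * y) by move=> c a b; rewrite !mulrDl -!pzscaleAl.
have br (a : E) : linear (fun y : E => a * z * y) by move=> c x y; rewrite mulrDr -pzscaleAr.
rewrite mulr_sumr mulr_suml; have := uc _ (fun a y => a * z * y) bl br e => H.
under eq_bigr => v _ do rewrite !mulrA.
by rewrite H; apply: eq_bigr => v _; rewrite mulrA.
Qed.

Section AzumayaFibre.
Variables (k : comPzRingType) (p : spec k) (F : pzAlgType k).

(** Lift z to w and average w over a Casimir element of F: the result is central in F, hence a
    scalar, and reduces to a unit multiple of z because z is already central. *)
Lemma fibre_center (t : k) (z : fibre_alg p F) : t \notin spec_ideal p -> csep F t ->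
  (forall z : F, (forall x, z * x = x * z) -> exists a : k, z = a *: (1 : F)) ->
  (forall x, z * x = x * z) -> exists c : resfield p, z = c *: (1 : fibre_alg p F).
Proof.
move=> tp /csep_bilin[u [um uc]] Fc zc.
have fS := bc_semilin (bc_fib p F).
have [s sp [w Hw]] := bc_fib_frac (bc_fib p F) z.
have [a Ha] := Fc _ (fun x => esym (csep_central uc w x)).
have [d ds] := fhom_unit (specM sp tp).
exists (d * fhom p a); rewrite -[LHS]scale1r -ds -!scalerA; congr (_ *: _).
transitivity (fib p (\sum_(v <- u) v.1 * w * v.2)); last first.
  by rewrite Ha (semilinZ fS) fib1.
rewrite (semilin_sum fS); transitivity (\sum_(v <- u) (fhom p s *: z) * (fib p (v.1 * v.2) : fibre_alg p F)).
  rewrite -mulr_sumr -(semilin_sum fS) um (semilinZ fS) fib1 -pzscaleAr mulr1 scalerA.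
  by rewrite rmorphM mulrC.
apply: eq_bigr => v _; rewrite !fibM -Hw mulrA; congr (_ * _).
by rewrite -pzscaleAl -pzscaleAr zc.
Qed.

Lemma azumaya_fibre (l : seq F) : (forall y, spn l y) -> azumaya F ->
  azumaya (fibre_alg p F).
Proof.
move=> lF [/csep1P Fs Ff Fc]; split.
- apply/csep1P; apply: (bc_csep (bc_fib p F) (@fibM k p F) (fib1 p F) _ Fs (c := 1)).
  by rewrite rmorph1 mulr1.
- move=> c Hc; apply: contrapT => /(resfield_field p).2[d dc].
  have F1 : fib p (1 : F) = 0.
    by rewrite fib1 -[LHS]scale1r -dc -scalerA Hc scaler0.
  (* If 1 vanished in F(p), Nakayama's lemma would give a denominator killing F, against the
     faithfulness of F over [k]. *)
  have [||s sp Hs] := @nakayama k p F (fun y => y = 0) l 1 (smod_zero F) (spec1 p).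
  + by move=> y; rewrite scale1r; apply: lF.
  + move=> y; have /fib_eq0[s sp Hs] : fib p y = 0.
      by rewrite -[y]mulr1 fibM F1 mulr0.
    by exists s => //; exists (s *: y); rewrite ?subrr.
  by case: (spec_neq0 sp); apply: Ff; apply: Hs.
by move=> z zc; apply: fibre_center (spec1 p) Fs Fc zc.
Qed.
End AzumayaFibre.

Section Endk.
Variables (R : comPzRingType) (M : lmodType R).
Local Notation ev := (@endo_fun R R (central_id R) M).
Lemma endkD (f g : endk M) x :
  ev (f + g) x = ev f x + ev g x. Proof. by []. Qed.
Lemma endkZ a (f : endk M) x :
  ev (a *: f) x = a *: ev f x. Proof. by []. Qed.
Lemma endkM (f g : endk M) x :
  ev (f * g) x = ev f (ev g x). Proof. by []. Qed.
Lemma endk1 x :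
  ev (1 : endk M) x = x. Proof. by []. Qed.
Lemma endk_sum (I : Type) (r : seq I)
  (F : I -> endk M) x :
  ev (\sum_(i <- r) F i) x = \sum_(i <- r) ev (F i) x.
Proof.
by elim: r => [|j r IHr]; rewrite ?big_nil // !big_cons endkD IHr.
Qed.

Definition rank1 (f : {linear M -> R^o}) (q : M) : endk M :=
  (mklin (scalel_linear f q) : {linear M -> M}).
Lemma rank1E (f : {linear M -> R^o}) (q : M) x :
  ev (rank1 f q) x = (f x : R) *: q.
Proof. by []. Qed.
Lemma rank1_linear (f : {linear M -> R^o}) :
  linear (rank1 f).
Proof.
move=> a x y; apply: endoP => z; rewrite endkD endkZ !rank1E.
by rewrite scalerDr !scalerA mulrC.
Qed.

End Endk.

Section EndkBaseChange.
Variables (k k' : comPzRingType) (phi : {rmorphism k -> k'}).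
Variables (Q : lmodType k) (Q' : lmodType k') (i : Q -> Q') (iP : is_bc phi i).
Hypothesis Q1 : sdual Q 1.
Let iS := bc_semilin iP.

Definition endk_bc (f : endk Q) : endk Q' := bc_map iP iS (endo_fun f).
Lemma endk_bcE f x : endo_fun (endk_bc f) (i x) = i (endo_fun f x).
Proof. exact: bc_mapE. Qed.

Lemma endk_eq (f g : endk Q') : (forall x, endo_fun f (i x) = endo_fun g (i x)) -> f = g.
Proof. by move=> fg; apply: endoP; apply: (bc_ext iP). Qed.

(** A dual basis of Q writes every endomorphism g as a sum of rank one maps f_j (x) g(x_j), which
    are determined by elements of Q and thus compatible with base change. *)
Lemma bc_endk : is_bc phi endk_bc.
Proof.
have [I [x [f Hf]]] := Q1.
have fs (g : endk Q') : g = \sum_j rank1 (bc_fun iP (f j)) (endo_fun g (i (x j))).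
  apply: endk_eq => y; rewrite endk_sum.
  rewrite -[y in LHS]scale1r Hf (semilin_sum iS) linear_sum.
  by apply: eq_bigr => j _; rewrite (semilinZ iS) linearZ_LR rank1E bc_funE.
have bS : semilin phi endk_bc.
  by split=> [g h|a g]; apply: endk_eq => y;
    rewrite ?endkD ?endkZ !endk_bcE ?endkD ?endkZ ?iS.1 ?iS.2.
have b1 j y : endk_bc (rank1 (f j) y) = rank1 (bc_fun iP (f j)) (i y).
  by apply: endk_eq => z; rewrite endk_bcE !rank1E iS.2 bc_funE.
split=> //.
  move=> g; have SP := @sum_smod k k' _ _ endk_bc; rewrite (fs g).
  apply: (smod_sum SP) => j _; move: (endo_fun g _); apply: (bc_ind iP) => [|y].
    exact: (smod_preim (mklin (@rank1_linear _ _ (bc_fun iP (f j)))) SP).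
  by rewrite -b1; exists [:: (1, rank1 (f j) y)]; rewrite big_seq1 scale1r.
move=> N g gP.
have HS j : semilin phi (fun y => g (rank1 (f j) y)).
  by split=> [y z|a y]; rewrite ?(linD (@rank1_linear _ _ (f j))) ?(linZ (@rank1_linear _ _ (f j))) ?gP.1 ?gP.2.
have hl : linear (fun g' : endk Q' => \sum_j bc_lift iP (HS j) (endo_fun g' (i (x j)))).
  by apply: sum_linear => j a u v; rewrite endkD endkZ linearP.
exists (mklin hl) => u /=.
have ue : u = \sum_j rank1 (f j) (endo_fun u (x j)).
  apply: endoP => y; rewrite endk_sum -[y in LHS]scale1r Hf linear_sum.
  by apply: eq_bigr => j _; rewrite linearZ_LR rank1E.
rewrite [in RHS]ue (semilin_sum gP); apply: eq_bigr => j _.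
by rewrite endk_bcE bc_liftE.
Qed.

Lemma endk_bcM f g : endk_bc (f * g) = endk_bc f * endk_bc g.
Proof. by apply: endk_eq => x; rewrite endkM !endk_bcE. Qed.
Lemma endk_bc1 : endk_bc 1 = 1.
Proof. by apply: endk_eq => x; rewrite endk_bcE. Qed.
End EndkBaseChange.

Lemma bc_spn (k k' : comPzRingType) (phi : {rmorphism k -> k'}) (M : lmodType k)
  (M' : lmodType k') (i : M -> M') (l : seq M) : is_bc phi i ->
  (forall y, spn l y) -> forall y, spn [seq i x | x <- l] y.
Proof.
move=> iP lM; apply: (bc_ind iP (smod_spn _)) => x.
have SP : @smod k M (fun x => spn [seq i x | x <- l] (i x)).
  have iS := bc_semilin iP; have SP := smod_spn [seq i x | x <- l].
  split=> [|y z Hy Hz|a y Hy].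
  - by rewrite (semilin0 iS); exact: (smod0 SP).
  - by rewrite (semilinD iS); exact: (smodD SP).
  by rewrite (semilinZ iS); exact: (smodZ SP).
have : spn l x by [].
move: x; apply: (spn_ind SP) => x xl.
by apply: spn_mem; apply: map_f.
Qed.

Lemma bc_alg_spn (k : comPzRingType) (M N : lmodType k) (f : M -> N) (l : seq M) :
  linear f -> (forall y, exists x, f x = y) -> (forall y, spn l y) ->
  forall y, spn [seq f x | x <- l] y.
Proof.
move=> fl fs lM y; have [x <-] := fs y.
have SP : @smod k M (fun x => spn [seq f x | x <- l] (f x)).
  exact: (smod_preim (mklin fl) (smod_spn _)).
have : spn l x by [].
move: x; apply: (spn_ind SP) => x xl.
by apply: spn_mem; apply: map_f.
Qed.

Lemma ideal_square_smod (k : comPzRingType) (A : pzAlgType k) (J : ideal2 A) :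
  @smod k A (fun x => x \in ideal_square J).
Proof.
split.
- by apply/asboolP; exists [::]; rewrite big_nil.
- move=> x y /asboolP[s [sJ ->]] /asboolP[t [tJ ->]]; apply/asboolP.
  by exists (s ++ t); rewrite all_cat sJ tJ big_cat.
move=> a x /asboolP[s [sJ ->]]; apply/asboolP.
exists [seq (a *: u.1, u.2) | u <- s]; split.
  rewrite all_map; apply: sub_all sJ => u /= /andP[u1 ->]; rewrite andbT.
  exact: (smodZ (smod_mem (ideal2_sub J))).
rewrite big_map scaler_sumr; apply: eq_bigr => u _; exact: pzscaleAl.
Qed.

Lemma bc_idempotent (k k' : comPzRingType) (phi : {rmorphism k -> k'})
  (A : pzAlgType k) (A' : pzAlgType k') (i : A -> A') (J : ideal2 A) (J' : ideal2 A') :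
  is_bc phi i -> (forall x y, i (x * y) = i x * i y) -> ideal_bc i J J' ->
  idempotent_ideal J -> idempotent_ideal J'.
Proof.
move=> iP iM JP JJ c; apply/idP/idP => [/asboolP[s [/allP sJ ->]]|cJ].
  rewrite big_seq; apply: (smod_sum (smod_mem (ideal2_sub J'))) => u /sJ /andP[u1 _].
  exact: ideal2Mr.
have SP := ideal_square_smod J'.
have [s Hs] := JP.2 (Submod cJ).
have -> : c = jval (Submod cJ) by [].
rewrite Hs; apply: (smod_sum SP) => u _; apply: (smodZ SP).
have [t Ht] := idempotent_seq JJ u.2.
rewrite Ht linear_sum (semilin_sum (bc_semilin iP)).
apply: (smod_sum SP) => v _.
rewrite (_ : i _ = i (jval v.1) * i (jval v.2)); last exact: iM.
apply/asboolP; exists [:: (i (jval v.1), i (jval v.2))]; rewrite big_seq1 /=.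
by rewrite !JP.1.
Qed.

(** * Heredity ideals and their fibres *)

Section Ideals.
Variables (k : comPzRingType) (A : pzAlgType k) (J : ideal2 A) (p : spec k).
Variable lA : seq A.
Hypotheses (k_noeth : noetherian k) (lAP : forall y, spn lA y).
Hypotheses (A1 : sdual A 1) (JJ : idempotent_ideal J).
Local Notation X := (ideal_mod J).
Local Notation Jp := (fibre_ideal J p).
Local Notation E := (end_ideal J).

Lemma ideal_mod_gens : exists l : seq X, forall y, spn l y.
Proof. exact: (submod_gens (ideal2_sub J) k_noeth lAP). Qed.

(** The two projectivity conditions become the membership of 1 in ideals of denominators. *)
Lemma heredityE : heredity J <-> [/\ sretract J 1, adual J 1 & k_semisimple E].
Proof.
have [l lX] := ideal_mod_gens.
split=> [[qP JP _ Es]|[r a Es]]; split=> //.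
- exact: quo_projective_sretract lAP qP.
- exact: projective_adual lX JP.
- exact: sretract_quo_projective.
exact: adual_projective.
Qed.

Lemma sretract_sdual s : sretract J s -> sdual X s.
Proof. by move=> [r Hr]; have := sdual_retract (i := jval) Hr A1; rewrite mul1r. Qed.

Lemma fibre_idempotent : idempotent_ideal Jp.
Proof. exact: bc_idempotent (bc_fib p A) (@fibM k p A) (fibre_ideal_bc J p) JJ. Qed.

Lemma fibre_ideal_gens : exists l : seq (ideal_mod Jp), forall y, spn l y.
Proof.
have [l lX] := ideal_mod_gens.
exists [seq jfib p x | x <- l].
apply: (jbc_ind (JP := fibre_ideal_bc J p) (smod_spn [seq jfib p x | x <- l])) => x; rewrite -/(jfib p x).
have iS := jfib_semilin J p.
have SP : @smod k X (fun x => spn [seq jfib p x | x <- l] (jfib p x)).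
  have SP := smod_spn [seq jfib p x | x <- l].
  split=> [|y z Hy Hz|a y Hy].
  - by rewrite (semilin0 iS); exact: (smod0 SP).
  - by rewrite (semilinD iS); exact: (smodD SP).
  by rewrite (semilinZ iS); exact: (smodZ SP).
have : spn l x by [].
move: x; apply: (spn_ind SP) => x xl.
by apply: spn_mem; apply: map_f.
Qed.

Lemma fibre_adual : heredity Jp -> adual Jp 1.
Proof.
move=> [_ JP _ _]; have [l lX] := fibre_ideal_gens.
exact: projective_adual fibre_idempotent lX JP.
Qed.

Lemma jfib_eq0 : heredity Jp -> forall y : X,
  jfib p y = 0 <-> loc_in p (fun z => z \in @mulspan k (spec_ideal p) X) y.
Proof.
move=> hJ y; split; first exact: fibre_heredity_inj JJ (fibre_adual hJ).
move=> [s sp Hs]; apply: jval_inj; rewrite jfibE linear0; apply/fib_eq0.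
by exists s => //; rewrite -linearZ_LR; apply: mulspan_lin.
Qed.

Lemma fibre_map_bij : heredity Jp -> bijective (@fibre_ideal_map k A J p).
Proof.
move=> hJ.
have fE (x : X) : fibre_ideal_map (fib p x) = jfib p x.
  by apply: jval_inj; rewrite jfibE; exact: fibre_mapE.
have inj0 (z : fibre p X) : fibre_ideal_map z = 0 -> z = 0.
  have [s sp [x Hx]] := bc_fib_frac (bc_fib p X) z => z0.
  have [c cs] := fhom_unit sp.
  rewrite -[z]scale1r -cs -scalerA Hx.
  suff -> : fib p x = 0 by rewrite scaler0.
  apply/fib_eq0/(jfib_eq0 hJ); rewrite -fE -Hx.
  by rewrite (linZ (@fibre_ideal_map_linear k A J p)) z0 scaler0.
have sur (y : ideal_mod Jp) : exists z : fibre p X, fibre_ideal_map z = y.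
  have /asboolP[z Hz] := jval_in y.
  by exists z; apply: jval_inj; rewrite Hz.
pose g y := sval (cid (sur y)).
have gK y : fibre_ideal_map (g y) = y by rewrite /g; case: cid.
exists g => // z; apply/eqP; rewrite -subr_eq0; apply/eqP; apply: inj0.
by rewrite (linB (@fibre_ideal_map_linear k A J p)) gK subrr.
Qed.

Lemma fibre_local_retract : heredity Jp ->
  exists2 s : k, s \notin spec_ideal p & sretract J s.
Proof.
move=> hJ; have [l lX] := ideal_mod_gens.
by apply: (local_retract lX A1) => y /(jfib_eq0 hJ).
Qed.

Lemma fibre_local_adual : heredity Jp -> sdual X 1 ->
  exists2 s : k, s \notin spec_ideal p & adual J s.
Proof.
move=> hJ X1; have [l lX] := ideal_mod_gens.
exact: (local_adual lX JJ A1 X1 (jfib_eq0 hJ) (fibre_adual hJ)).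
Qed.

Section Local.
Variables (s t : k).
Hypotheses (sp : s \notin spec_ideal p) (Jr : sretract J s).
Hypotheses (tp : t \notin spec_ideal p) (Ja : adual J t).

Lemma fibre_bc_jbc : is_bc (fhom p) (jbc (fibre_ideal_bc J p)).
Proof.
by have [c cs] := fhom_unit sp; exact: (bc_jbc (bc_fib p A) (fibre_ideal_bc J p) cs Jr).
Qed.

Lemma fibre_ebc : is_bc (fhom p) (ebc (bc_fib p A) (@fibM k p A) fibre_bc_jbc).
Proof. by have [c ct] := fhom_unit tp; exact: (bc_ebc (bc_fib p A) (@fibM k p A) fibre_bc_jbc ct Ja). Qed.

Lemma fibre_bc_adual : adual Jp 1.
Proof.
have [c ct] := fhom_unit tp; rewrite -ct; apply: (smodZ (adual_ideal Jp) c).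
exact: (bc_adual (bc_fib p A) (@fibM k p A) fibre_bc_jbc Ja).
Qed.

Lemma fibre_heredity : semisimple_ring (end_ideal Jp) -> heredity Jp.
Proof.
move=> Es; have lF := bc_spn (bc_fib p A) lAP; have Rf := resfield_field p.
have [r [rJ rid]] := field_retract Rf (ideal2_sub Jp) lF.
have F1 : sdual (fibre_alg p A) 1.
  by apply: (bc_sdual (c := 1) (bc_fib p A) _ A1); rewrite rmorph1 mulr1.
split=> //.
- apply: sretract_quo_projective F1 _.
  have rl : linear (fun x => Submod (rJ x) : ideal_mod Jp).
    by move=> a x y; apply: jval_inj; rewrite (linearP jval); exact: (linearP r).
  exists (mklin rl) => x; rewrite scale1r; apply: jval_inj.
  by rewrite -[LHS]/(r (jval x)) rid // jval_in.
- exact: adual_projective fibre_bc_adual.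
- exact: fibre_idempotent.
by apply/(field_k_semisimple Rf).
Qed.
End Local.
End Ideals.

(** * From the fibres to the whole ring *)

Section Global.
Variables (k : comPzRingType) (A : pzAlgType k) (J : ideal2 A).
Variable lA : seq A.
Hypotheses (k_noeth : noetherian k) (lAP : forall y, spn lA y).
Hypotheses (A1 : sdual A 1) (JJ : idempotent_ideal J).
Local Notation X := (ideal_mod J).
Local Notation E := (end_ideal J).

Lemma maximal_local_dual :
  (forall p : spec k, maximal_ideal p -> heredity (fibre_ideal J p)) ->
  sretract J 1 /\ adual J 1.
Proof.
move=> hJ.
have r1 : sretract J 1.
  apply: (ideal_local k_noeth (sretract_ideal J)) => p pm.
  exact: (fibre_local_retract k_noeth lAP A1 JJ (hJ p pm)).
(* The order matters: lifting projectivity over A uses that J is projective over [k], which the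
   retraction [r1] provides. *)
split=> //; apply: (ideal_local k_noeth (adual_ideal J)) => p pm.
exact: (fibre_local_adual k_noeth lAP A1 JJ (hJ p pm)) (sretract_sdual A1 r1).
Qed.

Section Fibres.
Hypotheses (r1 : sretract J 1) (a1 : adual J 1).

Lemma fibre_end_bc (p : spec k) : exists i : E -> end_ideal (fibre_ideal J p),
  [/\ is_bc (fhom p) i, forall x y, i (x * y) = i x * i y & i 1 = 1].
Proof.
have b := fibre_ebc (spec1 p) r1 (spec1 p) a1.
exists (ebc (bc_fib p A) (@fibM k p A) (fibre_bc_jbc (spec1 p) r1)).
by split=> //; [exact: ebcM|exact: ebc1].
Qed.

Lemma end_sdual : sdual E 1.
Proof. by have := sdual_end a1 (sretract_sdual A1 r1); rewrite mulr1. Qed.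

Lemma end_gens : exists l : seq E, forall y, spn l y.
Proof.
have [l Hl] := sdual_span end_sdual; exists l => y.
by have := Hl y; rewrite scale1r.
Qed.

(** Since E commutes with base change, its fibre at p is the endomorphism algebra of the fibre
    ideal; semisimplicity is a condition on fibres, so nothing has to be lifted. *)
Lemma heredity_fibres : k_semisimple E <->
  forall p : spec k, heredity (fibre_ideal J p).
Proof.
split=> [Es p|hJ p].
  apply: (fibre_heredity lAP A1 JJ (spec1 p) r1 (spec1 p) a1).
  have [i [ib iM i1]] := fibre_end_bc p.
  exact: (bc_semisimple (bc_fib p E) ib (@fibM k p E) iM (Es p)).
have [i [ib iM i1]] := fibre_end_bc p.
apply: (bc_semisimple ib (bc_fib p E) iM (@fibM k p E)).
by apply/(field_k_semisimple (resfield_field p)); case: (hJ p).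
Qed.

(** Semisimplicity concerns all primes, while the hypothesis of (b) speaks of maximal ideals only;
    separability is first made global and then descends to every fibre. *)
Lemma csep_k_semisimple : csep E 1 -> k_semisimple E.
Proof.
move=> Ec p; have [l lE] := end_gens.
apply: (csep_semisimple (resfield_field p) (bc_spn (bc_fib p E) lE)).
apply: (bc_csep (bc_fib p E) (@fibM k p E) (fib1 p E) (s := 1) (c := 1)) => //.
by rewrite rmorph1 mulr1.
Qed.

Lemma fibre_semisplit p : semisplit_alg E -> semisplit_alg (end_ideal (fibre_ideal J p)).
Proof.
move=> [n [F [Faz EF]]]; have [l lE] := end_gens.
have [i [ib iM i1]] := fibre_end_bc p.
exists n, (fun m => fibre_alg p (F m)); split=> [m|].
  have [phi [phiP phiU]] := EF; have [s [s1 _ _]] := prod_section phiP phiU.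
  have ps (y : F m) : exists x, phi m x = y by exists (s m y); rewrite s1.
  exact: (azumaya_fibre p (bc_alg_spn (phiP m).1 ps lE) (Faz m)).
exact: (alg_product_bc ib iM i1 (fun m => bc_fib p (F m)) (fun m => @fibM k p (F m))
  (fun m => fib1 p (F m)) EF).
Qed.

Lemma fibre_split p : split_alg E -> split_alg (end_ideal (fibre_ideal J p)).
Proof.
move=> [n [Q [QP EF]]]; have [i [ib iM i1]] := fibre_end_bc p.
have Qs m : exists l : seq (Q m), forall y, spn l y by apply: fin_gen_seq; case: (QP m).
have Qd m : sdual (Q m) 1.
  by have [l lQ] := Qs m; apply: projective_sdual lQ _; case: (QP m).
exists n, (fun m => fibre p (Q m)); split=> [m|].
  have d1 : sdual (fibre p (Q m)) 1.
    by apply: (bc_sdual (bc_fib p (Q m)) (s := 1) (c := 1)); rewrite ?rmorph1 ?mulr1.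
  split; last exact: sdual1_projective.
  have [l lQ] := Qs m; have lF := bc_spn (bc_fib p (Q m)) lQ.
  exists (size [seq fib p x | x <- l]), (tnth (in_tuple _)) => y.
  by have [c Hc] := spn_fin (lF y); exists c.
exact: (alg_product_bc ib iM i1 (fun m => bc_endk (bc_fib p (Q m)) (Qd m))
  (fun m => endk_bcM (bc_fib p (Q m))) (fun m => endk_bc1 (bc_fib p (Q m))) EF).
Qed.
End Fibres.

Lemma heredity_local : heredity J <-> forall p : spec k, heredity (fibre_ideal J p).
Proof.
split=> [/(heredityE k_noeth lAP A1 JJ)[r1 a1 Es]|hJ].
  exact/(heredity_fibres r1 a1).
have [r1 a1] := maximal_local_dual (fun p _ => hJ p).
by apply/(heredityE k_noeth lAP A1 JJ); split=> //; apply/(heredity_fibres r1 a1).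
Qed.

Lemma heredity_separable_local : heredity_separable J <->
  forall m : spec k, maximal_ideal m -> heredity_separable (fibre_ideal J m).
Proof.
split=> [[hJ /csep1P Es] m _|hJ].
  split; first exact: (proj1 heredity_local hJ m).
  have /(heredityE k_noeth lAP A1 JJ)[r1 a1 _] := hJ.
  have [i [ib iM i1]] := fibre_end_bc r1 a1 m.
  apply/csep1P; apply: (bc_csep ib iM i1 (s := 1) (c := 1)) => //.
  by rewrite rmorph1 mulr1.
have [r1 a1] := maximal_local_dual (fun p pm => (hJ p pm).1).
have Es : csep E 1.
  apply: (ideal_local k_noeth (csep_ideal E)) => p pm.
  have [i [ib iM i1]] := fibre_end_bc r1 a1 p.
  apply: (local_csep (spec1 p) (end_sdual r1 a1) ib iM i1).
  exact/csep1P/(hJ p pm).2.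
split; last exact/csep1P.
by apply/(heredityE k_noeth lAP A1 JJ); split=> //; apply: csep_k_semisimple.
Qed.
End Global.

(** * Primes of height one in normal domains *)

Section PrincipalIdeals.
Variable k : comPzRingType.

Definition multiple (d b : k) := exists y, b = d * y.

Lemma multiple_ideal d : ideal_like (multiple d).
Proof.
split=> [|_ _ [x ->] [y ->]|a _ [x ->]]; first by exists 0; rewrite mulr0.
  by exists (x + y); rewrite mulrDr.
by exists (a * x); rewrite -[_ *: _]/(a * (d * x)) mulrCA.
Qed.

(** The maximal ideal of k_p is principal, with one denominator [u] for all of p. *)
Definition principal_at (p : spec k) := exists2 d : k, d \in spec_ideal p &
  exists2 u : k, u \notin spec_ideal p & forall x, x \in spec_ideal p -> multiple d (u * x).

Lemma spec_gens (p : spec k) : noetherian k -> exists2 l : seq k,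
  (forall a, a \in l -> a \in spec_ideal p) & forall a, a \in spec_ideal p -> @spn k k^o l a.
Proof. by move=> kN; apply: ideal_gens (ideal_like_mem p). Qed.

Lemma spn_mkseq (M : lmodType k) (D : nat -> M) n y : spn (mkseq D n) y ->
  exists c : nat -> k, y = \sum_(i < n) c i *: D i.
Proof.
have SP : smod (fun y => exists c : nat -> k, y = \sum_(i < n) c i *: D i).
  split=> [|_ _ [c ->] [c' ->]|a _ [c ->]].
  - by exists (fun _ => 0); rewrite big1 // => i _; rewrite scale0r.
  - by exists (fun i => c i + c' i); rewrite -big_split; apply: eq_bigr => i _; rewrite scalerDl.
  by exists (fun i => a * c i); rewrite scaler_sumr; apply: eq_bigr => i _; rewrite scalerA.
move: y; apply: (spn_ind SP) => z /mapP[j]; rewrite mem_iota add0n => /andP[_ jn] ->.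
exists (fun i => (i == j)%:R); rewrite (bigD1 (Ordinal jn)) //= eqxx scale1r big1 ?addr0 //.
by move=> i; rewrite -val_eqE /= => /negPf ->; rewrite scale0r.
Qed.

Lemma addspan_scaled (M : lmodType k) (C : k -> Prop) (D : M -> Prop) (l : seq M) a y :
  ideal_like C -> smod D -> C a -> spn l y -> addspan C D l (a *: y).
Proof.
move=> CP DP Ca; have SP : smod (fun y => addspan C D l (a *: y)).
  have AP := smod_addspan l CP DP; split=> [|x z Hx Hz|b x Hx].
  - by rewrite scaler0; apply: (smod0 AP).
  - by rewrite scalerDr; apply: (smodD AP).
  by rewrite scalerA mulrC -scalerA; apply: (smodZ AP).
by move=> Hy; move: y Hy; apply: (spn_ind SP) => x xl; apply: addspan_mem.
Qed.
End PrincipalIdeals.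

Section Domains.
Variables (k : comPzRingType) (k_noeth : noetherian k) (dom : is_domain k).

Lemma dom_mulI (a b c : k) : a <> 0 -> a * b = a * c -> b = c.
Proof.
move=> a0 abc; have : a * (b - c) = 0 by rewrite mulrBr abc subrr.
by case/dom.2 => // /eqP; rewrite subr_eq0 => /eqP.
Qed.

Lemma dom_mul_neq0 (a b : k) : a <> 0 -> b <> 0 -> a * b <> 0.
Proof. by move=> a0 b0 /dom.2[]. Qed.

Lemma dom_exp_neq0 (a : k) n : a <> 0 -> a ^+ n <> 0.
Proof.
move=> a0; elim: n => [|n IHn]; first by rewrite expr0; exact: dom.1.
by rewrite exprS; apply: dom_mul_neq0.
Qed.

Definition zero_spec : spec k := Spec (zero_pred_prime dom).
Lemma zero_specE a : (a \in spec_ideal zero_spec) <-> a = 0.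
Proof. by rewrite inE; split=> [/eqP|->]. Qed.

Lemma height_le1P (p : spec k) : height_le p 1 <->
  forall q : spec k, {subset spec_ideal q <= spec_ideal p} ->
    ~ {subset spec_ideal p <= spec_ideal q} -> forall x, x \in spec_ideal q -> x = 0.
Proof.
split=> [hp q qp pq x xq|hp n c cc cp].
  apply: contrapT => x0.
  pose c (i : 'I_3) := if i == 0%N :> nat then zero_spec else if i == 1%N :> nat then q else p.
  have zq : {subset spec_ideal zero_spec <= spec_ideal q}.
    by move=> y /zero_specE ->; apply: (smod0 (smod_mem q)).
  have qz : ~ {subset spec_ideal q <= spec_ideal zero_spec} by move=> /(_ x xq)/zero_specE.
  suff cc : prime_chain c by have := hp 2 c cc (fun y => erefl).
  case=> [[|[|[|i]]] Hi] [[|[|[|j]]] Hj] //= _; rewrite /c /=; split=> //.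
    by move=> y yy; apply/qp/zq.
  by move=> yy; apply: pq => z zp; apply/zq/yy.
rewrite leqNgt; apply/negP => n2.
case: n n2 c cc cp => [|[|n]] // _ c cc cp.
pose i1 : 'I_n.+3 := inord n.+1; pose i0 : 'I_n.+3 := inord n.
have e1 : nat_of_ord i1 = n.+1 by rewrite inordK.
have e0 : nat_of_ord i0 = n by rewrite inordK // ltnS leqW.
have [s1 t1] : {subset c i1 <= c ord_max} /\ ~ {subset c ord_max <= c i1} by apply: cc; rewrite e1.
have [s0 t0] : {subset c i0 <= c i1} /\ ~ {subset c i1 <= c i0} by apply: cc; rewrite e1 e0.
apply: t0 => x x1.
have -> : x = 0.
  apply: (hp (c i1)) x1 => [y|pc]; first by rewrite -cp; apply: s1.
  by apply: t1 => y; rewrite cp; apply: pc.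
exact: (smod0 (smod_mem (c i0))).
Qed.

(** A prime q strictly below p does not contain the local generator d of p, so q = d q at p and
    Nakayama's lemma gives q = 0. *)
Lemma principal_height (p : spec k) : principal_at p -> height_le p 1.
Proof.
move=> [d dp [u up pd]]; apply/height_le1P => q qp pq.
have dq : d \notin spec_ideal q.
  apply/negP => dq; apply: pq => x /pd[y uxy].
  have : u * x \in spec_ideal q by rewrite uxy; apply: specMr.
  by case/(spec_prime q).2 => // /qp uq; move: up; rewrite uq.
have [l lq ql] := spec_gens q k_noeth.
have [|s sp Hs] := @nakayama_seq k p k^o (fun y => y = 0) l (@smod_zero k k^o).
  move=> x xl; exists u => //.
  have [y uxy] := pd _ (qp _ (lq _ xl)).
  have yq : y \in spec_ideal q.
    have : d * y \in spec_ideal q by rewrite -uxy; apply: specMl; apply: lq.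
    by case/(spec_prime q).2 => // dq'; rewrite dq' in dq.
  rewrite -[_ *: _]/(u * x) uxy.
  exact: (@addspan_scaled k k^o (fun a => a \in spec_ideal p) _ l d y (ideal_like_mem p) (@smod_zero k k^o) dp (ql _ yq)).
move=> x xq; have : s * x = 0.
  move: (ql _ xq); move: x {xq}.
  apply: (spn_ind (M := k^o) (E := fun x => s * x = 0)) => [|x xl]; last exact: Hs.
  split=> [|x y Hx Hy|a x Hx]; first by rewrite mulr0.
    by rewrite mulrDr Hx Hy addr0.
  by rewrite -[a *: x]/(a * x) mulrCA Hx mulr0.
by case/dom.2 => // s0; case: (spec_neq0 sp).
Qed.
End Domains.

(** The equation is s^n times an equation of integral dependence for b/s. *)
Lemma integral_multiple (k : comPzRingType) (s b : k) n (c : 'I_n -> k) :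
  integrally_closed_domain k -> s <> 0 ->
  b ^+ n + \sum_(i < n) c i * (b ^+ i * s ^+ (n - i)) = 0 -> multiple s b.
Proof.
move=> [dom kI] s0 bs.
have sp : s \notin spec_ideal (zero_spec dom) by apply/negP => /zero_specE.
pose h := @loc_hom k (zero_spec dom).
have [e es] := loc_unit sp; rewrite -/h in es.
have hX m : h (b ^+ m) = (h b) ^+ m by rewrite /h rmorphXn.
have [a Ha] : exists a, e * h b = to_fracfield dom a.
  apply: kI; exists n, c.
  transitivity (e ^+ n * h (b ^+ n + \sum_(i < n) c i * (b ^+ i * s ^+ (n - i)))).
    rewrite /h rmorphD rmorph_sum mulrDr exprMn rmorphXn; congr (_ + _).
    rewrite mulr_sumr; apply: eq_bigr => i _; rewrite !rmorphM !rmorphXn exprMn.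
    rewrite -[to_fracfield _ _]/(h (c i)) -/h.
    have -> : e ^+ n = e ^+ i * e ^+ (n - i) by rewrite -exprD subnKC // ltnW.
    rewrite -[LHS]mulr1 -(expr1n _ (n - i)) -es exprMn; ring.
  by rewrite bs /h rmorph0 mulr0.
exists a; have : h b = h (s * a).
  have -> : h (s * a) = h s * h a by rewrite /h rmorphM.
  by rewrite -[h a]/(to_fracfield dom a) -Ha mulrA [h s * e]mulrC es mul1r.
move/locfracP => [w]; rewrite dval1 !scale1r => H.
by apply: dom_mulI H => //; apply: spec_neq0 (valP w).
Qed.

(** A maximal element among the annihilators of the non-zero classes r b in k/(s) is prime. *)
Lemma associated_prime (k : comPzRingType) (s b : k) : noetherian k -> ~ multiple s b ->
  exists (p : spec k) (r : k), ~ multiple s (r * b) /\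
    forall a, a \in spec_ideal p <-> multiple s (a * (r * b)).
Proof.
move=> k_noeth sb; pose C r a := multiple s (a * (r * b)).
have CP r : ideal_like (C r).
  have [M0 MD MZ] := multiple_ideal s; split=> [|x y Hx Hy|a x Hx]; rewrite /C.
  - by rewrite mul0r.
  - by rewrite mulrDl; apply: MD.
  by rewrite -[a *: x]/(a * x) -mulrA; apply: MZ.
have [||C0 [r [-> r1]] rm] := @ideal_max k k_noeth (fun D => exists r, D = C r /\ ~ C r 1).
- by move=> D [r [-> _]].
- by exists (C 1), 1; split=> //; rewrite /C !mul1r.
have prC x y : C r (x * y) -> C r x \/ C r y.
  move=> xy; have [|nx] := pselect (C r x); [by left|right].
  apply: (rm (C (x * r))).
  - by exists (x * r); split=> //; rewrite /C mul1r -mulrA.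
  - move=> a [z Hz]; exists (x * z); rewrite -mulrA mulrCA Hz; ring.
  by move: xy => [z Hz]; exists z; rewrite -Hz; ring.
exists (mkspec (CP r) r1 prC), r; split; first by have := r1; rewrite /C mul1r.
by move=> a; apply: mkspecE.
Qed.

Section NormalDomains.
Variables (k : comPzRingType) (k_noeth : noetherian k) (kI : integrally_closed_domain k).
Let dom : is_domain k := let: ex_intro d _ := kI in d.

(* If all quotients b x / d stayed in p, then b / d would be integral. *)
Lemma conductor_principal (p : spec k) (d b : k) : d <> 0 -> ~ multiple d b ->
  (forall x, x \in spec_ideal p -> multiple d (b * x)) -> principal_at p.
Proof.
move=> d0 bd bp.
have [[x xp x0]|p0] := pselect (exists2 x, x \in spec_ideal p & x <> 0); last first.
  exists 0; first exact: (smod0 (smod_mem p)).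
  exists 1; first exact: spec1.
  move=> x xp; exists 0; rewrite mul1r mulr0.
  by apply: contrapT => x0; apply: p0; exists x.
pose B x y := b * x = d * y.
(* If b y = d z with z outside p, then y generates p at p: b w = d v implies z w = y v. *)
have [[y yp [z zp Bz]]|pp] := pselect (exists2 y, y \in spec_ideal p & exists2 z, z \notin spec_ideal p & B y z).
  exists y => //; exists z => // w wp; have [v Bv] := bp _ wp.
  exists v; apply: (dom_mulI dom d0).
  by rewrite mulrA -Bz [d * (y * v)]mulrCA -Bv; ring.
have step y : exists z, y \in spec_ideal p -> B y z /\ z \in spec_ideal p.
  have [yp|yp] := boolP (y \in spec_ideal p); last by exists 0.
  have [z Bz] := bp _ yp; exists z => _; split=> //.
  by apply: contrapT => /negP zp; apply: pp; exists y => //; exists z.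
have [g Hg] := choice step.
(* [D i] is x (b/d)^i. The spans of its initial segments become stationary, which is an equation of
   integral dependence for b/d after cancelling x. *)
pose D i := iter i g x.
have Dp i : D i \in spec_ideal p by elim: i => [|i IHi] //=; case: (Hg _ IHi).
have DS i : b * D i = d * D i.+1 by case: (Hg _ (Dp i)).
have DX i : b ^+ i * x = d ^+ i * D i.
  elim: i => [|i IHi]; first by rewrite !expr0.
  by rewrite exprS -mulrA IHi mulrCA DS exprS; ring.
have [||C [n ->] Cm] := @ideal_max k k_noeth (fun C => exists n, C = @spn k k^o (mkseq D n)).
- by move=> C [n ->]; apply: smod_spn.
- by exists (@spn k k^o (mkseq D 0)), 0%N.
have /spn_mkseq[c Hc] : @spn k k^o (mkseq D n) (D n).
  apply: (Cm (@spn k k^o (mkseq D n.+1))); first by exists n.+1.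
    apply: (spn_ind (M := k^o) (E := fun x => @spn k k^o (mkseq D n.+1) x)).
      exact: smod_spn.
    move=> y /mapP[i]; rewrite mem_iota => /andP[_ Hi] ->; apply: spn_mem.
    by apply/mapP; exists i; rewrite // mem_iota /= add0n ltnS ltnW.
  by apply: spn_mem; apply/mapP; exists n; rewrite // mem_iota add0n leqnn.
case: bd; apply: (integral_multiple (c := fun i : 'I_n => - c i) kI d0).
apply: (dom_mulI dom x0); rewrite mulr0 mulrDr [x * b ^+ n]mulrC DX Hc.
rewrite !mulr_sumr -big_split big1 // => i _.
rewrite -[c i *: D i]/(c i * D i) /=.
have -> : x * (- c i * (b ^+ i * d ^+ (n - i))) = - (c i * d ^+ (n - i) * (b ^+ i * x)) by ring.
have -> : d ^+ n = d ^+ i * d ^+ (n - i) by rewrite -exprD subnKC // ltnW.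
by rewrite DX; apply/eqP; rewrite subr_eq0; apply/eqP; ring.
Qed.

(** A normal domain is the intersection of its localisations in height one: by [conductor_principal]
    an associated prime of k/(s) is locally principal, hence of height at most one. *)
Lemma height1_multiple (s b : k) : s <> 0 ->
  (forall p : spec k, height_le p 1 -> exists2 t, t \notin spec_ideal p & multiple s (t * b)) ->
  multiple s b.
Proof.
move=> s0 Hb; apply: contrapT => /(associated_prime k_noeth)[p [r [nb pE]]].
have pp : principal_at p by apply: (conductor_principal s0 nb) => x /pE; rewrite mulrC.
have [t tp [y ty]] := Hb _ (principal_height k_noeth dom pp).
by move/negP: tp; apply; apply/pE; exists (r * y); rewrite mulrCA ty; ring.
Qed.

(** Take the least power q^(m+1) inside (a) at q. Some product y of m elements of q is not in (a) at
    q, but y q is, so [conductor_principal] applies to the fraction y/a. *)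
Lemma powsub_principal (q : spec k) (a : k) T : a <> 0 -> a \in spec_ideal q ->
  powsub q T (@loc_in k q k^o (multiple a)) -> principal_at q.
Proof.
move=> a0 aq HT; have aP := multiple_ideal a.
have exT : exists T, `[< powsub q T (@loc_in k q k^o (multiple a)) >].
  by exists T; apply/asboolP.
case: (ex_minnP exT) => -[|m] /asboolP Pm mm.
  have [|s sq [y Hy]] := Pm [::] erefl; first by [].
  move/negP: sq; case; rewrite -[s]mulr1 -[1](@big_nil k 1 *%R k (fun _ => true) id).
  by move: Hy; rewrite -[_ *: _]/(s * _) => ->; apply: specMr.
have /contrapT : ~ ~ exists l : seq k, [/\ size l = m, forall x, x \in l -> x \in spec_ideal q &
    ~ @loc_in k q k^o (multiple a) (\prod_(x <- l) x)].
  move=> nl; suff /asboolP/mm : powsub q m (@loc_in k q k^o (multiple a)) by rewrite ltnn.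
  by move=> l sl lq; apply: contrapT => H; apply: nl; exists l.
move=> [l [sl lq yl]]; set y := \prod_(x <- l) x in yl.
have [g gq qg] := spec_gens q k_noeth.
have [|s sq Hs] := @loc_in_span k q k^o (multiple a) [seq y * x | x <- g] aP.
  move=> _ /mapP[x xg ->]; have := Pm (x :: l); rewrite big_cons mulrC; apply; first by rewrite /= sl.
  by move=> z; rewrite inE => /orP[/eqP ->|/lq //]; apply: gq.
apply: (conductor_principal a0 (b := s * y)) => [sy|x xq].
  by apply: yl; exists s.
rewrite -mulrA; apply: (Hs (y * x)); move: (qg _ xq); move: x {xq}.
apply: (spn_ind (M := k^o) (E := fun x => @spn k k^o [seq y * x | x <- g] (y * x))).
  have SP := @smod_spn k k^o [seq y * x | x <- g].
  split=> [|x z Hx Hz|c x Hx]; first by rewrite mulr0; apply: (smod0 SP).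
    by rewrite mulrDr; apply: (smodD SP).
  by rewrite -[c *: x]/(c * x) mulrCA; apply: (smodZ SP).
by move=> x xg; apply: spn_mem; apply: map_f.
Qed.

Lemma height1_principal (p : spec k) : height_le p 1 -> principal_at p.
Proof.
move=> /(height_le1P dom) hp.
have [[a ap a0]|p0] := pselect (exists2 x, x \in spec_ideal p & x <> 0); last first.
  exists 0; first exact: (smod0 (smod_mem p)).
  exists 1; first exact: spec1.
  move=> x xp; exists 0; rewrite mul1r mulr0.
  by apply: contrapT => x0; apply: p0; exists x.
have aP := multiple_ideal a.
have [|q [aq qp [T HT]]] := @minimal_prime k k_noeth (multiple a) p aP.
  by move=> _ [y ->]; apply: specMr.
have aq' : a \in spec_ideal q by apply: aq; exists 1; rewrite mulr1.
have pq : {subset spec_ideal p <= spec_ideal q}.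
  by apply: contrapT => npq; apply: a0; apply: (hp q).
suff [d dq [u uq qd]] : principal_at q.
  exists d; first exact: qp.
  exists u; first by apply/negP => /pq uq'; move: uq; rewrite uq'.
  by move=> x /pq; apply: qd.
exact: powsub_principal a0 aq' HT.
Qed.
End NormalDomains.

(** * Central separable algebras *)

Section InnerMaps.
Variables (k : comPzRingType) (F : pzAlgType k).

(** Membership in the image of F (x) F^op -> End_k(F). *)
Definition inner (H : endk F) :=
  exists s : seq (F * F), forall z, endo_fun H z = \sum_(u <- s) u.1 * z * u.2.

Lemma inner_smod : smod inner.
Proof.
split=> [|f g [s Hs] [t Ht]|a f [s Hs]].
- by exists [::] => z; rewrite big_nil.
- by exists (s ++ t) => z; rewrite endkD Hs Ht big_cat.
exists [seq (a *: u.1, u.2) | u <- s] => z.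
rewrite endkZ Hs big_map scaler_sumr; apply: eq_bigr => u _ /=.
by rewrite -!pzscaleAl.
Qed.
End InnerMaps.

Section FieldCentral.
Variables (K : comPzRingType) (Kf : field_like K).

(** A linear retraction of K^I onto the image of z -> (g_i z) inverts this injection. *)
Lemma field_functionals (M : lmodType K) (I : finType) (g : I -> {linear M -> K^o}) :
  (forall z, (forall i, g i z = 0) -> z = 0) ->
  exists w : I -> M, forall z, z = \sum_i (g i z : K) *: w i.
Proof.
move=> g0; pose V := {ffun I -> K^o}.
pose e (i : I) : V := ffsingle i (1 : K^o).
have eE (v : V) : v = \sum_i (v i : K) *: e i.
  rewrite {1}(ffun_single v); apply: eq_bigr => i _; apply/ffunP => j.
  by rewrite !ffunE; case: eqP => _; rewrite ?scaler0 // -[RHS]/(v i * 1) mulr1.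
pose G z : V := [ffun i => g i z].
have Gl : linear G by move=> a x y; apply/ffunP => i; rewrite !ffunE linearP.
have SP : smod (fun v => exists z, v = G z).
  split=> [|_ _ [x ->] [y ->]|a _ [x ->]]; first by exists 0; rewrite (lin0 Gl).
    by exists (x + y); rewrite (linD Gl).
  by exists (a *: x); rewrite (linZ Gl).
have VS : forall v : V, spn [seq e i | i <- index_enum I] v by move=> v; rewrite (eE v); apply: spn_sum.
have [r [rS rid]] := field_retract Kf (mksub SP) VS.
have ex v : exists z, r v = G z by apply/(mksubE SP).
pose h v := sval (cid (ex v)); have hE v : G (h v) = r v by rewrite /h; case: cid.
have GI x y : G x = G y -> x = y.
  move=> xy; apply/eqP; rewrite -subr_eq0; apply/eqP; apply: g0 => i.
  by rewrite linearB; move/ffunP/(_ i): xy; rewrite !ffunE => ->; rewrite subrr.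
have hl : linear h by move=> a u v; apply: GI; rewrite Gl !hE linearP.
exists (fun i => h (e i)) => z.
have <- : h (G z) = z by apply: GI; rewrite hE rid //; apply/(mksubE SP); exists z.
rewrite {1}(eE (G z)) (linsum hl); apply: eq_bigr => i _; rewrite (linZ hl) ffunE.
by rewrite (_ : h (G z) = z) //; apply: GI; rewrite hE rid //; apply/(mksubE SP); exists z.
Qed.

(* Averaging u z v over a separability idempotent is a functional with values in
   the centre; two-sided averaging of a projection onto an ideal produces a
   central idempotent generating that ideal, so the only ideals are trivial. *)
Lemma central_inner (F : pzAlgType K) (l : seq F) : (forall y, spn l y) ->
  csep F 1 ->
  (forall z : F, (forall x, z * x = x * z) -> exists a : K, z = a *: (1 : F)) ->
  forall H : endk F, inner H.
Proof.
move=> lF /csep_bilin[u [um uc]] Fc H.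
have [F1|F1] := pselect ((1 : F) = 0).
  by exists [::] => z; rewrite big_nil -[LHS]mul1r F1 mul0r.
rewrite scale1r in um.
have unitI (a : K) : a *: (1 : F) = 0 -> a = 0.
  move=> a1; apply: contrapT => /(field_inv Kf)[b ba]; apply: F1.
  by rewrite -[LHS]scale1r -ba -scalerA a1 scaler0.
have [tau Ht] := choice (fun z => Fc _ (fun x => esym (csep_central uc z x))).
have avl : linear (fun z : F => \sum_(v <- u) v.1 * z * v.2).
  apply: sum_linear => v a x y.
  by rewrite mulrDr mulrDl -pzscaleAr -pzscaleAl.
have tl : linear (fun z => tau z : K^o).
  move=> a x y; apply/eqP; rewrite -subr_eq0; apply/eqP; apply: unitI.
  by rewrite scalerBl scalerDl -[_ *: (tau x : K^o)]/(a * tau x) -scalerA -!Ht avl subrr.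
(* The radical of the form tau(a z b), a two-sided ideal. Once it is 0, the finitely many
   functionals tau(x_i z x_j) separate points, and every z is a combination of fixed elements with
   these coefficients. *)
pose N z := forall a b, tau (a * z * b) = 0.
have NP : smod N.
  split=> [a b|x y Nx Ny a b|c x Nx a b].
  - by rewrite mulr0 mul0r; exact: (lin0 tl).
  - by rewrite mulrDr mulrDl (linD tl) Nx Ny addr0.
  by rewrite -pzscaleAr -pzscaleAl (linZ tl) Nx; exact: mulr0.
have Nl a x : N x -> N (a * x) by move=> Nx b c; rewrite !mulrA Nx.
have Nr a x : N x -> N (x * a) by move=> Nx b c; rewrite !mulrA -[_ * a * c]mulrA Nx.
have [r [rS rid]] := field_retract Kf (mksub NP) lF.
pose r1 x := \sum_(v <- u) v.1 * r (v.2 * x).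
have r1l e x : r1 (e * x) = e * r1 x.
  have bl (y : F) : linear (fun a : F => a * r (y * x)) by move=> a b c; rewrite mulrDl -pzscaleAl.
  have br (a : F) : linear (fun y : F => a * r (y * x)).
    by move=> c y z; rewrite mulrDl -pzscaleAl linearP mulrDr -pzscaleAr.
  have := uc _ (fun a y => a * r (y * x)) bl br e; rewrite /r1 mulr_sumr => He.
  under eq_bigr => v _ do rewrite mulrA.
  by rewrite -He; apply: eq_bigr => v _; rewrite mulrA.
have r1lin : linear r1.
  apply: sum_linear => v a x y; rewrite mulrDr -pzscaleAr linearP mulrDr.
  by rewrite -pzscaleAr.
pose r2 x := \sum_(v <- u) r1 (x * v.1) * v.2.
have r2l e x : r2 (e * x) = e * r2 x.
  by rewrite mulr_sumr; apply: eq_bigr => v _; rewrite -mulrA r1l mulrA.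
have r2r e x : r2 (x * e) = r2 x * e.
  have bl (y : F) : linear (fun a : F => r1 (x * a) * y).
    by move=> c a b; rewrite mulrDr -pzscaleAr r1lin mulrDl -pzscaleAl.
  have br (a : F) : linear (fun y : F => r1 (x * a) * y) by move=> c y z; rewrite mulrDr -pzscaleAr.
  have := uc _ (fun a y => r1 (x * a) * y) bl br e; rewrite /r2 mulr_suml => He.
  under eq_bigr => v _ do rewrite -mulrA.
  by rewrite He; apply: eq_bigr => v _; rewrite mulrA.
have r1N x : N (r1 x) by apply: (smod_sum NP) => v _; apply/Nl/(mksubE NP).
have r1id x : N x -> r1 x = x.
  move=> Nx; rewrite -[RHS]mul1r -um mulr_suml; apply: eq_bigr => v _.
  by rewrite rid ?mulrA //; apply/(mksubE NP)/Nl.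
have r2N x : N (r2 x) by apply: (smod_sum NP) => v _; apply: Nr.
have r2id x : N x -> r2 x = x.
  move=> Nx; rewrite -[RHS]mulr1 -um mulr_sumr; apply: eq_bigr => v _.
  by rewrite r1id ?mulrA //; apply: Nr.
have [a Ha] : exists a : K, r2 1 = a *: (1 : F).
  by apply: Fc => x; rewrite -r2r -r2l mulr1 mul1r.
(* As a bimodule map, [r2] is multiplication by the scalar [a]. For a = 0 the ideal N is 0;
   otherwise 1 lies in N, so tau(1) = 0, whereas averaging 1 gives 1. *)
have N0 z : N z -> z = 0.
  move=> Nz; apply: contrapT => z0.
  have [a0|/(field_inv Kf)[b ba]] := pselect (a = 0).
    by apply: z0; rewrite -(r2id _ Nz) -[z]mulr1 r2l Ha a0 scale0r mulr0.
  have : N 1 by rewrite -[1]scale1r -ba -scalerA -Ha; apply: (smodZ NP).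
  move=> /(_ 1 1); rewrite !mulr1 => t1; apply: F1.
  rewrite -um; transitivity (\sum_(v <- u) v.1 * 1 * v.2).
    by apply: eq_bigr => v _; rewrite mulr1.
  by rewrite Ht t1 scale0r.
pose x := tnth (in_tuple l).
have gl (ij : 'I_(size l) * 'I_(size l)) : linear (fun z => tau (x ij.1 * z * x ij.2) : K^o).
  by move=> c y z; rewrite mulrDr mulrDl -pzscaleAr -pzscaleAl; exact: tl.
have [z0|w Hw] := @field_functionals F _ (fun ij => mklin (gl ij)).
  move=> Hz; apply: N0 => b c.
  have xz (i j : 'I_(size l)) : tau (x i * z0 * x j) = 0 by have := Hz (i, j).
  have SPc (i : 'I_(size l)) : smod (fun c => tau (x i * z0 * c) = 0).
    exact: (smod_ker (mklin (comp_linear (mklin tl) (mklin (mull_linear (x i * z0)))))).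
  have xc i : tau (x i * z0 * c) = 0.
    have : spn l c by []. 
    move: (c); apply: (spn_ind (SPc i)) => y /(tnthP (in_tuple l))[j ->]; exact: xz.
  have SPb : smod (fun b : F => tau (b * (z0 * c)) = 0).
    exact: (smod_ker (mklin (comp_linear (mklin tl) (mklin (mulr_linear_alg (z0 * c)))))).
  rewrite -mulrA; have : spn l b by [].
  move: (b); apply: (spn_ind SPb) => y /(tnthP (in_tuple l))[i ->]; rewrite mulrA; exact: xc.
have IP := inner_smod F.
have -> : H = \sum_ij \sum_(v <- u)
   ((mklin (comp_linear (mklin (mull_linear (v.1 * x ij.1)))
           (mklin (mulr_linear_alg (x ij.2 * v.2 * endo_fun H (w ij))))) : {linear F -> F}) : endk F).
  apply: endoP => z; rewrite endk_sum {1}(Hw z) linear_sum.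
  apply: eq_bigr => ij _; rewrite endk_sum linearZ_LR.
  transitivity ((tau (x ij.1 * z * x ij.2) *: (1 : F)) * endo_fun H (w ij)).
    by rewrite -pzscaleAl mul1r.
  by rewrite -Ht mulr_suml; apply: eq_bigr => v _; rewrite /= !mulrA.
apply: (smod_sum IP) => ij _; apply: (smod_sum IP) => v _.
by eexists [:: (_, _)] => z; rewrite big_seq1 /= mulrA.
Qed.

Lemma endk_azumaya (V : lmodType K) (l : seq V) (v : V) : (forall y, spn l y) ->
  v <> 0 -> azumaya (endk V).
Proof.
move=> lV v0; have [n [x [f [xf fx]]]] := field_basis Kf lV.
case: n x f xf fx => [|n] x f xf fx; first by case: v0; rewrite [v]xf big_ord0.
have ex (e : endk V) i : e * rank1 (f ord0) (x i) = \sum_m (f m (endo_fun e (x i)) : K) *: rank1 (f ord0) (x m).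
  apply: endoP => y; rewrite endkM rank1E linearZ_LR endk_sum {1}[endo_fun e (x i)]xf scaler_sumr.
  by apply: eq_bigr => m _; rewrite endkZ rank1E !scalerA mulrC.
have xe (e : endk V) i : rank1 (f i) (x ord0) * e = \sum_m (f i (endo_fun e (x m)) : K) *: rank1 (f m) (x ord0).
  apply: endoP => y; rewrite endkM rank1E endk_sum {1}[y]xf linear_sum linear_sum scaler_suml.
  by apply: eq_bigr => m _; rewrite !linearZ_LR endkZ rank1E scalerA mulrC.
split.
(* The Casimir element of a matrix algebra, the sum of e_i0 (x) e_0i in matrix units. *)
- apply/csep1P; pose t := \sum_i tens (rank1 (f ord0) (x i)) (rank1 (f i) (x ord0)).
  exists t; split.
    rewrite (linsum (@mult_linear _ _)) scale1r; apply: endoP => y.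
    rewrite endk_sum [RHS]xf; apply: eq_bigr => i _.
    rewrite mult_tens endkM !rank1E linearZ_LR fx eqxx; congr (_ *: _); exact: mulr1.
  move=> e; rewrite (linsum (lact_linr e)) (linsum (ract_linl e)).
  transitivity (\sum_i \sum_m (f m (endo_fun e (x i)) : K) *: tens (rank1 (f ord0) (x m)) (rank1 (f i) (x ord0))).
    apply: eq_bigr => i _; rewrite lact_tens ex (linsum (tens_linl _)).
    by apply: eq_bigr => m _; rewrite (linZ (tens_linl _)).
  rewrite exchange_big; apply: eq_bigr => i _; rewrite ract_tens xe (linsum (tens_linr _)).
  by apply: eq_bigr => m _; rewrite (linZ (tens_linr _)).
- move=> a a1; apply: contrapT => /(field_inv Kf)[b ba]; apply: v0.
  rewrite -[v]scale1r -ba -scalerA -[v]/(endo_fun (1 : endk V) v) -endkZ a1.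
  by rewrite -[X in _ *: X]/(0 : V) scaler0.
move=> z zc; exists (f ord0 (endo_fun z (x ord0))); apply: endoP => y.
have := congr1 (fun g : endk V => endo_fun g (x ord0)) (zc (rank1 (f ord0) y)).
by rewrite !endkM !rank1E fx eqxx (_ : true%:R = 1) // scale1r.
Qed.
End FieldCentral.

Section ProductSections.
Variables (k : comPzRingType) (E : pzAlgType k) (n : nat) (F : 'I_n -> pzAlgType k).
Variables (phi : forall i, E -> F i) (s : forall i, {linear F i -> E}).
Hypotheses (phiP : forall i, alg_hom (phi i))
  (phiU : forall y : (forall i, F i), exists! x, forall i, phi i x = y i).
Hypotheses (s1 : forall i y, phi i (s i y) = y) (s2 : forall i j y, j != i -> phi j (s i y) = 0).

Lemma section_mul_l i x y : x * s i y = s i (phi i x * y).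
Proof.
apply: (prod_inj phiU) => j; rewrite (prod_homM phiP).
have [->|ji] := eqVneq j i; first by rewrite !s1.
by rewrite !s2 // mulr0.
Qed.
Lemma section_mul_r i x y : s i y * x = s i (y * phi i x).
Proof.
apply: (prod_inj phiU) => j; rewrite (prod_homM phiP).
have [->|ji] := eqVneq j i; first by rewrite !s1.
by rewrite !s2 // mul0r.
Qed.
End ProductSections.

Section ProductAlgebras.
Variables (k : comPzRingType) (E : pzAlgType k).

Lemma product_csep n (F : 'I_n -> pzAlgType k) : alg_product E F ->
  (forall i, csep (F i) 1) -> csep E 1.
Proof.
move=> [phi [phiP phiU]] Fs; have [s [s1 s2 s3]] := prod_section phiP phiU.
have eS := section_mul_l phiP phiU s1 s2; have Se := section_mul_r phiP phiU s1 s2.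
have sM i x y : s i (x * y) = s i x * s i y by rewrite eS s1.
pose u i := sval (cid (csep_bilin (Fs i))).
have Hu i := svalP (cid (csep_bilin (Fs i))); rewrite -/(u _) in Hu.
exists (\sum_i \sum_(v <- u i) tens (s i v.1) (s i v.2)); split.
  rewrite (linsum (@mult_linear _ _)) scale1r [RHS]s3; apply: eq_bigr => i _.
  rewrite (prod_hom1 phiP) -[1 in RHS](scale1r (1 : F i)) -(Hu i).1 linear_sum (linsum (@mult_linear _ _)).
  by apply: eq_bigr => v _; rewrite mult_tens sM.
move=> e; rewrite (linsum (lact_linr e)) (linsum (ract_linl e)).
apply: eq_bigr => i _; rewrite (linsum (lact_linr e)) (linsum (ract_linl e)).
have bl (y : F i) : linear (fun x : F i => tens (s i x) (s i y)).
  by move=> a x z; rewrite linearP tens_linl.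
have br (x : F i) : linear (fun y : F i => tens (s i x) (s i y)).
  by move=> a y z; rewrite linearP tens_linr.
have := (Hu i).2 _ (fun x y => tens (s i x) (s i y)) bl br (phi i e).
under eq_bigr => v _ do rewrite -eS.
under [X in _ = X -> _]eq_bigr => v _ do rewrite -Se.
move=> He; transitivity (\sum_(v <- u i) tens (e * s i v.1) (s i v.2)).
  by apply: eq_bigr => v _; rewrite lact_tens.
by rewrite He; apply: eq_bigr => v _; rewrite ract_tens.
Qed.

Lemma semisplit_csep : semisplit_alg E -> csep E 1.
Proof.
by move=> [n [F [FP EF]]]; apply: (product_csep EF) => i; apply/csep1P; case: (FP i).
Qed.

Lemma product_restrict n (F : 'I_n -> pzAlgType k) (P : pred 'I_n) :
  (forall i, ~~ P i -> forall x y : F i, x = y) -> alg_product E F ->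
  alg_product E (fun j : 'I_(#|P|) => F (enum_val j)).
Proof.
move=> F0 [phi [phiP phiU]]; have [s [s1 s2 s3]] := prod_section phiP phiU.
exists (fun j => phi (enum_val j)); split=> // y.
exists (\sum_j s (enum_val j) (y j)); split=> [j|x Hx].
  rewrite (linsum (prod_homL phiP _)) (bigD1 j) //= s1 big1 ?addr0 // => j' jj'.
  by rewrite s2 // (inj_eq enum_val_inj) eq_sym.
apply: (prod_inj phiU) => i; have [Pi|nPi] := boolP (P i); last exact: F0.
have [j ->] : exists j : 'I_(#|P|), i = enum_val j.
  by exists (enum_rank_in Pi i); rewrite enum_rankK_in.
rewrite (linsum (prod_homL phiP _)) (bigD1 j) //= s1 big1 ?addr0 // => j' jj'.
by rewrite s2 // (inj_eq enum_val_inj) eq_sym.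
Qed.
End ProductAlgebras.

(** A split algebra may have factors End(0) = 0, which are not Azumaya; they are discarded first. *)
Lemma field_split_semisplit (K : comPzRingType) (E : pzAlgType K) :
  field_like K -> split_alg E -> semisplit_alg E.
Proof.
move=> Kf [n [Q [QP EQ]]].
pose P : pred 'I_n := fun i => `[< exists v : Q i, v <> 0 >].
exists (#|P|), (fun j => endk (Q (enum_val j))); split=> [j|].
  have /asboolP[v v0] : P (enum_val j) := enum_valP j.
  have [l lQ] := fin_gen_seq (QP (enum_val j)).1.
  exact: (endk_azumaya Kf lQ v0).
apply: (product_restrict (F := fun i => endk (Q i)) (P := P)) EQ => i /asboolP nP f g.
have z (v : Q i) : v = 0 by apply: contrapT => v0; apply: nP; exists v.
by apply: endoP => y; rewrite [LHS]z [RHS]z.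
Qed.

Section LocalInner.
Variables (k : comPzRingType) (E : pzAlgType k) (p : spec k) (s0 : k).
Hypotheses (s0p : s0 \notin spec_ideal p) (E0 : sdual E s0).
Variables (E' : pzAlgType (resfield p)) (i : E -> E').
Hypotheses (iP : is_bc (fhom p) i) (iM : forall x y, i (x * y) = i x * i y).
Hypothesis E'inner : forall H : endk E', inner H.
Let iS := bc_semilin iP.

(** Nakayama's lemma in End_k(E), generated up to s0^2 by rank one maps: surjectivity of E (x) E^op
    -> End_k(E) passes from the fibre to a neighbourhood of p. *)
Lemma local_inner : exists2 c : k, c \notin spec_ideal p & forall H : endk E, inner (c *: H).
Proof.
have [I [x [f Hf]]] := E0.
have expand (H : endk E) : s0 *: H = \sum_j rank1 (f j) (endo_fun H (x j)).
  apply: endoP => z; rewrite endkZ -linearZ_LR Hf linear_sum endk_sum.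
  by apply: eq_bigr => j _; rewrite linearZ_LR rank1E.
pose l := [seq rank1 (f u.1) (x u.2) | u : I * I].
have lP (H : endk E) : spn l ((s0 * s0) *: H).
  have SP := smod_spn l.
  rewrite -scalerA [X in _ *: X]expand scaler_sumr; apply: (smod_sum SP) => j _.
  rewrite -(linZ (@rank1_linear _ _ (f j))) Hf (linsum (@rank1_linear _ _ (f j))).
  apply: (smod_sum SP) => m _; rewrite (linZ (@rank1_linear _ _ (f j))); apply: (smodZ SP).
  by apply: spn_mem; apply/imageP; exists (j, m).
have ker (H : endk E) : (forall z, i (endo_fun H z) = 0) ->
    loc_in p (fun G => G \in @mulspan k (spec_ideal p) (endk E)) H.
  move=> H0; have MP := @smod_mulspan k E (spec_ideal p).
  have [|t tp Ht] := @loc_in_all k p E _ [seq endo_fun H (x j) | j : I] MP.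
    by move=> _ /imageP[j _ ->]; apply/(bc_fib_eq0 iP).
  exists (t * s0); first exact: specM.
  rewrite -scalerA expand scaler_sumr.
  apply: (smod_sum (@smod_mulspan k (endk E) (spec_ideal p))) => j _; rewrite -(linZ (@rank1_linear _ _ (f j))).
  apply: (mulspan_lin (mklin (@rank1_linear _ _ (f j)))); apply: Ht.
  by apply/imageP; exists j.
have IP := inner_smod E.
apply: (nakayama (l := l) IP (specM s0p s0p)) => H; first exact: (addspan_spn IP).
have [s Hs] := E'inner (endk_bc iP H).
have [t1 t1p [a Ha]] := bc_fib_fracs iP (fun j => (tnth (in_tuple s) j).1).
have [t2 t2p [b Hb]] := bc_fib_fracs iP (fun j => (tnth (in_tuple s) j).2).
pose G : endk E := \sum_j ((mklin (comp_linear (mklin (mull_linear (a j))) (mklin (mulr_linear_alg (b j)))) : {linear E -> E}) : endk E).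
have GE z : endo_fun G z = \sum_j a j * z * b j.
  by rewrite endk_sum; apply: eq_bigr => j _; rewrite /= mulrA.
have [|t tp Ht] := ker ((t1 * t2) *: H - G).
  move=> z; rewrite endkD -[endo_fun (- G) z]/(- endo_fun G z) endkZ GE.
  rewrite (semilinB iS) (semilinZ iS) -(endk_bcE iP) Hs (semilin_sum iS) rmorphM.
  rewrite (big_tnth _ _ s) scaler_sumr -sumrB big1 // => j _.
  apply/eqP; rewrite subr_eq0; apply/eqP; rewrite !iM -Ha -Hb.
  by rewrite -!(pzscaleAl, pzscaleAr) scalerA mulrC.
exists (t * (t1 * t2)); first by do 2!apply: specM => //.
exists (t *: ((t1 * t2) *: H - G)) => //.
rewrite scalerBr scalerA opprB addrC subrK; apply: (smodZ IP).
apply: (smod_sum IP) => j _.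
by eexists [:: (_, _)] => z; rewrite big_seq1 /= mulrA.
Qed.
End LocalInner.

(** * Idempotent ideals over local rings with nilpotent maximal ideal *)

Section LocalRings.
Variables (S : comPzRingType) (p : spec S).
Hypothesis units : forall s : S, s \notin spec_ideal p -> exists c : S, c * s = 1.

Lemma local_nakayama (M : lmodType S) (l : seq M) :
  (forall x, x \in l -> addspan (fun a => a \in spec_ideal p) (fun y => y = 0) l x) ->
  forall x, x \in l -> x = 0.
Proof.
move=> Hl x xl; have [|s sp Hs] := nakayama_seq (p := p) (l := l) (smod_zero M).
  by move=> y /Hl; apply: loc_in_sub.
by have [c cs] := units sp; rewrite -[x]scale1r -cs -scalerA Hs // scaler0.
Qed.

(** The image of [rho] is a direct summand with coordinates in p, hence equal to p times itself;
    Nakayama's lemma makes it 0. *)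
Lemma idempotent_map_zero (V : lmodType S) (rho : {linear V -> V}) : sdual V 1 ->
  (forall x, rho (rho x) = rho x) ->
  (forall (f : {linear V -> S^o}) x, (f (rho x) : S) \in spec_ideal p) ->
  forall x, rho x = 0.
Proof.
move=> [I [x [f Hf]]] rr rp.
have x0 j : rho (x j) = 0.
  apply: (@local_nakayama _ [seq rho (x i) | i : I]); last by apply/imageP; exists j.
  move=> _ /imageP[i _ ->].
  have -> : rho (x i) = \sum_j (f j (rho (x i)) : S) *: rho (x j).
    by rewrite -{1}rr -{1}[rho (x i)]scale1r Hf linear_sum; apply: eq_bigr => m _; rewrite linearZ_LR.
  apply: (smod_sum (smod_addspan _ (ideal_like_mem p) (smod_zero V))) => m _.
  apply: (addspan_mem (ideal_like_mem p) (smod_zero V)) => //.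
  by apply/imageP; exists m.
move=> y; rewrite -[y]scale1r Hf linear_sum big1 // => j _.
by rewrite linearZ_LR x0 scaler0.
Qed.

(** A direct summand of a finitely generated projective module over a local ring is free. The bound
    on the rank later limits the size of a determinant. *)
Lemma idempotent_map_basis (V : lmodType S) (l : seq V) (rho : {linear V -> V}) :
  (forall y, spn l y) -> sdual V 1 -> (forall x, rho (rho x) = rho x) ->
  exists n, (n <= size l)%N /\ exists (u : 'I_n -> V) (f : 'I_n -> {linear V -> S^o}),
    [/\ forall i, rho (u i) = u i, forall y, rho y = \sum_i (f i y : S) *: u i &
        forall i j, (f i (u j) : S) = (i == j)%:R].
Proof.
move=> lV [I [v [g Hg]]] rr.
pose Q n := exists2 u : 'I_n -> V, (forall i, rho (u i) = u i) &
  forall y, exists c : 'I_n -> S, rho y = \sum_i c i *: u i.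
have Ql : Q (size l).
  exists (fun i => rho (tnth (in_tuple l) i)) => // y.
  have [c Hc] := spn_fin (lV y); exists c.
  by rewrite {1}Hc linear_sum; apply: eq_bigr => i _; rewrite linearZ_LR.
have exQ : exists n, `[< Q n >] by exists (size l); apply/asboolP.
case: (ex_minnP exQ) => n /asboolP[u ur us] nmin.
exists n; split; first by apply: nmin; apply/asboolP.
have relp (c : 'I_n -> S) : \sum_i c i *: u i = 0 -> forall i, c i \in spec_ideal p.
  move=> c0 i; apply: contrapT => /negP/units[e ec].
  case: n u ur us nmin c c0 i ec {exQ Ql} => [|n] u ur us nmin c c0 i ec; first by case: i ec.
  suff : Q n by move/asboolP/nmin; rewrite ltnn.
  exists (fun j => u (lift i j)) => [j|y]; first exact: ur.
  have [d Hd] := us y; exists (fun j => d (lift i j) - d i * e * c (lift i j)).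
  have ui : u i = - (e *: \sum_j c (lift i j) *: u (lift i j)).
    move: c0; rewrite (bigD1_ord i) //= => /(congr1 ( *:%R e)).
    rewrite scalerDr scalerA ec scale1r scaler0 => /eqP.
    by rewrite addr_eq0 => /eqP.
  rewrite Hd (bigD1_ord i) //= ui scalerN scalerA scaler_sumr addrC -sumrB.
  by apply: eq_bigr => j _; rewrite scalerBl scalerA.
have [c Hc] := choice (fun m => us (v m)).
have fl i : linear (fun y => \sum_m (g m (rho y) : S) * c m i : S^o).
  apply: sum_linear => m a x y; rewrite linearP linearP -[_ *: _]/(_ * _) mulrDl.
  by rewrite -[_ *: _ in RHS]/(_ * _) mulrA.
pose f i : {linear V -> S^o} := mklin (fl i).
have fE y : rho y = \sum_i (f i y : S) *: u i.
  rewrite -{1}rr -[rho y in LHS]scale1r Hg linear_sum.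
  under eq_bigr => m _ do rewrite linearZ_LR Hc scaler_sumr.
  rewrite exchange_big; apply: eq_bigr => i _.
  by rewrite scaler_suml; apply: eq_bigr => m _; rewrite scalerA.
exists u, f; split=> // i j.
pose W := {ffun 'I_n -> S^o}.
(* The matrix 1 - (f_i u_j) is idempotent, and its entries lie in p because a generating family of
   least size has no relation with a unit coefficient. By Nakayama's lemma it is 0. *)
pose D j : W := [ffun i => (i == j)%:R - (f i (u j) : S)].
have Dr m : \sum_i (D m i : S) *: u i = 0.
  under eq_bigr => a _ do rewrite ffunE scalerBl.
  rewrite sumrB -fE ur (bigD1 m) //= eqxx scale1r big1 ?addr0 ?subrr // => a /negPf ->.
  by rewrite scale0r.
have DD m : D m = \sum_a (D m a : S) *: D a.
  apply/ffunP => b; rewrite sum_ffunE.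
  have := congr1 (f b) (Dr m); rewrite linear_sum linear0 => Hb.
  transitivity (\sum_a ((D m a : S) * (b == a)%:R - (D m a : S) * (f b (u a) : S)) : S).
    rewrite sumrB (bigD1 b) //= eqxx mulr1 [X in _ = _ + X - _]big1 ?addr0 => [|a ab].
      rewrite (_ : \sum_a _ = 0) ?subr0 //; rewrite -[RHS]Hb.
      by apply: eq_bigr => a _; rewrite linearZ_LR.
    by rewrite eq_sym (negPf ab) mulr0.
  by apply: eq_bigr => a _; rewrite !ffunE -mulrBr.
have D0 : D j = 0.
  apply: (@local_nakayama _ [seq D a | a : 'I_n]); last by apply/imageP; exists j.
  move=> _ /imageP[m _ ->]; rewrite DD.
  apply: (smod_sum (smod_addspan _ (ideal_like_mem p) (smod_zero W))) => a _.
  apply: (addspan_mem (ideal_like_mem p) (smod_zero W)); last by apply/imageP; exists a.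
  exact: (relp (fun a => D m a) (Dr m)).
move/ffunP/(_ i): D0; rewrite !ffunE => /eqP; rewrite subr_eq0 => /eqP <-.
by [].
Qed.

Section Fitting.
Variables (N : nat) (B : pzAlgType S) (lB : seq B).
Hypotheses (S_noeth : noetherian S) (pN : powsub p N (fun a => a = 0)).
Hypothesis lBP : forall y, spn lB y.

Lemma nilpotent_mulspan (L : B) : L \in @mulspan S (spec_ideal p) B -> L ^+ N = 0.
Proof.
move=> LP.
(* Each factor L stands in for one element of p: L^m is killed by every product of N - m elements of
   p. *)
pose Q m (y : B) := forall l : seq S, (size l + m)%N = N ->
  (forall x, x \in l -> x \in spec_ideal p) -> (\prod_(x <- l) x) *: y = 0.
have QP m : smod (Q m).
  split=> [l _ _|x y Hx Hy l sl lp|a x Hx l sl lp]; first by rewrite scaler0.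
    by rewrite scalerDr Hx // Hy // addr0.
  by rewrite scalerA mulrC -scalerA Hx // scaler0.
have QS m y : Q m y -> Q m.+1 (y * L).
  move=> Qy; move: L LP; apply: mulspan_ind.
    exact: (smod_preim (mklin (mull_linear y)) (QP m.+1)).
  move=> a x ap l sl lp; rewrite -pzscaleAr scalerA mulrC.
  have -> : a * \prod_(x0 <- l) x0 = \prod_(x0 <- a :: l) x0 by rewrite big_cons.
  rewrite pzscaleAl Qy ?mul0r //= ?addSn -?addnS // => z.
  by rewrite inE => /orP[/eqP ->|/lp].
have QX m : (m <= N)%N -> Q m (L ^+ m).
  elim: m => [_ l|m IHm mN]; last by rewrite exprSr; apply/QS/IHm/ltnW.
  by rewrite addn0 => sl lp; rewrite (pN sl lp) scale0r.
by have := QX N (leqnn N) [::] (add0n N); rewrite big_nil scale1r; apply.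
Qed.

(** x satisfies a monic equation. With the terms below the first unit coefficient collected in L, it
    reads L + x^i (a + x y) = 0 with L in pB and a a unit. As L is nilpotent, the N-th power gives
    x^(iN) (a^N + x g) = 0, and a^N is invertible. *)
Lemma fitting_element (x : B) :
  exists (m : nat) (h : B), x * h = h * x /\ x ^+ m.+1 = x ^+ m.+2 * h.
Proof.
have [||_ [n ->] nmax] := @submodule_max S S_noeth B lB (fun C => exists n, C = spn (mkseq (fun i => x ^+ i) n)) lBP.
- by move=> _ [n ->]; apply: smod_spn.
- by exists (spn (mkseq (fun i => x ^+ i) 0)), 0%N.
have /spn_mkseq[c Hc] : spn (mkseq (fun i => x ^+ i) n) (x ^+ n).
  apply: (nmax (spn (mkseq (fun i => x ^+ i) n.+1))); first by exists n.+1.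
    apply: (spn_ind (smod_spn _)) => y /mapP[i]; rewrite mem_iota => /andP[_ Hi] ->; apply: spn_mem.
    by apply/mapP; exists i; rewrite // mem_iota /= add0n ltnS ltnW.
  by apply: spn_mem; apply/mapP; exists n; rewrite // mem_iota add0n leqnn.
pose Z y := x * y = y * x.
have ZP : smod Z.
  split=> [|y z Hy Hz|a y Hy]; rewrite /Z ?mulr0 ?mul0r //.
    by rewrite mulrDr mulrDl Hy Hz.
  by rewrite -pzscaleAr -pzscaleAl Hy.
have ZM y z : Z y -> Z z -> Z (y * z) by move=> Hy Hz; rewrite /Z mulrA Hy -!mulrA Hz.
have ZX i : Z (x ^+ i) by rewrite /Z -exprS exprSr.
have MP := @smod_mulspan S B (spec_ideal p).
have split (d : nat -> S) m : (\sum_(i < m) d i *: x ^+ i) \in @mulspan S (spec_ideal p) B \/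
    exists (i : nat) (L : B) (a : S) (y : B), [/\ (i < m)%N, L \in @mulspan S (spec_ideal p) B,
      a \notin spec_ideal p, Z y & \sum_(i < m) d i *: x ^+ i = L + x ^+ i * (a *: (1 : B) + x * y)].
  elim: m => [|m [IHm|[i [L [a [y [im LP ap Zy E]]]]]]].
  - by left; rewrite big_ord0; apply: (smod0 MP).
  - rewrite big_ord_recr /=; have [dp|dp] := boolP (d m \in spec_ideal p).
      by left; apply: (smodD MP) IHm _; apply: mulspan_mem.
    right; exists m, (\sum_(i < m) d i *: x ^+ i), (d m), 0; split=> //; first exact: (smod0 ZP).
    by rewrite mulr0 addr0 -pzscaleAr mulr1.
  right; exists i, L, a, (y + d m *: x ^+ (m - i.+1)); split=> //; first exact: ltnW.
    by apply: (smodD ZP) Zy _; apply/(smodZ ZP)/ZX.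
  rewrite big_ord_recr E /= -addrA; congr (_ + _); rewrite !mulrDr addrA; congr (_ + _).
  by rewrite -!pzscaleAr -exprS -exprD addnS -addSn subnKC.
have [i [L [a [y [LP ap Zy E]]]]] : exists (i : nat) (L : B) (a : S) (y : B),
    [/\ L \in @mulspan S (spec_ideal p) B, a \notin spec_ideal p, Z y & L + x ^+ i * (a *: (1 : B) + x * y) = 0].
  have E0 : \sum_(i < n) - c i *: x ^+ i + x ^+ n = 0.
    by under eq_bigr => i _ do rewrite scaleNr; rewrite sumrN -Hc addNr.
  have [H|[i [L [a [y [im LP ap Zy E]]]]]] := split (fun i => - c i) n.
    exists n, (\sum_(i < n) - c i *: x ^+ i), 1, 0; split=> //; [exact: spec1|exact: (smod0 ZP)|].
    by rewrite mulr0 addr0 scale1r mulr1.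
  exists i, L, a, (y + x ^+ (n - i.+1)); split=> //; first by apply: (smodD ZP) Zy (ZX _).
  rewrite -{}E0 E -addrA; congr (_ + _); rewrite !mulrDr addrA; congr (_ + _).
  by rewrite -exprS -exprD addnS -addSn subnKC.
have Zw : Z (a *: (1 : B) + x * y).
  apply: (smodD ZP); last by apply: ZM => //; rewrite /Z.
  by apply: (smodZ ZP); rewrite /Z mulr1 mul1r.
set w := _ + _ in Zw E.
have aw b : b *: w = (b * a) *: (1 : B) + b *: (x * y) by rewrite /w scalerDr scalerA.
clearbody w.
have Zc : GRing.comm (x ^+ i) w by apply/GRing.commr_sym/GRing.commrX/GRing.commr_sym.
have wN : x ^+ (i * N) * w ^+ N = 0.
  rewrite exprM -(GRing.exprMn_comm _ Zc).
  have -> : x ^+ i * w = - L by apply/eqP; rewrite -addr_eq0 addrC E.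
  apply: nilpotent_mulspan; exact: (smodN MP).
have [g Zg Hg] : exists2 g, Z g & w ^+ N = a ^+ N *: (1 : B) + x * g.
  elim: (N) => [|m [g Zg IHm]]; first by exists 0; rewrite ?mulr0 ?addr0 ?scale1r //; apply: (smod0 ZP).
  exists (a ^+ m *: y + g * w).
    by apply: (smodD ZP); [apply: (smodZ ZP)|apply: ZM].
  rewrite exprSr IHm mulrDl -pzscaleAl mul1r aw -addrA -exprSr; congr (_ + _).
  by rewrite mulrDr -pzscaleAr mulrA.
have [e ea] := units (specX N ap).
exists (i * N)%N, (- (e *: g)); split.
  by apply: (smodN ZP); apply: (smodZ ZP).
have -> : x ^+ (i * N).+1 = e *: (x * (x ^+ (i * N) * (w ^+ N - x * g))).
  by rewrite Hg addrK -pzscaleAr mulr1 -pzscaleAr scalerA ea scale1r -exprS.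
rewrite mulrBr wN sub0r !mulrN scalerN -pzscaleAr; congr (- (_ *: _)).
by rewrite !mulrA -exprS -exprSr.
Qed.

Variables (J : ideal2 B) (JJ : idempotent_ideal J).

Definition two_sided (e y : B) := exists s : seq (B * B), y = \sum_(u <- s) u.1 * e * u.2.

Lemma two_sided_smod e : smod (two_sided e).
Proof.
split=> [|_ _ [s ->] [t ->]|a _ [s ->]].
- by exists [::]; rewrite big_nil.
- by exists (s ++ t); rewrite big_cat.
exists [seq (a *: u.1, u.2) | u <- s].
by rewrite big_map scaler_sumr; apply: eq_bigr => u _ /=; rewrite -!pzscaleAl.
Qed.

Lemma two_sided_mul e a b : two_sided e (a * e * b).
Proof. by exists [:: (a, b)]; rewrite big_seq1. Qed.

Lemma two_sidedMl e a y : two_sided e y -> two_sided e (a * y).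
Proof.
move=> [s ->]; exists [seq (a * u.1, u.2) | u <- s].
by rewrite big_map mulr_sumr; apply: eq_bigr => u _ /=; rewrite !mulrA.
Qed.

Lemma two_sidedMr e a y : two_sided e y -> two_sided e (y * a).
Proof.
move=> [s ->]; exists [seq (u.1, u.2 * a) | u <- s].
by rewrite big_map mulr_suml; apply: eq_bigr => u _ /=; rewrite !mulrA.
Qed.

(** The left ideal J x_1 + ... + J x_n + BeB, from which the x_i are removed one by one. *)
Fixpoint left_span (e : B) (l : seq (ideal_mod J)) (y : B) : Prop := if l is x :: l' then
  exists2 a, a \in ideal2_sub J & left_span e l' (y - a * jval x) else two_sided e y.

(** Choose e with BeB maximal. For x in J, [fitting_element] at (1 - e) x (1 - e) yields an
    idempotent of J orthogonal to e; maximality puts it in BeB, so a power of x lies in BeB. Thus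
    J/BeB is nil. Modulo BeB, J = JJ is the sum of the J x_l over generators x_l, which nility
    allows to drop. *)
Lemma fitting_idempotent : exists e : B,
  [/\ e \in ideal2_sub J, e * e = e & forall x, x \in ideal2_sub J -> two_sided e x].
Proof.
have JP := smod_mem (ideal2_sub J).
pose Fm C := exists e : B, [/\ e \in ideal2_sub J, e * e = e & C = two_sided e].
have [||_ [e [eJ ee ->]] emax] := @submodule_max S S_noeth B lB Fm lBP.
- by move=> _ [e [_ _ ->]]; apply: two_sided_smod.
- by exists (two_sided 0), 0; split=> //; [exact: (smod0 JP)|exact: mulr0].
have DP := two_sided_smod e.
exists e; split=> //.
have nil x : x \in ideal2_sub J -> exists m, two_sided e (x ^+ m).
  move=> xJ; apply: contrapT => nx.
  pose y := (1 - e) * x * (1 - e).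
  have yx : two_sided e (y - x).
    have -> : y - x = - (1 * e * (x * (1 - e)) + x * e * 1) .
      have -> : y = x * (1 - e) - e * (x * (1 - e)) by rewrite /y !mulrBl !mul1r mulrA.
      by rewrite mul1r mulr1 [x * (1 - e)]mulrBr mulr1; abel.
    by apply: (smodN DP); apply: (smodD DP); apply: two_sided_mul.
  have yX m : two_sided e (y ^+ m - x ^+ m).
    elim: m => [|m IHm]; first by rewrite subrr; apply: (smod0 DP).
    have -> : y ^+ m.+1 - x ^+ m.+1 = (y ^+ m - x ^+ m) * y + x ^+ m * (y - x).
      by rewrite mulrBl mulrBr -!exprSr; abel.
    by apply: (smodD DP); [apply: two_sidedMr|apply: two_sidedMl].
  have yJ : y \in ideal2_sub J by apply/ideal2Mr/ideal2Ml.
  have ey : e * y = 0 by rewrite /y !mulrA [e * (1 - e)]mulrBr mulr1 ee subrr !mul0r.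
  have ye : y * e = 0 by rewrite /y -!mulrA [(1 - e) * e]mulrBl mul1r ee subrr !mulr0.
  clearbody y; have [m [h [yh yE]]] := fitting_element y.
  pose q := y ^+ m.+1; pose f := q * h ^+ m.+1.
  have yhX i : y * h ^+ i = h ^+ i * y by apply: GRing.commrX; apply: yh.
  have qh i : q * h ^+ i = h ^+ i * q by apply/esym/GRing.commrX/esym/yhX.
  have qX i : q = y ^+ (m.+1 + i) * h ^+ i.
    elim: i => [|i IHi]; first by rewrite addn0 mulr1.
    have -> : y ^+ (m.+1 + i.+1) * h ^+ i.+1 = y ^+ (i + m.+2) * h * h ^+ i.
      by rewrite exprS mulrA addnS -addSn [(_ + i)%N]addnC.
    by rewrite exprD -[_ * _ * h]mulrA -yE -exprD addnC.
  have qf : q * f = q by rewrite /f mulrA /q -exprD -qX.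
  have ff : f * f = f by rewrite {1}/f qh -mulrA qf -qh.
  have fD : ~ two_sided e f.
    move=> fD; apply: nx; exists m.+1.
    have -> : x ^+ m.+1 = q - (q - x ^+ m.+1) by rewrite opprB addrC subrK.
    by apply: (smodB DP) (yX _); rewrite -qf; apply: two_sidedMl.
  have ef : e * f = 0 by rewrite /f /q exprS !mulrA ey !mul0r.
  have fe : f * e = 0 by rewrite /f qh /q [y ^+ _]exprSr -!mulrA ye !mulr0.
  have fJ : f \in ideal2_sub J by rewrite /f /q exprS -mulrA; apply: ideal2Mr.
  apply: fD; apply: (emax (two_sided (e + f))).
  - exists (e + f); split=> //; first exact: (smodD JP).
    by rewrite mulrDr !mulrDl ee ef fe ff addr0 add0r.
  - have DP' := two_sided_smod (e + f).
    move=> z [s ->]; apply: (smod_sum DP') => u _.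
    have -> : u.1 * e * u.2 = (u.1 * e) * (e + f) * u.2.
      by rewrite mulrDr -[u.1 * e * e]mulrA ee -[u.1 * e * f]mulrA ef mulr0 addr0.
    exact: two_sided_mul.
  have := two_sided_mul (e + f) f 1; by rewrite mulr1 mulrDr fe ff add0r.
pose js := left_span e; have jsP l : smod (js l).
  elim: l => [|x l [I0 ID IZ]] //=; split=> [|y z [a aJ Ha] [b bJ Hb]|c y [a aJ Ha]].
  - by exists 0; [exact: (smod0 JP)|rewrite mul0r subr0].
  - exists (a + b); first exact: (smodD JP).
    by rewrite mulrDl opprD addrACA; apply: ID.
  exists (c *: a); first exact: (smodZ JP).
  by rewrite -pzscaleAl -scalerBr; apply: IZ.
have jsM l c y : js l y -> js l (c * y).
  elim: l y => [|x l IHl] y /=; first exact: two_sidedMl.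
  move=> [a aJ Ha]; exists (c * a); first exact: ideal2Ml.
  by rewrite -mulrA -mulrBr; apply: IHl.
have js0 l y : two_sided e y -> js l y.
  elim: l y => [|x l IHl] y //= Hy; exists 0; first exact: (smod0 JP).
  by rewrite mul0r subr0; apply: IHl.
have reduce l : (forall y, y \in ideal2_sub J -> js l y) -> forall y, y \in ideal2_sub J -> two_sided e y.
  elim: l => [|x l IHl] //= Hl; apply: IHl => y yJ.
  have [a aJ Ha] := Hl _ (jval_in x).
  have xl : js l (jval x).
    have [m am] := nil a aJ.
    (* Modulo the other generators (1 - a) x = 0 with a nil modulo BeB, and 1 - a^m = (sum a^i) (1 -
       a). *)
    have -> : jval x = (\sum_(i < m) a ^+ i) * (jval x - a * jval x) + a ^+ m * jval x.
      rewrite -{2}[jval x]mul1r -mulrBl mulrA.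
      have -> : (\sum_(i < m) a ^+ i) * (1 - a) = 1 - a ^+ m.
        elim: (m) => [|i IHi]; first by rewrite big_ord0 mul0r subrr.
        by rewrite big_ord_recr mulrDl IHi mulrBr mulr1 -exprSr; abel.
      by rewrite mulrBl mul1r subrK.
    by apply: (smodD (jsP l)); [apply: jsM|apply/js0/two_sidedMr].
  have [b bJ Hb] := Hl _ yJ.
  by rewrite -[y](subrK (b * jval x)); apply: (smodD (jsP l)) Hb (jsM _ _ _ xl).
have [l lX] := submod_gens (ideal2_sub J) S_noeth lBP.
apply: (reduce l) => y yJ.
have [s Hs] := idempotent_seq JJ (Submod yJ).
have -> : y = jval (Submod yJ) by [].
rewrite Hs linear_sum; apply: (smod_sum (jsP l)) => u _; rewrite jactE.
have SP : smod (fun v : ideal_mod J => js l (jval u.1 * jval v)).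
  exact: (smod_preim (mklin (comp_linear (mklin (mull_linear (jval u.1))) jval)) (jsP l)).
have mem x : x \in l -> js l (jval u.1 * jval x).
  elim: (l) => [|z l' IHl] //=; rewrite inE => /orP[/eqP ->|xl].
    exists (jval u.1); first exact: jval_in.
    by rewrite subrr; apply: js0; apply: (smod0 DP).
  exists 0; first exact: (smod0 JP).
  by rewrite mul0r subr0; apply: IHl.
have : spn l u.2 by apply: lX.
by move: (u.2); apply: (spn_ind SP).
Qed.
End Fitting.
End LocalRings.

(* Multiplication by c on J (x) J -> End_k(J), (x, y) |-> (z |-> x z y), hits all
   the maps z |-> H (b z a): the obstruction to J having central endomorphisms. *)
Definition sandwich (k : comPzRingType) (A : pzAlgType k) (J : ideal2 A) (c : k) :=
  forall (b a : ideal_mod J) (H : endk (ideal_mod J)),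
  exists s : seq (ideal_mod J * ideal_mod J), forall z : ideal_mod J,
    c *: endo_fun H (jact (jval b) (jract z (jval a))) =
    \sum_(u <- s) jact (jval u.1) (jract z (jval u.2)).

(** A separability idempotent of C = eBe, written with elements of B so that C need not be formed as
    an algebra. *)
Definition corner_csep (k : comPzRingType) (B : pzAlgType k) (e : B) (s : seq (B * B)) :=
  [/\ forall v, v \in s -> (e * v.1 = v.1 /\ v.1 * e = v.1) /\ (e * v.2 = v.2 /\ v.2 * e = v.2),
      \sum_(v <- s) v.1 * v.2 = e &
      forall (P : lmodType k) (b : B -> B -> P), (forall y, linear (b^~ y)) ->
        (forall x, linear (b x)) -> forall x, e * x = x -> x * e = x ->
        \sum_(v <- s) b (x * v.1) v.2 = \sum_(v <- s) b v.1 (v.2 * x)].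

(** * The corner C = eBe and its separability *)

Section Corner.
Variables (S : comPzRingType) (p : spec S).
Hypothesis units : forall s : S, s \notin spec_ideal p -> exists c : S, c * s = 1.
Variables (N : nat) (B : pzAlgType S) (lB : seq B).
Hypotheses (pN : powsub p N (fun a => a = 0)) (lBP : forall y, spn lB y).
Hypotheses (B1 : sdual B 1).
Variables (J : ideal2 B) (Ic : S -> Prop).
Local Notation X := (ideal_mod J).
Local Notation E := (end_ideal J).
Hypothesis Ic_star : forall c, Ic c -> sandwich J c.
Hypothesis Ic_det : forall (d : S) q, (q <= size lB * size lB)%N ->
  (forall c : 'I_q -> S, (forall i, Ic (c i)) -> exists y, \prod_i c i = d * y) ->
  d \notin spec_ideal p.
Variables (e : B) (eJ : e \in ideal2_sub J) (ee : e * e = e).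
Hypothesis Je : forall x, x \in ideal2_sub J -> two_sided e x.

(** C is free; let M be the matrix of C (x) C -> End(C). Elements of [Ic] invert M column by column
    up to a factor, which makes det M a unit. Surjectivity then gives an element t inducing a
    functional times e, and injectivity shows that t is a Casimir element. *)
Lemma corner_csep_exists : exists s : seq (B * B), corner_csep e s.
Proof.
pose rh (z : B) := e * z * e.
have rl : linear rh by move=> a x y; rewrite /rh mulrDr mulrDl -pzscaleAr -pzscaleAl.
have rr x : rh (rh x) = rh x by rewrite /rh !mulrA ee -!mulrA ee.
have [n [nl [u [f [uC fE fu]]]]] := idempotent_map_basis units (rho := mklin rl) lBP B1 rr.
have {}uC i : rh (u i) = u i := uC i.
have {}fE y : rh y = \sum_i (f i y : S) *: u i := fE y.
have eu i : e * u i = u i by rewrite -uC /rh !mulrA ee.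
have ue i : u i * e = u i by rewrite -uC /rh -!mulrA ee.
have uJ i : u i \in ideal2_sub J by rewrite -uC; apply: ideal2Ml.
have fex i z : (f i (rh z) : S) = f i z.
  rewrite fE linear_sum (bigD1 i) //= linearZ_LR fu eqxx big1 => [|j ji].
    by rewrite addr0; apply: mulr1.
  by rewrite linearZ_LR fu eq_sym (negPf ji); apply: mulr0.
pose X2 := ('I_n * 'I_n)%type; pose q := #|{: X2}|.
have qle : (q <= size lB * size lB)%N by rewrite /q card_prod card_ord leq_mul.
pose ev (i : 'I_q) : X2 := enum_val i; pose er (x : X2) : 'I_q := enum_rank x.
have evK x : ev (er x) = x by apply: enum_rankK.
have erK i : er (ev i) = i by apply: enum_valK.
(* The column y stands for u_y1 (x) u_y2, the row x for the coefficient of u_x1 in the image of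
   u_x2. *)
pose m (x y : X2) : S := f x.1 (u y.1 * u x.2 * u y.2).
pose M : 'M[S]_q := \matrix_(i, j) m (ev i) (ev j).
have sumq (V : nmodType) (F : X2 -> V) : \sum_x F x = \sum_i F (ev i).
  rewrite (reindex ev) //; exists er => [i _|x _]; [exact: erK|exact: evK].
have col c x : Ic c -> exists T : X2 -> S, forall y, \sum_z m y z * T z = c * (x == y)%:R.
  move=> /Ic_star Hc.
  pose H : endk X := (mklin (scalel_linear (mklin (comp_linear (f x.2) jval)) (Submod (uJ x.1) : X)) : {linear X -> X}).
  have [s Hs] := Hc (Submod eJ) (Submod eJ) H.
  exists (fun z => \sum_(v <- s) (f z.1 (jval v.1) : S) * (f z.2 (jval v.2) : S)) => y.
  have := congr1 jval (Hs (Submod (uJ y.2))).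
  rewrite linearZ_LR linear_sum /=.
  rewrite [X in c *: X = _](_ : _ = (f x.2 (rh (u y.2)) : S) *: u x.1); last first.
    by rewrite /rh mulrA.
  rewrite uC fu => E1.
  have {}E1 : (c * (x.2 == y.2)%:R) *: u x.1 =
      \sum_(v <- s) rh (jval v.1) * u y.2 * rh (jval v.2).
    rewrite -scalerA -[u x.1 in LHS]uC; transitivity (rh (c *: ((x.2 == y.2)%:R *: u x.1))).
      by rewrite /rh -!(pzscaleAr, pzscaleAl).
    rewrite E1 (linsum rl); apply: eq_bigr => v _.
    rewrite -[submod_val v.1]/(jval v.1) -[submod_val v.2]/(jval v.2) /rh.
    by rewrite -{1}(uC y.2) /rh !mulrA.
  have := congr1 (f y.1) E1; rewrite linearZ_LR fu linear_sum => E2.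
  transitivity (\sum_(v <- s) \sum_z (f z.1 (jval v.1) : S) * (f z.2 (jval v.2) : S) * m y z).
    rewrite exchange_big; apply: eq_bigr => z _; rewrite mulr_sumr.
    by apply: eq_bigr => v _; rewrite mulrC.
  transitivity (\sum_(v <- s) (f y.1 (rh (jval v.1) * u y.2 * rh (jval v.2)) : S)).
    apply: eq_bigr => v _; rewrite !fE mulr_suml mulr_suml linear_sum.
    rewrite -(pair_bigA _ (fun a b => (f a (jval v.1) : S) * (f b (jval v.2) : S) * m y (a, b))).
    apply: eq_bigr => a _; rewrite mulr_sumr linear_sum; apply: eq_bigr => b _.
    rewrite -!pzscaleAl -pzscaleAr 2!(linZ (linearP (f y.1))).
    exact/esym/mulrA.
  rewrite -E2 -[_ *: _]/(_ * _) -mulrA; congr (_ * _).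
  case: x y {H Hs E1 E2} => [x1 x2] [y1 y2] /=; rewrite xpair_eqE [x1 == _]eq_sym.
  by case: (y1 == x1); case: (x2 == y2); rewrite ?mulr0 ?mul0r ?mulr1.
have /units[di Hdi] : \det M \notin spec_ideal p.
  apply: (Ic_det qle) => c Hc.
  (* Each column uses its own element c_i of [Ic]; so det M divides the product of the c_i. *)
  have [T HT] := choice (fun i => col _ (ev i) (Hc i)).
  pose TM : 'M[S]_q := \matrix_(i, j) T j (ev i).
  exists (\det TM); rewrite -det_mulmx.
  transitivity (\det (diag_mx (\row_i c i))).
    by rewrite det_diag; apply: eq_bigr => i _; rewrite mxE.
  congr (\det _); apply/matrixP => i j; rewrite !mxE.
  transitivity (\sum_z m (ev i) z * T j z).
    rewrite HT; have [->|ij] := eqVneq i j; first by rewrite eqxx mulr1 mulr1n.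
    by rewrite (inj_eq (can_inj erK)) eq_sym (negPf ij) mulr0 mulr0n.
  by rewrite sumq; apply: eq_bigr => a _; rewrite !mxE.
have M_inj (W : X2 -> S) : (forall y, \sum_z m y z * W z = 0) -> forall z, W z = 0.
  move=> W0 z; pose v : 'cV[S]_q := \col_i W (ev i).
  have Mv : M *m v = 0.
    apply/matrixP => i j; rewrite !mxE -[RHS](W0 (ev i)) sumq.
    by apply: eq_bigr => a _; rewrite !mxE.
  have : di *: (\adj M *m (M *m v)) = 0 by rewrite Mv mulmx0 scaler0.
  rewrite mulmxA mul_adj_mx mul_scalar_mx scalerA Hdi scale1r => /matrixP/(_ (er z) 0).
  by rewrite !mxE evK.
have M_surj (W : X2 -> S) : exists T : X2 -> S, forall y, \sum_z m y z * T z = W y.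
  pose v : 'cV[S]_q := di *: (\adj M *m \col_i W (ev i)).
  exists (fun z => v (er z) 0) => y.
  have : M *m v = \col_i W (ev i).
    by rewrite -scalemxAr mulmxA mul_mx_adj mul_scalar_mx scalerA Hdi scale1r.
  move/matrixP/(_ (er y) 0); rewrite !mxE evK => <-; rewrite sumq.
  by apply: eq_bigr => a _; rewrite !mxE evK erK.
have span y : rh y = y -> y = \sum_i (f i y : S) *: u i by move=> ry; rewrite -fE ry.
have f_inj y z : rh y = y -> rh z = z -> (forall i, (f i y : S) = f i z) -> y = z.
  by move=> ry rz fyz; rewrite (span y ry) (span z rz); apply: eq_bigr => i _; rewrite fyz.
(* If every coordinate of e lies in p, then e is nilpotent and idempotent, hence 0. Otherwise some
   functional f_i0 can be scaled to take the value 1 at e. *)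
have [e0|[i0 [a0 Ha0]]] : e = 0 \/ exists i0, exists a0 : S, a0 * f i0 e = 1.
- have [[i0 /negP/units[a0 Ha0]]|nf] := pselect (exists i0, ~ ((f i0 e : S) \in spec_ideal p)).
    by right; exists i0, a0.
  left; have eN : e ^+ N = 0.
    apply: (nilpotent_mulspan pN); rewrite -[e](_ : rh e = e); last by rewrite /rh !ee.
    rewrite fE; apply: (smod_sum (@smod_mulspan S B (spec_ideal p))) => i _; apply: mulspan_mem.
    by apply: contrapT => H; apply: nf; exists i.
  have eX i : e ^+ i.+1 = e by elim: i => [|i IHi]; rewrite ?expr1 // exprS IHi ee.
  case: (N) eN => [|i]; last by rewrite eX.
  by rewrite expr0 => e1; rewrite -[e]mulr1 e1 mulr0.
- exists [::]; split=> //; first by rewrite big_nil.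
  by move=> *; rewrite !big_nil.
have [t Ht] := M_surj (fun y => a0 * f i0 (u y.2) * f y.1 e).
have tE z : rh z = z -> \sum_x t x *: (u x.1 * z * u x.2) = (a0 * f i0 z) *: e.
  move=> rz; apply: f_inj.
  - rewrite (linsum rl); apply: eq_bigr => x _; rewrite (linZ rl); congr (_ *: _).
    by rewrite /rh !mulrA eu -!mulrA ue.
  - by rewrite (linZ rl) /rh !ee.
  move=> i; rewrite linear_sum linearZ_LR -[RHS]/(_ * _).
  transitivity (\sum_j (f j z : S) * \sum_x m (i, j) x * t x).
    under [RHS]eq_bigr => j _ do rewrite mulr_sumr.
    rewrite exchange_big; apply: eq_bigr => x _; rewrite linearZ_LR -[_ *: _]/(_ * _).
    rewrite {1}(span z rz) mulr_sumr mulr_suml linear_sum mulr_sumr.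
    apply: eq_bigr => j _; rewrite -pzscaleAr -pzscaleAl linearZ_LR -[_ *: _]/(_ * _) /m /=; ring.
  under eq_bigr => j _ do rewrite Ht /=.
  rewrite [in RHS](span z rz) linear_sum mulr_sumr mulr_suml; apply: eq_bigr => j _.
  by rewrite linearZ_LR -[_ *: _]/(_ * _); ring.
exists [seq (t x *: u x.1, u x.2) | x <- index_enum {: X2}]; split.
- move=> _ /mapP[x _ ->] /=; rewrite -pzscaleAr -pzscaleAl.
  by rewrite !eu !ue.
- rewrite big_map /=; transitivity (\sum_x t x *: (u x.1 * e * u x.2)).
    by apply: eq_bigr => x _; rewrite ue -pzscaleAl.
  by rewrite tE ?Ha0 ?scale1r // /rh !ee.
move=> P b bl br x ex xe; rewrite !big_map /=.
pose W y := \sum_i t (i, y.2) * (f y.1 (x * u i) : S).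
pose W' y := \sum_i t (y.1, i) * (f y.2 (u i * x) : S).
have xu i : x * u i = \sum_j (f j (x * u i) : S) *: u j.
  by apply: span; rewrite /rh !mulrA ex -mulrA ue.
have ux i : u i * x = \sum_j (f j (u i * x) : S) *: u j.
  by apply: span; rewrite /rh !mulrA eu -mulrA xe.
have pairE (V : nmodType) (F : X2 -> V) : \sum_y F y = \sum_i \sum_j F (i, j).
  by rewrite pair_bigA; apply: eq_bigr => -[].
have gW (V : lmodType S) (g : B -> B -> V) : (forall y, linear (g^~ y)) -> (forall x, linear (g x)) ->
    \sum_y t y *: g (x * u y.1) (u y.2) = \sum_y W y *: g (u y.1) (u y.2).
  move=> gl gr.
  rewrite pairE [RHS]pairE /=.
  rewrite exchange_big [RHS]exchange_big; apply: eq_bigr => j _.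
  under [RHS]eq_bigr => i _ do rewrite scaler_suml.
  rewrite exchange_big; apply: eq_bigr => i _; rewrite {1}xu (linsum (gl _)) scaler_sumr.
  by apply: eq_bigr => h _; rewrite (linZ (gl _)) scalerA.
have gW' (V : lmodType S) (g : B -> B -> V) : (forall y, linear (g^~ y)) -> (forall x, linear (g x)) ->
    \sum_y t y *: g (u y.1) (u y.2 * x) = \sum_y W' y *: g (u y.1) (u y.2).
  move=> gl gr.
  rewrite pairE [RHS]pairE /=.
  apply: eq_bigr => i _.
  under [RHS]eq_bigr => j _ do rewrite scaler_suml.
  rewrite exchange_big; apply: eq_bigr => j _; rewrite {1}ux (linsum (gr _)) scaler_sumr.
  by apply: eq_bigr => h _; rewrite (linZ (gr _)) scalerA.
(* [W] and [W'] are the coordinates of x t and t x, which induce the same map because t sends C to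
   multiples of e. *)
have WW y : W y = W' y.
  apply/eqP; rewrite -subr_eq0; apply/eqP; apply: (M_inj (fun y => W y - W' y)) => z.
  pose g (a c : B) := a * u z.2 * c.
  have gl c : linear (g^~ c) by move=> a v w; rewrite /g !mulrDl -!pzscaleAl.
  have gr a : linear (g a) by move=> c v w; rewrite /g mulrDr -pzscaleAr.
  under eq_bigr => v _ do rewrite mulrBr.
  rewrite sumrB; apply/eqP; rewrite subr_eq0; apply/eqP.
  have WE (w : X2 -> S) : \sum_v m z v * w v = f z.1 (\sum_v w v *: g (u v.1) (u v.2)).
    by rewrite linear_sum; apply: eq_bigr => v _; rewrite linearZ_LR mulrC.
  rewrite !WE -(gW _ g gl gr) -(gW' _ g gl gr); congr (f _ _).
  transitivity (x * \sum_v t v *: (u v.1 * u z.2 * u v.2)).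
    by rewrite mulr_sumr; apply: eq_bigr => v _; rewrite /g -pzscaleAr !mulrA.
  transitivity ((\sum_v t v *: (u v.1 * u z.2 * u v.2)) * x).
    by rewrite tE // -pzscaleAr -pzscaleAl xe ex.
  by rewrite mulr_suml; apply: eq_bigr => v _; rewrite /g -pzscaleAl !mulrA.
transitivity (\sum_y t y *: b (x * u y.1) (u y.2)).
  by apply: eq_bigr => y _; rewrite -pzscaleAr (linZ (bl _)).
rewrite (gW _ b bl br); transitivity (\sum_y t y *: b (u y.1) (u y.2 * x)).
  by rewrite (gW' _ b bl br); apply: eq_bigr => y _; rewrite WW.
by apply: eq_bigr => y _; rewrite (linZ (bl _)).
Qed.

End Corner.

Section CornerToIdeal.
Variables (S : comPzRingType) (p : spec S).
Hypothesis units : forall s : S, s \notin spec_ideal p -> exists c : S, c * s = 1.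
Variables (B : pzAlgType S) (J : ideal2 B).
Local Notation X := (ideal_mod J).
Local Notation E := (end_ideal J).
Hypotheses (B1 : sdual B 1) (JJ : idempotent_ideal J) (Jr : sretract J 1).
Variables (e : B) (eJ : e \in ideal2_sub J) (ee : e * e = e).
Hypothesis Je : forall x, x \in ideal2_sub J -> two_sided e x.
Variables (s : seq (B * B)) (sP : corner_csep e s).

(* J is the image of Be (x)_C eB with C = eBe; the kernel of the multiplication is
   the image of an idempotent of a free module and is killed by c, hence zero. *)
Lemma corner_adual (c : S) : c <> 0 -> adual J c -> adual J 1.
Proof.
move=> c0 [IF [xF [F HF]]]; have [se sm sc] := sP.
have [I [w0 [g Hg]]] := B1.
(* Averaging the functional g_j over the separability idempotent gives a C-linear map eB -> C. The
   maps [psi j] and the elements e w0_j form a dual basis of the left C-module eB. *)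
pose psi j (q : B) : B := \sum_(v <- s) (g j (v.2 * q) : S) *: v.1.
have psil j : linear (psi j).
  apply: sum_linear => v a x y; rewrite mulrDr -pzscaleAr linearP scalerDl.
  by congr (_ + _); apply/esym/scalerA.
have psiM j x q : e * x = x -> x * e = x -> psi j (x * q) = x * psi j q.
  move=> ex xe.
  have bl y : linear (fun a : B => (g j (y * q) : S) *: a).
    by move=> a b d; rewrite scalerDr !scalerA mulrC.
  have br x0 : linear (fun y : B => (g j (y * q) : S) *: (x0 : B)).
    move=> a b d; rewrite mulrDl -pzscaleAl linearP scalerDl; congr (_ + _).
    exact/esym/scalerA.
  have := sc _ (fun a y => (g j (y * q) : S) *: a) bl br x ex xe => H.
  rewrite /psi mulr_sumr; under eq_bigr => v _ do rewrite mulrA.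
  by rewrite -H; apply: eq_bigr => v _; rewrite pzscaleAr.
have ep j q : e * psi j q = psi j q.
  rewrite mulr_sumr big_seq [RHS]big_seq; apply: eq_bigr => v /se[[e1 _] _].
  by rewrite -pzscaleAr e1.
have pe j q : psi j q * e = psi j q.
  rewrite mulr_suml big_seq [RHS]big_seq; apply: eq_bigr => v /se[[_ e1] _].
  by rewrite -pzscaleAl e1.
pose w j := e * w0 j.
have wJ j : w j \in ideal2_sub J by apply: ideal2Mr.
pose wX j : X := Submod (wJ j).
have psiw q : e * q = q -> \sum_j psi j q * w j = q.
  move=> eq; transitivity (\sum_(v <- s) v.1 * (1 *: (v.2 * q))).
    under eq_bigr => j _ do rewrite mulr_suml.
    rewrite exchange_big big_seq [RHS]big_seq; apply: eq_bigr => v /se[[_ e1] _].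
    rewrite Hg mulr_sumr; apply: eq_bigr => j _.
    by rewrite -pzscaleAl -pzscaleAr /w mulrA e1.
  rewrite -[RHS]eq -sm mulr_suml; apply: eq_bigr => v _.
  by rewrite scale1r mulrA.
have ew j : e * w j = w j by rewrite /w mulrA ee.
pose V := {ffun I -> B}.
(* An idempotent of the free module B^I with image Be (x)_C eB; [Th] below is the multiplication to
   J. *)
pose pi_fun (v : V) : V := [ffun j => \sum_i v i * psi j (w i)].
have pil : linear pi_fun.
  move=> a v v'; apply/ffunP => j; rewrite !ffunE scaler_sumr -big_split.
  by apply: eq_bigr => i _; rewrite !ffunE mulrDl -pzscaleAl.
pose pi : {linear V -> V} := mklin pil.
have piE v j : pi v j = \sum_i v i * psi j (w i) by rewrite /= ffunE.
pose act (a : B) (v : V) : V := [ffun j => a * v j].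
have pi_act a v : pi (act a v) = act a (pi v).
  apply/ffunP => j; rewrite piE ffunE piE mulr_sumr.
  by apply: eq_bigr => i _; rewrite ffunE mulrA.
have Thl : linear (fun v : V => \sum_j jact (v j) (wX j)).
  by apply: sum_linear => j a v v'; rewrite !ffunE jact_linl.
pose Th : {linear V -> X} := mklin Thl.
have ThE v : jval (Th v) = \sum_j v j * w j by rewrite linear_sum.
have Th_act a v : Th (act a v) = jact a (Th v).
  by apply: jval_inj; rewrite jactE !ThE mulr_sumr; apply: eq_bigr => j _; rewrite ffunE mulrA.
have pipi v : pi (pi v) = pi v.
  apply/ffunP => j; rewrite !piE.
  under eq_bigr => i _ do rewrite piE mulr_suml.
  rewrite exchange_big; apply: eq_bigr => l _.
  under eq_bigr => i _ do rewrite -mulrA -psiM ?ep ?pe //.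
  by rewrite -mulr_sumr -(linsum (psil j)) psiw.
have Thpi v : Th (pi v) = Th v.
  apply: jval_inj; rewrite !ThE.
  under eq_bigr => j _ do rewrite piE mulr_suml.
  rewrite exchange_big; apply: eq_bigr => i _.
  under eq_bigr => j _ do rewrite -mulrA.
  by rewrite -mulr_sumr psiw.
have Ths y : exists v, Th v = y.
  have [t Ht] := Je (jval_in y).
  exists [ffun j => \sum_(u <- t) u.1 * psi j (e * u.2)].
  apply: jval_inj; rewrite ThE Ht.
  under eq_bigr => j _ do rewrite ffunE mulr_suml.
  rewrite exchange_big; apply: eq_bigr => u _.
  under eq_bigr => j _ do rewrite -mulrA.
  by rewrite -mulr_sumr psiw mulrA // ee.
have idl : linear (fun x : X => x) by [].
have [sg Hsg] := sdual1_projective (sretract_sdual B1 Jr) (mklin idl) Ths.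
have {}Hsg x : Th (sg x) = x := Hsg x.
have rhl : linear (fun v => pi v - pi (sg (Th v))).
  by move=> a v v'; rewrite !(linearP pi) (linearP Th) (linearP sg) (linearP pi) scalerBr; abel.
pose rh : {linear V -> V} := mklin rhl.
have rhE v : rh v = pi v - pi (sg (Th v)) by [].
have Thrh v : Th (rh v) = 0 by rewrite rhE linearB !Thpi Hsg subrr.
have pirh v : pi (rh v) = rh v by rewrite !rhE linearB !pipi.
have rhrh v : rh (rh v) = rh v by rewrite rhE Thrh (linear0 sg) (linear0 pi) subr0 pirh.
(* A dual basis of J up to c recovers c v from the images of Th v under endomorphisms of J, so c
   kills the kernel of the multiplication. *)
have killed v : pi v = v -> Th v = 0 -> c *: v = 0.
  move=> pv tv; apply/ffunP => j; rewrite !ffunE -pv piE scaler_sumr.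
  have [t Ht] := choice (fun m => Je (jval_in (xF m))).
  have eF i m : e * jval (emap (F m) (wX i)) = jval (emap (F m) (wX i)).
    rewrite -jactE -emapA; congr (jval (emap _ _)); apply: jval_inj.
    by rewrite jactE; exact: ew.
  have cw i : c *: w i = \sum_m \sum_(u <- t m) (jval (emap (F m) (wX i)) * u.1 * e) * (e * u.2).
    rewrite -[w i]/(jval (wX i)) -linearZ_LR HF linear_sum; apply: eq_bigr => m _.
    rewrite jactE Ht mulr_sumr; apply: eq_bigr => u _.
    by rewrite !mulrA -[_ * e * e]mulrA ee.
  transitivity (\sum_m \sum_(u <- t m) (\sum_i v i * jval (emap (F m) (wX i))) * (u.1 * e * psi j (e * u.2))).
    under [RHS]eq_bigr => m _ do (under eq_bigr => u _ do rewrite mulr_suml).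
    under [RHS]eq_bigr => m _ do rewrite exchange_big.
    rewrite exchange_big; apply: eq_bigr => i _.
    rewrite pzscaleAr -(linZ (psil j)) cw (linsum (psil j)) mulr_sumr.
    apply: eq_bigr => m _; rewrite (linsum (psil j)) mulr_sumr; apply: eq_bigr => u _.
    rewrite psiM; last by rewrite -!mulrA ee.
      by rewrite !mulrA.
    by rewrite !mulrA eF.
  apply: big1 => m _; apply: big1 => u _.
  have -> : \sum_i v i * jval (emap (F m) (wX i)) = jval (emap (F m) (Th v)).
    rewrite linear_sum linear_sum; apply: eq_bigr => i _.
    by rewrite emapA jactE.
  by rewrite tv linear0 linear0 mul0r.
have V1 : sdual V 1 by apply: sdual_ffun.
have rh0 : forall v, rh v = 0.
  apply: (idempotent_map_zero units V1 rhrh) => f v.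
  apply: contrapT => /negP/units[d Hd]; apply: c0.
  rewrite -[c]mulr1 -Hd mulrCA.
  have -> : c * f (rh v) = 0 by rewrite -[_ * _]/(c *: (f (rh v))) -linearZ_LR killed ?linear0.
  by rewrite mulr0.
have pisg v : pi v = pi (sg (Th v)) by apply/eqP; rewrite -subr_eq0 -rhE rh0.
have fl j : linear (fun y : X => pi (sg y) j).
  by move=> a y z; rewrite (linearP sg) (linearP pi) !ffunE.
apply: (@adual_functionals _ _ _ _ I wX (fun j => mklin (fl j)) JJ) => [j a y|y].
  rewrite -[LHS]/(pi (sg (jact a y)) j) -[mklin _ y]/(pi (sg y) j).
  rewrite -{1}(Hsg y) -Th_act -pisg pi_act ffunE; congr (_ * _).
rewrite scale1r; transitivity (Th (pi (sg y))); first by rewrite Thpi Hsg.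
by apply: eq_bigr => j _.
Qed.

(** Morita invariance: E = E et E for the idempotent et = rho(e), and et E et consists of right
    multiplications by C. The legs of the Casimir element are exchanged since [rho] reverses
    products. *)
Lemma corner_end_csep : adual J 1 -> csep E 1.
Proof.
move=> [I [x [f Hf]]]; have [se sm sc] := sP.
pose et : E := rho J e.
pose eX : X := Submod eJ.
have rl := @rho_linear _ _ J.
have [w Hw] : two_sided et (1 : E).
  rewrite -[1](scale1r (1 : E)) -(adual_sum Hf); apply: (smod_sum (two_sided_smod et)) => i _.
  have [t ->] := Je (jval_in (x i)).
  rewrite (linsum rl) mulr_suml; apply: (smod_sum (two_sided_smod et)) => u _.
  by rewrite !rhoM -mulrA -mulrA mulrA; apply: two_sided_mul.
have cut (h : E) : exists a, [/\ e * a = a, a * e = a & et * h * et = rho J a].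
  exists (jval (emap h eX) * e).
  have eh : e * jval (emap h eX) = jval (emap h eX).
    rewrite -jactE -emapA; congr (jval (emap _ _)); apply: jval_inj.
    by rewrite jactE.
  split; first by rewrite mulrA eh.
    by rewrite -mulrA ee.
  rewrite -mulrA; have -> : h * et = rho J (jval (emap h eX)) by apply: (rho_left h eX).
  by rewrite -rhoM.
exists (\sum_(q <- w) \sum_(v <- s) tens (q.1 * rho J v.2) (rho J v.1 * q.2)); split.
  rewrite (linsum (@mult_linear _ _)) scale1r Hw; apply: eq_bigr => q _.
  rewrite (linsum (@mult_linear _ _)) /et -sm (linsum rl) mulr_sumr mulr_suml.
  by apply: eq_bigr => v _; rewrite mult_tens rhoM !mulrA.
move=> h; rewrite (linsum (lact_linr h)) (linsum (ract_linl h)).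
have move_in q l : \sum_(v <- s) tens (l.1 * (et * l.2 * h * q.1 * et) * rho J v.2) (rho J v.1 * q.2)
    = \sum_(v <- s) tens (l.1 * rho J v.2) (rho J v.1 * (et * l.2 * h * q.1 * et) * q.2).
  have [a [ea ae Ha]] := cut (l.2 * h * q.1).
  have {}Ha : et * l.2 * h * q.1 * et = rho J a by rewrite -Ha !mulrA.
  rewrite Ha.
  pose b (y z : B) := tens (l.1 * rho J z) (rho J y * q.2).
  have bl z : linear (b^~ z).
    by move=> c y y'; rewrite /b rl mulrDl -pzscaleAl tens_linr.
  have br y : linear (b y).
    by move=> c z z'; rewrite /b rl mulrDr -pzscaleAr tens_linl.
  have := sc _ b bl br a ea ae; rewrite /b => H.
  under eq_bigr => v _ do rewrite -mulrA -rhoM.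
  rewrite -H; apply: eq_bigr => v _; by rewrite rhoM.
transitivity (\sum_(q <- w) \sum_(l <- w) \sum_(v <- s)
    tens (l.1 * (et * l.2 * h * q.1 * et) * rho J v.2) (rho J v.1 * q.2)).
  apply: eq_bigr => q _; rewrite (linsum (lact_linr h)) exchange_big.
  rewrite big_seq [RHS]big_seq; apply: eq_bigr => v /se[_ [_ v2e]].
  rewrite lact_tens -[h in LHS]mul1r Hw mulr_suml mulr_suml (linsum (tens_linl _)).
  apply: eq_bigr => l _; congr (tens _ _).
  have -> : rho J v.2 = et * rho J v.2 by rewrite -rhoM v2e.
  by rewrite !mulrA -[_ * et * et]mulrA -rhoM ee.
transitivity (\sum_(l <- w) \sum_(q <- w) \sum_(v <- s)
    tens (l.1 * rho J v.2) (rho J v.1 * (et * l.2 * h * q.1 * et) * q.2)).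
  by rewrite exchange_big; apply: eq_bigr => l _; apply: eq_bigr => q _; apply: move_in.
apply: eq_bigr => l _; rewrite (linsum (ract_linl h)) exchange_big.
rewrite big_seq [RHS]big_seq; apply: eq_bigr => v /se[[ev1 _] _].
rewrite ract_tens -(linsum (tens_linr _)); congr (tens _ _).
transitivity (rho J v.1 * et * l.2 * h * \sum_(q <- w) q.1 * et * q.2).
  by rewrite mulr_sumr; apply: eq_bigr => q _; rewrite !mulrA.
by rewrite -Hw mulr1 -rhoM ev1.
Qed.
End CornerToIdeal.

(** * Extending ideals along a base change *)

Section Extension.
Variables (k k' : comPzRingType) (phi : {rmorphism k -> k'}).
Variables (A : pzAlgType k) (A' : pzAlgType k') (i : A -> A').
Hypotheses (iP : is_bc phi i) (iM : forall x y, i (x * y) = i x * i y).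
Variable J : ideal2 A.
Local Notation X := (ideal_mod J).

Definition ext_pred (y : A') := exists s : seq (k' * X), y = \sum_(u <- s) u.1 *: i (jval u.2).
Lemma ext_smod : smod ext_pred. Proof. exact: (sum_smod (fun x : X => i (jval x))). Qed.
Definition ext_sub : submodClosed A' := mksub ext_smod.

Lemma ext_mem (x : X) : ext_pred (i (jval x)).
Proof. by exists [:: (1, x)]; rewrite big_seq1 scale1r. Qed.

Fact ext_mul_l (a y : A') : y \in ext_sub -> a * y \in ext_sub.
Proof.
move=> /(mksubE ext_smod)[s ->]; apply/(mksubE ext_smod).
rewrite mulr_sumr; apply: (smod_sum ext_smod) => u _; rewrite -pzscaleAr.
apply: (smodZ ext_smod); move: a; apply: (bc_ind iP) => [|a].
  exact: (smod_preim (mklin (mulr_linear_alg (i (jval u.2)))) ext_smod).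
by rewrite -iM -jactE; apply: ext_mem.
Qed.

Fact ext_mul_r (y a : A') : y \in ext_sub -> y * a \in ext_sub.
Proof.
move=> /(mksubE ext_smod)[s ->]; apply/(mksubE ext_smod).
rewrite mulr_suml; apply: (smod_sum ext_smod) => u _; rewrite -pzscaleAl.
apply: (smodZ ext_smod); move: a; apply: (bc_ind iP) => [|a].
  exact: (smod_preim (mklin (mull_linear (i (jval u.2)))) ext_smod).
by rewrite -iM -jractE; apply: ext_mem.
Qed.

Definition ext_ideal : ideal2 A' := Ideal2 ext_mul_l ext_mul_r.

Lemma ext_ideal_bc : ideal_bc i J ext_ideal.
Proof.
split=> [x|y]; first by apply/(mksubE ext_smod)/ext_mem.
by have /(mksubE ext_smod) := jval_in y.
Qed.

Variables (J' : ideal2 A') (JP : ideal_bc i J J').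
Local Notation j := (jbc JP).

Lemma bc_sretract : sretract J 1 -> sretract J' 1.
Proof.
move=> [r Hr]; pose r' := bc_map iP (jbc_semilin iP JP) r.
exists r' => y; rewrite scale1r.
have EP : smod (fun y => r' (jval y) = y).
  split=> [|x z Hx Hz|a x Hx]; first by rewrite !linear0.
    by rewrite !linearD Hx Hz.
  by rewrite (linearZ_LR jval) (linearZ_LR r') Hx.
move: y; apply: (jbc_ind (JP := JP) EP) => x.
by rewrite jbcE bc_mapE Hr scale1r.
Qed.

(** The condition cuts out a submodule in each of b, a and H, so elements coming from J suffice; for
    H this uses that End_k(J) commutes with base change. *)
Lemma bc_sandwich c : is_bc phi j -> sdual X 1 -> sandwich J c -> sandwich J' (phi c).
Proof.
move=> jP X1 Jc; have jS := bc_semilin jP.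
pose K (G : endk (ideal_mod J')) := exists s : seq (ideal_mod J' * ideal_mod J'),
  forall z, endo_fun G z = \sum_(u <- s) jact (jval u.1) (jract z (jval u.2)).
have KP : smod K.
  split=> [|f g [s Hs] [t Ht]|a f [s Hs]].
  - by exists [::] => z; rewrite big_nil.
  - by exists (s ++ t) => z; rewrite endkD Hs Ht big_cat.
  exists [seq (a *: u.1, u.2) | u <- s] => z.
  rewrite endkZ Hs big_map scaler_sumr; apply: eq_bigr => u _.
  exact: (esym (linZ (jact_linl (jract z (jval u.2))) a (jval u.1))).
have ml (a b : ideal_mod J') : linear (fun z : ideal_mod J' => jact (jval b) (jract z (jval a))).
  by move=> d x y; rewrite jract_linl jact_linr.
pose G (b a : ideal_mod J') (H : endk (ideal_mod J')) : endk (ideal_mod J') :=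
  (mklin (scale_linear (phi c) (mklin (comp_linear (endo_fun H) (mklin (ml a b))))) : {linear ideal_mod J' -> ideal_mod J'}).
suff GK : forall b a H, K (G b a H) by move=> b a H; have [s Hs] := GK b a H; exists s.
have GE b a H z : endo_fun (G b a H) z = phi c *: endo_fun H (jact (jval b) (jract z (jval a))) by [].
have Gl1 a H : linear (fun b => G b a H).
  move=> d x y; apply: endoP => z; rewrite endkD endkZ !GE (linearP jval) jact_linl.
  by rewrite (linearP (endo_fun H)) scalerDr !scalerA mulrC.
have Gl2 b H : linear (fun a => G b a H).
  move=> d x y; apply: endoP => z; rewrite endkD endkZ !GE (linearP jval) jract_linr jact_linr.
  by rewrite (linearP (endo_fun H)) scalerDr !scalerA mulrC.
have Gl3 b a : linear (fun H => G b a H).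
  by move=> d f g; apply: endoP => z; rewrite endkD endkZ /= scalerDr !scalerA mulrC.
move=> b a H; move: b; apply: (bc_ind jP) => [|b]; first exact: (smod_preim (mklin (Gl1 a H)) KP).
move: a; apply: (bc_ind jP) => [|a]; first exact: (smod_preim (mklin (Gl2 _ H)) KP).
move: H; apply: (bc_ind (bc_endk jP X1)) => [|H]; first exact: (smod_preim (mklin (Gl3 _ _)) KP).
have [s Hs] := Jc b a H.
exists [seq (j u.1, j u.2) | u <- s].
have sl : linear (fun z : ideal_mod J' => \sum_(u <- [seq (j u.1, j u.2) | u <- s]) jact (jval u.1) (jract z (jval u.2))).
  by apply: sum_linear => u; apply: ml.
apply: (bc_ext jP (f := endo_fun (G (j b) (j a) (endk_bc jP H))) (g := mklin sl)) => z.
rewrite GE -[mklin sl _]/(\sum_(u <- _) _) big_map; transitivity (j (\sum_(u <- s) jact (jval u.1) (jract z (jval u.2)))).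
  rewrite -Hs (semilinZ jS) -(endk_bcE jP); congr (_ *: endo_fun _ _).
  by rewrite (jbc_act iM) (jbc_ract iM).
rewrite (semilin_sum jS); apply: eq_bigr => u _.
by rewrite (jbc_act iM) (jbc_ract iM).
Qed.
End Extension.

(** * Truncations and purity in codimension two *)

Section PrimePowers.
Variables (k : comPzRingType) (p : spec k) (g : seq k).
Hypotheses (gp : forall a, a \in g -> a \in spec_ideal p)
  (pg : forall a, a \in spec_ideal p -> @spn k k^o g a).

Fixpoint monomials n : seq k :=
  if n is n'.+1 then [seq x * y | x <- g, y <- monomials n'] else [:: 1].
Local Notation pw n := (@spn k k^o (monomials n)).

Lemma power_mul n x y : x \in spec_ideal p -> pw n y -> pw n.+1 (x * y).
Proof.
have SP := @smod_spn k k^o (monomials n.+1) => /pg Hx Hy; move: x Hx.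
apply: (spn_ind (M := k^o) (E := fun x => pw n.+1 (x * y))).
  split=> [|a b Ha Hb|c a Ha]; first by rewrite mul0r; exact: (smod0 SP).
    by rewrite mulrDl; exact: (smodD SP).
  by rewrite -[c *: a]/(c * a) -mulrA; exact: (smodZ SP).
move=> x xg; move: y Hy; apply: (spn_ind (M := k^o) (E := fun y => pw n.+1 (x * y))).
  split=> [|a b Ha Hb|c a Ha]; first by rewrite mulr0; exact: (smod0 SP).
    by rewrite mulrDr; exact: (smodD SP).
  by rewrite -[c *: a]/(c * a) mulrCA; exact: (smodZ SP).
by move=> y yn; apply: spn_mem; apply: allpairs_f.
Qed.

Lemma powsub_power n : powsub p n (pw n).
Proof.
elim: n => [|n IHn] [|x l] //= => [_ _|[sl] lp].
  by rewrite big_nil; apply: spn_mem; rewrite inE.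
rewrite big_cons; apply: power_mul; first by apply: lp; rewrite inE eqxx.
by apply: IHn => // y yl; apply: lp; rewrite inE yl orbT.
Qed.

Lemma power_succ n y : y \in monomials n.+1 ->
  exists x z, [/\ x \in spec_ideal p, z \in monomials n & y = x * z].
Proof. by move=> /allpairsP[[x z] /= [xg zn ->]]; exists x, z; split=> //; apply: gp. Qed.

Lemma power_ideal n y : pw n.+1 y -> y \in spec_ideal p.
Proof.
apply: (spn_ind (M := k^o) (E := fun y => y \in spec_ideal p)); first exact: smod_mem.
by move=> x /power_succ[a [b [ap _ ->]]]; apply: specMr.
Qed.

Lemma power_le n m y : pw (n + m) y -> pw n y.
Proof.
elim: m y => [|m IHm] y; first by rewrite addn0.
rewrite addnS => Hy; apply: IHm; move: y Hy.
apply: (spn_ind (M := k^o) (E := fun y => pw (n + m) y)); first exact: smod_spn.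
move=> x /power_succ[a [b [_ bn ->]]].
by apply: (smodZ (@smod_spn k k^o _) a); apply: spn_mem.
Qed.

(** Nakayama's lemma for p^n: a remainder in p^(n+m+1) lies in p p^n. *)
Lemma power_nakayama n m (D : k -> Prop) : ideal_like D ->
  powsub p n (@loc_in k p k^o (fun a => exists2 b, pw (n + m.+1) b & D (a - b))) ->
  powsub p n (@loc_in k p k^o D).
Proof.
move=> DP Hn.
have up y : pw (n + m.+1) y -> @addspan k k^o (fun a => a \in spec_ideal p) D (monomials n) y.
  have AP := smod_addspan (M := k^o) (monomials n) (ideal_like_mem p) DP.
  move: y; apply: (spn_ind AP) => y; rewrite addnS => /power_succ[a [b [ap bn ->]]].
  apply: (addspan_scaled (M := k^o) (ideal_like_mem p) DP ap (power_le (m := m) _)).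
  exact: spn_mem.
have mon x : x \in monomials n -> exists2 l, size l = n & (forall y, y \in l -> y \in spec_ideal p) /\ x = \prod_(y <- l) y.
  elim: (n) x => [|r IHr] x.
    by rewrite inE => /eqP ->; exists [::]; rewrite ?big_nil.
  move=> /power_succ[a [b [ap /IHr[l sl [lp ->]] ->]]]; exists (a :: l); rewrite /= ?sl //.
  by rewrite big_cons; split=> // y; rewrite inE => /orP[/eqP ->|/lp].
have [|s sp Hs] := @nakayama_seq k p k^o D (monomials n) DP.
  move=> x /mon[l sl [lp ->]]; have [t tp [b Hb Db]] := Hn l sl lp.
  exists t => //; rewrite -[X in addspan _ _ _ X](subrK b).
  have AP := smod_addspan (M := k^o) (monomials n) (ideal_like_mem p) DP.
  apply: (smodD AP) (up _ Hb); apply: addspan_sub => //; exact: ideal_like_mem.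
move=> l sl lp; exists s => //; have := powsub_power sl lp.
move: (\prod_(x <- l) x) => y {l sl lp}.
apply: (spn_ind (M := k^o) (E := fun y => D (s *: (y : k^o)))); last exact: Hs.
split=> [|a b Ha Hb|c a Ha]; first by rewrite scaler0; exact: (smod0 DP).
  by rewrite scalerDr; exact: (smodD DP).
by rewrite scalerA mulrC -scalerA; exact: (smodZ DP).
Qed.

Lemma powsub_chunks (C : k -> Prop) n q (l : seq k) : powsub p n C -> size l = (q * n)%N ->
  (forall x, x \in l -> x \in spec_ideal p) ->
  exists c : 'I_q -> k, (forall i, C (c i)) /\ \prod_(x <- l) x = \prod_i c i.
Proof.
move=> Cn; elim: q l => [|q IHq] l.
  by move/size0nil => -> _; exists (fun=> 0); rewrite big_nil big_ord0; split=> // -[].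
rewrite mulSn => sl lp.
have st : size (take n l) = n by rewrite size_takel // sl leq_addr.
have [||c [Hc pc]] := IHq (drop n l).
- by rewrite size_drop sl addKn.
- by move=> x /mem_drop; apply: lp.
exists (fun i => if unlift ord0 i is Some j then c j else \prod_(x <- take n l) x).
split=> [i|].
  by case: unliftP => [j _|_]; [exact: Hc|apply: Cn => // x /mem_take; apply: lp].
rewrite big_ord_recl unlift_none -[in LHS](cat_take_drop n l) big_cat pc.
by congr (_ * _); apply: eq_bigr => j _; rewrite liftK.
Qed.
End PrimePowers.

Section ReductionTransition.
Variables (R : comPzRingType) (I1 I2 : {pred R}).

Definition red_trans of {subset I1 <= I2} := fun c : redring I1 => redpi I2 (repr c : R^o) : redring I2.

Variable I12 : {subset I1 <= I2}.
Local Notation f := (red_trans I12).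

Lemma red_transE (x : R^o) : f (redpi I1 x) = redpi I2 x.
Proof.
apply: redpiP; move: (red_repr I1 x).
move: (_ - _) => y; apply: (@mulspan_ind R R^o I1 (fun y => y \in @mulspan R I2 R^o)).
  exact: smod_mulspan.
by move=> a z aI; apply: mulspan_mem; apply: I12.
Qed.

Fact red_trans_zmod : zmod_morphism f.
Proof.
move=> c d; elim/red_ind: c => x; elim/red_ind: d => y.
rewrite -[redpi I1 x]/(red_hom I1 x) -[redpi I1 y]/(red_hom I1 y) -rmorphB.
by rewrite !red_transE -[RHS](rmorphB (red_hom I2)).
Qed.
Fact red_trans_monoid : GRing.monoid_morphism f.
Proof.
split=> [|c d]; first by rewrite -(rmorph1 (red_hom I1)) red_transE.
elim/red_ind: c => x; elim/red_ind: d => y.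
rewrite -[redpi I1 x]/(red_hom I1 x) -[redpi I1 y]/(red_hom I1 y) -rmorphM.
by rewrite !red_transE -[RHS](rmorphM (red_hom I2)).
Qed.
HB.instance Definition _ := GRing.isZmodMorphism.Build (redring I1) (redring I2) f red_trans_zmod.
HB.instance Definition _ := GRing.isMonoidMorphism.Build (redring I1) (redring I2) f red_trans_monoid.
End ReductionTransition.

(** * The Artinian rings k_p / p^(n+1) *)

Section Truncation.
Variables (k : comPzRingType) (k_noeth : noetherian k) (p : spec k) (g : seq k) (n : nat).
Hypotheses (gp : forall a, a \in g -> a \in spec_ideal p)
  (pg : forall a, a \in spec_ideal p -> @spn k k^o g a).
Local Notation pw := (@spn k k^o (monomials g n.+1)).

(** The exponent is n + 1 so that the ideal lies in p and the truncation maps to the residue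
    field. *)
Definition trunc_pred : {pred locring p} := fun c => `[< exists2 a : k, pw a & c = loc_hom p a >].
Local Notation S := (redring trunc_pred).
Local Notation h := (lr_hom trunc_pred).

Lemma loc_frac (c : locring p) : exists s : k, s \notin spec_ideal p /\
  exists a : k, loc_hom p s * c = loc_hom p a.
Proof.
elim/loc_ind: c => a s; exists (dval s); split; first exact: (valP s).
exists a; rewrite [LHS](locring_mulE (dval s) a); apply: locfrac_eq.
by rewrite dval1 scale1r /= mul1r.
Qed.

Lemma loc_hom_eq (a b : k) : loc_hom p a = loc_hom p b ->
  exists w, w \notin spec_ideal p /\ w * a = w * b.
Proof.
move=> /locfracP[w]; rewrite dval1 !scale1r => H.
by exists (dval w); split; first exact: (valP w).
Qed.

Lemma trunc_eq0 (a : k) : h a = 0 <-> @loc_in k p k^o pw a.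
Proof.
have PP := @smod_spn k k^o (monomials g n.+1).
have lD (x y : k) : loc_hom p (x + y) = loc_hom p x + loc_hom p y by apply: rmorphD.
have lM (x y : k) : loc_hom p (x * y) = loc_hom p x * loc_hom p y by apply: rmorphM.
pose L (c : locring p) := exists s, s \notin spec_ideal p /\ exists2 b : k, pw b & loc_hom p s * c = loc_hom p b.
have LP : @smod (locring p) (locring p)^o L.
  split=> [|x y [s [sp [b Hb E]]] [t [tp [d Hd F]]]|c x [s [sp [b Hb E]]]].
  - exists 1; split; first exact: spec1.
    by exists 0; [exact: (smod0 PP)|rewrite mulr0 rmorph0].
  - exists (s * t); split; first exact: specM.
    exists (t * b + s * d); first by apply: (smodD PP); apply: (smodZ PP).
    rewrite lD !lM -E -F; ring.
  have [t [tp [d Hd]]] := loc_frac c; exists (t * s); split; first exact: specM.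
  exists (d * b); first exact: (smodZ PP).
  rewrite -[c *: x]/(c * x) !lM -E -Hd; ring.
split=> [/redpi_eq0 Ha|[s sp Hs]].
  have [s [sp [b Hb]]] : L (loc_hom p a).
    have LI (c : locring p) (x : (locring p)^o) : c \in trunc_pred -> L (c *: x).
      move=> /asboolP[b Hb ->]; rewrite -[_ *: _]/(loc_hom p b * x) mulrC.
      apply: (smodZ LP); exists 1; split; first exact: spec1.
      by exists b => //; rewrite rmorph1 mul1r.
    exact: (@mulspan_ind (locring p) (locring p)^o trunc_pred L LP LI _ Ha).
  rewrite -rmorphM => /loc_hom_eq[w [wp E]]; exists (w * s); first exact: specM.
  rewrite -[_ *: _]/(w * s * a) -mulrA E; exact: (smodZ PP).
have [d ds] := loc_unit sp; apply/redpi_eq0.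
rewrite -[X in X \in _]/(loc_hom p a).
have -> : loc_hom p a = loc_hom p (s * a) *: (d : (locring p)^o).
  by rewrite -[RHS]/(loc_hom p (s * a) * d) rmorphM mulrC mulrA ds mul1r.
by apply: mulspan_mem; apply/asboolP; exists (s * a).
Qed.

Fact trunc_sub : {subset trunc_pred <= @locprime k p}.
Proof.
by move=> c /asboolP[a Ha ->]; apply/locprimeE; exists a => //; apply: (power_ideal gp) Ha.
Qed.

Definition trunc_res : {rmorphism S -> resfield p} := red_trans trunc_sub.
Lemma trunc_resE a : trunc_res (h a) = fhom p a.
Proof. exact: red_transE. Qed.

Lemma trunc_frac (c : S) : exists s : k, s \notin spec_ideal p /\ exists a : k, h s * c = h a.
Proof.
elim/red_ind: c => x; have [s [sp [a Ha]]] := loc_frac x.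
exists s; split=> //; exists a; rewrite -[redpi _ x]/(red_hom trunc_pred x).
by rewrite -[h s]/(red_hom trunc_pred (loc_hom p s)) -rmorphM Ha.
Qed.

Fact trunc_ker : ideal_like (fun c : S => trunc_res c = 0).
Proof.
split=> [|x y Hx Hy|a x Hx]; first exact: rmorph0.
  by rewrite rmorphD Hx Hy addr0.
by rewrite -[a *: x]/(a * x) rmorphM Hx mulr0.
Qed.
Fact trunc_ker1 : trunc_res 1 <> 0.
Proof. by rewrite rmorph1; exact: (resfield_field p).1. Qed.
Fact trunc_ker_prime a b : trunc_res (a * b) = 0 -> trunc_res a = 0 \/ trunc_res b = 0.
Proof.
rewrite rmorphM => ab; have [|/(resfield_field p).2[c ca]] := pselect (trunc_res a = 0); first by left.
by right; rewrite -[LHS]mul1r -ca -mulrA ab mulr0.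
Qed.
Definition trunc_spec : spec S := mkspec trunc_ker trunc_ker1 trunc_ker_prime.
Lemma trunc_specE c : (c \in spec_ideal trunc_spec) <-> trunc_res c = 0.
Proof. exact: mkspecE. Qed.

Lemma trunc_units (c : S) : c \notin spec_ideal trunc_spec -> exists d, d * c = 1.
Proof.
move=> /negP cp; have [s [sp [a Ha]]] := trunc_frac c.
have ap : a \notin spec_ideal p.
  apply/negP => ap; apply: cp; apply/trunc_specE.
  have [d ds] := fhom_unit sp; rewrite -[LHS]mul1r -ds -mulrA -(trunc_resE s) -rmorphM Ha.
  by rewrite trunc_resE fhom0 // mulr0.
have [d da] := lr_unit trunc_pred ap.
by exists (d * h s); rewrite -mulrA Ha.
Qed.

Lemma trunc_nil : powsub trunc_spec n.+1 (fun c => c = 0).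
Proof.
move=> l sl lp.
have [s [sp [l' [sl' [lp' E]]]]] : exists s, s \notin spec_ideal p /\ exists l' : seq k,
    size l' = size l /\ (forall x, x \in l' -> x \in spec_ideal p) /\
    h s * \prod_(x <- l) x = h (\prod_(x <- l') x).
  elim: l lp {sl} => [|c l IHl] lp.
    by exists 1; split; [exact: spec1|exists [::]; rewrite !big_nil mulr1].
  have [|s [sp [l' [sl' [lp' E]]]]] := IHl; first by move=> x xl; apply: lp; rewrite inE xl orbT.
  have [t [tp [a Ha]]] := trunc_frac c.
  exists (t * s); split; first exact: specM.
  exists (a :: l'); split; first by rewrite /= sl'.
  split.
    move=> x; rewrite inE => /orP[/eqP ->|]; last exact: lp'.
    apply: fhom_eq0; rewrite -trunc_resE -Ha rmorphM.
    by have /trunc_specE -> : c \in spec_ideal trunc_spec; rewrite ?mulr0 //; apply: lp; rewrite inE eqxx.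
  have hM (x y : k) : h (x * y) = h x * h y by apply: rmorphM.
  rewrite !big_cons !hM -E -Ha; ring.
have [d ds] := lr_unit trunc_pred sp.
have := congr1 ( *%R d) E; rewrite mulrA ds mul1r => ->.
rewrite (_ : h _ = 0) ?mulr0 //; apply/trunc_eq0.
by apply: loc_in_sub; apply: (powsub_power pg) => //; rewrite sl'.
Qed.

Lemma trunc_noetherian : noetherian S.
Proof.
move=> L; have LP := smod_mem L.
have CP : ideal_like (fun a : k => (h a : S^o) \in L).
  split=> [|x y Hx Hy|a x Hx]; first by rewrite rmorph0; exact: (smod0 LP).
    by rewrite rmorphD; exact: (smodD LP).
  by rewrite -[a *: x]/(a * x) rmorphM; exact: (smodZ LP).
have [l lL Ll] := ideal_gens k_noeth CP.
have li (i : 'I_(size l)) : (h (tnth (in_tuple l) i) : S^o) \in L by apply: lL; apply: mem_tnth.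
exists (size l), (fun i => Submod (li i)) => -[y yL].
have [s [sp [a Ha]]] := trunc_frac y.
have aL : (h a : S^o) \in L by rewrite -Ha; exact: (smodZ LP).
have [c Hc] := spn_fin (Ll a aL).
have [d ds] := lr_unit trunc_pred sp.
exists (fun i => d * h (c i)); apply: val_inj => /=.
rewrite -[val]/(@submod_val _ _ L) linear_sum.
rewrite -[LHS]mul1r -ds -mulrA Ha Hc rmorph_sum mulr_sumr; apply: eq_bigr => i _.
have hM (x z : k) : h (x * z) = h x * h z by apply: rmorphM.
rewrite -[c i *: _]/(c i * tnth (in_tuple l) i) hM linearZ_LR; exact: mulrA.
Qed.
End Truncation.

(** * Purity: from height one to all primes *)

Section Purity.
Variables (k : comPzRingType) (A : pzAlgType k) (J : ideal2 A) (lA : seq A).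
Hypotheses (k_noeth : noetherian k) (kI : integrally_closed_domain k).
Hypotheses (lAP : forall y, spn lA y) (A1 : sdual A 1) (JJ : idempotent_ideal J).
Hypothesis r1 : sretract J 1.
Local Notation X := (ideal_mod J).
Local Notation E := (end_ideal J).

Section AtPrime.
Variables (p : spec k) (T : nat).
Hypothesis p_height : ~ height_le p 1.
Local Notation Ic := (fun c : k => adual J c /\ sandwich J c).
Hypothesis pT : powsub p T (@loc_in k p k^o Ic).
Local Notation Jp := (fibre_ideal J p).

(** Otherwise p^n lies in (d) at p by [power_nakayama], and [powsub_principal] makes p principal. As
    d only lifts an element of a truncation it may be 0; then p^n vanishes at p and any non-zero
    element of p can replace d. *)
Lemma power_height (g : seq k) (d : k) n m :
  (forall a, a \in g -> a \in spec_ideal p) ->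
  (forall a, a \in spec_ideal p -> @spn k k^o g a) -> d \in spec_ideal p ->
  ~ powsub p n (@loc_in k p k^o (fun a => exists2 b : k, @spn k k^o (monomials g (n + m.+1)) b & multiple d (a - b))).
Proof.
move=> gp pg dp H; apply: p_height; case: (kI) => dom _.
apply: (principal_height k_noeth dom).
have [[a ap a0]|p0] := pselect (exists2 x, x \in spec_ideal p & x <> 0); last first.
  exists 0; first exact: (smod0 (smod_mem p)).
  exists 1; first exact: spec1.
  move=> x xp; exists 0; rewrite mul1r mulr0.
  by apply: contrapT => x0; apply: p0; exists x.
have {}H := power_nakayama gp pg (multiple_ideal d) H.
have [d0|d0] := pselect (d = 0); last exact: (powsub_principal k_noeth kI d0 dp H).
apply: (powsub_principal k_noeth kI a0 ap (T := n)) => l sl lp.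
apply: loc_in_imp (H l sl lp) => y [z ->]; rewrite d0 mul0r.
by exists 0; rewrite mulr0.
Qed.

(* Over k_p / p^N, J is generated by an idempotent e, and the determinant d of
   C (x) C -> End(C), C = eBe, divides all long products of elements of Ic, which
   contains p^T at p. If d were in p then
   p^M <= (d) + p^N, hence p^M <= (d) at p, and p would be principal. *)
Lemma purity_fibre : adual Jp 1 /\ csep (end_ideal Jp) 1.
Proof.
have [g gp pg] := spec_gens p k_noeth.
(* [q0] bounds the size of the determinant, whose divisibility concerns products of at most q0 T
   elements of p; the further T keeps some element of [Ic] non-zero in the truncation. *)
pose q0 := (size lA * size lA)%N; pose n := (q0 * T + T)%N.
pose I := @trunc_pred k p g n; pose h := lr_hom I; pose S := redring I.
pose B := lr_alg I A; pose i : A -> B := @lrpi k p I A.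
have iP : is_bc h i by apply: bc_lr.
have iM : forall x y, i (x * y) = i x * i y by apply: lrpiM.
have h11 : 1 * h 1 = 1 by rewrite mul1r rmorph1.
pose JS := ext_ideal iP iM J; have JSP : ideal_bc i J JS := ext_ideal_bc iP iM J.
have jP := bc_jbc iP JSP h11 r1.
have lB := bc_spn iP lAP.
have B1 : sdual B 1 := bc_sdual iP h11 A1.
have JJS : idempotent_ideal JS := bc_idempotent iP iM JSP JJ.
have rS : sretract JS 1 := bc_sretract iP JSP r1.
have X1 := sretract_sdual A1 r1.
have h0 a : h a = 0 -> @loc_in k p k^o (@spn k k^o (monomials g n.+1)) a.
  exact: (proj1 (trunc_eq0 p g n a)).
have units c : c \notin spec_ideal (trunc_spec n gp) -> exists d : S, d * c = 1.
  exact: (@trunc_units k p g n gp c).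
pose IcS (c' : S) := exists2 c, Ic c & c' = h c.
have Ic_star c : IcS c -> sandwich JS c.
  by move=> [b [_ Hb] ->]; apply: (bc_sandwich iM jP X1 Hb).
have Ic_adual c : IcS c -> adual JS c.
  by move=> [b [Hb _] ->]; apply: (bc_adual iP iM jP Hb).
have Ic_det (d : S) q : (q <= size [seq i x | x <- lA] * size [seq i x | x <- lA])%N ->
    (forall c : 'I_q -> S, (forall m, IcS (c m)) -> exists y, \prod_m c m = d * y) ->
    d \notin spec_ideal (trunc_spec n gp).
  rewrite size_map -/q0 => qle Hd; apply/negP => /trunc_specE dp.
  have [s [sp [d0 Hd0]]] := trunc_frac d.
  have d0p : d0 \in spec_ideal p by apply: fhom_eq0; rewrite -(trunc_resE n gp) -Hd0 rmorphM dp mulr0.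
  apply: (power_height (n := q * T) (m := (q0 - q) * T + T) gp pg d0p) => l sl lp.
  have [c [Hc ->]] := powsub_chunks pT sl lp.
  have cE m : exists t, t \notin spec_ideal p /\ Ic (t * c m).
    by have [t tp Ht] := Hc m; exists t.
  have [t Ht] := choice cE.
  have [|y Hy] := Hd (fun m => h (t m * c m)).
    by move=> m; exists (t m * c m) => //; apply: (Ht m).2.
  have [s' [sp' [y0 Hy0]]] := trunc_frac y.
  have tp : \prod_m t m \notin spec_ideal p.
    by apply: (big_ind (fun x => x \notin spec_ideal p)); [exact: spec1|exact: specM|move=> m _; apply: (Ht m).1].
  have hM (x z : k) : h (x * z) = h x * h z by apply: rmorphM.
  have E1 : h (s * s' * \prod_m t m * \prod_m c m - d0 * y0) = 0.
    rewrite /h rmorphB -/h; apply/eqP; rewrite subr_eq0; apply/eqP.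
    rewrite -mulrA -big_split hM [h (\prod_m _)](rmorph_prod h) Hy !hM.
    rewrite -[RHS]/(h d0 * h y0) -Hd0 -Hy0; ring.
  have [w wp Hw] := h0 _ E1.
  exists (w * (s * s' * \prod_m t m)); first by do 2!apply: specM => //; apply: specM.
  have -> : (q * T + ((q0 - q) * T + T).+1 = n.+1)%N.
    by rewrite addnS addnA -mulnDl subnKC.
  exists (w *: (s * s' * \prod_m t m * \prod_m c m - d0 * y0 : k^o)) => //.
  exists (w * y0); rewrite -![_ *: _]/(_ * _); ring.
(* Otherwise p^T lies in p^(n+1) at p, which [power_height] excludes with d = 0. *)
have [c [IcC c0]] : exists c, IcS c /\ c <> 0.
  apply: contrapT => nc.
  have Iz c : Ic c -> h c = 0.
    by move=> Hc; apply: contrapT => c0; apply: nc; exists (h c); split=> //; exists c.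
  apply: (power_height (n := T) (m := q0 * T) gp pg (smod0 (smod_mem p))) => l sl lp.
  have [t tp Ht] := pT sl lp; have [w wp Hw] := h0 _ (Iz _ Ht).
  exists (w * t); first exact: specM.
  have -> : (T + (q0 * T).+1 = n.+1)%N by rewrite addnS addnC.
  exists (w *: (t *: (\prod_(x <- l) x : k^o))) => //.
  by exists 0; rewrite -scalerA subrr mulr0.
have pN := @trunc_nil k p g n gp pg.
have SN : noetherian S := @trunc_noetherian k k_noeth p g n.
have [e [eJ ee Je]] := fitting_idempotent units SN pN lB JJS.
have [s sP] := corner_csep_exists units pN lB B1 Ic_star Ic_det eJ ee.
have aS : adual JS 1 := corner_adual units B1 JJS rS eJ ee Je sP c0 (Ic_adual _ IcC).
have cS : csep (end_ideal JS) 1 := corner_end_csep eJ ee Je sP aS.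
(* Both conclusions hold over the truncation and are now reduced to the residue field. *)
pose psi := @trunc_res k p g n gp.
have [f fE fP] := bc_cancel (fun a => esym (trunc_resE n gp a)) iP (bc_fib p A).
have fS := bc_semilin fP.
have fM : forall x y : B, f (x * y) = (f x : fibre_alg p A) * f y.
  move=> x y; move: x; apply: (bc_ind iP) => [|x].
    split=> [|x z Hx Hz|a x Hx]; first by rewrite mul0r !(semilin0 fS) mul0r.
      by rewrite mulrDl !(semilinD fS) mulrDl Hx Hz.
    by rewrite -pzscaleAl !(semilinZ fS) Hx pzscaleAl.
  move: y; apply: (bc_ind iP) => [|y].
    split=> [|y z Hy Hz|a y Hy]; first by rewrite mulr0 !(semilin0 fS) mulr0.
      by rewrite mulrDr !(semilinD fS) mulrDr Hy Hz.
    by rewrite -pzscaleAr !(semilinZ fS) Hy pzscaleAr.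
  by rewrite -iM !fE; apply: fibM.
have psi11 : 1 * psi 1 = 1 by rewrite mul1r rmorph1.
have JpP : ideal_bc f JS Jp.
  split=> [x|y].
    have PP := smod_mem (ideal2_sub Jp).
    have SP : smod (fun x : ideal_mod JS => f (jval x) \in ideal2_sub Jp).
      split=> [|y z Hy Hz|a y Hy]; first by rewrite linear0 (semilin0 fS); apply: (smod0 PP).
        by rewrite linearD (semilinD fS); apply: (smodD PP).
      by rewrite (linearZ_LR jval) (semilinZ fS); apply: (smodZ PP).
    move: x; apply: (jbc_ind (JP := JSP) SP) => x.
    by rewrite jbcE fE; apply: fibre_ideal_inE.
  have [u Hu] := (fibre_ideal_bc J p).2 y.
  exists [seq (v.1, jbc JSP v.2) | v <- u]; rewrite big_map Hu.
  by apply: eq_bigr => v _; rewrite jbcE fE.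
have fjP := bc_jbc fP JpP psi11 rS.
split; first by rewrite -(rmorph1 psi); apply: (bc_adual fP fM fjP aS).
exact: (bc_csep (bc_ebc fP fM fjP psi11 aS) (ebcM fP fM fjP) (ebc1 fP fM fjP) psi11 cS).
Qed.
End AtPrime.

Hypothesis E_center : forall z : E, (forall x, z * x = x * z) -> exists a : k, z = a *: (1 : E).

Lemma sandwich_ideal : ideal_like (sandwich J).
Proof.
split=> [b a H|c d Hc Hd b a H|c d Hd b a H].
- by exists [::] => z; rewrite scale0r big_nil.
- have [s Hs] := Hc b a H; have [t Ht] := Hd b a H.
  by exists (s ++ t) => z; rewrite scalerDl Hs Ht big_cat.
have [s Hs] := Hd b a H; exists [seq (c *: u.1, u.2) | u <- s] => z.
rewrite -[c *: d]/(c * d) -scalerA Hs big_map scaler_sumr; apply: eq_bigr => u _.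
exact: (esym (linZ (jact_linl (jract z (jval u.2))) c (jval u.1))).
Qed.

(** At p every endomorphism of E is inner up to a denominator, as E has centre [k]. With g = rho(z
    a) one has b z a = g(b), so a coordinate of H(b z a) is a functional of g, hence of the form sum
    v1 g v2; at a generator x_m of J this is sum v2(x_m) z v1(a). *)
Lemma local_sandwich (p : spec k) (s t : k) : s \notin spec_ideal p -> sdual E s ->
  t \notin spec_ideal p -> csep E t -> exists2 c, c \notin spec_ideal p & sandwich J c.
Proof.
move=> sp Es tp Et; have [d ds] := fhom_unit sp; have [d' dt] := fhom_unit tp.
have E's : csep (fibre_alg p E) 1 := bc_csep (bc_fib p E) (@fibM k p E) (fib1 p E) dt Et.
have E'd : sdual (fibre_alg p E) 1 := bc_sdual (bc_fib p E) ds Es.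
have [l Hl] := sdual_span E'd.
have lE' y : spn l y by have := Hl y; rewrite scale1r.
have E'i : forall H : endk (fibre_alg p E), inner H.
  apply: (central_inner (resfield_field p) lE' E's) => z zc.
  exact: fibre_center tp Et E_center zc.
have [c cp Hc] := local_inner sp Es (bc_fib p E) (@fibM k p E) E'i.
exists c => // b a H.
have [I [x [mu Hmu]]] := sretract_sdual A1 r1.
have thl m : linear (fun g : E => (mu m (endo_fun H (emap g b)) : k) *: (1 : E)).
  move=> e g g'; rewrite emapD emapZ (linearP (endo_fun H)) (linearP (mu m)) scalerDl.
  by congr (_ + _); apply/esym/scalerA.
have [u Hu] := choice (fun m => Hc (mklin (thl m) : {linear E -> E})).
exists (flatten [seq [seq (emap v.2 (x m), emap v.1 a) | v <- u m] | m <- index_enum I]) => z.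
rewrite big_flatten big_map; pose g : E := rho J (jval z * jval a).
have gE y : emap g y = jact (jval y) (jract z (jval a)).
  by rewrite rhoE; apply: jval_inj; rewrite jractE jactE jractE.
rewrite -(gE b) -[endo_fun H _]scale1r Hmu scaler_sumr; apply: eq_bigr => m _.
rewrite big_map scalerA.
transitivity (emap (endo_fun (c *: ((mklin (thl m) : {linear E -> E}) : endk E)) g) (x m)).
  rewrite endkZ emapZ -[endo_fun _ g]/((mu m (endo_fun H (emap g b)) : k) *: (1 : E)).
  by rewrite emapZ emap1 scalerA.
rewrite Hu emap_sum; apply: eq_bigr => v _.
by rewrite !emapM gE emapA emap_ract.
Qed.

Lemma normal_heredity :
  (forall p : spec k, height_le p 1 -> exists2 s, s \notin spec_ideal p & adual J s) ->
  (forall p : spec k, height_le p 1 -> exists2 t, t \notin spec_ideal p & csep E t) ->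
  adual J 1 /\ csep E 1.
Proof.
move=> Ha Hs; have X1 := sretract_sdual A1 r1.
pose C c := [/\ adual J c, sandwich J c & csep E c].
have [a0 aD aZ] := adual_ideal J; have [w0 wD wZ] := sandwich_ideal; have [c0 cD cZ] := csep_ideal E.
have CP : ideal_like C.
  split=> [|x y [? ? ?] [? ? ?]|x y [? ? ?]]; first by split.
    by split; [exact: aD|exact: wD|exact: cD].
  by split; [exact: aZ|exact: wZ|exact: cZ].
suff [] : C 1 by [].
have prodC p s t : s \notin spec_ideal p -> adual J s -> t \notin spec_ideal p -> csep E t ->
    exists2 c, c \notin spec_ideal p & C c.
  move=> sp Js tp Et; have Es : sdual E s.
    by have := sdual_end Js X1; rewrite mul1r.
  have [c cp Jc] := local_sandwich sp Es tp Et.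
  exists (s * t * c); first by do 2!apply: specM => //.
  split; last 2 first.
  - exact: (wZ (s * t)).
  - by rewrite mulrAC; exact: (cZ (s * c)).
  by rewrite -mulrA mulrC; exact: (aZ (t * c)).
apply: contrapT => nC; have [q _ Cq] := ideal_in_maximal k_noeth CP nC.
have [p [Cp _ [T pT]]] := minimal_prime k_noeth CP Cq.
suff [c cp Cc] : exists2 c, c \notin spec_ideal p & C c by move/negP: cp; apply; apply: Cp.
have [hp|hp] := pselect (height_le p 1).
  have [s sp Js] := Ha p hp; have [t tp Et] := Hs p hp; exact: prodC sp Js tp Et.
have [|aJp cJp] := purity_fibre hp (T := T).
  by move=> l sl lp; apply: loc_in_imp (pT l sl lp) => z [].
(* The good fibre at p is lifted back, which produces an element of [C] outside p. *)
have jf0 (y : X) : jfib p y = 0 <-> loc_in p (fun z => z \in @mulspan k (spec_ideal p) X) y.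
  exact: (bc_fib_eq0 (fibre_bc_jbc (spec1 p) r1)).
have [l lX] := ideal_mod_gens J k_noeth lAP.
have [s sp Js] := local_adual lX JJ A1 X1 jf0 aJp.
have Es : sdual E s by have := sdual_end Js X1; rewrite mul1r.
have b := fibre_ebc (spec1 p) r1 sp Js.
have [t tp Et] := local_csep sp Es b (ebcM _ _ _) (ebc1 _ _ _) cJp.
exact: prodC sp Js tp Et.
Qed.
End Purity.

Lemma zero_height (k : comPzRingType) (dom : is_domain k) : height_le (zero_spec dom) 1.
Proof.
by apply/(height_le1P dom) => q qz _ x /qz/zero_specE.
Qed.

Lemma dom_torsionfree (k : comPzRingType) (dom : is_domain k) (M : lmodType k) (s : k) (y : M) :
  sdual M 1 -> s <> 0 -> s *: y = 0 -> y = 0.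
Proof.
move=> [I [x [f Hf]]] s0 sy; rewrite -[y]scale1r Hf big1 // => i _.
have : s * f i y = 0 by rewrite -[LHS]/(s *: f i y) -linearZ_LR sy linear0.
by case/dom.2 => // ->; rewrite scale0r.
Qed.

(** Split 1 = y z + b along Fz and a complementary left ideal. Then z b lies in both, so z = z y z =
    y z z = 0. *)
Lemma central_nilpotent (K : comPzRingType) (F : pzAlgType K) (l : seq F) (z : F) :
  field_like K -> (forall y, spn l y) -> csep F 1 -> (forall x, z * x = x * z) ->
  z * z = 0 -> z = 0.
Proof.
move=> Kf lF Fs zc zz; have LP : @smod F F^o (fun x => exists y, x = y * z).
  split=> [|_ _ [x ->] [y ->]|a _ [x ->]]; first by exists 0; rewrite mul0r.
    by exists (x + y); rewrite mulrDl.
  by exists (a * x); rewrite -[_ *: _]/(a * (x * z)) mulrA.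
have [L' [L0 L1]] := csep_semisimple Kf lF Fs (mksub LP).
have [a [b [/(mksubE LP)[y Hy] bL E]]] := L1 (1 : F).
have zb : z * b = 0.
  apply: L0; last exact: (smodZ (smod_mem L') z bL).
  by apply/(mksubE LP); exists b.
have : z = z * a + z * b by rewrite -mulrDr -E mulr1.
by rewrite zb addr0 Hy mulrA zc -mulrA zz mulr0.
Qed.

Lemma csep_surj (k : comPzRingType) (E F : pzAlgType k) (f : E -> F) (t : k) :
  alg_hom f -> (forall y, exists x, f x = y) -> csep E t -> csep F t.
Proof.
move=> [fl [f1 fM]] fs /csep_bilin[u [um uc]].
apply: (csep_intro (u := [seq (f v.1, f v.2) | v <- u])).
  rewrite big_map /= -f1 -(linZ fl) -um (linsum fl).
  by apply: eq_bigr => v _; rewrite fM.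
move=> e; have [e' <-] := fs e; rewrite !big_map /=.
have bl (y : E) : linear (fun x : E => tens (f x) (f y)) by move=> a x z; rewrite fl tens_linl.
have br (x : E) : linear (fun y : E => tens (f x) (f y)) by move=> a y z; rewrite fl tens_linr.
have := uc _ (fun x y => tens (f x) (f y)) bl br e' => H.
under eq_bigr => v _ do rewrite -fM.
by rewrite H; apply: eq_bigr => v _; rewrite fM.
Qed.

(** * Descent of semisplit type *)

Section Idempotents.
Variables (k : comPzRingType) (A : pzAlgType k) (J : ideal2 A).
Hypotheses (k_noeth : noetherian k) (kI : integrally_closed_domain k).
Hypotheses (X1 : sdual (ideal_mod J) 1).
Local Notation X := (ideal_mod J).
Local Notation E := (end_ideal J).
Variable dom : is_domain k.
Local Notation p0 := (zero_spec dom).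

Lemma end_torsionfree (s : k) (f : E) : s <> 0 -> s *: f = 0 -> f = 0.
Proof.
move=> s0 sf; apply: emap_inj => x; rewrite emap0; apply: (dom_torsionfree dom X1 s0).
by rewrite -emapZ sf emap0.
Qed.

Lemma end_cancel (s : k) (f g : E) : s <> 0 -> s *: f = s *: g -> f = g.
Proof.
move=> s0 sfg; apply/eqP; rewrite -subr_eq0; apply/eqP; apply: (end_torsionfree s0).
by rewrite scalerBr sfg subrr.
Qed.

Variables (E0 : pzAlgType (resfield p0)) (i : E -> E0).
Hypotheses (iP : is_bc (fhom p0) i) (iM : forall x y, i (x * y) = i x * i y).
Let iS := bc_semilin iP.

Lemma generic_unit (s : k) : s <> 0 -> exists c : resfield p0, c * fhom p0 s = 1.
Proof. by move=> s0; apply: fhom_unit; apply/negP => /zero_specE. Qed.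

Lemma generic_inj (f g : E) : i f = i g -> f = g.
Proof.
move=> fg; have /(bc_fib_eq0 iP)[s sp Hs] : i (f - g) = 0 by rewrite (semilinB iS) fg subrr.
have s0 : s <> 0 by apply: spec_neq0 sp.
apply/eqP; rewrite -subr_eq0; apply/eqP; apply: (end_torsionfree s0).
move: Hs; move: (s *: _) => y; apply: (mulspan_ind (smod_zero E)) => a x /zero_specE ->.
by rewrite scale0r.
Qed.

Lemma generic_central (f : E) : (forall x, i f * x = x * i f) -> forall x, f * x = x * f.
Proof. by move=> fc x; apply: generic_inj; rewrite !iM fc. Qed.

Lemma generic_commute (f : E) : (forall x, f * x = x * f) -> forall y, i f * y = y * i f.
Proof.
move=> fc; apply: (bc_ext iP (f := mklin (mull_linear (i f))) (g := mklin (mulr_linear_alg (i f)))) => x.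
by rewrite /= -!iM fc.
Qed.

Hypothesis local_sep : forall p : spec k, height_le p 1 -> exists t, t \notin spec_ideal p /\
  csep E t /\ sdual E t.

(* The denominators of a central idempotent form an ideal; if it were contained in a
   prime (d) of height 1, then s g = g^2 and the absence of central nilpotents
   modulo p would allow dividing by d. *)
Lemma idempotent_lift (eta : E0) : eta * eta = eta -> (forall x, eta * x = x * eta) ->
  exists e : E, i e = eta.
Proof.
move=> ee ec; pose C s := exists g, i g = fhom p0 s *: eta.
have CP : ideal_like C.
  split=> [|x y [g Hg] [h Hh]|a x [g Hg]].
  - by exists 0; rewrite (semilin0 iS) rmorph0 scale0r.
  - by exists (g + h); rewrite (semilinD iS) rmorphD scalerDl Hg Hh.
  by exists (a *: g); rewrite (semilinZ iS) Hg -[a *: x]/(a * x) rmorphM scalerA.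
have [s0 s0p [g0 Hg0]] := bc_fib_frac iP eta.
have s00 : s0 <> 0 by apply: spec_neq0 s0p.
have Cs0 : C s0 by exists g0.
have [l lC Cl] := ideal_gens k_noeth CP.
have Cp p : height_le p 1 -> exists s, s \notin spec_ideal p /\ C s.
  move=> hp; apply: contrapT => nC.
  have Csub s : C s -> s \in spec_ideal p.
    by move=> Cs; apply: contrapT => /negP sp; apply: nC; exists s.
  have [d dp [u up pd]] := height1_principal k_noeth kI hp.
  have d0 : d <> 0.
    move=> d0; have [y Hy] := pd _ (Csub _ Cs0).
    have : u * s0 = 0 by rewrite Hy d0 mul0r.
    by case/dom.2 => // u0; case: (spec_neq0 up).
  have [t [tp [Et Ed]]] := local_sep hp.
  have step s : C s -> exists w, w \notin spec_ideal p /\ exists2 c, C c & w * s = d * c.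
    move=> Cs; have [g Hg] := Cs; have [y Hy] := pd _ (Csub _ Cs).
    have gc : forall x, g * x = x * g.
      by apply: generic_central => x; rewrite Hg -pzscaleAl -pzscaleAr ec.
    have gg : g * g = s *: g.
      by apply: generic_inj; rewrite iM (semilinZ iS) Hg -pzscaleAl -pzscaleAr ee.
    have [e et] := fhom_unit tp; have fS := bc_semilin (bc_fib p E).
    have [lf Hlf] := sdual_span (bc_sdual (bc_fib p E) et Ed).
    have lfP z : spn lf z by have := Hlf z; rewrite scale1r.
    have /fib_eq0[w wp Hw] : fib p g = 0.
      apply: (central_nilpotent (resfield_field p) lfP).
      - exact: (bc_csep (bc_fib p E) (@fibM k p E) (fib1 p E) et Et).
      - apply: (bc_ext (bc_fib p E) (f := mklin (mull_linear (fib p g : fibre_alg p E))) (g := mklin (mulr_linear_alg (fib p g : fibre_alg p E)))) => x.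
        by rewrite /= -!fibM gc.
      by rewrite -fibM gg (semilinZ fS) fhom0 ?scale0r //; apply: Csub.
    have [h Hh] : exists h, u *: (w *: g) = d *: h.
      move: Hw; move: (w *: g) => z; apply: (mulspan_ind (E := fun z => exists h, u *: z = d *: h)).
        split=> [|x x' [h Hx] [h' Hx']|a x [h Hx]]; first by exists 0; rewrite !scaler0.
          by exists (h + h'); rewrite !scalerDr Hx Hx'.
        by exists (a *: h); rewrite scalerA mulrC -scalerA Hx !scalerA mulrC.
      move=> a x /pd[b Hb]; exists (b *: x).
      by rewrite !scalerA Hb.
    exists (u * w); split; first exact: specM.
    have uws : u * w * s = d * (w * y) by rewrite mulrAC Hy; ring.
    exists (w * y) => //.
    exists h; have [c cd] := generic_unit d0.
    rewrite -[i h]scale1r -cd -scalerA -(semilinZ iS) -Hh !(semilinZ iS) Hg.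
    have hM (a b : k) : fhom p0 (a * b) = fhom p0 a * fhom p0 b by apply: rmorphM.
    rewrite !scalerA; congr (_ *: _).
    have -> : c * (fhom p0 u * fhom p0 w) * fhom p0 s = c * fhom p0 w * fhom p0 (u * s) by rewrite hM; ring.
    by rewrite Hy !hM -[RHS]mul1r -cd; ring.
  (* By [step] the ideal C lies in d C at p, so it vanishes there, although it contains s0. *)
  have [|w wp Hw] := @nakayama_seq k p k^o (fun y => y = 0) l (@smod_zero k k^o).
    move=> x xl; have [w [wp [c Cc Hc]]] := step _ (lC _ xl); exists w => //.
    rewrite -[_ *: _]/(w * x) Hc.
    exact: (@addspan_scaled k k^o (fun a => a \in spec_ideal p) _ l d c (ideal_like_mem p) (@smod_zero k k^o) dp (Cl _ Cc)).
  have : w * s0 = 0.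
    move: (Cl _ Cs0); move: (s0); apply: (spn_ind (M := k^o) (E := fun x => w * x = 0)) => [|x xl]; last exact: Hw.
    split=> [|x y Hx Hy|a x Hx]; first by rewrite mulr0.
      by rewrite mulrDr Hx Hy addr0.
    by rewrite -[a *: x]/(a * x) mulrCA Hx mulr0.
  by case/dom.2 => // w0; case: (spec_neq0 wp).
have [I [x [f Hf]]] := X1.
(* The coordinates of g0 y are divisible by s0 at all primes of height at most one, hence in [k];
   dividing g0 by s0 gives the endomorphism sought. *)
have div (y : X) : exists z, emap g0 y = s0 *: z.
  have dj m : multiple s0 (f m (emap g0 y)).
    apply: (height1_multiple k_noeth kI s00) => p hp.
    have [s [sp [g Hg]]] := Cp p hp; exists s => //.
    have E1 : s *: g0 = s0 *: g.
      by apply: generic_inj; rewrite !(semilinZ iS) Hg -Hg0 !scalerA mulrC.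
    exists (f m (emap g y)); rewrite -[LHS]/(s *: f m (emap g0 y)) -[RHS]/(s0 *: f m (emap g y)).
    by rewrite -!(linZ (linearP (f m))) -!emapZ E1.
  have [c Hc] := choice dj; exists (\sum_m c m *: x m).
  rewrite -[LHS]scale1r Hf scaler_sumr; apply: eq_bigr => m _.
  by rewrite Hc scalerA.
have [h Hh] := choice div.
have hI (y z : X) : s0 *: y = s0 *: z -> y = z.
  move=> yz; apply/eqP; rewrite -subr_eq0; apply/eqP; apply: (dom_torsionfree dom X1 s00).
  by rewrite scalerBr yz subrr.
have hl : linear h.
  by move=> a y z; apply: hI; rewrite -Hh linearP !Hh scalerDr !scalerA mulrC.
have hA a y : h (jact a y) = jact a (h y).
  by apply: hI; rewrite -Hh emapA Hh (linZ (jact_linr a)).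
exists (emk hl hA); have [c cs] := generic_unit s00.
have E1 : s0 *: emk hl hA = g0 by apply: emap_inj => y; rewrite emapZ emkE Hh.
by rewrite -[LHS]scale1r -cs -scalerA -(semilinZ iS) E1 -Hg0 scalerA cs scale1r.
Qed.
End Idempotents.

(** * Cutting J by a central idempotent of E *)

Section CornerIdeal.
Variables (k : comPzRingType) (A : pzAlgType k) (J : ideal2 A).
Local Notation X := (ideal_mod J).
Local Notation E := (end_ideal J).
Variables (e : E) (ee : e * e = e) (ec : forall f, e * f = f * e).

Lemma corner_ract x a : emap e (jract x a) = jract (emap e x) a.
Proof. by rewrite -!rhoE -!emapM ec. Qed.

(** The subset e J. It is a two-sided ideal because right multiplications belong to E and so commute
    with the central e ([corner_ract]). *)
Definition corner_pred (y : A) := exists x : X, y = jval (emap e x).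
Lemma corner_smod : smod corner_pred.
Proof.
split=> [|_ _ [x ->] [y ->]|a _ [x ->]]; first by exists 0; rewrite !linear0.
  by exists (x + y); rewrite !linearD.
by exists (a *: x); rewrite (linearZ_LR (emap e)) (linearZ_LR jval).
Qed.

Fact corner_mul_l (a y : A) : y \in mksub corner_smod -> a * y \in mksub corner_smod.
Proof.
move=> /(mksubE corner_smod)[x ->]; apply/(mksubE corner_smod).
by exists (jact a x); rewrite emapA jactE.
Qed.
Fact corner_mul_r (y a : A) : y \in mksub corner_smod -> y * a \in mksub corner_smod.
Proof.
move=> /(mksubE corner_smod)[x ->]; apply/(mksubE corner_smod).
by exists (jract x a); rewrite corner_ract jractE.
Qed.
Definition corner_ideal : ideal2 A := Ideal2 corner_mul_l corner_mul_r.
Local Notation Je := corner_ideal.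
Local Notation Xe := (ideal_mod Je).
Local Notation Ee := (end_ideal Je).

Lemma corner_in (x : X) : jval (emap e x) \in ideal2_sub Je.
Proof. by apply/(mksubE corner_smod); exists x. Qed.
Lemma corner_sub (y : Xe) : jval y \in ideal2_sub J.
Proof. by have /(mksubE corner_smod)[x ->] := jval_in y; apply: jval_in. Qed.

Definition jprj (x : X) : Xe := Submod (corner_in x).
Definition jinc (y : Xe) : X := Submod (corner_sub y).
Lemma jprjE x : jval (jprj x) = jval (emap e x). Proof. by []. Qed.
Lemma jincE y : jval (jinc y) = jval y. Proof. by []. Qed.

Lemma jprjK x : jinc (jprj x) = emap e x.
Proof. by apply: jval_inj; rewrite jincE jprjE. Qed.
Lemma jinc_fix y : emap e (jinc y) = jinc y.
Proof.
have /(mksubE corner_smod)[x Hx] := jval_in y.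
have -> : jinc y = emap e x by apply: jval_inj; rewrite jincE.
by rewrite -emapM ee.
Qed.
Lemma jincK y : jprj (jinc y) = y.
Proof. by apply: jval_inj; rewrite jprjE jinc_fix jincE. Qed.
Lemma jinc_linear : linear jinc.
Proof. by move=> a x y; apply: jval_inj; rewrite (linearP jval) !jincE (linearP jval). Qed.
Lemma jprj_linear : linear jprj.
Proof. by move=> a x y; apply: jval_inj; rewrite (linearP jval) !jprjE (linearP (emap e)) (linearP jval). Qed.
Lemma jinc_act a y : jinc (jact a y) = jact a (jinc y).
Proof. by apply: jval_inj; rewrite jincE !jactE jincE. Qed.
Lemma jprj_act a x : jprj (jact a x) = jact a (jprj x).
Proof. by apply: jval_inj; rewrite jprjE emapA !jactE jprjE. Qed.

Lemma res_linear (f : E) : linear (fun y => jprj (emap f (jinc y))).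
Proof. by move=> a x y; rewrite jinc_linear (linearP (emap f)) jprj_linear. Qed.
Lemma res_act (f : E) a y : jprj (emap f (jinc (jact a y))) = jact a (jprj (emap f (jinc y))).
Proof. by rewrite jinc_act emapA jprj_act. Qed.
Definition res (f : E) : Ee := emk (res_linear f) (res_act f).
Lemma resE f y : jinc (emap (res f) y) = emap f (jinc y).
Proof. by rewrite emkE jprjK -emapM ec emapM jinc_fix. Qed.

Lemma ext_linear (g : Ee) : linear (fun x => jinc (emap g (jprj x))).
Proof. by move=> a x y; rewrite jprj_linear (linearP (emap g)) jinc_linear. Qed.
Lemma ext_act (g : Ee) a x : jinc (emap g (jprj (jact a x))) = jact a (jinc (emap g (jprj x))).
Proof. by rewrite jprj_act emapA jinc_act. Qed.
Definition ext (g : Ee) : E := emk (ext_linear g) (ext_act g).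
Lemma extE g x : emap (ext g) x = jinc (emap g (jprj x)). Proof. exact: emkE. Qed.

Lemma jinc_inj : injective jinc. Proof. exact: can_inj jincK. Qed.

Lemma res_ext g : res (ext g) = g.
Proof. by apply: emap_inj => y; apply: jinc_inj; rewrite resE extE jincK. Qed.
Lemma ext_res f : ext (res f) = e * f.
Proof. by apply: emap_inj => x; rewrite extE resE jprjK ec emapM. Qed.
Lemma ext_fix g : e * ext g = ext g.
Proof. by apply: emap_inj => x; rewrite emapM extE jinc_fix. Qed.

Lemma res_hom : alg_hom res.
Proof.
split; first by move=> a f g; apply: emap_inj => y; apply: jinc_inj;
  rewrite resE !emapD !emapZ jinc_linear !resE.
split; first by apply: emap_inj => y; apply: jinc_inj; rewrite resE !emap1.
by move=> f g; apply: emap_inj => y; apply: jinc_inj; rewrite resE !emapM !resE.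
Qed.

Lemma ext_hom_linear : linear ext.
Proof.
by move=> a f g; apply: emap_inj => x; rewrite emapD emapZ !extE emapD emapZ jinc_linear.
Qed.
Lemma extM f g : ext (f * g) = ext f * ext g.
Proof. by apply: emap_inj => x; rewrite emapM !extE emapM jincK. Qed.
Lemma ext1 : ext 1 = e.
Proof. by apply: emap_inj => x; rewrite extE emap1 jprjK. Qed.
Lemma ext_rho y : ext (rho Je (jval y)) = e * rho J (jval (jinc y)).
Proof.
apply: emap_inj => x; rewrite extE rhoE emapM rhoE corner_ract.
by apply: jval_inj; rewrite jincE !jractE.
Qed.

Lemma corner_sretract : sretract J 1 -> sretract Je 1.
Proof.
move=> [r Hr]; have rl : linear (fun a => jprj (r a)).
  by move=> a x y; rewrite linearP jprj_linear.
exists (mklin rl) => y; rewrite scale1r /=.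
by have := Hr (jinc y); rewrite scale1r => E1; rewrite -[RHS]jincK -E1.
Qed.

Lemma corner_adual_restrict s : adual J s -> adual Je s.
Proof.
move=> [I [x [f Hf]]]; exists I, (fun m => jprj (x m)), (fun m => res (f m)) => y.
apply: jinc_inj; rewrite (linZ jinc_linear) (linsum jinc_linear).
rewrite -jinc_fix -(linearZ_LR (emap e)) Hf linear_sum; apply: eq_bigr => m _.
by rewrite emapA jinc_act jprjK -[jval (emap (res _) _)]/(jval (jinc (emap (res (f m)) y))) resE.
Qed.

Lemma corner_idempotent : idempotent_ideal J -> idempotent_ideal Je.
Proof.
move=> JJ c; have JP := smod_mem (ideal2_sub Je); apply/idP/idP.
  move=> /asboolP[s [/allP sJ ->]]; rewrite big_seq; apply: (smod_sum JP) => u /sJ /andP[u1 _].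
  exact: ideal2Mr.
move=> /(mksubE corner_smod)[x ->]; have [t Ht] := idempotent_seq JJ x.
rewrite Ht !linear_sum; apply: (smod_sum (ideal_square_smod Je)) => u _.
apply/asboolP; exists [:: (jval (emap e u.1), jval (emap e u.2))].
split; first by rewrite /= !corner_in.
rewrite big_seq1 -[RHS]jractE -corner_ract -jact_val !emapA.
by rewrite -emapM ee.
Qed.

Lemma corner_end_separable t : csep E t -> csep Ee t.
Proof. by apply: (csep_surj res_hom) => g; exists (ext g); apply: res_ext. Qed.
End CornerIdeal.

Lemma adual_intro (k : comPzRingType) (A : pzAlgType k) (J : ideal2 A) (c : k)
  (s : seq (ideal_mod J * end_ideal J)) :
  \sum_(u <- s) rho J (jval u.1) * u.2 = c *: (1 : end_ideal J) -> adual J c.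
Proof.
move=> Hs; exists 'I_(size s), (fun m => (tnth (in_tuple s) m).1), (fun m => (tnth (in_tuple s) m).2) => y.
have := congr1 (fun f : end_ideal J => emap f y) Hs; rewrite emapZ emap1 => <-.
rewrite emap_sum (big_tnth _ _ s); apply: eq_bigr => m _.
by rewrite emapM rhoE jact_val.
Qed.

(** In terms of [adual_intro]: each e_j lies in rho(J) E by the dual basis of e_j J, and the e_j sum
    to 1. *)
Lemma adual_covering (k : comPzRingType) (A : pzAlgType k) (J : ideal2 A) n
  (e : 'I_n -> end_ideal J) (ee : forall j, e j * e j = e j)
  (ec : forall j f, e j * f = f * e j) : \sum_j e j = 1 ->
  (forall j, adual (corner_ideal (ec j)) 1) -> adual J 1.
Proof.
move=> e1 Je; pose P g := exists s : seq (ideal_mod J * end_ideal J),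
  g = \sum_(u <- s) rho J (jval u.1) * u.2.
have P0 : P 0 by exists [::]; rewrite big_nil.
have PD f g : P f -> P g -> P (f + g).
  by move=> [s ->] [t ->]; exists (s ++ t); rewrite big_cat.
suff [s Hs] : P 1 by apply: (adual_intro (s := s)); rewrite scale1r.
rewrite -e1; apply: (big_ind P) => // j _.
have [I [x [f Hf]]] := Je j.
have := congr1 (ext (ec := ec j)) (adual_sum Hf); rewrite scale1r ext1 => <-.
rewrite (linsum (@ext_hom_linear _ _ _ _ (ec j))); apply: (big_ind P) => // m _.
exists [:: (jinc (x m), e j * ext (f m))]; rewrite big_seq1 (extM (ee j)) ext_rho /=.
by rewrite ec mulrA.
Qed.

Section SemisplitDescent.
Variables (k : comPzRingType) (A : pzAlgType k) (J : ideal2 A) (lA : seq A).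
Hypotheses (k_noeth : noetherian k) (kI : integrally_closed_domain k).
Hypotheses (lAP : forall y, spn lA y) (A1 : sdual A 1) (JJ : idempotent_ideal J).
Hypothesis r1 : sretract J 1.
Local Notation X := (ideal_mod J).
Local Notation E := (end_ideal J).
Variable dom : is_domain k.
Local Notation p0 := (zero_spec dom).

(** g acts on e J as a fraction a/s. As g preserves J, its powers applied to one vector stay in a
    finitely generated module, so a/s is integral and lies in [k]. *)
Lemma corner_center (E0 : pzAlgType (resfield p0)) (i : E -> E0) (e g : E)
    (c : resfield p0) :
  is_bc (fhom p0) i -> (forall x y, i (x * y) = i x * i y) -> e * e = e -> e != 0 ->
  e * g = g -> i g = c *: i e -> exists a : k, g = a *: e.
Proof.
move=> iP iM ee e0 eg ig; have iS := bc_semilin iP; have X1 := sretract_sdual A1 r1.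
have [s sp [a Ha]] := fhom_frac c; have s0 : s <> 0 := spec_neq0 sp.
have sg : s *: g = a *: e.
  by apply: (generic_inj X1 iP); rewrite !(semilinZ iS) ig scalerA Ha.
have [x0 ex0] : exists x, emap e x <> 0.
  apply: contrapT => nx; move/eqP: e0; apply; apply: emap_inj => x; rewrite emap0.
  by apply: contrapT => ex; apply: nx; exists x.
pose v := emap e x0; pose D m := iter m (emap g) v.
have sD m : s ^+ m *: D m = a ^+ m *: v.
  elim: m => [|m IHm]; first by rewrite !expr0.
  rewrite exprS -scalerA -(linZ (linearP (emap g))) IHm (linZ (linearP (emap g))).
  rewrite scalerA mulrC -scalerA -emapZ sg emapZ -emapM ee scalerA.
  by rewrite exprSr.
have [l lX] := ideal_mod_gens J k_noeth lAP.
have [||_ [n ->] nmax] := @submodule_max k k_noeth X l (fun C => exists n, C = spn (mkseq D n)) lX.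
- by move=> _ [n ->]; apply: smod_spn.
- by exists (spn (mkseq D 0)), 0%N.
have /spn_mkseq[d Hd] : spn (mkseq D n) (D n).
  apply: (nmax (spn (mkseq D n.+1))); first by exists n.+1.
    apply: (spn_ind (smod_spn _)) => y /mapP[m]; rewrite mem_iota => /andP[_ Hm] ->; apply: spn_mem.
    by apply/mapP; exists m; rewrite // mem_iota /= add0n ltnS ltnW.
  by apply: spn_mem; apply/mapP; exists n; rewrite // mem_iota add0n leqnn.
have [a' Ha'] : multiple s a.
  apply: (integral_multiple (c := fun m : 'I_n => - d m) kI s0).
  apply: contrapT => nz; apply: ex0; apply: (dom_torsionfree dom X1 nz).
  rewrite scalerDl -[emap e x0]/v -sD Hd scaler_sumr scaler_suml -big_split big1 // => m _.
  have Em : (a ^+ m * s ^+ (n - m)) *: v = s ^+ n *: D m.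
    by rewrite mulrC -scalerA -sD scalerA -exprD subnK // ltnW.
  by rewrite /= mulNr scaleNr -scalerA Em !scalerA [d m * _]mulrC subrr.
by exists a'; apply: (end_cancel X1 dom s0); rewrite sg Ha' scalerA.
Qed.

Hypothesis hJ : forall p : spec k, height_le p 1 -> heredity_semisplit (fibre_ideal J p).

Lemma semisplit_descent : heredity_semisplit J.
Proof.
have X1 := sretract_sdual A1 r1.
have la p : height_le p 1 -> exists2 s, s \notin spec_ideal p & adual J s.
  by move=> /hJ[hp _]; apply: (fibre_local_adual k_noeth lAP A1 JJ hp X1).
have ls p : height_le p 1 -> exists2 t, t \notin spec_ideal p & csep E t.
  move=> hp; have [s sp Js] := la p hp.
  have Es : sdual E s by have := sdual_end Js X1; rewrite mul1r.
  have b := fibre_ebc (spec1 p) r1 sp Js.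
  exact: (local_csep sp Es b (ebcM _ _ _) (ebc1 _ _ _) (semisplit_csep (hJ hp).2)).
have loc p : height_le p 1 -> exists t, t \notin spec_ideal p /\ csep E t /\ sdual E t.
  move=> hp; have [s sp Js] := la p hp; have [t tp Et] := ls p hp.
  exists (s * t); split; first exact: specM.
  split; first exact: (smodZ (csep_ideal E) s).
  rewrite mulrC; apply: (smodZ (sdual_ideal E) t).
  by have := sdual_end Js X1; rewrite mul1r.
have [s0 s0p Js0] := la _ (@zero_height k dom).
have iP := fibre_ebc (spec1 p0) r1 s0p Js0.
set i := ebc _ _ _ in iP.
have iM : forall x y, i (x * y) = i x * i y by apply: ebcM.
have i1 : i 1 = 1 by apply: ebc1.
have iS := bc_semilin iP.
have [n [F [Faz [phi [phiP phiU]]]]] := (hJ (@zero_height k dom)).2.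
have [s [s1 s2 s3]] := prod_section phiP phiU.
have sl := section_mul_l phiP phiU s1 s2; have sr := section_mul_r phiP phiU s1 s2.
have ex j : exists e : E, i e = s j 1.
  apply: (idempotent_lift k_noeth kI X1 iP iM loc) => [|x].
    by rewrite sl s1 mulr1.
  by rewrite sl sr mulr1 mul1r.
have [e He] := choice ex.
have inj := generic_inj X1 iP.
have ee j : e j * e j = e j by apply: inj; rewrite iM !He sl s1 mulr1.
have eo j l : l != j -> e j * e l = 0.
  by move=> lj; apply: inj; rewrite iM !He sl s2 ?mul0r ?linear0 ?(semilin0 iS) // eq_sym.
have e1 : \sum_j e j = 1.
  apply: inj; rewrite (semilin_sum iS) i1 [RHS]s3; apply: eq_bigr => j _.
  by rewrite He (prod_hom1 phiP).
have ec j : forall f, e j * f = f * e j.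
  by apply: (generic_central X1 iP iM) => x; rewrite He sl sr mulr1 mul1r.
have e0 j : e j != 0.
  apply/eqP => ej; have [_ Ff _] := Faz j.
  apply: (resfield_field p0).1; apply: Ff.
  by rewrite scale1r -(s1 j 1) -He ej (semilin0 iS) (lin0 (phiP j).1).
(* A central z of the corner extends to a central g of E, whose image in the j-th generic factor is
   a scalar since that factor is Azumaya. *)
have center j (z : end_ideal (corner_ideal (ec j))) : (forall x, z * x = x * z) ->
    exists a : k, z = a *: (1 : end_ideal (corner_ideal (ec j))).
  move=> zc; pose g := ext z; have eg : e j * g = g := ext_fix (ee j) z.
  have gc : forall f, g * f = f * g.
    have ge : g * e j = g by rewrite -ec eg.
    move=> f; transitivity (ext (z * res (ec j) f)).
      by rewrite (extM (ee j)) (ext_res (ee j)) -/g mulrA ge.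
    by rewrite zc (extM (ee j)) (ext_res (ee j)) -/g ec -mulrA eg.
  have zeta := generic_commute iP iM gc.
  have [_ _ /(_ (phi j (i g)))[y|c Hc]] := Faz j.
    by rewrite -(s1 j y) -!(prod_homM phiP) zeta.
  have [|a Ha] := corner_center (c := c) iP iM (ee j) (e0 j) eg.
    by rewrite -{1}eg iM He sr mul1r Hc linearZ_LR.
  exists a; rewrite -[z](res_ext (ee j)) -/g Ha (linZ (res_hom (ee j) (ec j)).1).
  by rewrite -[X in res _ X](ext1 (ec j)) (res_ext (ee j)).
have Jj j : adual (corner_ideal (ec j)) 1 /\ csep (end_ideal (corner_ideal (ec j))) 1.
  apply: (normal_heredity k_noeth kI lAP A1 (corner_idempotent (ee j) (ec j) JJ)
    (corner_sretract (ee j) (ec j) r1) (center j)) => p hp.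
    by have [t tp Jt] := la p hp; exists t => //; apply: corner_adual_restrict.
  by have [t tp Et] := ls p hp; exists t => //; apply: corner_end_separable.
have a1 : adual J 1 by apply: (adual_covering ee e1) => j; apply: (Jj j).1.
have Eprod : alg_product E (fun j => end_ideal (corner_ideal (ec j))).
  exists (fun j => res (ec j)); split=> [j|y]; first exact: res_hom.
  exists (\sum_l ext (y l)); split=> [j|x Hx].
    rewrite (linsum (res_hom (ee j) (ec j)).1) (bigD1 j) //= (res_ext (ee j)) big1 ?addr0 // => l lj.
    rewrite -[LHS](res_ext (ee j)) (ext_res (ee j)) -(ext_fix (ee l)) mulrA eo // mul0r.
    by rewrite (lin0 (res_hom (ee j) (ec j)).1).
  rewrite -[RHS]mul1r -e1 mulr_suml; apply: eq_bigr => j _.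
  by rewrite -Hx (ext_res (ee j)).
have Ecs : csep E 1 by apply: (product_csep Eprod) => j; apply: (Jj j).2.
split.
  apply/(heredityE k_noeth lAP A1 JJ); split=> //.
  exact: (csep_k_semisimple A1 r1 a1 Ecs).
exists n, (fun j => end_ideal (corner_ideal (ec j))); split=> // j; split.
- exact/csep1P/(Jj j).2.
- move=> a a1'; apply: contrapT => a0; move/eqP: (e0 j); apply.
  apply: (end_torsionfree X1 dom a0); rewrite -(ext1 (ec j)) -(linZ (@ext_hom_linear _ _ _ _ (ec j))) a1'.
  by rewrite (lin0 (@ext_hom_linear _ _ _ _ (ec j))).
exact: center.
Qed.
End SemisplitDescent.

(** * Regular domains of dimension two *)

Section RegularRings.
Variables (k : comPzRingType) (k_noeth : noetherian k) (dom : is_domain k).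

Lemma principal_loc (p : spec k) (d : k) : d \in spec_ideal p ->
  (forall x, x \in spec_ideal p -> exists u, u \notin spec_ideal p /\ multiple d (u * x)) ->
  principal_at p.
Proof.
move=> dp pd; have [g gp pg] := spec_gens p k_noeth.
have [|u up Hu] := @loc_in_span k p k^o (multiple d) g (multiple_ideal d).
  by move=> x /gp/pd[u [up Hu]]; exists u.
by exists d => //; exists u => // x /pg; apply: Hu.
Qed.

Definition two_generated (p : spec k) (a b : k) := [/\ a \in spec_ideal p, b \in spec_ideal p &
  forall x, x \in spec_ideal p -> exists u, u \notin spec_ideal p /\
    exists y z, u * x = a * y + b * z].

Section TwoGenerators.
Variables (p : spec k) (a b : k) (ab : two_generated p a b) (p_height : ~ height_le p 1).

Lemma two_gen_neq0 : a <> 0.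
Proof.
case: ab => ap bp pab a0; apply: p_height; apply: (principal_height k_noeth dom).
apply: (principal_loc bp) => x /pab[u [up [y [z E]]]]; exists u; split=> //.
by exists z; rewrite E a0 mul0r add0r.
Qed.

Definition loc_sum (I : k -> Prop) (x : k) := exists u, u \notin spec_ideal p /\
  exists z r, I z /\ u * x = z + a * r.

(* Krull's principal ideal theorem for p = (a, b): if p were minimal over (a), the
   ideals x^n k_q would stabilise modulo a, for a nonzero x in a smaller prime q. *)
Lemma two_gen_power T : ~ @loc_in k p k^o (multiple a) (b ^+ T).
Proof.
case: (ab) => ap bp pab [w wp [y0 Hw]]; apply: p_height; apply/(height_le1P dom) => q qp pq x xq.
apply: contrapT => x0.
have notq u : u \notin spec_ideal p -> u \notin spec_ideal q.
  by move=> up; apply/negP => /qp uq; move: up; rewrite uq.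
have aq : a \notin spec_ideal q.
  apply/negP => aq; have bq : b \in spec_ideal q.
    have : w * b ^+ T \in spec_ideal q by rewrite -[w * _]/(w *: (b ^+ T : k^o)) Hw; apply: specMr.
    case/(spec_prime q).2 => [wq|]; first by move: (notq _ wp); rewrite wq.
    elim: (T) => [|m IHm]; first by move=> q1; case/negP: (spec1 q).
    by rewrite exprS => /(spec_prime q).2[].
  apply: pq => z /pab[u [up [r [s E]]]].
  have : u * z \in spec_ideal q.
    by rewrite E; apply: (smodD (smod_mem q)); apply: specMr.
  by case/(spec_prime q).2 => // uq; move: (notq _ up); rewrite uq.
(* The intersection of x^n k_q with [k]. *)
pose I n y := exists u, u \notin spec_ideal q /\ multiple (x ^+ n) (u * y).
have IP n : ideal_like (I n).
  split=> [|y z [u [uq [r Hr]]] [v [vq [s Hs]]]|c y [u [uq [r Hr]]]].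
  - by exists 1; split; [exact: spec1|exists 0; rewrite !mulr0].
  - exists (u * v); split; first exact: specM.
    exists (v * r + u * s).
    have -> : u * v * (y + z) = v * (u * y) + u * (v * z) by ring.
    rewrite Hr Hs; ring.
  by exists u; split=> //; exists (c * r); rewrite -[c *: y]/(c * y) mulrCA Hr mulrCA.
have IS n y : I n.+1 y -> I n y.
  by move=> [u [uq [r Hr]]]; exists u; split=> //; exists (x * r); rewrite Hr exprSr; ring.
have ex n : exists j, `[< loc_sum (I n) (b ^+ j) >].
  exists T; apply/asboolP; exists w; split=> //; exists 0, y0; split; first exact: (smod0 (IP n)).
  by rewrite add0r -Hw.
(* As p = (a, b) at p, the ideals of k_p above a are generated modulo a by powers of b, and [f n] is
   the length of k_p modulo a and [I n]. It is non-decreasing in n and bounded by T, hence takes the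
   same value at some n and n + 1. *)
pose f n := ex_minn (ex n).
have fP n : loc_sum (I n) (b ^+ (f n)) by rewrite /f; case: ex_minnP => j /asboolP.
have fmin n j : loc_sum (I n) (b ^+ j) -> (f n <= j)%N.
  by rewrite /f; case: ex_minnP => m _ mm /asboolP; apply: mm.
have fS n : (f n <= f n.+1)%N.
  apply: fmin; have [u [up [z [r [Iz E]]]]] := fP n.+1.
  by exists u; split=> //; exists z, r; split=> //; apply: IS.
have fT n : (f n <= T)%N.
  apply: fmin; exists w; split=> //; exists 0, y0; split; first exact: (smod0 (IP n)).
  by rewrite add0r -Hw.
have [n fn] : exists n, f n.+1 = f n.
  apply: contrapT => nf; have lt n : (f n < f n.+1)%N.
    by rewrite ltn_neqAle fS andbT; apply/eqP => E; apply: nf; exists n.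
  have ge n : (n <= f n)%N by elim: n => // n IHn; apply: leq_ltn_trans IHn (lt n).
  by have := leq_trans (ge T.+1) (fT T.+1); rewrite ltnn.
have filt y j : I n y -> (j <= f n)%N -> exists u, u \notin spec_ideal p /\ exists r s, u * y = a * r + b ^+ j * s.
  move=> Iy; elim: j => [|j IHj] jn.
    by exists 1; split; [exact: spec1|exists 0, y; rewrite mulr0 add0r expr0 !mul1r].
  have [u [up [r [s E]]]] := IHj (ltnW jn).
  have [sp|sp] := boolP (s \in spec_ideal p).
    have [v [vp [c [d F]]]] := pab _ sp.
    exists (v * u); split; first exact: specM.
    exists (v * r + b ^+ j * c), d; rewrite exprSr -mulrA E mulrDr [v * (b ^+ j * s)]mulrCA F; ring.
  have : (f n <= j)%N; last by rewrite leqNgt jn.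
  apply: fmin; exists s; split=> //; exists (u * y), (- r); split.
    exact: (smodZ (IP n) u Iy).
  by rewrite E; ring.
(* Thus I_n = I_(n+1) + a I_n at p: the cofactor of a again lies in I_n because a is outside q. *)
have step y : I n y -> exists u, u \notin spec_ideal p /\ exists z r, [/\ I n.+1 z, I n r & u * y = z + a * r].
  move=> Iy; have [u [up [r [s E]]]] := filt y _ Iy (leqnn _).
  have [v [vp [z [r' [Iz F]]]]] := fP n.+1; rewrite fn in F.
  have Is : I n.+1 (s * z) by apply: (smodZ (IP n.+1) s Iz).
  have E2 : v * u * y = s * z + a * (v * r + s * r').
    by rewrite -mulrA E mulrDr [v * (_ * s)]mulrA F; ring.
  exists (v * u); split; first exact: specM.
  exists (s * z), (v * r + s * r'); split=> //.
  have Ia : I n (a * (v * r + s * r')).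
    have -> : a * (v * r + s * r') = v * u * y - s * z by rewrite E2; ring.
    by apply: (smodB (IP n)) (IS _ _ Is); apply: (smodZ (IP n) (v * u) Iy).
  have [c [cq [d Hd]]] := Ia; exists (c * a); split; first exact: specM.
  by exists d; rewrite -Hd mulrA.
have [l lI Il] := ideal_gens k_noeth (IP n).
have [|s sp Hs] := @nakayama_seq k p k^o (I n.+1) l (IP n.+1).
  move=> y /lI/step[u [up [z [r [Iz Ir E]]]]]; exists u => //.
  have AP := smod_addspan (M := k^o) l (ideal_like_mem p) (IP n.+1).
  rewrite -[u *: y]/(u * y) E; apply: (smodD AP).
    by apply: addspan_sub => //; exact: ideal_like_mem.
  exact: (@addspan_scaled k k^o (fun a => a \in spec_ideal p) _ l a r (ideal_like_mem p) (IP n.+1) ap (Il _ Ir)).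
have : I n.+1 (s * x ^+ n).
  have : I n (x ^+ n) by exists 1; split; [exact: spec1|exists 1; rewrite mulrC].
  move=> /Il; move: (x ^+ n); apply: (spn_ind (M := k^o) (E := fun y => I n.+1 (s * y))); last exact: Hs.
  split=> [|y z Hy Hz|c y Hy]; first by rewrite mulr0; exact: (smod0 (IP _)).
    by rewrite mulrDr; exact: (smodD (IP _)).
  by rewrite -[c *: y]/(c * y) mulrCA; exact: (smodZ (IP _)).
move=> [u [uq [z Hz]]].
have usx : u * s = x * z.
  apply: (dom_mulI dom (dom_exp_neq0 dom (n := n) x0)).
  by rewrite mulrC -mulrA Hz exprSr; ring.
have : u * s \in spec_ideal q by rewrite usx; apply: specMr.
by case/(spec_prime q).2 => [uq'|sq]; [rewrite uq' in uq|move: (notq _ sp); rewrite sq].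
Qed.

(** The y killed modulo a by a power of b form an ideal Z, contained in p by [two_gen_power]. Hence
    Z lies in (a) + b Z at p, and Nakayama's lemma puts Z into (a). *)
Lemma two_gen_regular x : multiple a (b * x) -> @loc_in k p k^o (multiple a) x.
Proof.
case: (ab) => ap bp pab ax; have aP := multiple_ideal a; have LP := smod_loc_in p aP.
pose Z y := exists n, @loc_in k p k^o (multiple a) (b ^+ n * y).
have ZP : ideal_like Z.
  have up n m y : (n <= m)%N -> @loc_in k p k^o (multiple a) (b ^+ n * y) -> @loc_in k p k^o (multiple a) (b ^+ m * y).
    move=> nm H; have -> : b ^+ m * y = b ^+ (m - n) * (b ^+ n * y) by rewrite mulrA -exprD subnK.
    exact: (smodZ LP).
  split=> [|y z [n Hn] [m Hm]|c y [n Hn]].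
  - by exists 0%N; rewrite mulr0; exact: (smod0 LP).
  - exists (n + m)%N; rewrite mulrDr; apply: (smodD LP).
      exact: up (leq_addr m n) Hn.
    exact: up (leq_addl n m) Hm.
  by exists n; rewrite -[c *: y]/(c * y) mulrCA; exact: (smodZ LP).
have [l lZ Zl] := ideal_gens k_noeth ZP.
have [|s sp Hs] := @nakayama_seq k p k^o (multiple a) l aP.
  move=> y /lZ Zy; have [yp|yp] := boolP (y \in spec_ideal p); last first.
    have [n Hn] := Zy; case: (@two_gen_power n).
    by apply: (loc_inZ (p := p) (M := k^o) (s := y)) => //; rewrite -[y *: _]/(y * b ^+ n) mulrC.
  have [u [uP [r [s E]]]] := pab _ yp; exists u => //.
  have AP := smod_addspan (M := k^o) l (ideal_like_mem p) aP.
  rewrite -[u *: y]/(u * y) E; apply: (smodD AP).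
    by apply: addspan_sub; [exact: ideal_like_mem|exists r].
  apply: (@addspan_scaled k k^o (fun a => a \in spec_ideal p) _ l b s (ideal_like_mem p) aP bp); apply: Zl.
  have [n Hn] := Zy; exists n.+1; rewrite exprSr -mulrA.
  have -> : b * s = u * y - a * r by rewrite E addrC addKr.
  rewrite mulrBr; apply: (smodB LP); first by rewrite mulrCA; apply: (smodZ LP u Hn).
  by apply: loc_in_sub; exists (b ^+ n * r); rewrite mulrCA.
exists s => //; have : Z x by exists 1%N; rewrite expr1; apply: loc_in_sub.
move=> /Zl; move: (x); apply: (spn_ind (M := k^o) (E := fun y => multiple a (s *: (y : k^o)))); last exact: Hs.
split=> [|y z Hy Hz|c y Hy]; first by rewrite scaler0; exact: (smod0 aP).
  by rewrite scalerDr; exact: (smodD aP).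
by rewrite scalerA mulrC -scalerA; exact: (smodZ aP).
Qed.
End TwoGenerators.
End RegularRings.

Section RegularDomains.
Variables (k : comPzRingType) (k_reg : regular_domain k) (k_dim : krull_dim_le k 2).
Let dom : is_domain k. Proof. by case: k_reg. Qed.
Let k_noeth : noetherian k. Proof. by case: k_reg. Qed.

Section AtPrime.
Variable p : spec k.
Local Notation R := (locring p).
Local Notation h := (loc_hom p).

Fact contract_ideal (q : spec R) : ideal_like (fun a : k => (h a : R^o) \in spec_ideal q).
Proof.
have QP := smod_mem q; split=> [|x y Hx Hy|a x Hx].
- by rewrite rmorph0; exact: (smod0 QP).
- by rewrite rmorphD; exact: (smodD QP).
by rewrite -[a *: x]/(a * x) rmorphM; exact: (smodZ QP).
Qed.
Fact contract1 (q : spec R) : ~ ((h 1 : R^o) \in spec_ideal q).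
Proof. by rewrite rmorph1; apply/negP/spec1. Qed.
Fact contract_prime (q : spec R) a b : (h (a * b) : R^o) \in spec_ideal q ->
  (h a : R^o) \in spec_ideal q \/ (h b : R^o) \in spec_ideal q.
Proof. by rewrite rmorphM; apply: (spec_prime q).2. Qed.
Definition contract (q : spec R) : spec k := mkspec (contract_ideal q) (@contract1 q) (@contract_prime q).
Lemma contractE q a : (a \in spec_ideal (contract q)) <-> (h a : R^o) \in spec_ideal q.
Proof. exact: mkspecE. Qed.

Lemma contract_sub q : {subset spec_ideal (contract q) <= spec_ideal p}.
Proof.
move=> a /contractE aq; apply: contrapT => /negP/loc_unit[c ca].
by case/negP: (spec1 q); rewrite -ca; apply: specMl.
Qed.

Lemma contract_reflect q q' : {subset spec_ideal (contract q) <= spec_ideal (contract q')} ->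
  {subset spec_ideal q <= spec_ideal q'}.
Proof.
move=> qq c cq; have [s [sp [a Ha]]] := loc_frac c.
have /contractE : a \in spec_ideal (contract q').
  by apply: qq; apply/contractE; rewrite -Ha; apply: specMl.
rewrite -Ha => /(spec_prime q').2[sq|//].
by have := contract_sub (proj2 (contractE q' s) sq); rewrite (negPf sp).
Qed.

Lemma contract_chain n (c : 'I_n.+1 -> spec R) : prime_chain c -> prime_chain (fun i => contract (c i)).
Proof.
move=> cc i j ij; have [s t] := cc i j ij; split.
  by move=> a /contractE/s; apply: (proj2 (contractE (c j) a)).
by move=> H; apply: t; apply: contract_reflect.
Qed.

Definition loc_max (c : R) := exists s, s \notin spec_ideal p /\ exists2 a, a \in spec_ideal p & h s * c = h a.
Lemma loc_max_ideal : @smod R R^o loc_max.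
Proof.
have hD (x y : k) : h (x + y) = h x + h y by apply: rmorphD.
have hM (x y : k) : h (x * y) = h x * h y by apply: rmorphM.
split=> [|x y [s [sp [b Hb E]]] [t [tp [d Hd F]]]|c x [s [sp [b Hb E]]]].
- exists 1; split; first exact: spec1.
  by exists 0; [exact: (smod0 (smod_mem p))|rewrite mulr0 rmorph0].
- exists (s * t); split; first exact: specM.
  exists (t * b + s * d); first by apply: (smodD (smod_mem p)); apply: specMl.
  rewrite hD !hM -E -F; ring.
have [t [tp [d Hd]]] := loc_frac c; exists (t * s); split; first exact: specM.
exists (d * b); first exact: specMl.
rewrite -[c *: x]/(c * x) !hM -E -Hd; ring.
Qed.

Lemma loc_max1 : ~ loc_max 1.
Proof.
move=> [s [sp [a ap]]]; rewrite mulr1 => /loc_hom_eq[w [wp E]].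
by have := specM wp sp; rewrite E specMl.
Qed.

Lemma loc_max_maximal : maximal_ideal (mksub loc_max_ideal : ideal R).
Proof.
split=> [|I I1 sub c cI]; first by apply/negP => /(mksubE loc_max_ideal)/loc_max1.
apply/(mksubE loc_max_ideal); have [s [sp [a Ha]]] := loc_frac c.
exists s; split=> //; exists a => //; apply: contrapT => /negP/loc_unit[d da].
case/negP: I1; rewrite -da -Ha; exact: (smodZ (smod_mem I) d (smodZ (smod_mem I) (h s) cI)).
Qed.

Lemma regular_generators : exists (d : nat) (a : 'I_d -> k),
  [/\ (d <= 2)%N, forall i, a i \in spec_ideal p,
    forall x, x \in spec_ideal p -> exists u, u \notin spec_ideal p /\
      exists c : 'I_d -> k, u * x = \sum_i c i * a i &
    d = 2%N -> ~ height_le p 1].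
Proof.
have [_ _ /(_ p)[_ [m [mm mU [d [[_ [ch chP]] [v Hv]]]]]]] := k_reg.
have mE c : c \in m <-> loc_max c.
  by rewrite -(mU _ loc_max_maximal); apply: (mksubE loc_max_ideal).
have va i : exists a, a \in spec_ideal p /\ exists s, s \notin spec_ideal p /\ h s * v i = h a.
  have /mE[s [sp [a ap E]]] : v i \in m.
    apply/Hv; exists (fun j => (j == i)%:R); rewrite (bigD1 i) //= eqxx mul1r big1 ?addr0 // => j /negPf ->.
    by rewrite mul0r.
  by exists a; split=> //; exists s.
have [a Ha] := choice va; exists d, a; split.
- exact: k_dim (contract_chain chP).
- by move=> i; case: (Ha i).
- move=> x xp; have : (h x : R^o) \in m.
    apply/mE; exists 1; split; first exact: spec1.
    by exists x; rewrite // rmorph1 mul1r.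
  move=> /Hv[c Hc]; pose L (y : R) := exists u, u \notin spec_ideal p /\ exists c : 'I_d -> k, h u * y = h (\sum_i c i * a i).
  have hD (y z : k) : h (y + z) = h y + h z by apply: rmorphD.
  have hM (y z : k) : h (y * z) = h y * h z by apply: rmorphM.
  have LP : @smod R R^o L.
    split=> [|y z [u [up [b E]]] [w [wp [e F]]]|b y [u [up [e E]]]].
    - exists 1; split; first exact: spec1.
      by exists (fun=> 0); rewrite mulr0 big1 ?rmorph0 // => i _; rewrite mul0r.
    - exists (u * w); split; first exact: specM.
      exists (fun i => w * b i + u * e i).
      under eq_bigr => i _ do rewrite mulrDl -!mulrA.
      rewrite big_split -!mulr_sumr hD !hM -E -F /=; ring.
    have [t [tp [f Hf]]] := loc_frac b; exists (t * u); split; first exact: specM.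
    exists (fun i => f * e i); under eq_bigr => i _ do rewrite -mulrA.
    rewrite -mulr_sumr -[b *: y]/(b * y) !hM -E -Hf; ring.
  have [u [up [e]]] : L (h x).
    rewrite Hc; apply: (smod_sum LP) => i _; apply: (smodZ LP).
    have [_ [s [sp E]]] := Ha i; exists s; split=> //.
    exists (fun j => (j == i)%:R); rewrite E (bigD1 i) //= eqxx mul1r big1 ?addr0 // => j /negPf ->.
    by rewrite mul0r.
  rewrite -hM => /loc_hom_eq[w [wp E]]; exists (w * u); split; first exact: specM.
  exists (fun i => w * e i); rewrite -mulrA E mulr_sumr.
  by apply: eq_bigr => i _; rewrite mulrA.
move=> d2; subst d => /(height_le1P dom) hp.
have cc := contract_chain chP.
pose o0 : 'I_3 := ord0; pose o1 : 'I_3 := inord 1; pose o2 : 'I_3 := ord_max.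
have e1 : nat_of_ord o1 = 1%N by rewrite inordK.
have [_ t01] : {subset contract (ch o0) <= contract (ch o1)} /\ ~ {subset contract (ch o1) <= contract (ch o0)}.
  by apply: cc; rewrite e1.
have [_ t12] : {subset contract (ch o1) <= contract (ch o2)} /\ ~ {subset contract (ch o2) <= contract (ch o1)}.
  by apply: cc; rewrite e1.
apply: t01 => x x1; rewrite (hp (contract (ch o1)) _ _ x x1).
- exact: (smod0 (smod_mem _)).
- exact: contract_sub.
by move=> H; apply: t12 => y /contract_sub/H.
Qed.

(** Local dimensions 0 and 1 give a principal p. *)
Lemma regular_cases : principal_at p \/ (~ height_le p 1 /\ exists a b, two_generated p a b).
Proof.
have [d [a [d2 ap pa dh]]] := regular_generators.
case: d a d2 ap pa dh => [|[|[|d]]] a // _ ap pa dh.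
- left; apply: (principal_loc k_noeth (d := 0)); first exact: (smod0 (smod_mem p)).
  move=> x /pa[u [up [c E]]]; exists u; split=> //; exists 0.
  by rewrite E big_ord0 mulr0.
- left; apply: (principal_loc k_noeth (ap ord0)) => x /pa[u [up [c E]]].
  by exists u; split=> //; exists (c ord0); rewrite E big_ord1 mulrC.
right; split; first exact: dh.
exists (a ord0), (a ord_max); split=> // x /pa[u [up [c E]]]; exists u; split=> //.
exists (c ord0), (c ord_max); rewrite E big_ord_recl big_ord1.
rewrite (_ : lift ord0 ord0 = ord_max); [ring|exact: val_inj].
Qed.
End AtPrime.

(** An integral fraction al/be outside [k] yields an associated prime p of k/(be). If p is principal
    at p, the integral equation puts a power of an element outside p into p; if p = (a, b) at p,
    regularity of the pair puts an element outside p into the annihilator p. *)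
Lemma regular_integral : integrally_closed_domain k.
Proof.
exists dom => x [n [c xc]].
have [be [bp [al Hx]]] := loc_frac x.
have b0 : be <> 0 := spec_neq0 bp.
suff [y Hy] : multiple be al.
  exists y; have [d db] := loc_unit bp.
  by rewrite -[LHS]mul1r -db -mulrA Hx Hy rmorphM mulrA db mul1r.
pose h := loc_hom (zero_spec dom).
have hI (u v : k) : h u = h v -> u = v.
  by move=> /loc_hom_eq[w [wp E]]; apply: (dom_mulI dom (spec_neq0 wp) E).
have rel : al ^+ n + \sum_(i < n) c i * (al ^+ i * be ^+ (n - i)) = 0.
  apply: hI; have {}Hx : h be * x = h al := Hx.
  transitivity (h be ^+ n * (x ^+ n + \sum_(i < n) to_fracfield dom (c i) * x ^+ i)); last first.
    by rewrite xc mulr0 /h rmorph0.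
  transitivity (h al ^+ n + \sum_(i < n) h (c i) * (h al ^+ i * h be ^+ (n - i))).
    rewrite /h rmorphD rmorphXn rmorph_sum; congr (_ + _); apply: eq_bigr => i _.
    by rewrite !rmorphM !rmorphXn.
  rewrite -Hx mulrDr exprMn mulr_sumr; congr (_ + _); apply: eq_bigr => i _.
  rewrite -[to_fracfield _ _]/(h (c i)) exprMn.
  have -> : h be ^+ n = h be ^+ i * h be ^+ (n - i) by rewrite -exprD subnKC // ltnW.
  ring.
apply: contrapT => /(associated_prime k_noeth)[p [r [nb pE]]].
have bep : be \in spec_ideal p by apply/pE; exists (r * al).
have [[d dp [u up pd]]|[hp [a [b ab]]]] := regular_cases p.
  have d0 : d <> 0.
    move=> d0; have [y Hy] := pd _ bep; have : u * be = 0 by rewrite Hy d0 mul0r.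
    by case/dom.2 => // u0; case: (spec_neq0 up).
  have [y Hy] := proj1 (pE d) dp.
  have [yp|yp] := boolP (y \in spec_ideal p).
    have [y' Hy'] := pd _ yp; move/negP: up; apply; apply/pE.
    exists y'; apply: (dom_mulI dom d0).
    by rewrite mulrCA Hy [RHS]mulrCA -Hy'; ring.
  have E1 : y ^+ n + \sum_(i < n) c i * r ^+ (n - i) * y ^+ i * d ^+ (n - i) = 0.
    apply: (dom_mulI dom (dom_exp_neq0 dom (n := n) b0)); rewrite mulr0 mulrDr -exprMn -Hy.
    transitivity (d ^+ n * r ^+ n * (al ^+ n + \sum_(i < n) c i * (al ^+ i * be ^+ (n - i)))).
      rewrite mulrDr !exprMn !mulr_sumr; congr (_ + _); first by ring.
      apply: eq_bigr => i _.
      have sp (z : k) : z ^+ n = z ^+ i * z ^+ (n - i) by rewrite -exprD subnKC // ltnW.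
      rewrite (sp be) (sp d) (sp r).
      transitivity (c i * r ^+ (n - i) * (be * y) ^+ i * be ^+ (n - i) * d ^+ (n - i)).
        by rewrite exprMn; ring.
      by rewrite -Hy !exprMn; ring.
    by rewrite rel mulr0.
  have yn : y ^+ n \in spec_ideal p.
    have -> : y ^+ n = - \sum_(i < n) c i * r ^+ (n - i) * y ^+ i * d ^+ (n - i).
      by apply/eqP; rewrite -addr_eq0 E1.
    apply: (smodN (smod_mem p)); apply: (smod_sum (smod_mem p)) => i _.
    apply: specMl; have : (0 < n - i)%N by rewrite subn_gt0.
    by case: (n - i)%N => // m _; rewrite exprS; apply: specMr.
  by have := specX n yp; rewrite yn.
have [ap bp' pab] := ab; have a0 := two_gen_neq0 k_noeth dom ab hp.
have [y Hy] := proj1 (pE a) ap; have [z Hz] := proj1 (pE b) bp'.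
have [|u up [y' Hy']] := two_gen_regular k_noeth dom ab hp (x := y).
  exists z; apply: (dom_mulI dom b0).
  by rewrite mulrCA -Hy [RHS]mulrCA -Hz; ring.
move/negP: up; apply; apply/pE; exists y'; apply: (dom_mulI dom a0).
by rewrite mulrCA Hy [RHS]mulrCA -Hy' -[u *: _]/(u * y); ring.
Qed.
End RegularDomains.

Lemma sdual_regular (k : comPzRingType) : sdual k^o 1.
Proof. by exists unit, (fun=> 1), (fun=> idfun) => y; rewrite big_const card_unit /= addr0 scale1r [RHS]mulr1. Qed.

(** * Saturated submodules in dimension two *)

Section SaturatedSubmodules.
Variables (k : comPzRingType) (k_reg : regular_domain k) (k_dim : krull_dim_le k 2).
Let dom : is_domain k. Proof. by case: k_reg. Qed.
Let k_noeth : noetherian k. Proof. by case: k_reg. Qed.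
Variables (M : lmodType k) (lM : seq M).
Hypotheses (lMP : forall y, spn lM y) (M1 : sdual M 1).
Variables (D : M -> Prop) (DP : smod D).
Hypothesis sat : forall (s : k) x, s <> 0 -> D (s *: x) -> D x.
Local Notation Q := (submod (mksub DP)).
Let qv : {linear Q -> M} := @submod_val k M (mksub DP).
Let qv_inj : injective qv. Proof. exact: val_inj. Qed.
Let qvP q : D (qv q). Proof. by apply/(mksubE DP)/(valP q). Qed.
Let qmk x (Dx : D x) : Q := Submod (let: conj _ h := mksubE DP x in h Dx).
Let tf (s : k) (x : Q) : s <> 0 -> s *: x = 0 -> x = 0.
Proof.
move=> s0 sx; apply: qv_inj; rewrite linear0; apply: (dom_torsionfree dom M1 s0).
by rewrite -(linZ (linearP qv)) sx linear0.
Qed.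

Section Relations.
Variables (p : spec k) (n : nat) (x : 'I_n -> Q) (s : k).
Hypotheses (sp : s \notin spec_ideal p)
  (xs : forall q, exists c : 'I_n -> k, s *: q = \sum_i c i *: x i).
Local Notation V := {ffun 'I_n -> k^o}.
Let comb (c : V) : Q := \sum_i (c i : k) *: x i.
Let comb_linear : linear comb.
Proof.
move=> a c d; rewrite /comb scaler_sumr -big_split; apply: eq_bigr => i _.
by rewrite !ffunE /= scalerA -scalerDl.
Qed.
Let cD := linD comb_linear. Let cZ := linZ comb_linear.
Let comb_ex q : exists c : V, s *: q = comb c.
Proof.
have [c Hc] := xs q; exists [ffun i => c i]; rewrite Hc.
by apply: eq_bigr => i _; rewrite ffunE.
Qed.
Hypothesis rel_in : forall c, comb c = 0 -> forall i, (c i : k) \in spec_ideal p.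

(* The module of relations R satisfies R = pR at p. If p = (a, b) is not principal,
   write c = a al + b be; then a (comb al) + b (comb be) = 0, so that comb be = a q
   by regularity of (a, b), and a combination representing q corrects al and be
   to relations. *)
Lemma relation_split c : comb c = 0 -> exists u a b al be, [/\ u \notin spec_ideal p,
  a \in spec_ideal p /\ b \in spec_ideal p, comb al = 0, comb be = 0 &
  u *: c = a *: al + b *: be].
Proof.
move=> c0; have [[d dp [u up pd]]|[hp [a [b ab]]]] := regular_cases k_reg k_dim p.
  have [y Hy] : exists y : V, u *: c = d *: y.
    have [y Hy] := choice (fun i => pd _ (rel_in c0 i)).
    by exists [ffun i => y i]; apply/ffunP => i; rewrite !ffunE; exact: Hy.
  have [d0|/eqP d0] := eqVneq d 0.
    exists u, d, d, 0, 0; split=> //; [exact: lin0|exact: lin0|].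
    by rewrite !scaler0 addr0 Hy d0 scale0r.
  exists u, d, d, y, 0; split=> //; [|exact: lin0|by rewrite scaler0 addr0].
  by apply: (tf d0); rewrite -cZ -Hy cZ c0 scaler0.
have a0 := two_gen_neq0 k_noeth dom ab hp; have [ap bp pab] := ab.
have [u up [al [be E]]] : exists2 u, u \notin spec_ideal p & exists al be : V, u *: c = a *: al + b *: be.
  have SP : smod (fun c : V => exists al be : V, c = a *: al + b *: be).
    split=> [|_ _ [y [z ->]] [y' [z' ->]]|r _ [y [z ->]]].
    - by exists 0, 0; rewrite !scaler0 addr0.
    - by exists (y + y'), (z + z'); rewrite !scalerDr; abel.
    by exists (r *: y), (r *: z); rewrite scalerDr !scalerA ![r * _]mulrC.
  rewrite -/(loc_in p (fun c : V => exists al be : V, c = a *: al + b *: be) c).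
  rewrite [c]ffun_single; apply: (smod_sum (smod_loc_in p SP)) => i _.
  have [u [up [y [z E]]]] := pab _ (rel_in c0 i).
  exists u => //; exists (ffsingle i (y : k^o)), (ffsingle i (z : k^o)).
  by rewrite -!(linZ (@ffsingle_linear _ _ _ _)) -(linD (@ffsingle_linear _ _ _ _)); congr ffsingle.
have rel : a *: comb al + b *: comb be = 0 by rewrite -!cZ -cD -E cZ c0 scaler0.
have [t tp [y Hy]] : exists2 t, t \notin spec_ideal p & exists y, t *: qv (comb be) = a *: y.
  have SP : smod (fun z : M => exists y, z = a *: y).
    split=> [|_ _ [y ->] [z ->]|r _ [y ->]].
    - by exists 0; rewrite scaler0.
    - by exists (y + z); rewrite scalerDr.
    by exists (r *: y); rewrite !scalerA mulrC.
  have [I [e [f ef]]] := M1.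
  rewrite -/(loc_in p (fun z : M => exists y, z = a *: y) (qv (comb be))).
  rewrite -[qv _]scale1r ef; apply: (smod_sum (smod_loc_in p SP)) => j _.
  have [|t tp [m Hm]] := two_gen_regular k_noeth dom ab hp (x := f j (qv (comb be))).
    exists (f j (qv (- comb al))).
    have <- : f j (qv (b *: comb be)) = b * (f j (qv (comb be)) : k).
      by rewrite (linZ (linearP qv)) (linZ (linearP (f j))).
    have -> : b *: comb be = a *: - comb al.
      by apply/eqP; rewrite scalerN -addr_eq0 addrC rel.
    by rewrite (linZ (linearP qv)) (linZ (linearP (f j))).
  by exists t => //; exists (m *: e j); rewrite !scalerA -Hm.
have Dy : D y by apply: (sat a0); rewrite -Hy; apply: (smodZ DP); apply: qvP.
have Hq : t *: comb be = a *: qmk Dy by apply: qv_inj; rewrite !(linZ (linearP qv)) Hy.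
have [ga Hga] := comb_ex (qmk Dy).
exists (s * t * u), a, b, ((s * t) *: al + b *: ga), ((s * t) *: be - a *: ga); split.
- by apply: specM => //; apply: specM.
- by [].
- apply: (tf a0); rewrite cD !cZ -Hga.
  rewrite scalerDr (_ : a *: (b *: (s *: qmk Dy)) = (s * b) *: (a *: qmk Dy)); last first.
    by rewrite !scalerA; congr (_ *: _); ring.
  transitivity ((s * t) *: (a *: comb al + b *: comb be)); last by rewrite rel scaler0.
  by rewrite -Hq scalerDr !scalerA; congr (_ *: _ + _ *: _); ring.
- by rewrite (linB comb_linear) !cZ -Hga -[(s * t) *: _]scalerA Hq !scalerA mulrC subrr.
transitivity ((s * t) *: (u *: c)); first by rewrite scalerA.
rewrite E !scalerDr !scalerN !scalerA [b * a]mulrC ![(s * t) * _]mulrC.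
abel.
Qed.

Lemma relation_zero c : comb c = 0 -> c = 0.
Proof.
move=> c0; have V1 : sdual V 1 by apply: sdual_ffun; exact: sdual_regular.
have [lV HV] := sdual_span V1.
have RP : smod (fun c => comb c = 0).
  split=> [|y z Hy Hz|r y Hy]; first exact: lin0.
    by rewrite cD Hy Hz addr0.
  by rewrite cZ Hy scaler0.
have [l lR Rl] := submodule_gens k_noeth (l := lV) RP (fun y _ => ltac:(rewrite -[y]scale1r; apply: HV)).
have [y yl|v vp Hv] := @nakayama_seq k p V (fun y => y = 0) l (smod_zero V).
  have [u [a [b [al [be [up [ap bp] al0 be0 E]]]]]] := relation_split (lR _ yl).
  exists u => //; rewrite E; have IP := ideal_like_mem (spec_ideal p); have ZP := smod_zero V.
  by apply: (smodD (smod_addspan l IP ZP)); apply: addspan_scaled => //; apply: Rl.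
have : v *: c = 0.
  move: {c0}(Rl _ c0); move: c; apply: spn_ind => //.
  split=> [|y z Hy Hz|r y Hy]; first by rewrite scaler0.
    by rewrite scalerDr Hy Hz addr0.
  by rewrite scalerA mulrC -scalerA Hy scaler0.
by apply: (dom_torsionfree dom V1 (spec_neq0 vp)).
Qed.

Lemma relation_sdual : sdual Q s.
Proof.
have [c Hc] := choice comb_ex.
have cU y z : comb y = comb z -> y = z.
  move=> yz; apply/eqP; rewrite -subr_eq0; apply/eqP/relation_zero.
  by rewrite (linB comb_linear) yz subrr.
have cl i : linear (fun q => c q i : k^o).
  move=> a q r; have -> : c (a *: q + r) = a *: c q + c r.
    by apply: cU; rewrite cD cZ -!Hc scalerDr !scalerA mulrC.
  by rewrite !ffunE.
by exists 'I_n, x, (fun i => mklin (cl i)) => q; rewrite Hc.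
Qed.
End Relations.

Lemma saturated_projective : fin_gen Q /\ projective Q.
Proof.
have [l lQ] := submod_gens (mksub DP) k_noeth lMP.
split.
  exists (size l), (tnth (in_tuple l)) => q; exact: spn_fin.
apply: sdual1_projective; apply: (ideal_local k_noeth (sdual_ideal Q)) => p _.
pose P n := `[< exists (x : 'I_n -> Q) (s : k), s \notin spec_ideal p /\
  forall q, exists c : 'I_n -> k, s *: q = \sum_i c i *: x i >].
have exP : exists n, P n.
  exists (size l); apply/asboolP; exists (tnth (in_tuple l)), 1; split; first exact: spec1.
  by move=> q; apply: spn_fin; apply: lQ.
(* For the least number n of local generators no relation has a coefficient outside p, as that would
   eliminate a generator. *)
case: (ex_minnP exP) => n /asboolP[x [s [sp xs]]] nmin; exists s => //.
apply: (relation_sdual sp xs) => c c0 i; apply: contrapT => /negP ci.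
case: n x xs c c0 i ci nmin => [|n] x xs c c0 i ci nmin; first by case: i {ci}.
suff /nmin : P n by rewrite ltnn.
apply/asboolP.
exists (fun j => x (lift i j)), (c i * s); split; first exact: specM.
move=> q; have [d Hd] := xs q; exists (fun j => c i * d (lift i j) - d i * c (lift i j)).
rewrite -scalerA Hd (bigD1_ord i) //= scalerDr.
have -> : c i *: (d i *: x i) = - (d i *: \sum_j (c (lift i j) : k) *: x (lift i j)).
  apply/eqP; rewrite -addr_eq0 scalerA mulrC -scalerA -scalerDr.
  by move: c0; rewrite (bigD1_ord i) //= => ->; rewrite scaler0.
rewrite addrC !scaler_sumr -sumrB; apply: eq_bigr => j _.
by rewrite !scalerA scalerBl.
Qed.
End SaturatedSubmodules.

(** * Split type *)

Section RankOneElement.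
Variables (k : comPzRingType) (k_noeth : noetherian k).
Variables (kI : integrally_closed_domain k) (dom : is_domain k).
Variables (F : pzAlgType k) (lF : seq F).
Hypotheses (lFP : forall y, spn lF y) (F1 : sdual F 1) (Faz : azumaya F).

Lemma azumaya_inner (H : endk F) : inner H.
Proof.
have [/csep1P Fs _ Fc] := Faz; have [I0 ID IZ] := @inner_smod k F.
have CP : ideal_like (fun c : k => forall H : endk F, inner (c *: H)).
  split=> [G|x y Hx Hy G|a x Hx G]; first by rewrite scale0r.
    by rewrite scalerDl; apply: ID.
  by rewrite -[a *: x]/(a * x) -scalerA; apply: IZ.
have := ideal_local k_noeth CP; rewrite -[H]scale1r; apply=> p _.
apply: (local_inner (spec1 p) F1 (bc_fib p F) (@fibM k p F)).
apply: (central_inner (resfield_field p) (bc_spn (bc_fib p F) lFP)).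
  by apply: (bc_csep (c := 1) (bc_fib p F) (@fibM k p F) (fib1 p F)) Fs; rewrite rmorph1 mulr1.
by move=> z; apply: (fibre_center (spec1 p) Fs Fc).
Qed.

Variables (g : F) (g0 : g <> 0).
Hypothesis gg : forall x, exists a b : k, b <> 0 /\ b *: (g * x * g) = a *: g.
Let tf (s : k) (y : F) : s <> 0 -> s *: y = 0 -> y = 0 := dom_torsionfree dom F1.
Let cancel_scale (s : k) (x y : F) : s <> 0 -> s *: x = s *: y -> x = y.
Proof.
move=> s0 E; apply/eqP; rewrite -subr_eq0; apply/eqP/(tf s0).
by rewrite scalerBr E subrr.
Qed.

Definition left_multiple (x : F) := exists b : k, b <> 0 /\ exists y, b *: x = y * g.
Lemma left_multiple_smod : smod left_multiple.
Proof.
split=> [|x x' [b [b0 [y E]]] [b' [b'0 [y' E']]]|a x [b [b0 [y E]]]].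
- by exists 1; split; [exact: dom.1|exists 0; rewrite scaler0 mul0r].
- exists (b * b'); split; first exact: dom_mul_neq0.
  exists (b' *: y + b *: y').
  by rewrite mulrDl -!pzscaleAl -E -E' scalerDr !scalerA [b' * b]mulrC.
by exists b; split=> //; exists (a *: y); rewrite -pzscaleAl -E !scalerA mulrC.
Qed.
Lemma left_multiple_saturated (s : k) x : s <> 0 -> left_multiple (s *: x) -> left_multiple x.
Proof.
move=> s0 [b [b0 [y E]]]; exists (b * s); split; first exact: dom_mul_neq0.
by exists y; rewrite -scalerA.
Qed.
Local Notation Q := (submod (mksub left_multiple_smod)).
Let qv : {linear Q -> F} := @submod_val k F (mksub left_multiple_smod).
Let qv_inj : injective qv. Proof. exact: val_inj. Qed.
Let qvP q : left_multiple (qv q). Proof. by apply/(mksubE left_multiple_smod)/(valP q). Qed.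
Let qmk x (Dx : left_multiple x) : Q :=
  Submod (let: conj _ h := mksubE left_multiple_smod x in h Dx).

Let qact_in x q : left_multiple (x * qv q).
Proof.
have [b [b0 [y E]]] := qvP q; exists b; split=> //; exists (x * y).
by rewrite pzscaleAr E mulrA.
Qed.
Let qact x q : Q := qmk (qact_in x q).
Let qactE x q : qv (qact x q) = x * qv q. Proof. by []. Qed.
Let qact_linear x : linear (qact x).
Proof.
move=> a q r; apply: qv_inj; rewrite (linearP qv) !qactE (linearP qv).
by rewrite mulrDr pzscaleAr.
Qed.
Let lam (x : F) : endk Q := (mklin (qact_linear x) : {linear Q -> Q}).
Local Notation ev := (@endo_fun k k (central_id k) Q).
Let lamE x q : qv (ev (lam x) q) = x * qv q. Proof. by []. Qed.
Let endk_ext (f h : endk Q) : (forall q, qv (ev f q) = qv (ev h q)) -> f = h.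
Proof. by move=> E; apply: endoP => q; apply: qv_inj. Qed.

Lemma lam_hom : alg_hom lam.
Proof.
split=> [a x y|]; last first.
  split=> [|x y]; apply: endk_ext => q; rewrite ?endk1 ?endkM !lamE ?mul1r //.
  by rewrite mulrA.
apply: endk_ext => q; rewrite endkD endkZ (linearP qv) !lamE.
by rewrite mulrDl pzscaleAl.
Qed.

Let g_in : left_multiple g.
Proof. by exists 1; split; [exact: dom.1|exists 1; rewrite scale1r mul1r]. Qed.
Let gQ : Q := qmk g_in.
Let gQE : qv gQ = g. Proof. by []. Qed.

(* h u q is a fixed fractional multiple of h, since g F g lies in Frac(k) g. *)
Lemma right_scalar u q : exists B A : k, B <> 0 /\
  forall h, B *: (qv h * u * qv q) = A *: qv h.
Proof.
have [b [b0 [y E]]] := qvP q; have [a [c [c0 E2]]] := gg (u * y).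
exists (c * b), a; split=> [|h]; first exact: dom_mul_neq0.
have [b' [b'0 [y' E']]] := qvP h; apply: (cancel_scale b'0).
have -> : b' *: ((c * b) *: (qv h * u * qv q)) = c *: ((b' *: qv h) * u * (b *: qv q)).
  by rewrite -!pzscaleAl -!pzscaleAr !scalerA; congr (_ *: _); ring.
transitivity (y' * (c *: (g * (u * y) * g))).
  by rewrite E E' -pzscaleAr; congr (_ *: _); rewrite !mulrA.
by rewrite E2 -pzscaleAr -E' !scalerA mulrC.
Qed.

(** Right multiplication by u q acts on Q as a fraction of [k] ([right_scalar]), so it commutes with
    every [k]-linear H. *)
Lemma end_right (H : endk Q) h u q :
  qv (ev H h) * u * qv q = qv (ev H (qact (qv h * u) q)).
Proof.
have [B [A [B0 E]]] := right_scalar u q; apply: (cancel_scale B0).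
have -> : B *: qv (ev H (qact (qv h * u) q)) = qv (ev H (B *: qact (qv h * u) q)).
  by rewrite (linZ (linearP (endo_fun H))) (linZ (linearP qv)).
have -> : B *: qact (qv h * u) q = A *: h.
  by apply: qv_inj; rewrite !(linZ (linearP qv)) qactE E.
by rewrite E (linZ (linearP (endo_fun H))) (linZ (linearP qv)).
Qed.

(** As F is Azumaya, the endomorphism z -> tau(z) 1 is inner. *)
Lemma trace_form (tau : {linear F -> k^o}) : exists u : seq (F * F),
  forall z, \sum_(v <- u) v.1 * z * v.2 = (tau z : k) *: (1 : F).
Proof.
have [u Hu] := azumaya_inner (rank1 tau (1 : F)); exists u => z.
by rewrite -Hu rank1E.
Qed.

(** With sum v1 z v2 = tau(z) for all z, the element x = sum H(v1 w) v2 acts as q -> sum H(v1 w v2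
    q) = tau(w) H(q), by [end_right]. *)
Lemma lam_multiple (tau : {linear F -> k^o}) (w : Q) (H : endk Q) :
  exists x, lam x = (tau (qv w) : k) *: H.
Proof.
have [u Hu] := trace_form tau.
exists (\sum_(v <- u) qv (ev H (qact v.1 w)) * v.2); apply: endk_ext => q.
rewrite lamE endkZ (linZ (linearP qv)) mulr_suml.
transitivity (\sum_(v <- u) qv (ev H (qact (v.1 * qv w * v.2) q))).
  by apply: eq_bigr => v _; rewrite end_right.
rewrite -(linsum (linearP qv)) -(linsum (linearP (endo_fun H))).
have -> : \sum_(v <- u) qact (v.1 * qv w * v.2) q = (tau (qv w) : k) *: q.
  apply: qv_inj; rewrite (linsum (linearP qv)) (linZ (linearP qv)).
  rewrite -[qv q]mul1r pzscaleAl -Hu mulr_suml.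
  by apply: eq_bigr => v _; rewrite qactE.
by rewrite (linZ (linearP (endo_fun H))) (linZ (linearP qv)).
Qed.

Lemma trace_neq0 : exists tau : {linear F -> k^o}, (tau g : k) <> 0.
Proof.
have [I [e [f ef]]] := F1; apply: contrapT => nf; apply: g0.
rewrite -[g]scale1r ef big1 // => i _; rewrite (_ : (f i g : k) = 0) ?scale0r //.
by apply: contrapT => fg; apply: nf; exists (f i).
Qed.

Lemma lam_inj x y : lam x = lam y -> x = y.
Proof.
move=> xy; have [tau tg] := trace_neq0; have [u Hu] := trace_form tau.
apply: (cancel_scale tg).
have E z : (tau g : k) *: z = \sum_(v <- u) qv (ev (lam z) (qact v.1 gQ)) * v.2.
  rewrite -[z in LHS]mulr1 pzscaleAr -Hu mulr_sumr; apply: eq_bigr => v _.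
  by rewrite lamE qactE gQE !mulrA.
by rewrite !E xy.
Qed.

(** Some tau(w) is outside p. Otherwise Q lies in pF = dF at p, saturation gives Q = dQ there, and
    Nakayama's lemma kills g. *)
Lemma lam_local (p : spec k) : height_le p 1 -> exists2 t, t \notin spec_ideal p &
  forall H : endk Q, exists x, lam x = (t : k) *: H.
Proof.
move=> hp; have [d dp [u up pd]] := height1_principal k_noeth kI hp.
apply: contrapT => nt.
have taup (tau : {linear F -> k^o}) w : (tau (qv w) : k) \in spec_ideal p.
  apply: contrapT => /negP tp; apply: nt; exists (tau (qv w)) => // H.
  exact: lam_multiple.
have [l lQ] := submod_gens (mksub left_multiple_smod) k_noeth lFP.
have pQ (w : Q) : loc_in p (fun z => exists2 w, w \in @mulspan k (spec_ideal p) Q & z - w = 0) w.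
   have [s sp Hs] := sdual_detects (spec1 p) F1 (fun tau => taup tau w).
  have [y Hy] : exists y, (u * s) *: qv w = d *: y.
    rewrite -scalerA; move: (s *: qv w) Hs.
    apply: (@mulspan_ind k F (spec_ideal p) (fun z => exists y, u *: z = d *: y)).
      split=> [|x x' [y Ey] [z Ez]|r x [y Ey]].
      - by exists 0; rewrite !scaler0.
      - by exists (y + z); rewrite !scalerDr -Ey -Ez.
      by exists (r *: y); transitivity (r *: ((u : k) *: x)); [|rewrite Ey]; rewrite !scalerA mulrC.
    by move=> a x /pd[m Hm]; exists (m *: x); rewrite !scalerA Hm.
  exists (u * s); first exact: specM.
  have [d0|/eqP d0] := eqVneq d 0.
    exists 0; first exact: (smod0 (@smod_mulspan k Q _)).
    by rewrite subr0; apply: qv_inj; rewrite (linZ (linearP qv)) Hy d0 scale0r linear0.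
  have Dy : left_multiple y.
    by apply: (left_multiple_saturated d0); rewrite -Hy; apply: (smodZ left_multiple_smod).
  exists (d *: qmk Dy); first exact: mulspan_mem.
  by apply: qv_inj; rewrite (linB (linearP qv)) !(linZ (linearP qv)) Hy subrr linear0.
have [|s sp Hs] := nakayama (smod_zero Q) (spec1 p) _ pQ (l := l).
  by move=> y; rewrite scale1r; apply: (addspan_spn (smod_zero Q) (lQ y)).
apply: g0; apply: (tf (spec_neq0 sp)).
by rewrite -gQE -(linZ (linearP qv)) Hs linear0.
Qed.

Lemma lam_surj H : exists x, lam x = H.
Proof.
have [tau tg] := trace_neq0; have [x0 Hx0] := lam_multiple tau gQ H.
rewrite gQE in Hx0; set c0 := (tau g : k) in tg Hx0.
have [I [e [f ef]]] := F1.
(* x0 represents c0 H. Its coordinates are divisible by c0 at the primes of height at most one,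
   where [lam_local] applies, hence in [k]. *)
have mul i : multiple c0 (f i x0).
  apply: (height1_multiple k_noeth kI tg) => p /lam_local[t tp Ht]; exists t => //.
  have [x Hx] := Ht H; exists (f i x).
  have E : (t : k) *: x0 = c0 *: x.
    by apply: lam_inj; rewrite !(linZ lam_hom.1) Hx0 Hx !scalerA mulrC.
  transitivity (f i ((t : k) *: x0) : k); first by rewrite (linZ (linearP (f i))).
  by rewrite E (linZ (linearP (f i))).
have [y Hy] := choice mul; exists (\sum_i y i *: e i).
have E : x0 = c0 *: \sum_i y i *: e i.
  by rewrite -[x0]scale1r ef scaler_sumr; apply: eq_bigr => i _; rewrite Hy scalerA.
apply: endk_ext => q; apply: (cancel_scale tg); rewrite -!(linZ (linearP qv)) -!endkZ.
by rewrite -(linZ lam_hom.1) -E Hx0.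
Qed.
Lemma rank_one_endk : exists lam : F -> endk Q,
  [/\ alg_hom lam, injective lam & forall H, exists x, lam x = H].
Proof. by exists lam; split; [exact: lam_hom|exact: lam_inj|exact: lam_surj]. Qed.
End RankOneElement.

Lemma azumaya_rank_one_split (k : comPzRingType) (F : pzAlgType k) (lF : seq F) (g : F) :
  regular_domain k -> krull_dim_le k 2 -> (forall y, spn lF y) -> sdual F 1 -> azumaya F ->
  g <> 0 -> (forall x, exists a b : k, b <> 0 /\ b *: (g * x * g) = a *: g) ->
  exists Q : lmodType k, [/\ fin_gen Q, projective Q & exists lam : F -> endk Q,
    [/\ alg_hom lam, injective lam & forall H, exists x, lam x = H]].
Proof.
move=> k_reg k_dim lFP F1 Faz g0 gg; have [dom k_noeth _] := k_reg.
have kI := regular_integral k_reg k_dim.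
have [fQ pQ] := saturated_projective k_reg k_dim lFP F1 (left_multiple_smod dom g)
  (fun s x => @left_multiple_saturated _ dom _ g s x).
eexists; split; [exact: fQ|exact: pQ|exact: (rank_one_endk k_noeth kI dom lFP F1 Faz g0 gg)].
Qed.

Section SplitDescent.
Variables (k : comPzRingType) (A : pzAlgType k) (J : ideal2 A) (lA : seq A).
Hypotheses (k_reg : regular_domain k) (k_dim : krull_dim_le k 2).
Hypotheses (lAP : forall y, spn lA y) (A1 : sdual A 1) (JJ : idempotent_ideal J).
Hypothesis r1 : sretract J 1.
Local Notation E := (end_ideal J).
Hypothesis hJ : forall p : spec k, height_le p 1 -> heredity_split (fibre_ideal J p).

Lemma split_descent : heredity_split J.
Proof.
have [dom k_noeth _] := k_reg; have kI := regular_integral k_reg k_dim.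
have [|hE Esemi] := semisplit_descent k_noeth kI lAP A1 JJ r1 dom.
  move=> p /hJ[hp /(field_split_semisplit (resfield_field p))]; by split.
split=> //; have [_ a1 _] := (heredityE k_noeth lAP A1 JJ).1 hE.
have E1 := end_sdual A1 r1 a1; have [lE lEP] := end_gens A1 r1 a1.
have [n [F [Faz [phi [phiP phiU]]]]] := Esemi.
have [s [s1 s2 s3]] := prod_section phiP phiU.
have sl := section_mul_l phiP phiU s1 s2; have sr := section_mul_r phiP phiU s1 s2.
pose p0 := zero_spec dom; have [i [iP iM i1]] := fibre_end_bc r1 a1 p0.
have iS := bc_semilin iP; have X1 := sretract_sdual A1 r1.
have inj := generic_inj X1 iP.
have [m [Q0 [Q0P [psi [psiP psiU]]]]] := (hJ (@zero_height k dom)).2.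
have [t [t1 t2 t3]] := prod_section psiP psiU.
have tl := section_mul_l psiP psiU t1 t2; have tr := section_mul_r psiP psiU t1 t2.
have split_factor j : exists Q : lmodType k, [/\ fin_gen Q, projective Q &
    exists lam : F j -> endk Q, [/\ alg_hom lam, injective lam & forall H, exists x, lam x = H]].
  have nz : s j 1 <> 0.
    move=> sj; have [_ Ff _] := Faz j; apply: dom.1; apply: Ff.
    by rewrite scale1r -(s1 j 1) sj (lin0 (phiP j).1).
  (* The unit of the generic fibre of E is a sum of rank one idempotents, and one of them survives
     multiplication by the unit of the j-th factor. Clearing its denominator gives [g]. *)
  have [e [ee ze]] : exists e : end_ideal (fibre_ideal J p0),
      (forall y, exists c : resfield p0, e * y * e = c *: e) /\ i (s j 1) * e <> 0.
    apply: contrapT => ne; apply: nz; apply: inj; rewrite (semilin0 iS).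
    transitivity (i (s j 1) * \sum_l t l (psi l 1)); first by rewrite -t3 mulr1.
    rewrite mulr_sumr big1 // => l _.
    have [lQ HQ] := fin_gen_seq (Q0P l).1.
    have [d [x [f [xf fx]]]] := field_basis (resfield_field p0) HQ.
    have -> : psi l 1 = \sum_h rank1 (f h) (x h).
      rewrite (prod_hom1 psiP); apply: endoP => y.
      rewrite endk1 endk_sum [LHS]xf; apply: eq_bigr => h _.
      by rewrite rank1E.
    rewrite linear_sum mulr_sumr big1 // => h _; apply: contrapT => zh; apply: ne.
    exists (t l (rank1 (f h) (x h))); split=> // y.
    exists (f h (endo_fun (psi l y) (x h))).
    rewrite tr -(linZ (linearP (t l))) tl (t1 l) ; congr (t l _).
    apply: endoP => z; rewrite endkZ !endkM !rank1E.
    rewrite (linZ (linearP (endo_fun (psi l y)))) (linZ (linearP (f h))).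
    by rewrite scalerA mulrC.
  have [c cp [g Hg]] := bc_fib_frac iP e.
  have [c' Hc'] := fhom_unit cp.
  have g0 : phi j g <> 0.
    move=> gj; apply: ze; rewrite -[e]scale1r -Hc' -scalerA Hg -pzscaleAr -iM.
    by rewrite sr mul1r gj linear0 (semilin0 iS) scaler0.
  have gg x : exists a b : k, b <> 0 /\ b *: (phi j g * x * phi j g) = a *: phi j g.
    have [ka Hk] := ee (i (s j x)); have [d dp [a Ha]] := fhom_frac ka.
    exists (c * a), d; split; first exact: spec_neq0 dp.
    rewrite -(s1 j x) -!(prod_homM phiP) -!(linZ (phiP j).1); congr (phi j _).
    apply: inj; rewrite !(semilinZ iS) !iM -Hg -!pzscaleAl -!pzscaleAr Hk rmorphM -Ha !scalerA.
    have rg (K : comPzRingType) (u v w : K) : v * (u * u * w) = u * (v * w) * u by ring.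
    by rewrite rg.
  apply: (azumaya_rank_one_split k_reg k_dim _ _ (Faz j) g0 gg (lF := [seq phi j x | x <- lE])).
    by apply: (bc_alg_spn (phiP j).1 _ lEP) => y; exists (s j y); exact: s1.
  have := @sdual_retract k E (F j) (s j) (mklin (phiP j).1) 1 1 _ E1.
  by rewrite mulr1; apply=> x; rewrite scale1r -[RHS](s1 j x).
have [Q HQ] := choice split_factor.
have lamE j : exists lam : F j -> endk (Q j), [/\ alg_hom lam, injective lam & forall H, exists x, lam x = H].
  by have [_ _ H] := HQ j.
pose la j := sval (cid (lamE j)); have laP j : [/\ alg_hom (la j), injective (la j) & forall H, exists x, la j x = H].
  exact: svalP (cid (lamE j)).
clearbody la.
exists n, Q; split=> [j|]; first by have [? ? _] := HQ j.
exists (fun j x => la j (phi j x)); split=> [j|y].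
  have [lh _ _] := laP j; split=> [a x z|].
    by rewrite (phiP j).1 lh.1.
  split=> [|x z]; first by rewrite (prod_hom1 phiP) lh.2.1.
  by rewrite (prod_homM phiP) lh.2.2.
have z j : exists x, la j x = y j by have [_ _] := laP j; apply.
have [x [Hx xu]] := phiU (fun j => sval (cid (z j))).
exists x; split=> [j|x' Hx']; first by rewrite Hx; apply: svalP (cid (z j)).
apply: xu => j; have [_ lI _] := laP j; apply: lI.
by rewrite Hx'; apply/esym; apply: svalP (cid (z j)).
Qed.
End SplitDescent.

Theorem theorem2p6 (k : comPzRingType) (A : pzAlgType k) (J : ideal2 A)
    (k_noetherian : noetherian k)
    (A_fin_gen : @fin_gen k A) (A_projective : @projective k A)
    (J_idempotent : idempotent_ideal J) :
  ((forall p : spec k,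
      heredity (fibre_ideal J p) -> bijective (@fibre_ideal_map k A J p)) /\
   (heredity J <-> forall p : spec k, heredity (fibre_ideal J p)))
  /\
  (heredity_separable J <->
     forall m : spec k, maximal_ideal m -> heredity_separable (fibre_ideal J m))
  /\
  (integrally_closed_domain k -> @projective k (quomod J) ->
     (heredity_semisplit J <->
        forall p : spec k,
          height_le p 1 -> heredity_semisplit (fibre_ideal J p)))
  /\
  (regular_domain k -> krull_dim_le k 2 -> @projective k (quomod J) ->
     (heredity_split J <->
        forall p : spec k, height_le p 1 -> heredity_split (fibre_ideal J p))).
Proof.
have [lA lAP] := fin_gen_seq A_fin_gen; have A1 := projective_sdual lAP A_projective.
have loc := heredity_local k_noetherian lAP A1 J_idempotent.
have hE := heredityE k_noetherian lAP A1 J_idempotent.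
split; first by split=> // p; apply: (fibre_map_bij k_noetherian lAP J_idempotent).
split; first exact: (heredity_separable_local k_noetherian lAP A1 J_idempotent).
split=> [kI|k_reg k_dim] /(quo_projective_sretract lAP) r1; split.
- move=> [hJ Es] p _; split; first exact: (loc.1 hJ p).
  by have [_ a1 _] := hE.1 hJ; apply: fibre_semisplit.
- have [dom _] := kI; exact: (semisplit_descent k_noetherian kI lAP A1 J_idempotent r1 dom).
- move=> [hJ Es] p _; split; first exact: (loc.1 hJ p).
  by have [_ a1 _] := hE.1 hJ; apply: fibre_split.
exact: (split_descent k_reg k_dim lAP A1 J_idempotent r1).
Qed.
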